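(* Let $m>0$ and $b>0$. For any $s>0$ and any $\psi_0\in H^s(\mathbb{R}^2,\mathbb{C}^2)$ there exist a time $T=T(\|\psi_0\|_{H^s})>0$ and a unique solution $\psi\in C([0,T);H^s(\mathbb{R}^2,\mathbb{C}^2))$ to the integral equation $$\psi(t)=e^{-\mathrm{i}t\mathcal{D}_m}\psi_0+\mathrm{i}\int_0^t e^{-\mathrm{i}(t-\tau)\mathcal{D}_m}\big((b-\Delta)^{-1}|\psi(\tau)|^2\big)\gamma^0\psi(\tau)\,d\tau.$$
   Context: Here $\mathcal{D}_m=-\mathrm{i}(\alpha^1\partial_{x_1}+\alpha^2\partial_{x_2})+m\gamma^0$ is the two-dimensional Dirac operator, self-adjoint on $L^2(\mathbb{R}^2,\mathbb{C}^2)$ with domain $H^1(\mathbb{R}^2,\mathbb{C}^2)$, where $$\gamma^0=\begin{pmatrix}1&0\\0&-1\end{pmatrix},\quad \alpha^1=\begin{pmatrix}0&\mathrm{i}\\-\mathrm{i}&0\end{pmatrix},\quad \alpha^2=\begin{pmatrix}0&1\\1&0\end{pmatrix}.$$ $|\psi|^2$ is the squared Euclidean (Hermitian) norm of $\psi\in\mathbb{C}^2$ pointwise, and $(b-\Delta)^{-1}$ is the Fourier multiplier with symbol $(b+|\xi|^2)^{-1}$ on $\mathbb{R}^2$. The notation $T=T(\|\psi_0\|_{H^s})$ means that $T$ depends on $\psi_0$ only through its $H^s$ norm. *)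

(* Defs.v *)
From HB Require Import structures.
From mathcomp Require Import all_boot all_order all_algebra.
From mathcomp Require Import complex.
From mathcomp Require Import all_classical all_reals all_analysis.

Set Implicit Arguments.
Unset Strict Implicit.
Unset Printing Implicit Defensive.

Import Order.TTheory GRing.Theory Num.Theory.
Import numFieldNormedType.Exports.

Local Open Scope classical_set_scope.
Local Open Scope ring_scope.

(* Elements of L^2, H^s, ... are represented by genuine functions on the plane;
   two of them denote the same element when they agree almost everywhere for
   [leb2].  Norms are extended real numbers; [Hnorm s] is only meaningful on
   [Hs s], since [fourier2] is a default function outside L^2. *)

Section Defs.
Context {R : realType}.
Local Notation C := R[i].
Local Notation "z %:C" := (real_complex R z).

Definition leb2 := (@lebesgue_measure R \x @lebesgue_measure R)%E.

Definition imunit : C := Complex 0 1.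
Local Notation normc := ComplexField.Normc.normc.

Definition scalar := R * R -> C.
Definition spinor := R * R -> 'cV[C]_2.

Implicit Types (f g : scalar) (psi phi : spinor).

Definition component psi (k : 'I_2) : scalar := fun x => psi x k 0.

(* |psi|^2, the pointwise squared Hermitian norm *)
Definition density psi (x : R * R) : R := \sum_(k < 2) normc (component psi k x) ^+ 2.

Definition Lpnorm (p : R) f : \bar R := Lnorm leb2 p%:E (fun x => (normc (f x))%:E).

Definition cmeasurable f : Prop :=
  measurable_fun [set: measurableTypeR R * measurableTypeR R] (fun x => complex.Re (f x)) /\
  measurable_fun [set: measurableTypeR R * measurableTypeR R] (fun x => complex.Im (f x)).

Definition Lp (p : R) f : Prop := cmeasurable f /\ (Lpnorm p f < +oo)%E.

Definition L2 psi : Prop := forall k, Lp 2 (component psi k).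

Definition L2norm psi : \bar R :=
  Lnorm leb2 2%:E (fun x => (Num.sqrt (density psi x))%:E).

Definition cintegral f : C :=
  Complex (Rintegral leb2 setT (fun x => complex.Re (f x)))
          (Rintegral leb2 setT (fun x => complex.Im (f x))).

Definition cis (t : R) : C := Complex (cos t) (sin t).

(* Fourier transform of an integrable function, with the unitary
   normalisation (2 pi)^-1 in dimension two. *)
Definition fourier1 f : scalar := fun xi =>
  ((2 * pi)^-1)%:C *
    cintegral (fun x => cis (- (x.1 * xi.1 + x.2 * xi.2)) * f x).

(* Fourier-Plancherel transform on L^2: continuous extension of [fourier1]
   from L^1 `&` L^2. *)
Definition is_fourier2 f g : Prop :=
  [/\ Lp 2 f, Lp 2 g &
   exists u : nat -> scalar,
    [/\ forall n, Lp 1 (u n) /\ Lp 2 (u n),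
        Lpnorm 2 (u n - f) @[n --> \oo] --> 0%E &
        Lpnorm 2 (fourier1 (u n) - g) @[n --> \oo] --> 0%E]].

Definition fourier2 f : scalar := xget (fun=> 0) [set g | is_fourier2 f g].

Definition fourier psi : spinor := fun xi =>
  \col_k fourier2 (component psi k) xi.

Definition jbracket (xi : R * R) : R := Num.sqrt (1 + xi.1 ^+ 2 + xi.2 ^+ 2).

Definition Hweight (s : R) psi : spinor := fun xi =>
  ((jbracket xi) `^ s)%:C *: fourier psi xi.

Definition Hs (s : R) psi : Prop := L2 psi /\ L2 (Hweight s psi).

Definition Hnorm (s : R) psi : \bar R := L2norm (Hweight s psi).

(* Fourier multiplier with symbol [sigma], acting on integrable functions f
   such that sigma * fourier1 f is square integrable. *)
Definition multiplier (sigma : R * R -> R) f : scalar :=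
  xget (fun=> 0) [set g | Lp 2 g /\
    fourier2 g = (fun xi => (sigma xi)%:C * fourier1 f xi) %[ae leb2]].

Definition resolvent (b : R) : scalar -> scalar :=
  multiplier (fun xi => (b + (xi.1 ^+ 2 + xi.2 ^+ 2))^-1).

Fixpoint Ck (n : nat) (theta : R * R -> R) : Prop :=
  continuous theta /\
  if n is n'.+1 then
    (forall x, derivable theta x (1, 0)) /\ Ck n' ('D_(1, 0) theta) /\
    (forall x, derivable theta x (0, 1)) /\ Ck n' ('D_(0, 1) theta)
  else True.

Definition test_function (theta : R * R -> R) : Prop :=
  (forall n, Ck n theta) /\
  exists K, compact K /\ forall x, ~ K x -> theta x = 0.

(* g is the distributional derivative of f in the direction e *)
Definition weak_derivative (e : R * R) f g : Prop :=
  forall theta, test_function theta ->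
    cintegral (fun x => f x * ('D_e theta x)%:C) =
    - cintegral (fun x => g x * (theta x)%:C).

Definition spinor_derivative (e : R * R) psi phi : Prop :=
  L2 phi /\ forall k, weak_derivative e (component psi k) (component phi k).

Definition mx2 (a b c d : C) : 'M[C]_2 :=
  \matrix_(i, j) if i == 0 then (if j == 0 then a else b)
                 else (if j == 0 then c else d).

Definition gamma0 : 'M[C]_2 := mx2 1 0 0 (- 1).
Definition alpha1 : 'M[C]_2 := mx2 0 imunit (- imunit) 0.
Definition alpha2 : 'M[C]_2 := mx2 0 1 1 0.

(* Graph of D_m = - i (alpha1 d_1 + alpha2 d_2) + m gamma0 with domain H^1 *)
Definition dirac_op (m : R) psi phi : Prop :=
  Hs 1 psi /\ L2 phi /\
  exists d1 d2 : spinor,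
    [/\ spinor_derivative (1, 0) psi d1, spinor_derivative (0, 1) psi d2 &
        phi = (fun x => - imunit *: (alpha1 *m d1 x + alpha2 *m d2 x)
                        + m%:C *: (gamma0 *m psi x)) %[ae leb2]].

(* U is the family (e^{-itA})_t, i.e. the strongly continuous one-parameter
   unitary group on L^2 whose infinitesimal generator is exactly -iA (Stone);
   A is given by its graph. *)
Definition generated_by (A : spinor -> spinor -> Prop)
    (U : R -> spinor -> spinor) : Prop :=
  [/\ (forall t psi, L2 psi -> L2 (U t psi) /\ L2norm (U t psi) = L2norm psi),
      (forall t (a : C) psi phi, L2 psi -> L2 phi ->
         U t (a *: psi + phi) = a *: U t psi + U t phi %[ae leb2]),
      (forall psi, L2 psi -> U 0 psi = psi %[ae leb2]) /\
      (forall t t' psi, L2 psi -> U (t + t') psi = U t (U t' psi) %[ae leb2]),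
      (forall psi, L2 psi -> L2norm (U t psi - psi) @[t --> (0 : R)] --> 0%E) &
      (forall psi phi, L2 psi -> L2 phi ->
         A psi phi <->
         L2norm ((h^-1)%:C *: (U h psi - psi) + imunit *: phi)
           @[h --> (0 : R)^'] --> 0%E)].

Definition dirac_group (m : R) : R -> spinor -> spinor :=
  xget (fun _ psi => psi) [set U : R -> spinor -> spinor | generated_by (dirac_op m) U].

(* I is the integral over [a, b] of the H^s-valued function F, as the limit in
   H^s of Riemann sums over tagged partitions.  For continuous F this is the
   Bochner integral. *)
Definition is_Hs_integral (s a b : R) (F : R -> spinor) (I : spinor) : Prop :=
  [/\ forall tau, a <= tau <= b -> Hs s (F tau), Hs s I &
   forall eps : R, 0 < eps -> exists2 delta : R, 0 < delta &
   forall (p : seq R) (tag : nat -> R), itv_partition a b p ->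
     (forall i, (i < size p)%N ->
        nth b (a :: p) i <= tag i <= nth b (a :: p) i.+1 /\
        nth b (a :: p) i.+1 - nth b (a :: p) i < delta) ->
     (Hnorm s (\sum_(i < size p)
           (nth b (a :: p) i.+1 - nth b (a :: p) i)%:C *: F (tag i) - I)%R
      < eps%:E)%E].

Definition continuous_Hs (s T : R) (psi : R -> spinor) : Prop :=
  forall t, 0 <= t < T -> Hs s (psi t) /\
    Hnorm s (psi t' - psi t) @[t' --> within `[0, T[ (nbhs t)] --> 0%E.

Definition nonlinearity (b : R) psi : spinor := fun x =>
  resolvent b (fun y => (density psi y)%:C) x *: (gamma0 *m psi x).

Definition duhamel_solution (m b s : R) (psi0 : spinor) (T : R)
    (psi : R -> spinor) : Prop :=
  continuous_Hs s T psi /\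
  forall t, 0 <= t < T -> exists2 I : spinor,
    is_Hs_integral s 0 t
      (fun tau => dirac_group m (t - tau) (nonlinearity b (psi tau))) I &
    psi t = dirac_group m t psi0 + imunit *: I %[ae leb2].

End Defs.

(* Main.v *)
(* A contraction argument in the interaction picture [w t = e^{itD} psi t].  It needs two facts.

   The cubic map [psi |-> ((b - Delta)^{-1} |psi|^2) gamma0 psi] is locally Lipschitz on [H^s] for every
   [s > 0]: the Fourier transform of a product [f conj(g)] of [H^s] functions is [O(<xi>^{-s})] by Peetre's
   inequality and Cauchy-Schwarz, so the potential has a Fourier transform [v] of size [O(<xi>^{-2-s})]; in
   dimension two [v] is integrable even against a small power of [<xi>], and [|v| * |psi^|] is controlled in
   the weighted [L^2] space by a weighted Cauchy-Schwarz inequality.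

   The Dirac group is isometric and strongly continuous on [H^s].  Only its generator is known, so this is
   obtained by commutation: a bounded Fourier multiplier [B] preserves the domain [H^1] of the generator and
   commutes with it, hence [|| U t (B psi) - B (U t psi) ||] has zero derivative in [t]; applied to the
   truncated weights [<xi>^s 1_{<xi> <= n}] this transfers the [L^2] isometry to [H^s].

   The Plancherel theorem behind both facts comes from the multiplication formula, tested against the
   approximate identity whose Fourier transform is [exp(-eps (|xi1| + |xi2|))]. *)
From HB Require Import structures.
Require Import Defs.
From mathcomp Require Import all_boot all_order all_algebra.
From mathcomp Require Import finmap complex ring lra.
From mathcomp Require Import all_classical all_reals all_analysis.
From mathcomp Require Import measurable_realfun.

Set Implicit Arguments.
Unset Strict Implicit.
Unset Printing Implicit Defensive.

Import Order.TTheory GRing.Theory Num.Theory.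
Import numFieldNormedType.Exports.

Local Open Scope classical_set_scope.
Local Open Scope ring_scope.

(** Elements of [H^s] are represented by functions, so the evolution runs in a vector space without
    norm or topology: a membership predicate [P] and a seminorm [N] meaningful on [P], with
    [N (x - y) = 0] standing for almost everywhere equality. Group law and linearity of [U t] hold
    only in that sense, and so does the fixed point equation. The interaction picture frees the
    kernel of the Duhamel integral from [t]. What remains is an antiderivative of a continuous
    field, obtained from polygons; Riemann sums serve only to pass between it and the integral of
    the statement. As [U t] preserves [N], the field inherits the Lipschitz bound of the
    nonlinearity, and the lifespan is an explicit function of [N x0]. For small [s] the density of a
    spinor in [H^s] is integrable but need not be square integrable; its transform is therefore
    [fourier1], estimated pointwise, and the resolvent is what brings the potential into [L2].
    Uniqueness concerns all continuous solutions, not only those in the contraction ball: on a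
    compact subinterval two solutions are bounded, and an exponentially weighted iteration makes
    their difference vanish. *)

Notation normc := ComplexField.Normc.normc.

(** * Complex-valued integration *)

Section ComplexNumbers.
Context {R : realType}.
Local Notation C := R[i].
Implicit Types (z w : C) (x : R).

Lemma normc_ge0 z : 0 <= normc z.
Proof. by case: z => a b; exact: sqrtr_ge0. Qed.

Lemma sqr_normcE z : normc z ^+ 2 = complex.Re z ^+ 2 + complex.Im z ^+ 2.
Proof. by case: z => a b /=; rewrite sqr_sqrtr// addr_ge0// sqr_ge0. Qed.

Lemma normc_Re z : `|complex.Re z| <= normc z.
Proof.
rewrite -(@ler_pXn2r _ 2) ?nnegrE ?normc_ge0// sqr_normcE real_normK ?num_real//.
by rewrite lerDl sqr_ge0.
Qed.

Lemma normc_Im z : `|complex.Im z| <= normc z.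
Proof.
rewrite -(@ler_pXn2r _ 2) ?nnegrE ?normc_ge0// sqr_normcE real_normK ?num_real//.
by rewrite lerDr sqr_ge0.
Qed.

Lemma normc_ReIm z : normc z <= `|complex.Re z| + `|complex.Im z|.
Proof.
rewrite -(@ler_pXn2r _ 2) ?nnegrE ?normc_ge0 ?addr_ge0// sqr_normcE sqrrD.
by rewrite !real_normK ?num_real// addrAC lerDl mulrn_wge0// mulr_ge0.
Qed.

Lemma normc_real x : normc (real_complex R x) = `|x|.
Proof. by rewrite /= expr0n/= addr0 sqrtr_sqr. Qed.

Lemma normc_conj z : normc (conjc z) = normc z.
Proof. by case: z => a b /=; rewrite sqrrN. Qed.

Lemma normcM z w : normc (z * w) = normc z * normc w.
Proof. exact: ComplexField.Normc.normcM. Qed.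

Lemma normcN z : normc (- z) = normc z.
Proof. by case: z => a b /=; rewrite !sqrrN. Qed.

Lemma normcD z w : normc (z + w) <= normc z + normc w.
Proof. exact: le_normcD. Qed.

Lemma normc0 : normc (0 : C) = 0.
Proof. exact: ComplexField.Normc.normc0. Qed.

Lemma normc1 : normc (1 : C) = 1.
Proof. exact: ComplexField.Normc.normc1. Qed.

Lemma normc_eq0 z : (normc z == 0) = (z == 0).
Proof.
apply/eqP/eqP => [|->]; last exact: normc0.
exact: ComplexField.Normc.eq0_normc.
Qed.

Lemma mul_conjc z : z * conjc z = real_complex R (normc z ^+ 2).
Proof.
rewrite sqr_normcE; case: z => a b; apply/eqP; rewrite eq_complex /=.
by apply/andP; split; apply/eqP; ring.
Qed.

Lemma normc_imunit : normc (@imunit R) = 1.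
Proof. by rewrite /= expr0n/= expr1n add0r sqrtr1. Qed.

Lemma normc_cis x : normc (cis x) = 1.
Proof. by rewrite /= cos2Dsin2 sqrtr1. Qed.

Lemma cisD x y : cis (x + y) = cis x * cis y :> C.
Proof.
rewrite /cis cosD sinD; apply/eqP; rewrite eq_complex /=.
by apply/andP; split; apply/eqP; ring.
Qed.

Lemma conj_cis x : conjc (cis x) = cis (- x) :> C.
Proof. by rewrite /cis cosN sinN. Qed.

Lemma ReD z w : complex.Re (z + w) = complex.Re z + complex.Re w.
Proof. by case: z w => [a b] [c e]. Qed.
Lemma ImD z w : complex.Im (z + w) = complex.Im z + complex.Im w.
Proof. by case: z w => [a b] [c e]. Qed.
Lemma ReN z : complex.Re (- z) = - complex.Re z.
Proof. by case: z. Qed.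
Lemma ImN z : complex.Im (- z) = - complex.Im z.
Proof. by case: z. Qed.
Lemma ReM z w : complex.Re (z * w) =
  complex.Re z * complex.Re w - complex.Im z * complex.Im w.
Proof. by case: z w => [a b] [c e]. Qed.
Lemma ImM z w : complex.Im (z * w) =
  complex.Re z * complex.Im w + complex.Im z * complex.Re w.
Proof. by case: z w => [a b] [c e] /=; rewrite addrC. Qed.

Lemma complexP z w :
  complex.Re z = complex.Re w -> complex.Im z = complex.Im w -> z = w.
Proof. by case: z w => [a b] [c e] /= -> ->. Qed.

Lemma normc_le_sum2 z w : normc (z + w) ^+ 2 <= 2 * normc z ^+ 2 + 2 * normc w ^+ 2.
Proof.
rewrite !sqr_normcE ReD ImD -subr_ge0.
have -> : 2 * (complex.Re z ^+ 2 + complex.Im z ^+ 2) + 2 * (complex.Re w ^+ 2 + complex.Im w ^+ 2)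
  - ((complex.Re z + complex.Re w) ^+ 2 + (complex.Im z + complex.Im w) ^+ 2)
  = (complex.Re z - complex.Re w) ^+ 2 + (complex.Im z - complex.Im w) ^+ 2 by ring.
by rewrite addr_ge0 ?sqr_ge0.
Qed.

End ComplexNumbers.

Section ComplexMeasurable.
Context {R : realType} d (T : measurableType d).
Local Notation C := R[i].
Implicit Types f g : T -> C.

Definition cmeas f :=
  measurable_fun [set: T] (fun x => complex.Re (f x)) /\
  measurable_fun [set: T] (fun x => complex.Im (f x)).

Lemma cmeas_cst c : cmeas (fun=> c).
Proof. by split; exact: measurable_cst. Qed.

Lemma cmeasD f g : cmeas f -> cmeas g -> cmeas (fun x => f x + g x).
Proof.
move=> [f1 f2] [g1 g2]; split.
  by under eq_fun do rewrite ReD; exact: measurable_funD.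
by under eq_fun do rewrite ImD; exact: measurable_funD.
Qed.

Lemma cmeasN f : cmeas f -> cmeas (fun x => - f x).
Proof.
move=> [f1 f2]; split.
  by under eq_fun do rewrite ReN; exact: measurableT_comp.
by under eq_fun do rewrite ImN; exact: measurableT_comp.
Qed.

Lemma cmeasB f g : cmeas f -> cmeas g -> cmeas (fun x => f x - g x).
Proof. by move=> mf /cmeasN; exact: cmeasD. Qed.

Lemma cmeasM f g : cmeas f -> cmeas g -> cmeas (fun x => f x * g x).
Proof.
move=> [f1 f2] [g1 g2]; split.
  under eq_fun do rewrite ReM.
  by apply: measurable_funB; exact: measurable_funM.
under eq_fun do rewrite ImM.
by apply: measurable_funD; exact: measurable_funM.
Qed.

Lemma cmeas_conj f : cmeas f -> cmeas (fun x => conjc (f x)).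
Proof.
move=> [f1 f2]; split.
  by rewrite (_ : (fun x => _) = (fun x => complex.Re (f x))) //; apply/funext => x; case: (f x).
rewrite (_ : (fun x => _) = (fun x => - complex.Im (f x))).
  exact: measurableT_comp.
by apply/funext => x; case: (f x).
Qed.

Lemma cmeas_real (u : T -> R) :
  measurable_fun [set: T] u -> cmeas (fun x => real_complex R (u x)).
Proof. by move=> mu; split => //; exact: measurable_cst. Qed.

Lemma cmeas_cis (u : T -> R) : measurable_fun [set: T] u -> cmeas (fun x => cis (u x)).
Proof.
move=> mu; split; apply: (measurableT_comp _ mu); apply: continuous_measurable_fun.
  exact: continuous_cos.
exact: continuous_sin.
Qed.

Lemma measurable_normc2 f : cmeas f -> measurable_fun [set: T] (fun x => normc (f x) ^+ 2).
Proof.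
move=> [f1 f2]; under eq_fun do rewrite sqr_normcE.
by apply: measurable_funD; exact: measurable_funX.
Qed.

Lemma measurable_normc f : cmeas f -> measurable_fun [set: T] (fun x => normc (f x)).
Proof.
move=> /measurable_normc2 mf.
rewrite (_ : (fun x => _) = (fun x => Num.sqrt (normc (f x) ^+ 2))).
  apply: (measurableT_comp _ mf); apply: continuous_measurable_fun.
  exact: sqrt_continuous.
by apply/funext => x; rewrite sqrtr_sqr ger0_norm ?normc_ge0.
Qed.

End ComplexMeasurable.

Lemma cmeas_comp {R : realType} d (T : measurableType d) d' (T' : measurableType d')
  (h : T' -> T) (f : T -> R[i]) :
  measurable_fun [set: T'] h -> cmeas f -> cmeas (fun x => f (h x)).
Proof. by move=> mh [f1 f2]; split; [exact: (measurableT_comp f1 mh)|exact: (measurableT_comp f2 mh)]. Qed.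

Section ComplexIntegral.
Context {R : realType} d (T : measurableType d) (mu : {measure set T -> \bar R}).
Local Notation C := R[i].
Implicit Types f g : T -> C.

Definition cint f : C :=
  Complex (Rintegral mu setT (fun x => complex.Re (f x)))
          (Rintegral mu setT (fun x => complex.Im (f x))).

Definition cintable f := cmeas f /\ (\int[mu]_x (normc (f x))%:E < +oo)%E.

Lemma ge0_int_le (f g : T -> \bar R) : (forall x, 0 <= f x)%E ->
  measurable_fun setT f -> measurable_fun setT g -> (forall x, f x <= g x)%E ->
  (\int[mu]_x f x <= \int[mu]_x g x)%E.
Proof. by move=> f0 mf mg fg; apply: ge0_le_integral. Qed.

Lemma cintable_Re f : cintable f -> mu.-integrable setT (EFin \o (fun x => complex.Re (f x))).
Proof.
move=> [mf foo]; apply/integrableP; split; first by apply/measurable_EFinP; case: mf.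
apply: le_lt_trans foo; apply: ge0_int_le => //.
- by apply: measurableT_comp => //; apply/measurable_EFinP; case: mf.
- exact/measurable_EFinP/measurable_normc.
- by move=> x /=; rewrite lee_fin normc_Re.
Qed.

Lemma cintable_Im f : cintable f -> mu.-integrable setT (EFin \o (fun x => complex.Im (f x))).
Proof.
move=> [mf foo]; apply/integrableP; split; first by apply/measurable_EFinP; case: mf.
apply: le_lt_trans foo; apply: ge0_int_le => //.
- by apply: measurableT_comp => //; apply/measurable_EFinP; case: mf.
- exact/measurable_EFinP/measurable_normc.
- by move=> x /=; rewrite lee_fin normc_Im.
Qed.

Lemma cintable_le f g : cmeas f -> cintable g -> (forall x, normc (f x) <= normc (g x)) ->
  cintable f.
Proof.
move=> mf [mg goo] fg; split => //; apply: le_lt_trans goo; apply: ge0_int_le.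
- by move=> x; rewrite lee_fin normc_ge0.
- exact/measurable_EFinP/measurable_normc.
- exact/measurable_EFinP/measurable_normc.
- by move=> x; rewrite lee_fin.
Qed.

Lemma cintableP f : cmeas f -> mu.-integrable setT (fun x => (normc (f x))%:E) -> cintable f.
Proof.
move=> mf /integrableP[_ foo]; split => //; apply: le_lt_trans foo.
by apply: ge0_int_le => //; [move=> x; rewrite lee_fin normc_ge0|
  exact/measurable_EFinP/measurable_normc|
  apply: measurableT_comp => //; exact/measurable_EFinP/measurable_normc|
  move=> x /=; rewrite lee_fin ler_norm].
Qed.

Lemma cintable_integrable f : cintable f -> mu.-integrable setT (fun x => (normc (f x))%:E).
Proof.
move=> [mf foo]; apply/integrableP; split; first exact/measurable_EFinP/measurable_normc.
by under eq_integral do rewrite gee0_abs ?lee_fin ?normc_ge0//.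
Qed.

Lemma cintable_bounded_by f (u : T -> R) : cmeas f -> mu.-integrable setT (EFin \o u) ->
  (forall x, normc (f x) <= u x) -> cintable f.
Proof.
move=> mf iu fu; apply: cintableP => //; apply: le_integrable iu => //.
  exact/measurable_EFinP/measurable_normc.
by move=> x _ /=; rewrite lee_fin ger0_norm ?normc_ge0// (le_trans (fu x))// ler_norm.
Qed.

Lemma cintableD f g : cintable f -> cintable g -> cintable (fun x => f x + g x).
Proof.
move=> If Ig; have mf := If.1; have mg := Ig.1.
apply: (@cintable_bounded_by _ (fun x => normc (f x) + normc (g x))).
- exact: cmeasD.
- exact: (integrableD measurableT (cintable_integrable If) (cintable_integrable Ig)).
- by move=> x; exact: normcD.
Qed.

Lemma cintableMr f (h : T -> C) (M : R) : cintable f -> cmeas h ->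
  (forall x, normc (h x) <= M) -> cintable (fun x => h x * f x).
Proof.
move=> If mh hM; have mf := If.1.
apply: (@cintable_bounded_by _ (fun x => M * normc (f x))).
- exact: cmeasM.
- exact: (integrableZl measurableT M (cintable_integrable If)).
- by move=> x; rewrite normcM ler_wpM2r ?normc_ge0.
Qed.

Lemma cintableZ c f : cintable f -> cintable (fun x => c * f x).
Proof. by move=> If; apply: (@cintableMr _ (fun=> c) (normc c)) => //; exact: cmeas_cst. Qed.

Lemma cintableN f : cintable f -> cintable (fun x => - f x).
Proof.
move=> If; apply: (cintable_le _ If) => [|x]; first exact: cmeasN If.1.
by rewrite normcN.
Qed.

Lemma cintableB f g : cintable f -> cintable g -> cintable (fun x => f x - g x).
Proof. by move=> If /cintableN; exact: cintableD. Qed.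

Lemma cintable_conj f : cintable f -> cintable (fun x => conjc (f x)).
Proof.
move=> If; apply: (cintable_le _ If) => [|x]; first exact: cmeas_conj If.1.
by rewrite normc_conj.
Qed.

Lemma cint_eq f g : f =1 g -> cint f = cint g.
Proof. by move=> /funext ->. Qed.

Lemma cintD f g : cintable f -> cintable g ->
  cint (fun x => f x + g x) = cint f + cint g.
Proof.
move=> If Ig; apply: complexP; rewrite ?ReD ?ImD /cint /=.
  under [LHS]eq_Rintegral do rewrite ReD.
  by rewrite RintegralD//; exact: cintable_Re.
under [LHS]eq_Rintegral do rewrite ImD.
by rewrite RintegralD//; exact: cintable_Im.
Qed.

Lemma cintZ c f : cintable f -> cint (fun x => c * f x) = c * cint f.
Proof.
move=> If; have iR := cintable_Re If; have iI := cintable_Im If.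
have iZR (r : R) : mu.-integrable setT (EFin \o (fun x => r * complex.Re (f x))).
  exact: (integrableZl measurableT r iR).
have iZI (r : R) : mu.-integrable setT (EFin \o (fun x => r * complex.Im (f x))).
  exact: (integrableZl measurableT r iI).
apply: complexP; rewrite ?ReM ?ImM /cint /=.
  under [LHS]eq_Rintegral do rewrite ReM.
  by rewrite RintegralB// !RintegralZl.
under [LHS]eq_Rintegral do rewrite ImM.
by rewrite RintegralD// !RintegralZl.
Qed.

Lemma cintN f : cintable f -> cint (fun x => - f x) = - cint f.
Proof.
move=> If; rewrite -[RHS]mulN1r -cintZ//; apply: cint_eq => x.
by rewrite mulN1r.
Qed.

Lemma cintB f g : cintable f -> cintable g ->
  cint (fun x => f x - g x) = cint f - cint g.
Proof. by move=> If Ig; rewrite cintD ?cintN//; exact: cintableN. Qed.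

Lemma cint_conj f : cintable f -> cint (fun x => conjc (f x)) = conjc (cint f).
Proof.
move=> If; apply: complexP; rewrite /cint /=.
  by apply: eq_Rintegral => x _; case: (f x).
rewrite (@eq_Rintegral _ _ _ mu setT (fun x => (-1) * complex.Im (f x))).
  by rewrite RintegralZl ?mulN1r//; exact: cintable_Im.
by move=> x _; case: (f x) => a b /=; rewrite mulN1r.
Qed.

Lemma cint_real (u : T -> R) : cint (fun x => real_complex R (u x)) = real_complex R (Rintegral mu setT u).
Proof. by apply: complexP; rewrite /cint //= /Rintegral integral0. Qed.

(* Rotating by a unit complex number makes the integral real. *)
Lemma normc_cint_le f : cintable f ->
  ((normc (cint f))%:E <= \int[mu]_x (normc (f x))%:E)%E.
Proof.
move=> If; set I := cint f.
have [I0|I0] := eqVneq I 0.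
  rewrite I0 normc0; apply: integral_ge0 => x _.
  by rewrite lee_fin normc_ge0.
have n0 : normc I != 0 by rewrite normc_eq0.
pose c := conjc I * real_complex R (normc I)^-1.
have nc : normc c = 1.
  by rewrite normcM normc_conj normc_real ger0_norm ?invr_ge0 ?normc_ge0// divff.
have cI : c * I = real_complex R (normc I).
  rewrite mulrAC [_ * I]mulrC mul_conjc -rmorphM; congr (real_complex R _).
  by rewrite expr2 -mulrA divff ?mulr1.
have Icf : cintable (fun x => c * f x) by exact: cintableZ.
have := congr1 (@complex.Re R) cI; rewrite -cintZ//= => <-.
have := cintable_Re Icf => iR.
rewrite /Rintegral fineK ?integrable_fin_num//.
have iN := cintable_integrable If.
apply: (@le_integral _ _ _ mu) => //.
move=> x _ /=; rewrite lee_fin (le_trans (ler_norm _))// (le_trans (normc_Re _))//.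
by rewrite normcM nc mul1r.
Qed.

End ComplexIntegral.

(** * Fubini's theorem for real and complex integrands *)

Section Fubini.
Context {R : realType} d1 d2 (T1 : measurableType d1) (T2 : measurableType d2).
Variables (m1 : {sigma_finite_measure set T1 -> \bar R}) (m2 : {sigma_finite_measure set T2 -> \bar R}).

(** The extended integral of a slice is the difference of the Tonelli integrals of the positive and
    negative parts, both measurable in the parameter, and [fine] preserves measurability; slices
    with infinite parts do no harm. *)
Lemma measurable_Rintegral_fst (u : T1 * T2 -> R) : measurable_fun setT u ->
  measurable_fun setT (fun x => Rintegral m2 setT (fun y => u (x, y))).
Proof.
move=> mu; have meu : measurable_fun setT (EFin \o u) by exact/measurable_EFinP.
apply: measurableT_comp => //.
rewrite [X in measurable_fun _ X](_ : _ = fun x =>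
  (fubini_F m2 (EFin \o u)^\+%E x - fubini_F m2 (EFin \o u)^\-%E x)%E).
  apply: emeasurable_funB.
    by apply: measurable_fun_fubini_tonelli_F => //; exact: measurable_funepos.
  by apply: measurable_fun_fubini_tonelli_F => //; exact: measurable_funeneg.
apply/funext => x; rewrite integralE /fubini_F.
by congr (_ - _)%E; apply: eq_integral => y _; rewrite ?funeposE ?funenegE.
Qed.

Lemma measurable_Rintegral_snd (u : T1 * T2 -> R) : measurable_fun setT u ->
  measurable_fun setT (fun y => Rintegral m1 setT (fun x => u (x, y))).
Proof.
move=> mu; have meu : measurable_fun setT (EFin \o u) by exact/measurable_EFinP.
apply: measurableT_comp => //.
rewrite [X in measurable_fun _ X](_ : _ = fun y =>
  (fubini_G m1 (EFin \o u)^\+%E y - fubini_G m1 (EFin \o u)^\-%E y)%E).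
  apply: emeasurable_funB.
    by apply: measurable_fun_fubini_tonelli_G => //; exact: measurable_funepos.
  by apply: measurable_fun_fubini_tonelli_G => //; exact: measurable_funeneg.
apply/funext => y; rewrite integralE /fubini_G.
by congr (_ - _)%E; apply: eq_integral => x _; rewrite ?funeposE ?funenegE.
Qed.

(** [Rintegral] sends an infinite inner integral to 0 through [fine], so the iterated real integrals
    match the extended ones only on the almost all slices that are integrable; the extended Fubini
    theorem then exchanges the order. *)
Lemma Rintegral_fubini (u : T1 * T2 -> R) :
  (m1 \x m2)%E.-integrable setT (EFin \o u) ->
  Rintegral m1 setT (fun x => Rintegral m2 setT (fun y => u (x, y))) =
  Rintegral m2 setT (fun y => Rintegral m1 setT (fun x => u (x, y))).
Proof.
move=> iu; have mu : measurable_fun setT u.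
  by have := measurable_int _ iu => /measurable_EFinP.
have meu : measurable_fun setT (EFin \o u) by exact/measurable_EFinP.
have E1 : (\int[m1]_x (Rintegral m2 setT (fun y => u (x, y)))%:E =
   \int[m1]_x \int[m2]_y (EFin \o u) (x, y))%E.
  apply: ae_eq_integral => //.
  - exact/measurable_EFinP/measurable_Rintegral_fst.
  - exact: (measurable_fubini_F iu).
  - have := ae_integrable1 iu; apply: filterS => x h _.
    by rewrite /Rintegral fineK// integrable_fin_num.
have E2 : (\int[m2]_y (Rintegral m1 setT (fun x => u (x, y)))%:E =
   \int[m2]_y \int[m1]_x (EFin \o u) (x, y))%E.
  apply: ae_eq_integral => //.
  - exact/measurable_EFinP/measurable_Rintegral_snd.
  - exact: (measurable_fubini_G iu).
  - have := ae_integrable2 iu; apply: filterS => x h _.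
    by rewrite /Rintegral fineK// integrable_fin_num.
by rewrite [LHS]/Rintegral E1 [RHS]/Rintegral E2 Fubini.
Qed.

Lemma cmeas_cint_fst (f : T1 * T2 -> R[i]) : cmeas f ->
  cmeas (fun x => cint m2 (fun y => f (x, y))).
Proof.
move=> [f1 f2]; split; first exact: measurable_Rintegral_fst f1.
exact: measurable_Rintegral_fst f2.
Qed.

Lemma cmeas_cint_snd (f : T1 * T2 -> R[i]) : cmeas f ->
  cmeas (fun y => cint m1 (fun x => f (x, y))).
Proof.
move=> [f1 f2]; split; first exact: measurable_Rintegral_snd f1.
exact: measurable_Rintegral_snd f2.
Qed.

Lemma cintable_prod (f : T1 * T2 -> R[i]) : cmeas f ->
  (\int[m1]_x \int[m2]_y (normc (f (x, y)))%:E < +oo)%E -> cintable (m1 \x m2)%E f.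
Proof.
move=> mf foo; split => //; rewrite (fubini_tonelli1 (fun z => (normc (f z))%:E))//.
  exact/measurable_EFinP/measurable_normc.
by move=> x; rewrite lee_fin normc_ge0.
Qed.

Lemma cint_fubini (f : T1 * T2 -> R[i]) : cmeas f ->
  (\int[m1]_x \int[m2]_y (normc (f (x, y)))%:E < +oo)%E ->
  cint m1 (fun x => cint m2 (fun y => f (x, y))) =
  cint m2 (fun y => cint m1 (fun x => f (x, y))).
Proof.
move=> mf foo; have If := cintable_prod mf foo.
apply: complexP; rewrite /cint /=.
  exact: (Rintegral_fubini (u := fun z => complex.Re (f z)) (cintable_Re If)).
exact: (Rintegral_fubini (u := fun z => complex.Im (f z)) (cintable_Im If)).
Qed.

Lemma cintable_cint_fst (f : T1 * T2 -> R[i]) : cmeas f ->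
  (\int[m1]_x \int[m2]_y (normc (f (x, y)))%:E < +oo)%E ->
  cintable m1 (fun x => cint m2 (fun y => f (x, y))).
Proof.
move=> mf foo; have If := cintable_prod mf foo.
have mn : measurable_fun setT (fun z : T1 * T2 => (normc (f z))%:E).
  exact/measurable_EFinP/measurable_normc.
split; first exact: cmeas_cint_fst.
apply: le_lt_trans foo; apply: ae_ge0_le_integral => //.
- by move=> x _; rewrite lee_fin normc_ge0.
- exact/measurable_EFinP/measurable_normc/cmeas_cint_fst.
- by move=> x _; apply: integral_ge0 => y _; rewrite lee_fin normc_ge0.
- have := @measurable_fun_fubini_tonelli_F _ _ _ _ _ m2 _ mn; apply => z.
  by rewrite lee_fin normc_ge0.
(* The triangle inequality for the inner integral is applied on integrable slices, hence the outer
   integrands are compared almost everywhere. *)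
have iN := cintable_integrable If.
have := ae_integrable1 iN; apply: filterS => x h _.
apply: normc_cint_le; apply: cintableP => //.
case: mf => f1 f2; split.
  exact: (measurable_fun_pair2 x f1).
exact: (measurable_fun_pair2 x f2).
Qed.

End Fubini.

(** * Square-integrable functions *)

Section SquareIntegrable.
Context {R : realType} d (T : measurableType d) (mu : {measure set T -> \bar R}).
Local Notation C := R[i].
Implicit Types f g h : T -> C.

Definition sq f : \bar R := (\int[mu]_x (normc (f x) ^+ 2)%:E)%E.
Definition isL2 f := cmeas f /\ (sq f < +oo)%E.
(** A real-valued norm, for use in real estimates. [fine] sends an infinite [sq f] to 0, which is
    why the norm inequalities assume square integrability or a bound on [sq]. *)
Definition n2 f : R := Num.sqrt (fine (sq f)).

Lemma sq_ge0 f : (0 <= sq f)%E.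
Proof. by apply: integral_ge0 => x _; rewrite lee_fin sqr_ge0. Qed.

Lemma n2_ge0 f : 0 <= n2 f.
Proof. exact: sqrtr_ge0. Qed.

Lemma sqE f : isL2 f -> sq f = (n2 f ^+ 2)%:E.
Proof.
move=> [_ foo]; rewrite /n2 sqr_sqrtr ?fine_ge0 ?sq_ge0// fineK// ge0_fin_numE//.
exact: sq_ge0.
Qed.

Lemma measurable_sq f : cmeas f -> measurable_fun setT (fun x => (normc (f x) ^+ 2)%:E).
Proof. by move=> mf; apply/measurable_EFinP; exact: measurable_normc2. Qed.

Lemma sq_le f g : cmeas f -> cmeas g -> (forall x, normc (f x) <= normc (g x)) ->
  (sq f <= sq g)%E.
Proof.
move=> mf mg fg; apply: ge0_int_le.
- by move=> x; rewrite lee_fin sqr_ge0.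
- exact: measurable_sq.
- exact: measurable_sq.
- by move=> x; rewrite lee_fin ler_sqr ?nnegrE ?normc_ge0.
Qed.

Lemma isL2_le f g : cmeas f -> isL2 g -> (forall x, normc (f x) <= normc (g x)) -> isL2 f.
Proof. by move=> mf [mg g2] fg; split => //; apply: le_lt_trans g2; exact: sq_le. Qed.

Lemma sqZ c f : cmeas f -> sq (fun x => c * f x) = ((normc c ^+ 2)%:E * sq f)%E.
Proof.
move=> mf; rewrite /sq -ge0_integralZl//.
- by apply: eq_integral => x _; rewrite normcM exprMn EFinM.
- exact: measurable_sq.
- by move=> x _; rewrite lee_fin sqr_ge0.
- by rewrite lee_fin sqr_ge0.
Qed.

Lemma sqD_le f g : cmeas f -> cmeas g ->
  (sq (fun x => f x + g x)%R <= 2%:E * sq f + 2%:E * sq g)%E.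
Proof.
move=> mf mg; have mf2 := measurable_sq mf; have mg2 := measurable_sq mg.
have p0 h x : (0 <= (normc (h x) ^+ 2)%:E)%E by rewrite lee_fin sqr_ge0.
rewrite /sq -!ge0_integralZl// -ge0_integralD//.
- apply: ge0_int_le.
  + by move=> x; rewrite lee_fin sqr_ge0.
  + exact/measurable_sq/cmeasD.
  + by apply: emeasurable_funD; exact: measurable_funeM.
  + by move=> x; rewrite -!EFinM -EFinD lee_fin normc_le_sum2.
- by move=> x _; apply: mule_ge0 => //; exact: p0.
- exact: measurable_funeM.
- by move=> x _; apply: mule_ge0 => //; exact: p0.
- exact: measurable_funeM.
Qed.

Lemma isL2D f g : isL2 f -> isL2 g -> isL2 (fun x => f x + g x).
Proof.
move=> [mf f2] [mg g2]; split; first exact: cmeasD.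
by apply: le_lt_trans (sqD_le mf mg) _; rewrite lte_add_pinfty// lte_mul_pinfty.
Qed.

Lemma isL2M (M : R) h f : cmeas h -> (forall x, normc (h x) <= M) -> isL2 f ->
  isL2 (fun x => h x * f x).
Proof.
move=> mh hM [mf f2]; have M0 (x : T) : 0 <= M := le_trans (normc_ge0 _) (hM x).
split; first exact: cmeasM.
apply: (@le_lt_trans _ _ (sq (fun x => real_complex R `|M| * f x))); last first.
  by rewrite sqZ// lte_mul_pinfty// lee_fin sqr_ge0.
apply: sq_le; [exact: cmeasM|apply: cmeasM => //; exact: cmeas_cst|move=> x].
by rewrite !normcM ler_wpM2r ?normc_ge0// normc_real normr_id (le_trans (hM x))// ler_norm.
Qed.

Lemma isL2Z c f : isL2 f -> isL2 (fun x => c * f x).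
Proof. by apply: (@isL2M (normc c)) => //; exact: cmeas_cst. Qed.

Lemma isL2N f : isL2 f -> isL2 (fun x => - f x).
Proof. by move=> f2; apply: (isL2_le _ f2) => [|x]; [exact: cmeasN f2.1|rewrite normcN]. Qed.

Lemma isL2B f g : isL2 f -> isL2 g -> isL2 (fun x => f x - g x).
Proof. by move=> f2 /isL2N; exact: isL2D. Qed.

Lemma isL2_conj f : isL2 f -> isL2 (fun x => conjc (f x)).
Proof. by move=> f2; apply: (isL2_le _ f2) => [|x]; [exact: cmeas_conj f2.1|rewrite normc_conj]. Qed.

Lemma isL20 : isL2 (fun=> 0).
Proof.
split; first exact: cmeas_cst.
by rewrite /sq; under eq_integral do rewrite normc0 expr0n; rewrite integral0.
Qed.

Lemma sq_norm_eq f g : (forall x, normc (f x) = normc (g x)) -> sq f = sq g.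
Proof. by move=> fg; apply: eq_integral => x _; rewrite fg. Qed.

Lemma n2_norm_eq f g : (forall x, normc (f x) = normc (g x)) -> n2 f = n2 g.
Proof. by move=> fg; rewrite /n2 (sq_norm_eq fg). Qed.

Lemma n2N f : n2 (fun x => - f x) = n2 f.
Proof. by apply: n2_norm_eq => x; rewrite normcN. Qed.

Lemma n2_conj f : n2 (fun x => conjc (f x)) = n2 f.
Proof. by apply: n2_norm_eq => x; rewrite normc_conj. Qed.

Lemma n2C f g : n2 (fun x => f x - g x) = n2 (fun x => g x - f x).
Proof. by rewrite -n2N; congr n2; apply/funext => x; rewrite opprB. Qed.

Lemma n2_0 : n2 (fun=> 0) = 0.
Proof.
rewrite /n2 /sq; under eq_integral do rewrite normc0 expr0n.
by rewrite integral0 sqrtr0.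
Qed.

Lemma sq_ae f g : cmeas f -> cmeas g -> f = g %[ae mu] -> sq f = sq g.
Proof.
move=> mf mg fg; apply: ae_eq_integral => //; try exact: measurable_sq.
by apply: filterS fg => x /= h _; rewrite h.
Qed.

Lemma isL2_ae f g : cmeas g -> f = g %[ae mu] -> isL2 f -> isL2 g.
Proof. by move=> mg fg [mf f2]; split => //; rewrite -(sq_ae mf mg). Qed.

Lemma n2_ae f g : cmeas f -> cmeas g -> f = g %[ae mu] -> n2 f = n2 g.
Proof. by move=> mf mg fg; rewrite /n2 (sq_ae mf mg fg). Qed.

Lemma sq_eq0 f : cmeas f -> sq f = 0%E -> f = (fun=> 0) %[ae mu].
Proof.
move=> mf; rewrite /sq => f0.
have /ae_eq_integral_abs : measurable_fun setT (fun x => (normc (f x) ^+ 2)%:E).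
  exact: measurable_sq.
move=> /(_ mu measurableT)[+ _].
under eq_integral do rewrite gee0_abs ?lee_fin ?sqr_ge0//.
move=> /(_ f0); apply: filterS => x /= /(_ I)[/eqP].
by rewrite sqrf_eq0 normc_eq0 => /eqP.
Qed.

Lemma n2_eq0 f : isL2 f -> n2 f = 0 -> f = (fun=> 0) %[ae mu].
Proof. by move=> f2 f0; apply: sq_eq0; [exact: f2.1|rewrite sqE// f0 expr0n]. Qed.

Lemma n2B_eq0 f g : isL2 f -> isL2 g -> n2 (fun x => f x - g x) = 0 -> f = g %[ae mu].
Proof.
move=> f2 g2 /n2_eq0 => /(_ (isL2B f2 g2)); apply: filterS => x /= /(_ I)/eqP.
by rewrite subr_eq0 => /eqP.
Qed.

Lemma n2_le f (c : R) : 0 <= c -> (sq f <= (c ^+ 2)%:E)%E -> n2 f <= c.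
Proof.
move=> c0 fc; rewrite /n2 -(ger0_norm c0) -sqrtr_sqr ler_wsqrtr//.
by rewrite -lee_fin fineK// ge0_fin_numE ?sq_ge0// (le_lt_trans fc)// ltry.
Qed.

Lemma n2_le_norm f g : cmeas f -> isL2 g -> (forall x, normc (f x) <= normc (g x)) ->
  n2 f <= n2 g.
Proof.
by move=> mf g2 fg; apply: n2_le; rewrite ?n2_ge0// -sqE//; apply: sq_le => //; case: g2.
Qed.

Lemma n2Z c f : isL2 f -> n2 (fun x => c * f x) = normc c * n2 f.
Proof.
move=> f2; rewrite [LHS]/n2 sqZ; last by case: f2.
by rewrite (sqE f2) -EFinM /= -exprMn sqrtr_sqr ger0_norm// mulr_ge0 ?normc_ge0 ?n2_ge0.
Qed.

Lemma n2M_le (M : R) h f : cmeas h -> (forall x, normc (h x) <= M) -> 0 <= M -> isL2 f ->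
  n2 (fun x => h x * f x) <= M * n2 f.
Proof.
move=> mh hM M0 f2; rewrite -{1}(ger0_norm M0) -normc_real -n2Z//.
apply: n2_le_norm; [exact: cmeasM mh f2.1|exact: isL2Z|move=> x].
by rewrite !normcM ler_wpM2r ?normc_ge0// normc_real ger0_norm.
Qed.

Lemma Lnorm2E f : Lnorm mu 2%:E (fun x => (normc (f x))%:E) = (sq f `^ 2^-1)%E.
Proof.
rewrite unlock /sq; congr (_ `^ _)%E; apply: eq_integral => x _.
by rewrite abse_EFin poweR_EFin ger0_norm ?normc_ge0// powR_mulrn ?normc_ge0.
Qed.

Lemma Lnorm2_lty f : (Lnorm mu 2%:E (fun x => (normc (f x))%:E) < +oo)%E <-> (sq f < +oo)%E.
Proof.
rewrite Lnorm2E; split => h; last by rewrite poweR_lty.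
have : (sq f `^ 2^-1 != +oo)%E by rewrite -ltey.
by apply: contraTT; rewrite -leNgt leye_eq => /eqP ->; rewrite poweRyr// invr_neq0.
Qed.

Lemma Lnorm2_n2 f : isL2 f -> Lnorm mu 2%:E (fun x => (normc (f x))%:E) = (n2 f)%:E.
Proof.
move=> f2; rewrite Lnorm2E sqE// poweR_EFin; congr (_%:E).
by rewrite -powR_mulrn ?n2_ge0// -powRrM divff// powRr1 ?n2_ge0.
Qed.

(* AM-GM dominates the product. *)
Lemma cintable_mul f g : isL2 f -> isL2 g -> cintable mu (fun x => f x * g x).
Proof.
move=> [mf f2] [mg g2]; split; first exact: cmeasM.
apply: (@le_lt_trans _ _ (sq f + sq g)%E); last by rewrite lte_add_pinfty.
rewrite /sq -ge0_integralD//; try by [move=> x _; rewrite lee_fin sqr_ge0|exact: measurable_sq].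
apply: ge0_int_le.
- by move=> x; rewrite lee_fin normc_ge0.
- exact/measurable_EFinP/measurable_normc/cmeasM.
- by apply: emeasurable_funD; exact: measurable_sq.
- move=> x; rewrite -EFinD lee_fin normcM.
  have := normc_ge0 (f x); have := normc_ge0 (g x).
  by move: (normc (f x)) (normc (g x)) => a b; nra.
Qed.

Lemma hoelder2_n2 f g : isL2 f -> isL2 g ->
  (\int[mu]_x (normc (f x * g x))%:E <= (n2 f * n2 g)%:E)%E.
Proof.
move=> f2 g2; have mf := measurable_normc f2.1; have mg := measurable_normc g2.1.
have := @hoelder _ _ _ mu _ _ 2 2 mf mg.
rewrite EFinM -!Lnorm2_n2// => h; apply: le_trans (h _ _ _) => //; last first.
  by rewrite -div1r -mulrDl divff.
rewrite Lnorm1; under [leRHS]eq_integral do rewrite /= ger0_norm ?mulr_ge0 ?normc_ge0//.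
by under [leLHS]eq_integral do rewrite normcM.
Qed.

Lemma cauchy_schwarz f g : isL2 f -> isL2 g ->
  normc (cint mu (fun x => f x * g x)) <= n2 f * n2 g.
Proof.
move=> f2 g2; rewrite -lee_fin; apply: le_trans (hoelder2_n2 f2 g2).
exact/normc_cint_le/cintable_mul.
Qed.

Lemma cint_sqr f : isL2 f ->
  cint mu (fun x => f x * conjc (f x)) = real_complex R (n2 f ^+ 2).
Proof.
move=> f2; under cint_eq do rewrite mul_conjc.
by rewrite cint_real /Rintegral -/(sq f) sqE.
Qed.

(** The polarisation identity. It yields the triangle inequality through Cauchy-Schwarz, and later
    the inversion theorem, where two functions are shown equal from their norms and their
    pairing. *)
Lemma n2_sub_sqr f g : isL2 f -> isL2 g -> n2 (fun x => f x - g x) ^+ 2 =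
  n2 f ^+ 2 + n2 g ^+ 2 - 2 * complex.Re (cint mu (fun x => f x * conjc (g x))).
Proof.
move=> f2 g2; have cg2 := isL2_conj g2; have cf2 := isL2_conj f2.
have := cint_sqr (isL2B f2 g2).
rewrite (@cint_eq _ _ _ mu _ (fun x => (f x * conjc (f x) + g x * conjc (g x)) -
   (f x * conjc (g x) + conjc (f x * conjc (g x))))); last first.
  move=> x; case: (f x) (g x) => [a b] [c e].
  by apply: complexP => /=; ring.
rewrite cintB ?cintD ?cint_conj//; try exact: cintable_mul.
- move=> /(congr1 (@complex.Re R)); rewrite !cint_sqr//.
  by case: (cint mu _) => a b /= <-; ring.
- exact/cintable_conj/cintable_mul.
- by apply: cintableD; exact: cintable_mul.
- by apply: cintableD; [|apply: cintable_conj]; exact: cintable_mul.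
Qed.

Lemma n2B f g : isL2 f -> isL2 g -> n2 (fun x => f x - g x) <= n2 f + n2 g.
Proof.
move=> f2 g2; rewrite -(@ler_pXn2r _ 2) ?nnegrE ?addr_ge0 ?n2_ge0// n2_sub_sqr//.
have := cauchy_schwarz f2 (isL2_conj g2); rewrite n2_conj.
have := normc_Re (cint mu (fun x => f x * conjc (g x))); rewrite ler_norml => /andP[+ _].
by move: (complex.Re _) (normc _) (n2 f) (n2 g) => r s a b; nra.
Qed.

Lemma n2D f g : isL2 f -> isL2 g -> n2 (fun x => f x + g x) <= n2 f + n2 g.
Proof.
move=> f2 g2; rewrite -(n2N g); have := n2B f2 (isL2N g2).
by under [X in n2 X]eq_fun do rewrite opprK.
Qed.

Lemma n2_dist f g : isL2 f -> isL2 g -> `|n2 f - n2 g| <= n2 (fun x => f x - g x).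
Proof.
move=> f2 g2; rewrite ler_norml; apply/andP; split.
  rewrite lerNl opprB lerBlDr n2C.
  have := n2D (isL2B g2 f2) f2; by under [X in n2 X]eq_fun do rewrite subrK.
rewrite lerBlDr; have := n2D (isL2B f2 g2) g2.
by under [X in n2 X]eq_fun do rewrite subrK.
Qed.

Lemma n2_tri f g h : isL2 f -> isL2 g -> isL2 h ->
  n2 (fun x => f x - h x) <= n2 (fun x => f x - g x) + n2 (fun x => g x - h x).
Proof.
move=> f2 g2 h2; have := n2D (isL2B f2 g2) (isL2B g2 h2).
by under [X in n2 X]eq_fun do rewrite addrA subrK.
Qed.

Lemma cvg_cint_mul (u v : nat -> T -> C) f g :
  (forall n, isL2 (u n)) -> (forall n, isL2 (v n)) -> isL2 f -> isL2 g ->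
  n2 (fun x => u n x - f x) @[n --> \oo] --> (0 : R) ->
  n2 (fun x => v n x - g x) @[n --> \oo] --> (0 : R) ->
  normc (cint mu (fun x => u n x * v n x) - cint mu (fun x => f x * g x)) @[n --> \oo] --> (0 : R).
Proof.
move=> u2 v2 f2 g2 uf vg.
apply: (@squeeze_cvgr _ _ _ _ (fun=> 0) (fun n => n2 (fun x => u n x - f x) * (n2 g + n2 (fun x => v n x - g x)) + n2 f * n2 (fun x => v n x - g x))).
- apply: nearW => n; apply/andP; split; first exact: normc_ge0.
  have -> : cint mu (fun x => u n x * v n x) - cint mu (fun x => f x * g x) =
    cint mu (fun x => (u n x - f x) * v n x) + cint mu (fun x => f x * (v n x - g x)).
    rewrite -cintB -?cintD; try exact: cintable_mul; first last.
    + by apply: cintable_mul => //; exact: isL2B.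
    + by apply: cintable_mul => //; exact: isL2B.
    by apply: cint_eq => x; ring.
  apply: le_trans (normcD _ _) _; apply: lerD.
    apply: le_trans (cauchy_schwarz _ _) _ => //; first exact: isL2B.
    rewrite ler_wpM2l ?n2_ge0//; have := n2D g2 (isL2B (v2 n) g2).
    by under [X in n2 X <= _]eq_fun do rewrite addrC subrK.
  by apply: cauchy_schwarz => //; exact: isL2B.
- exact: cvg_cst.
- rewrite -[X in _ --> X](_ : 0 * (n2 g + 0) + n2 f * 0 = 0); last by rewrite mul0r mulr0 addr0.
  by apply: cvgD; apply: cvgM => //; [apply: cvgD => //; exact: cvg_cst|exact: cvg_cst].
Qed.

(** Density principle: a bilinear identity checked on approximating sequences passes to their [L2]
    limits. It extends the multiplication formula to [L2] and carries difference quotients to the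
    limit in integration by parts. *)
Lemma eq_cint_mul_lim (u v u' v' : nat -> T -> C) f g f' g' :
  (forall n, isL2 (u n)) -> (forall n, isL2 (v n)) -> isL2 f -> isL2 g ->
  (forall n, isL2 (u' n)) -> (forall n, isL2 (v' n)) -> isL2 f' -> isL2 g' ->
  n2 (fun x => u n x - f x) @[n --> \oo] --> (0 : R) ->
  n2 (fun x => v n x - g x) @[n --> \oo] --> (0 : R) ->
  n2 (fun x => u' n x - f' x) @[n --> \oo] --> (0 : R) ->
  n2 (fun x => v' n x - g' x) @[n --> \oo] --> (0 : R) ->
  (forall n, cint mu (fun x => u n x * v n x) = cint mu (fun x => u' n x * v' n x)) ->
  cint mu (fun x => f x * g x) = cint mu (fun x => f' x * g' x).
Proof.
move=> u2 v2 f2 g2 u2' v2' f2' g2' uf vg uf' vg' e.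
have h := cvg_cint_mul u2 v2 f2 g2 uf vg; have h' := cvg_cint_mul u2' v2' f2' g2' uf' vg'.
apply/eqP; rewrite -subr_eq0 -normc_eq0 eq_le normc_ge0 andbT.
have hh := @cvgD _ _ _ _ eventually_filter _ _ _ _ h h'; rewrite addr0 in hh.
have := @cvgr_to_ge _ _ _ _ _ _ (normc (cint mu (fun x => f x * g x) - cint mu (fun x => f' x * g' x))) hh.
apply.
apply: nearW => n.
change (normc (cint mu (fun x => f x * g x) - cint mu (fun x => f' x * g' x)) <=
  normc (cint mu (fun x => u n x * v n x) - cint mu (fun x => f x * g x)) +
  normc (cint mu (fun x => u' n x * v' n x) - cint mu (fun x => f' x * g' x))).
rewrite e.
set a := cint _ _; set b := cint _ _; set c := cint _ _.
have -> : a - b = - (c - a) + (c - b) by ring.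
by apply: le_trans (normcD _ _) _; rewrite normcN.
Qed.

End SquareIntegrable.

(** * Completeness of L2 *)

Lemma limn_einf_le_near {R : realType} (u : nat -> \bar R) (c : \bar R) (N : nat) :
  (forall n, (N <= n)%N -> (u n <= c)%E) -> (limn_einf u <= c)%E.
Proof.
move=> uc; rewrite limn_einf_lim; apply: lime_le; first exact: is_cvg_einfs.
apply: nearW => m; apply: (@le_trans _ _ (u (maxn m N))); last by rewrite uc// leq_maxr.
by apply: ereal_inf_lbound; exists (maxn m N) => //=; exact: leq_maxl.
Qed.

Lemma limn_einf_ge0 {R : realType} (u : nat -> \bar R) :
  (forall n, (0 <= u n)%E) -> (0 <= limn_einf u)%E.
Proof.
move=> u0; rewrite limn_einf_lim; apply: lime_ge; first exact: is_cvg_einfs.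
by apply: nearW => m; apply: le_ereal_inf_tmp => _ [k _ <-].
Qed.

Lemma cvgn_summable_increments {R : realType} (a d : nat -> R) :
  (forall k, `|a k.+1 - a k| <= d k) -> cvgn (series d) -> cvgn a.
Proof.
move=> ad cd; have d0 k : 0 <= d k by apply: le_trans (ad k); rewrite normr_ge0.
have c1 : cvgn [normed series (telescope a)].
  by apply: series_le_cvg cd => // k /=; rewrite normr_ge0.
have c2 := normed_cvg c1.
rewrite (_ : a = (fun n => a 0%N + series (telescope a) n)).
  by apply: is_cvgD => //; exact: is_cvg_cst.
by apply/funext => n; rewrite -eq_sum_telescope.
Qed.

Section Completeness.
Context {R : realType} d (T : measurableType d) (mu : {measure set T -> \bar R}).
Local Notation C := R[i].

Lemma measurable_limn_einf (h : nat -> T -> \bar R) :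
  (forall n, measurable_fun setT (h n)) -> measurable_fun setT (fun x => limn_einf (h ^~ x)).
Proof.
move=> mh; apply: measurableT_comp => //.
have := @measurable_fun_limn_esup _ T R setT (fun n x => (- h n x)%E).
by apply=> n; exact: measurableT_comp.
Qed.

(** Squares are summed with weights [2^k]: the integral of [S] is at most 1 by the fast decay of the
    norms, so [S] is finite almost everywhere, and there [D <= 2^k D^2 + 2^-k] makes the increments
    summable. *)
Lemma ae_cvg_fast (g : nat -> T -> C) : (forall k, isL2 mu (g k)) ->
  (forall k, n2 mu (fun x => g k.+1 x - g k x) <= (2 ^ k.+1)%:R^-1) ->
  {ae mu, forall x, cvgn (fun k => complex.Re (g k x)) /\ cvgn (fun k => complex.Im (g k x))}.
Proof.
move=> g2 gd; pose D k x := normc (g k.+1 x - g k x).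
pose S x := (\sum_(k <oo) ((2 ^ k)%:R * D k x ^+ 2)%:E)%E.
have mD k : measurable_fun setT (fun x => ((2 ^ k)%:R * D k x ^+ 2)%:E).
  apply/measurable_EFinP; apply: measurable_funM; first exact: measurable_cst.
  by apply: measurable_normc2; apply: cmeasB; [exact: (g2 _).1|exact: (g2 _).1].
have D0 k x : (0 <= ((2 ^ k)%:R * D k x ^+ 2)%:E)%E by rewrite lee_fin mulr_ge0// sqr_ge0.
have intS : (\int[mu]_x S x <= 1%:E)%E.
  rewrite integral_nneseries//.
  apply: le_trans (epsilon_trick0 (fun=> true) (ler01 : 0 <= 1 :> R)).
  apply: lee_nneseries => [i _ _|k _]; first exact: integral_ge0.
  under eq_integral do rewrite EFinM.
  rewrite ge0_integralZl//; last by move=> x _; rewrite lee_fin sqr_ge0.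
    rewrite -/(sq mu (fun x => g k.+1 x - g k x)) (sqE (isL2B (g2 _) (g2 _))) -EFinM lee_fin.
    have := gd k; have := n2_ge0 mu (fun x => g k.+1 x - g k x).
    move: (n2 _ _) => r r0 rk.
    apply: (@le_trans _ _ ((2 ^ k)%:R * ((2 ^ k.+1)%:R^-1 * (2 ^ k.+1)%:R^-1))).
      by rewrite ler_wpM2l// expr2 ler_pM.
    rewrite mul1r mulrA -[leRHS]mul1r ler_wpM2r ?invr_ge0//.
    by rewrite ler_pdivrMr ?ltr0n ?expn_gt0// mul1r ler_nat leq_exp2l.
  exact/measurable_sq/cmeasB/(g2 _).1/(g2 _).1.
have mS : measurable_fun setT S.
  by apply: ge0_emeasurable_sum => [k x _ _|k _]; [exact: D0|exact: mD].
have S0 x : (0 <= S x)%E by apply: nneseries_ge0 => k _ _; exact: D0.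
have iS : mu.-integrable setT S.
  apply/integrableP; split => //; under eq_integral do rewrite gee0_abs//.
  by apply: le_lt_trans intS _; rewrite ltry.
have := integrable_ae measurableT iS; apply: filterS => x /(_ I) Sx.
have Soo : (S x < +oo)%E by rewrite -ge0_fin_numE.
have c1 : cvgn (series (fun k => (2 ^ k)%:R * D k x ^+ 2)).
  by apply: nnseries_is_cvg Soo => k; rewrite mulr_ge0// sqr_ge0.
have c2 : cvgn (series (geometric 1 (2^-1 : R))).
  by apply: is_cvg_geometric_series; rewrite ger0_norm// invf_lt1// ltr1n.
have gE k : geometric 1 (2^-1 : R) k = (2 ^+ k)^-1 by rewrite /geometric /= mul1r exprVn.
have c3 : cvgn (series (fun k => D k x)).
  have c12 := is_cvgD c1 c2.
  apply: (@series_le_cvg _ _ (fun k => (2 ^ k)%:R * D k x ^+ 2 + geometric 1 2^-1 k)).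
  - by move=> k; exact: normc_ge0.
  - move=> k; rewrite gE; apply: addr_ge0; first by rewrite mulr_ge0// sqr_ge0.
    by rewrite invr_ge0 exprn_ge0.
  - move=> k; rewrite gE natrX.
    have p0 : 0 < (2 : R) ^+ k by rewrite exprn_gt0.
    move: (D k x) (2 ^+ k) p0 => t p p0; rewrite -subr_ge0.
    have -> : p * t ^+ 2 + p^-1 - t = ((t * p) ^+ 2 - t * p + 1) / p.
      by field; exact: lt0r_neq0.
    by rewrite divr_ge0 ?ltW//; move: (t * p) => z; nra.
  have -> : series (fun k => (2 ^ k)%:R * D k x ^+ 2 + geometric 1 2^-1 k) =
      series (fun k => (2 ^ k)%:R * D k x ^+ 2) + series (geometric 1 2^-1).
    by apply/funext => n; rewrite /series/= big_split.
  exact: c12.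
split; apply: cvgn_summable_increments c3 => k.
  by apply: le_trans (normc_Re _); rewrite ReD ReN.
by apply: le_trans (normc_Im _); rewrite ImD ImN.
Qed.

(** Fatou's lemma against an arbitrary [f]. With [f] a term of the original Cauchy sequence and [g]
    an extracted subsequence, it bounds [f - l] directly, so square integrability of [l] and
    convergence of the full sequence come from one estimate. *)
Lemma L2_fast_limit (g : nat -> T -> C) : (forall k, isL2 mu (g k)) ->
  (forall k, n2 mu (fun x => g k.+1 x - g k x) <= (2 ^ k.+1)%:R^-1) ->
  exists l : T -> C, cmeas l /\
    forall f, isL2 mu f -> forall (c : R) N, 0 <= c ->
      (forall k, (N <= k)%N -> n2 mu (fun x => f x - g k x) <= c) ->
      (sq mu (fun x => f x - l x)%R <= (c ^+ 2)%:E)%E.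
Proof.
move=> g2 gd; have gcvg := ae_cvg_fast g2 gd.
(* Upper limits are measurable everywhere and equal the limits wherever these exist; [fine] gives
   some value on the remaining null set. *)
pose l x := Complex (fine (limn_esup (fun k => (complex.Re (g k x))%:E)))
                    (fine (limn_esup (fun k => (complex.Im (g k x))%:E))).
have ml : cmeas l.
  split; (apply: measurableT_comp; first by []); apply: measurable_fun_limn_esup => k;
    by apply/measurable_EFinP; case: (g2 k) => -[].
exists l; split => // f f2 c N c0 fgc.
have mh k : measurable_fun setT (fun x => (normc (f x - g k x) ^+ 2)%:E).
  exact/measurable_sq/cmeasB/(g2 _).1/f2.1.
apply: (@le_trans _ _ (\int[mu]_x limn_einf (fun k => (normc (f x - g k x) ^+ 2)%:E))%E).
  apply: ae_ge0_le_integral => //.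
  - by move=> x _; rewrite lee_fin sqr_ge0.
  - exact/measurable_sq/cmeasB/ml/f2.1.
  - by move=> x _; apply: limn_einf_ge0 => k; rewrite lee_fin sqr_ge0.
  - exact: measurable_limn_einf.
  - apply: filterS gcvg => x [cR cI] _.
    have eR : complex.Re (l x) = limn (fun k => complex.Re (g k x)).
      have cE : (complex.Re (g k x))%:E @[k --> \oo] --> (limn (fun k => complex.Re (g k x)))%:E.
        by apply: cvg_EFin cR; exact: nearW.
      by rewrite /l /= (cvg_limn_einf_sup cE).2.
    have eI : complex.Im (l x) = limn (fun k => complex.Im (g k x)).
      have cE : (complex.Im (g k x))%:E @[k --> \oo] --> (limn (fun k => complex.Im (g k x)))%:E.
        by apply: cvg_EFin cI; exact: nearW.
      by rewrite /l /= (cvg_limn_einf_sup cE).2.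
    have cc : (normc (f x - g k x) ^+ 2)%:E @[k --> \oo] --> (normc (f x - l x) ^+ 2)%:E.
      apply: cvg_EFin; first exact: nearW.
      under eq_fun do rewrite /= sqr_normcE ReD ImD ReN ImN.
      rewrite sqr_normcE ReD ImD ReN ImN eR eI.
      by apply: cvgD; apply: cvgM; (apply: cvgB; [exact: cvg_cst|]).
    by have [-> _] := cvg_limn_einf_sup cc.
apply: le_trans (fatou mu measurableT mh _) _.
  by move=> k x _; rewrite lee_fin sqr_ge0.
apply: (@limn_einf_le_near _ _ _ N) => k Nk.
rewrite -/(sq mu (fun x => f x - g k x)) (sqE (isL2B f2 (g2 k))) lee_fin.
by rewrite ler_sqr ?nnegrE ?n2_ge0// fgc.
Qed.

Theorem L2_complete (f : nat -> T -> C) : (forall n, isL2 mu (f n)) ->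
  (forall eps : R, 0 < eps -> exists N, forall m n, (N <= m)%N -> (N <= n)%N ->
     n2 mu (fun x => f m x - f n x) <= eps) ->
  exists2 l, isL2 mu l & n2 mu (fun x => f n x - l x) @[n --> \oo] --> (0 : R).
Proof.
move=> f2 fC.
have /choice[N NP] : forall k : nat, exists N, forall m n, (N <= m)%N -> (N <= n)%N ->
    n2 mu (fun x => f m x - f n x) <= (2 ^ k.+1)%:R^-1.
  by move=> k; apply: fC; rewrite invr_gt0 ltr0n expn_gt0.
(* Partial sums give a nondecreasing sequence of indices with [p k] above the threshold [N k]. *)
pose p k := (\sum_(j < k.+1) N j)%N.
have pS k : (p k <= p k.+1)%N by rewrite /p [X in (_ <= X)%N]big_ord_recr leq_addr.
have Np k : (N k <= p k)%N by rewrite /p big_ord_recr leq_addl.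
have kp j k : (j <= k)%N -> (p j <= p k)%N.
  elim: k => [|k IH]; first by rewrite leqn0 => /eqP ->.
  by rewrite leq_eqVlt => /predU1P[->//|]; rewrite ltnS => /IH h; exact: leq_trans h _.
have [|l [ml lP]] := @L2_fast_limit (fun k => f (p k)) (fun k => f2 _).
  by move=> k; apply: NP; [exact: leq_trans (Np k) (pS k)|exact: Np].
have fl (k : nat) m : (N k <= m)%N -> (sq mu (fun x => f m x - l x)%R <= ((2 ^ k.+1)%:R^-1 ^+ 2)%:E)%E.
  move=> Nm; apply: (@lP _ (f2 m) _ k) => // j kj.
  by apply: NP => //; exact: leq_trans (Np k) (kp _ _ kj).
have l2 : isL2 mu l.
  have h : isL2 mu (fun x => f (N 0%N) x - l x).
    split; first exact: cmeasB (f2 _).1 ml.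
    by apply: le_lt_trans (fl 0%N _ (leqnn _)) _; rewrite ltry.
  have := isL2B (f2 (N 0%N)) h.
  by under [X in isL2 _ X -> _]eq_fun do rewrite opprB addrC subrK.
exists l => //; apply/cvgrPdist_le => e e0.
have [k ke] : exists k : nat, (2 ^ k.+1)%:R^-1 <= e.
  exists (Num.truncn e^-1); rewrite -[leRHS]invrK lef_pV2 ?posrE ?invr_gt0 ?ltr0n ?expn_gt0//.
  have e0' : 0 <= e^-1 by rewrite invr_ge0 ltW.
  have /andP[_ /ltW h] := truncn_itv e0'; apply: le_trans h _.
  by rewrite ler_nat ltnW// ltn_expl.
exists (N k) => // m /= Nm; rewrite sub0r normrN ger0_norm ?n2_ge0//.
by apply: le_trans ke; apply: n2_le => //; exact: fl.
Qed.

End Completeness.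

(** * Continuity of translations in L2 *)

Section MeasurePreserving.
Context {R : realType} d (T : measurableType d) (mu : {measure set T -> \bar R}).

Definition mpres (phi : T -> T) := measurable_fun setT phi /\
  forall A, measurable A -> mu (phi @^-1` A) = mu A.

Lemma ge0_integral_mpres phi (f : T -> \bar R) : mpres phi ->
  measurable_fun setT f -> (forall x, (0 <= f x)%E) ->
  (\int[mu]_x f (phi x) = \int[mu]_x f x)%E.
Proof.
move=> [mphi phiE] mf f0.
have := @ge0_integral_pushforward _ _ _ _ _ phi mphi mu setT f measurableT mf (fun y _ => f0 y).
rewrite preimage_setT => <-.
by apply: eq_measure_integral => A mA _; exact: phiE.
Qed.

Lemma Rintegral_mpres phi (f : T -> R) : mpres phi -> measurable_fun setT f ->
  Rintegral mu setT (fun x => f (phi x)) = Rintegral mu setT f.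
Proof.
move=> mp mf; have mef : measurable_fun setT (EFin \o f) by exact/measurable_EFinP.
rewrite /Rintegral integralE [in RHS]integralE; congr (fine (_ - _)).
  rewrite -[RHS](ge0_integral_mpres mp)//; last exact: measurable_funepos.
  by apply: eq_integral => x _; rewrite !funeposE.
rewrite -[RHS](ge0_integral_mpres mp)//; last exact: measurable_funeneg.
by apply: eq_integral => x _; rewrite !funenegE.
Qed.

Lemma cint_mpres phi (f : T -> R[i]) : mpres phi -> cmeas f ->
  cint mu (fun x => f (phi x)) = cint mu f.
Proof. by move=> mp [f1 f2]; rewrite /cint (Rintegral_mpres mp f1) (Rintegral_mpres mp f2). Qed.

Lemma sq_mpres phi (f : T -> R[i]) : mpres phi -> cmeas f ->
  sq mu (fun x => f (phi x)) = sq mu f.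
Proof.
move=> mp mf; apply: (@ge0_integral_mpres phi (fun y => (normc (f y) ^+ 2)%:E)) => //.
- exact: measurable_sq.
- by move=> x; rewrite lee_fin sqr_ge0.
Qed.

Lemma n2_mpres phi (f : T -> R[i]) : mpres phi -> cmeas f ->
  n2 mu (fun x => f (phi x)) = n2 mu f.
Proof. by move=> mp mf; rewrite /n2 sq_mpres. Qed.

Lemma isL2_mpres phi (f : T -> R[i]) : mpres phi -> isL2 mu f ->
  isL2 mu (fun x => f (phi x)).
Proof.
by move=> mp [mf f2]; split; [exact: cmeas_comp mp.1 mf|rewrite sq_mpres].
Qed.

Lemma cintable_mpres phi (f : T -> R[i]) : mpres phi -> cintable mu f ->
  cintable mu (fun x => f (phi x)).
Proof.
move=> mp [mf f2]; split; first exact: cmeas_comp mp.1 mf.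
rewrite (@ge0_integral_mpres phi (fun y => (normc (f y))%:E))//.
  exact/measurable_EFinP/measurable_normc.
by move=> x; rewrite lee_fin normc_ge0.
Qed.

End MeasurePreserving.

Section Lebesgue.
Context {R : realType}.
Local Notation lam := (@lebesgue_measure R).
Local Notation mR := (measurableTypeR R).

(** The image of Lebesgue measure has the prescribed values on half-open intervals, and these
    determine it. *)
Lemma mpres_itv (f : R -> R) :
  measurable_fun [set: mR] (f : mR -> mR) ->
  (forall u v, lam (f @^-1` `]u, v]%classic) = lam `]u, v]%classic) -> mpres lam (f : mR -> mR).
Proof.
move=> mf fE; split => // A mA.
have mfp := isMeasurableFun.Build _ _ _ _ (f : mR -> mR) mf.
pose F : {mfun mR >-> mR} := HB.pack (f : mR -> mR) mfp.
apply/esym; apply: (@lebesgue_measure_unique _ (pushforward lam F)) => //.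
by move=> _ [[u v] _ <-]; exact/esym/fE.
Qed.

Lemma mpres_shift1 (a : R) : mpres lam (fun x : mR => x + a : mR).
Proof.
apply: mpres_itv => [|u v].
  by apply: measurable_funD => //; exact: measurable_cst.
rewrite (_ : _ @^-1` _ = `]u - a, v - a]%classic).
  rewrite !lebesgue_measure_itv/= !lte_fin ltrD2r; case: ifP => // _.
  by rewrite -!EFinB; congr (_%:E); ring.
by apply/seteqP; split => x /=; rewrite !in_itv/= ltrBlDr lerBrDr.
Qed.

Lemma mpres_opp1 : mpres lam (fun x : mR => - x : mR).
Proof.
apply: mpres_itv => [|u v]; first exact: measurableT_comp.
rewrite (_ : _ @^-1` _ = `[- v, - u[%classic).
  rewrite !lebesgue_measure_itv/= !lte_fin ltrN2; case: ifP => // _.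
  by rewrite -!EFinD; congr (_%:E); ring.
by apply/seteqP; split => x /=; rewrite !in_itv/= lerNl ltrNr andbC.
Qed.

End Lebesgue.

Section Product.
Context {R : realType} d1 d2 (T1 : measurableType d1) (T2 : measurableType d2).
Variables (m1 : {sigma_finite_measure set T1 -> \bar R}) (m2 : {sigma_finite_measure set T2 -> \bar R}).

Lemma mpres_prod (f : T1 -> T1) (g : T2 -> T2) : mpres m1 f -> mpres m2 g ->
  mpres (m1 \x m2)%E (fun x => (f x.1, g x.2)).
Proof.
move=> [mf fE] [mg gE].
have mfg : measurable_fun setT (fun x : T1 * T2 => (f x.1, g x.2)).
  by apply: measurable_fun_pair; [exact: (measurableT_comp mf measurable_fst)|
    exact: (measurableT_comp mg measurable_snd)].
split => // A mA.
have mfp := isMeasurableFun.Build _ _ _ _ (fun x : T1 * T2 => (f x.1, g x.2)) mfg.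
pose F : {mfun (T1 * T2)%type >-> (T1 * T2)%type} := HB.pack (fun x : T1 * T2 => (f x.1, g x.2)) mfp.
apply/esym; apply: (@product_measure_unique _ _ _ _ _ m1 m2 (pushforward (m1 \x m2)%E F)) => //.
move=> B C mB mC.
transitivity ((m1 \x m2)%E ((f @^-1` B) `*` (g @^-1` C))); first by [].
rewrite product_measure1E//.
- by rewrite -(fE B mB) -(gE C mC).
- by rewrite -[X in measurable X]setTI; exact: mf.
- by rewrite -[X in measurable X]setTI; exact: mg.
Qed.

End Product.

Lemma measure_tail_small {R : realType} d (T : measurableType d)
    (mu : {measure set T -> \bar R}) (F : (set T)^nat) (e : R) :
  (mu (F 0%N) < +oo)%E -> (forall n, measurable (F n)) -> nonincreasing_seq F ->
  \bigcap_n F n = set0 -> 0 < e -> exists n, (mu (F n) <= e%:E)%E.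
Proof.
move=> F0 mF niF F00 e0.
have := nonincreasing_cvg_mu F0 mF (bigcapT_measurable mF) niF.
rewrite F00 measure0 => /fine_cvgP[Ffin /cvgrPdist_le/(_ _ e0)].
move=> [N1 _ N1P]; case: Ffin => N2 _ N2P; exists (maxn N1 N2).
have := N1P (maxn N1 N2) (leq_maxl _ _); have /= := N2P (maxn N1 N2) (leq_maxr _ _).
by move=> /fineK <- /=; rewrite sub0r normrN ger0_norm ?fine_ge0.
Qed.

Section ShiftContinuity.
Context {R : realType} d (T : measurableType d) (mu : {measure set T -> \bar R}).
Context (Z : Type) (F : set_system Z) {FF : Filter F} (tau : Z -> T -> T).
Hypothesis mp : forall z, mpres mu (tau z).
Local Notation C := R[i].

Definition dif (A : set T) z : \bar R := (\int[mu]_x (`|\1_A (tau z x) - \1_A x|)%:E)%E.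
Definition shiftc (A : set T) := forall e : R, 0 < e -> \forall z \near F, (dif A z <= e%:E)%E.

Lemma measurable_indic_shift A z : measurable A -> measurable_fun setT (fun x => \1_A (tau z x) : R).
Proof.
move=> mA; have h : measurable_fun setT (\1_A : T -> R) by exact: measurable_indic.
exact: (measurableT_comp h (mp z).1).
Qed.

Lemma measurable_dif A z : measurable A ->
  measurable_fun setT (fun x => (`|\1_A (tau z x) - \1_A x : R|)%:E).
Proof.
move=> mA; apply/measurable_EFinP; apply: measurableT_comp => //.
by apply: measurable_funB; [exact: measurable_indic_shift|exact: measurable_indic].
Qed.

Lemma dif_sub A B D z : measurable A -> measurable B -> measurable D ->
  (forall u v, `|\1_A u - \1_A v : R| <= `|\1_B u - \1_B v| + `|\1_D u - \1_D v|) ->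
  (dif A z <= dif B z + dif D z)%E.
Proof.
move=> mA mB mD ABD; rewrite /dif -ge0_integralD//; try by [move=> x _; rewrite lee_fin|exact: measurable_dif].
apply: ge0_int_le.
- by move=> x; rewrite lee_fin.
- exact: measurable_dif.
- by apply: emeasurable_funD; exact: measurable_dif.
- by move=> x; rewrite -EFinD lee_fin ABD.
Qed.

Lemma dif_le A z : measurable A -> (dif A z <= 2%:E * mu A)%E.
Proof.
move=> mA; have mi : measurable_fun setT (fun x => (\1_A x : R)%:E).
  by apply/measurable_EFinP; exact: measurable_indic.
have mi' : measurable_fun setT (fun x => (\1_A (tau z x) : R)%:E).
  by apply/measurable_EFinP; exact: measurable_indic_shift.
have -> : (2%:E * mu A = \int[mu]_x ((\1_A (tau z x) : R)%:E + (\1_A x : R)%:E))%E.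
  rewrite ge0_integralD//.
  rewrite (ge0_integral_mpres (f := fun x => (\1_A x : R)%:E) (mp z))//.
  by rewrite !integral_indic// setIT -mule2n -mule_natl.
apply: ge0_int_le.
- by move=> x; rewrite lee_fin.
- exact: measurable_dif.
- exact: emeasurable_funD.
- move=> x; rewrite -EFinD lee_fin; apply: le_trans (ler_normB _ _) _.
  by rewrite !ger0_norm.
Qed.

(** A set contributes at most twice its measure, whatever [z] is, because [tau z] preserves the
    measure. So a remainder [D] of small measure can be discarded. *)
Lemma shiftc_approx A : measurable A ->
  (forall e : R, 0 < e -> exists B D, [/\ measurable B, measurable D, shiftc B,
     (mu D <= e%:E)%E &
     forall u v, `|\1_A u - \1_A v : R| <= `|\1_B u - \1_B v| + `|\1_D u - \1_D v| ]) ->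
  shiftc A.
Proof.
move=> mA H e e0; have e4 : 0 < e / 4 by rewrite divr_gt0.
have [B [D [mB mD cB De ABD]]] := H _ e4.
have := cB _ e4; apply: filterS => z Bz.
apply: le_trans (dif_sub z mA mB mD ABD) _.
apply: (@le_trans _ _ ((e / 4)%:E + 2%:E * (e / 4)%:E)%E).
  apply: leeD => //; apply: le_trans (dif_le z mD) _.
  by rewrite lee_wpmul2l.
by rewrite -EFinM -EFinD lee_fin; lra.
Qed.

Lemma shiftc_sub A B D : measurable A -> measurable B -> measurable D ->
  (forall u v, `|\1_A u - \1_A v : R| <= `|\1_B u - \1_B v| + `|\1_D u - \1_D v|) ->
  shiftc B -> shiftc D -> shiftc A.
Proof.
move=> mA mB mD ABD cB cD e e0; have e2 : 0 < e / 2 by rewrite divr_gt0.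
have := cB _ e2; have := cD _ e2; apply: filterS2 => z Dz Bz.
apply: le_trans (dif_sub z mA mB mD ABD) _.
by rewrite (splitr e) EFinD leeD.
Qed.

Lemma indic_addE (A B D : set T) : A = B `|` D -> B `&` D = set0 ->
  forall x, \1_A x = \1_B x + \1_D x :> R.
Proof.
move=> -> BD x; rewrite !indicE in_setU.
have [/set_mem xB|] := boolP (x \in B); have [/set_mem xD|] := boolP (x \in D); rewrite ?addr0 ?add0r//.
by have : (B `&` D) x by []; rewrite BD.
Qed.

Lemma indic_addP (A B D : set T) : A = B `|` D -> B `&` D = set0 ->
  forall u v, `|\1_A u - \1_A v : R| <= `|\1_B u - \1_B v| + `|\1_D u - \1_D v|.
Proof.
move=> AE BD u v; rewrite !(indic_addE AE BD).
have -> : \1_B u + \1_D u - (\1_B v + \1_D v) = (\1_B u - \1_B v) + (\1_D u - \1_D v) :> R by ring.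
exact: ler_normD.
Qed.

Lemma indic_subP (A B D : set T) : A = B `|` D -> B `&` D = set0 ->
  forall u v, `|\1_D u - \1_D v : R| <= `|\1_A u - \1_A v| + `|\1_B u - \1_B v|.
Proof.
move=> AE BD u v; rewrite !(indic_addE AE BD).
have -> : \1_D u - \1_D v = (\1_B u + \1_D u - (\1_B v + \1_D v)) - (\1_B u - \1_B v) :> R by ring.
exact: ler_normB.
Qed.

Lemma shiftc0 : shiftc set0.
Proof.
move=> e e0; apply: nearW => z; rewrite /dif.
under eq_integral do rewrite indic0 subrr normr0.
by rewrite integral0 lee_fin ltW.
Qed.

(** The sets [A] whose intersection with [Q] is continuous under shifts form a Dynkin system.
    Intersecting with a set of finite measure is what allows a countable union to be replaced by a
    finite one up to small measure. *)
Lemma shiftc_dynkin (G : set (set T)) (Q : set T) :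
  @measurable _ T = <<s G >> -> setI_closed G -> measurable Q -> (mu Q < +oo)%E -> shiftc Q ->
  (forall A, G A -> shiftc (A `&` Q)) -> forall A, measurable A -> shiftc (A `&` Q).
Proof.
move=> GE GI mQ Qoo cQ cG A mA.
apply: (@dynkin_induction _ T G (fun A => shiftc (A `&` Q))) => //.
- by rewrite setTI.
- move=> S mS cS.
  have E : Q = (S `&` Q) `|` (~` S `&` Q) by rewrite -setIUl setUv setTI.
  have E0 : (S `&` Q) `&` (~` S `&` Q) = set0.
    by rewrite setIACA setICr set0I.
  apply: (shiftc_sub _ _ _ (indic_subP E E0)) => //; apply: measurableI => //.
  exact: measurableC.
- move=> H mH tH cH.
  pose U n := \big[setU/set0]_(k < n) (H k `&` Q).
  have mHQ k : measurable (H k `&` Q) by exact: measurableI.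
  have mU n : measurable (U n) by exact: bigsetU_measurable.
  have cU n : shiftc (U n).
    elim: n => [|n IH]; first by rewrite /U big_ord0; exact: shiftc0.
    have UE : U n.+1 = U n `|` (H n `&` Q) by rewrite /U big_ord_recr.
    apply: (shiftc_sub _ _ _ (indic_addP UE _)) => //.
    rewrite /U big_distrl /= big1// => k _.
    have /trivIsetP/(_ k n I I) := tH; rewrite neq_ltn ltn_ord => /(_ isT) kn.
    by rewrite setIACA kn set0I.
  have mE : measurable (\bigcup_k H k `&` Q) by apply: measurableI => //; exact: bigcupT_measurable.
  apply: shiftc_approx => // e e0.
  pose D n := (\bigcup_k H k `&` Q) `\` U n.
  have [|||||n Dn] := @measure_tail_small _ _ _ mu D e.
  - apply: le_lt_trans Qoo; apply: le_measure; rewrite ?inE//; first exact: measurableD.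
    by move=> x [[_ ?] _].
  - by move=> n; exact: measurableD.
  - apply/nonincreasing_seqP => n; apply/subsetPset => x [Ex nUx]; split => // Ux.
    by apply: nUx; rewrite /U big_ord_recr; left.
  - rewrite -subset0 => x Dx; have [[[k _ Hkx] Qx] _] := Dx 0%N I.
    have [_] := Dx k.+1 I; apply; rewrite /U big_ord_recr; right; split => //.
  - exact: e0.
  exists (U n), (D n); split => //; first exact: measurableD.
  apply: indic_addP; last by rewrite /D setDE setICA setICr setI0.
  rewrite /D setDUK//; elim: n {Dn} => [|n IH]; first by rewrite /U big_ord0.
  by rewrite /U big_ord_recr => x [/IH//|[Hnx Qx]]; split => //; exists n.
by rewrite -GE.
Qed.

(** A set of finite measure lies in one [Q n] up to a small remainder, by continuity of the measure
    from above. *)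
Lemma shiftc_exhaust (Q : (set T)^nat) (A : set T) :
  (forall n, measurable (Q n)) -> nondecreasing_seq Q -> \bigcup_n Q n = setT ->
  (forall n, shiftc (A `&` Q n)) -> measurable A -> (mu A < +oo)%E -> shiftc A.
Proof.
move=> mQ ndQ QT cA mA Aoo; apply: shiftc_approx => // e e0.
have [|||||n Dn] := @measure_tail_small _ _ _ mu (fun n => A `\` Q n) e.
- by apply: le_lt_trans Aoo; apply: le_measure; rewrite ?inE//; exact: measurableD.
- by move=> n; exact: measurableD.
- apply/nonincreasing_seqP => n; apply/subsetPset => x [Ax nQx]; split => // Qx.
  by apply: nQx; have /subsetPset := ndQ _ _ (leqnSn n); apply.
- rewrite -subset0 => x Dx; have : [set: T] x by []; rewrite -QT => -[n _ Qx].
  by have [_] := Dx n I.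
- exact: e0.
exists (A `&` Q n), (A `\` Q n); split => //; [exact: measurableI|exact: measurableD|].
apply: indic_addP; first by rewrite setUIDK.
by rewrite setDE setIACA setICr setI0.
Qed.

End ShiftContinuity.

Lemma n2_dct {R : realType} d (T : measurableType d) (mu : {measure set T -> \bar R})
    (h : nat -> T -> R[i]) (G : T -> R[i]) :
  isL2 mu G -> (forall n, cmeas (h n)) ->
  {ae mu, forall x, normc (h n x) @[n --> \oo] --> (0 : R)} ->
  (forall n x, normc (h n x) <= normc (G x)) ->
  n2 mu (h n) @[n --> \oo] --> (0 : R).
Proof.
move=> G2 mh h0 hG.
have [|||||_ _ H] := @dominated_convergence _ _ _ mu setT measurableT
  (fun n x => (normc (h n x) ^+ 2)%:E) (fun=> 0%E) (fun x => (normc (G x) ^+ 2)%:E).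
- by move=> n; exact: measurable_sq.
- exact: measurable_cst.
- apply: filterS h0 => x hx _; apply: cvg_EFin; first exact: nearW.
  by rewrite -[X in _ --> X](mulr0 (0 : R)); apply: cvgM.
- apply/integrableP; split; first exact: measurable_sq G2.1.
  under eq_integral do rewrite gee0_abs ?lee_fin ?sqr_ge0//.
  exact: G2.2.
- apply: nearW => x n _; rewrite abse_EFin lee_fin ger0_norm ?sqr_ge0//.
  by rewrite ler_sqr ?nnegrE ?normc_ge0.
rewrite integral0 in H.
have H' : fine (sq mu (h n)) @[n --> \oo] --> (0 : R) by apply: fine_cvg; exact: H.
rewrite -[X in _ --> X](sqrtr0 R).
by apply: (cvg_comp _ _ H'); exact: sqrt_continuous.
Qed.

Section TranslationContinuity.
Context {R : realType} d (T : measurableType d) (mu : {measure set T -> \bar R}).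
Context (Z : Type) (F : set_system Z) {FF : Filter F} (tau : Z -> T -> T).
Hypothesis mp : forall z, mpres mu (tau z).
Local Notation C := R[i].
Local Notation "x %:C" := (real_complex R x).

Definition tc (f : T -> C) := forall e : R, 0 < e ->
  \forall z \near F, n2 mu (fun x => f (tau z x) - f x) <= e.

Lemma tcD f g : isL2 mu f -> isL2 mu g -> tc f -> tc g -> tc (fun x => f x + g x).
Proof.
move=> f2 g2 cf cg e e0; have e2 : 0 < e / 2 by rewrite divr_gt0.
have := cf _ e2; have := cg _ e2; apply: filterS2 => z gz fz.
rewrite (_ : (fun x => _) = (fun x => (f (tau z x) - f x) + (g (tau z x) - g x))).
  apply: le_trans (n2D (isL2B (isL2_mpres (mp z) f2) f2) (isL2B (isL2_mpres (mp z) g2) g2)) _.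
  by rewrite (splitr e) lerD.
by apply/funext => x; ring.
Qed.

Lemma tcZ c f : isL2 mu f -> tc f -> tc (fun x => c * f x).
Proof.
move=> f2 cf e e0; have e2 : 0 < e / (normc c + 1) by rewrite divr_gt0// ltr_wpDl// normc_ge0.
have := cf _ e2; apply: filterS => z fz.
under [X in n2 _ X]eq_fun do rewrite -mulrBr.
rewrite n2Z; last exact: isL2B (isL2_mpres (mp z) f2) f2.
have c1 : 0 < normc c + 1 by rewrite ltr_wpDl// normc_ge0.
apply: (@le_trans _ _ ((normc c + 1) * (e / (normc c + 1)))).
  by apply: ler_pM => //; rewrite ?normc_ge0 ?n2_ge0// lerDl.
by rewrite mulrC divfK// lt0r_neq0.
Qed.

Lemma tc0 : tc (fun=> 0).
Proof.
move=> e e0; apply: nearW => z.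
under [X in n2 _ X]eq_fun do rewrite subrr.
by rewrite n2_0 ltW.
Qed.

Lemma tc_lim f : isL2 mu f ->
  (forall e : R, 0 < e -> exists2 g, isL2 mu g /\ tc g & n2 mu (fun x => f x - g x) <= e) -> tc f.
Proof.
move=> f2 H e e0; have e3 : 0 < e / 3 by rewrite divr_gt0.
have [g [g2 cg] fg] := H _ e3.
have := cg _ e3; apply: filterS => z gz.
have fz2 := isL2_mpres (mp z) f2; have gz2 := isL2_mpres (mp z) g2.
apply: le_trans (n2_tri fz2 gz2 f2) _.
apply: le_trans (lerD (lexx _) (n2_tri gz2 g2 f2)) _.
rewrite (n2_mpres (f := fun y => f y - g y) (mp z)); last exact: cmeasB f2.1 g2.1.
by rewrite (n2C _ g f); lra.
Qed.

Lemma isL2_indic A : measurable A -> (mu A < +oo)%E -> isL2 mu (fun x => (\1_A x)%:C).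
Proof.
move=> mA Aoo; split; first by apply: cmeas_real; exact: measurable_indic.
rewrite /sq (_ : (fun x => _) = (fun x => (\1_A x)%:E)); first by rewrite integral_indic// setIT.
apply/funext => x; rewrite normc_real indicE; case: (x \in A).
  by rewrite normr1 expr1n.
by rewrite normr0 expr0n.
Qed.

Lemma tc_indic A : measurable A -> (mu A < +oo)%E -> shiftc mu F tau A -> tc (fun x => (\1_A x)%:C).
Proof.
move=> mA Aoo cA e e0; have e2 : 0 < e ^+ 2 by rewrite exprn_gt0.
have := cA _ e2; apply: filterS => z Az; apply: n2_le; first exact: ltW.
have A2 := isL2_indic mA Aoo.
apply: le_trans Az; apply: ge0_int_le.
- by move=> x; rewrite lee_fin sqr_ge0.
- exact/measurable_sq/cmeasB/A2.1/(isL2_mpres (mp z) A2).1.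
- exact: (measurable_dif mp).
(* A difference of indicators takes the values -1, 0 and 1, so its square is its absolute value and
   the squared [L2] distance is controlled by [dif]. *)
- move=> x; rewrite lee_fin -rmorphB normc_real !indicE.
  case: (_ \in A); case: (x \in A); rewrite ?subrr ?normr0 ?subr0 ?sub0r ?normrN ?normr1.
  all: by rewrite ?expr0n ?expr1n.
Qed.

Hypothesis cA : forall A, measurable A -> (mu A < +oo)%E -> shiftc mu F tau A.

Lemma tc_sum n (f : nat -> T -> C) : (forall k, isL2 mu (f k) /\ tc (f k)) ->
  isL2 mu (fun x => \sum_(i < n) f i x) /\ tc (fun x => \sum_(i < n) f i x).
Proof.
move=> H; elim: n => [|n [IH1 IH2]].
  under eq_fun do rewrite big_ord0; split; [exact: isL20|exact: tc0].
under eq_fun do rewrite big_ord_recr /=.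
by split; [apply: isL2D|apply: tcD] => //; case: (H n).
Qed.

Import HBNNSimple.

Lemma tc_nnsfun (g : {nnsfun T >-> R}) : isL2 mu (fun x => (g x)%:C) ->
  tc (fun x => (g x)%:C).
Proof.
move=> g2; pose s : seq R := fset_set (g @` setT).
pose f (i : nat) x : C := (s`_i)%:C * (\1_(g @^-1` [set s`_i]) x)%:C.
have -> : (fun x => (g x)%:C) = (fun x => \sum_(i < size s) f i x).
  by apply/funext => x; rewrite fimfunEord rmorph_sum; apply: eq_bigr => i _; rewrite rmorphM.
apply: (tc_sum _ _).2 => k; set c := s`_k; set A := g @^-1` [set c].
have mA : measurable A by exact: measurable_sfunP.
(* The level set of the value 0 may have infinite measure, but its term vanishes; every other level
   set has finite measure by Chebyshev's inequality. *)
have [c0|c0] := eqVneq c 0.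
  have -> : f k = fun=> 0 by apply/funext => x; rewrite /f -/c c0 mul0r.
  by split; [exact: isL20|exact: tc0].
have Aoo : (mu A < +oo)%E.
  have c20 : 0 < c ^+ 2 by rewrite exprn_even_gt0.
  rewrite -(@lte_pmul2l _ (c ^+ 2)%:E) ?lte_fin// [ltRHS]gt0_muley ?lte_fin//.
  apply: le_lt_trans g2.2.
  rewrite -(setIT A) -(integral_indic mu measurableT mA) -ge0_integralZl//.
  - apply: ge0_int_le.
    + by move=> x; rewrite mule_ge0// lee_fin ltW.
    + by apply: measurable_funeM; apply/measurable_EFinP; exact: measurable_indic.
    + exact: measurable_sq g2.1.
    + move=> x; rewrite -EFinM lee_fin normc_real indicE.
      have [/set_mem xA|_] := boolP (x \in A); last by rewrite mulr0 sqr_ge0.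
      by rewrite mulr1 (_ : g x = c)// real_normK ?num_real.
  - by apply/measurable_EFinP; exact: measurable_indic.
  - by rewrite lee_fin ltW.
by split; [apply: isL2Z; exact: isL2_indic|apply: tcZ; [exact: isL2_indic|exact: tc_indic (cA _ _)]].
Qed.

Lemma tc_nneg (u : T -> R) : (forall x, 0 <= u x) -> isL2 mu (fun x => (u x)%:C) ->
  tc (fun x => (u x)%:C).
Proof.
move=> u0 u2; apply: tc_lim => // e e0.
have mu' : measurable_fun setT u by exact: u2.1.1.
have meu : measurable_fun setT (EFin \o u) by exact/measurable_EFinP.
pose g := nnsfun_approx measurableT meu.
have gu n x : 0 <= g n x <= u x.
  rewrite fun_ge0 -lee_fin /g nnsfun_approxE /=.
  by apply: (@le_approx _ _ _ setT (EFin \o u)) => // y _; rewrite /= lee_fin.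
have gcvg x : g n x @[n --> \oo] --> u x.
  have := @cvg_nnsfun_approx _ _ _ _ measurableT _ meu (fun x _ => u0 x) x I.
  exact: fine_cvg.
have mg n : cmeas (fun x => (g n x)%:C) by exact: cmeas_real.
have H n : cmeas (fun x => (u x)%:C - (g n x)%:C) by exact: cmeasB u2.1 (mg n).
have nc : n2 mu (fun x => (u x)%:C - (g n x)%:C) @[n --> \oo] --> (0 : R).
  apply: n2_dct u2 H _ _.
    apply: nearW => x; under eq_fun do rewrite -rmorphB normc_real.
    rewrite -(normr0 R) -(subrr (u x)); apply: cvg_norm.
    by apply: cvgB => //; exact: cvg_cst.
  move=> n x; rewrite -rmorphB !normc_real; have /andP[g0 gu'] := gu n x.
  by rewrite !ger0_norm ?subr_ge0// lerBlDr lerDl.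
move/cvgrPdist_le : nc => /(_ e e0)[N _ NP].
have := NP N (leqnn _); rewrite sub0r normrN ger0_norm ?n2_ge0// => Ne.
exists (fun x => (g N x)%:C) => //.
have gN2 : isL2 mu (fun x => (g N x)%:C).
  apply: (isL2_le (mg N) u2) => x; rewrite !normc_real; have /andP[g0 gu'] := gu N x.
  by rewrite !ger0_norm.
by split => //; exact: tc_nnsfun.
Qed.

Theorem tc_L2 f : isL2 mu f -> tc f.
Proof.
move=> f2; have [f1 f1'] := f2.1.
have P1 (u : T -> R) : measurable_fun setT u -> (forall x, `|u x| <= normc (f x)) ->
    isL2 mu (fun x => (u x)%:C) /\ tc (fun x => (u x)%:C).
  move=> mu' uf.
  have H (v : T -> R) : measurable_fun setT v -> (forall x, 0 <= v x <= `|u x|) ->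
      isL2 mu (fun x => (v x)%:C) /\ tc (fun x => (v x)%:C).
    move=> mv vu; have v2 : isL2 mu (fun x => (v x)%:C).
      apply: (isL2_le _ f2) => [|x]; first exact: cmeas_real.
      have /andP[v0 vu'] := vu x.
      by rewrite normc_real ger0_norm// (le_trans vu').
    by split => //; apply: tc_nneg => // x; have /andP[] := vu x.
  have [a2 ta] : isL2 mu (fun x => (Num.max (u x) 0)%:C) /\ tc (fun x => (Num.max (u x) 0)%:C).
    apply: H => [|x]; first by apply: measurable_maxr => //; exact: measurable_cst.
    by rewrite le_max lexx orbT ge_max ler_norm normr_ge0.
  have [b2 tb] : isL2 mu (fun x => (Num.max (- u x) 0)%:C) /\ tc (fun x => (Num.max (- u x) 0)%:C).
    apply: H => [|x]; first by apply: measurable_maxr; [exact: measurableT_comp|exact: measurable_cst].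
    by rewrite le_max lexx orbT ge_max -normrN ler_norm normr_ge0.
  have -> : (fun x => (u x)%:C) = (fun x => (Num.max (u x) 0)%:C + (-1) * (Num.max (- u x) 0)%:C).
    apply/funext => x; rewrite mulN1r -rmorphB; congr (real_complex R _).
    case/orP: (le_total 0 (u x)) => u0.
      by rewrite (max_l u0) (@max_r _ _ (- u x)) ?oppr_le0// subr0.
    by rewrite (max_r u0) (@max_l _ _ (- u x)) ?oppr_ge0// sub0r opprK.
  exact: (conj (isL2D a2 (isL2Z (-1) b2)) (tcD a2 (isL2Z (-1) b2) ta (tcZ (-1) b2 tb))).
have [a2 ta] := P1 _ f1 (fun x => normc_Re (f x)).
have [b2 tb] := P1 _ f1' (fun x => normc_Im (f x)).
have -> : f = (fun x => (complex.Re (f x))%:C + imunit * (complex.Im (f x))%:C).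
  by apply/funext => x; case: (f x) => a b; apply: complexP => /=; ring.
exact: (tcD a2 (isL2Z imunit b2) ta (tcZ imunit b2 tb)).
Qed.

End TranslationContinuity.

(** * Measure and translations of the plane *)

Section PlaneMeasure.
Context {R : realType}.
Local Notation lam := (@lebesgue_measure R).
Local Notation mR := (measurableTypeR R).
Local Notation R2 := (mR * mR)%type.

Definition square (n : nat) : set R2 := `[- n%:R, n%:R]%classic `*` `[- n%:R, n%:R]%classic.

Lemma measurable_square n : measurable (square n).
Proof. by apply: measurableX; exact: measurable_itv. Qed.

Lemma leb2_square_lty n : (leb2 (square n) < +oo)%E.
Proof.
pose I := `[- n%:R, n%:R]%classic : set mR.
have h : (lam I < +oo)%E.
  by rewrite /I lebesgue_measure_itv; case: ifP => _; rewrite ?ltry.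
rewrite /leb2 product_measure1E; try exact: measurable_itv.
by rewrite -/I lte_mul_pinfty// ge0_fin_numE.
Qed.

Lemma nd_square : nondecreasing_seq square.
Proof.
move=> m n mn; apply/subsetPset => x [/=]; rewrite !in_itv/= => /andP[a b] /andP[c e].
have mn' : (m%:R : R) <= n%:R by rewrite ler_nat.
by split; rewrite /= in_itv/=; apply/andP; split;
  rewrite ?(le_trans b)// ?(le_trans e)// ?(le_trans _ a)// ?(le_trans _ c)// lerN2.
Qed.

Lemma mem_square (x : R * R) (n : nat) : `|x.1| <= n%:R -> `|x.2| <= n%:R -> square n x.
Proof. by rewrite !ler_norml => h1 h2; split; rewrite /= in_itv. Qed.

Lemma bigcup_square : \bigcup_n square n = setT.
Proof.
rewrite -subTset => x _; exists (Num.truncn (`|x.1 : R| + `|x.2 : R|)).+1 => //.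
have x0 : 0 <= `|x.1 : R| + `|x.2 : R| by rewrite addr_ge0.
have /andP[_ /ltW h] := truncn_itv x0.
by apply: mem_square; apply: le_trans h; rewrite ?lerDl ?lerDr.
Qed.

HB.instance Definition _ := Measure.on (@leb2 R).

Lemma sigma_finite_leb2 : sigma_finite [set: R2] (@leb2 R).
Proof.
exists square; first by rewrite bigcup_square.
by move=> n; split; [exact: measurable_square|exact: leb2_square_lty].
Qed.

HB.instance Definition _ := Measure_isSigmaFinite.Build _ _ _ (@leb2 R) sigma_finite_leb2.

(** The product measure of the statement with its sigma-finite structure attached; it is convertible
    to [leb2], so results about either apply to the other. *)
Definition mu2 : {sigma_finite_measure set R2 -> \bar R} := (@leb2 R).

Lemma cintegral_cint (f : R * R -> R[i]) : cintegral f = cint mu2 f.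
Proof. by []. Qed.

Definition tshift (z x : R2) : R2 := (x.1 + z.1, x.2 + z.2).

Lemma mpres_tshift z : mpres mu2 (tshift z).
Proof. exact: (mpres_prod (mpres_shift1 z.1) (mpres_shift1 z.2)). Qed.

Lemma mpres_opp : mpres mu2 (fun x : R2 => (- x.1, - x.2) : R2).
Proof. exact: (mpres_prod (@mpres_opp1 R) (@mpres_opp1 R)). Qed.

Definition shift1 (z : R) (x : mR) : mR := x + z.

(** Under a shift by [z] the indicator of an interval changes only within distance [|z|] of an
    endpoint, on a set of measure at most [4 |z|]. *)
Lemma shiftc_itv (a b : R) :
  shiftc lam (nbhs (0 : R)) shift1 `]a, b]%classic.
Proof.
move=> e e0; have e4 : 0 < e / 4 by rewrite divr_gt0.
near=> z; have ze : `|z| < e / 4.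
  by near: z; apply: (nbhs0_lt (V := R)).
pose I c := `[c - `|z|, c + `|z|]%classic : set mR.
have mI c : measurable (I c) by exact: measurable_itv.
have lI c : lam (I c) = (2 * `|z|)%:E.
  rewrite /I lebesgue_measure_itv/= lte_fin.
  have [z0|z0] := eqVneq `|z| 0; first by rewrite z0 subr0 addr0 ltxx mulr0.
  have zp : 0 < `|z| by rewrite lt_neqAle eq_sym z0 normr_ge0.
  rewrite ifT; last by lra.
  by rewrite -EFinB; congr (_%:E); ring.
apply: (@le_trans _ _ (\int[lam]_x ((\1_(I a) x : R)%:E + (\1_(I b) x : R)%:E))%E).
  apply: ge0_int_le.
  - by move=> x; rewrite lee_fin.
  - exact: (measurable_dif (fun z => mpres_shift1 z)).
  - by apply: emeasurable_funD; apply/measurable_EFinP; exact: measurable_indic.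
  - move=> x; rewrite -EFinD lee_fin !indicE !mem_setE !in_itv/=.
    have n1 := ler_norm z; have := ler_norm (- z); rewrite normrN => n2.
    have B01 (p q : bool) : `|p%:R - q%:R : R| <= 1.
      by case: p; case: q; rewrite ?subrr ?normr0 ?subr0 ?sub0r ?normrN ?normr1.
    have [xa|xa] := boolP (a - `|z| <= x <= a + `|z|).
      by apply: le_trans (B01 _ _) _; rewrite lerDl.
    have [xb|xb] := boolP (b - `|z| <= x <= b + `|z|).
      by apply: le_trans (B01 _ _) _; rewrite lerDr.
    have ea : (a < x + z) = (a < x).
      move: xa; rewrite negb_and -!ltNge => /orP[xa|xa].
        by apply/idP/idP => h; lra.
      by apply/idP/idP => h; lra.
    have eb : (x + z <= b) = (x <= b).
      move: xb; rewrite negb_and -!ltNge => /orP[xb|xb].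
        by apply/idP/idP => h; lra.
      by apply/idP/idP => h; lra.
    by rewrite ea eb subrr normr0 addr_ge0.
rewrite ge0_integralD//; try by apply/measurable_EFinP; exact: measurable_indic.
rewrite !integral_indic// !setIT.
apply: (@le_trans _ _ ((2 * `|z|)%:E + (2 * `|z|)%:E)%E).
  by rewrite -{1}(lI a) -(lI b); exact: leeD.
by rewrite -EFinD lee_fin; lra.
Unshelve. all: by end_near. Qed.

Lemma shiftc_line (A : set mR) : measurable A -> (lam A < +oo)%E ->
  shiftc lam (nbhs (0 : R)) shift1 A.
Proof.
move=> mA Aoo; pose Q (n : nat) : set mR := `]- n%:R, n%:R]%classic.
have Qoo n : (lam (Q n) < +oo)%E.
  by rewrite /Q lebesgue_measure_itv; case: ifP => _; rewrite ?ltry.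
apply: (@shiftc_exhaust _ _ _ _ _ _ _ _ (fun z => mpres_shift1 z) Q) => //.
- by move=> n; exact: measurable_itv.
- move=> m n mn; apply/subsetPset => x; rewrite /Q /= !in_itv/= => /andP[a b].
  have mn' : (m%:R : R) <= n%:R by rewrite ler_nat.
  by rewrite (le_trans b)// (le_lt_trans _ a)// lerN2.
- rewrite -subTset => x _; exists (Num.truncn `|x : R|).+1 => //.
  have /andP[_ h] := truncn_itv (normr_ge0 (x : R)).
  have := h; rewrite ltr_norml => /andP[h1 h2].
  by rewrite /Q /= in_itv/= h1 ltW.
- move=> n; apply: (@shiftc_dynkin _ _ _ _ _ _ _ _ (fun z => mpres_shift1 z) (@ocitv R)) => //.
  + exact: ocitvI.
  + exact: measurable_itv.
  + exact: Qoo.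
  + exact: shiftc_itv.
  + move=> B oB; have [[u v] _ <-] := ocitvI oB (is_ocitv (- n%:R) n%:R).
    exact: shiftc_itv.
Qed.

Local Notation F0 := (nbhs (0 : R * R)).

(** The identity [a b - a' b' = (a - a') b + a' (b - b')] for indicators, together with Tonelli's
    theorem, reduces a rectangle to its two sides. *)
Lemma shiftc_rectangle (A B : set mR) : measurable A -> measurable B ->
  (lam A < +oo)%E -> (lam B < +oo)%E -> shiftc mu2 F0 tshift (A `*` B).
Proof.
move=> mA mB Aoo Boo e e0.
have Afin : lam A \is a fin_num by rewrite ge0_fin_numE.
have Bfin : lam B \is a fin_num by rewrite ge0_fin_numE.
(* The summand 1 keeps [M] positive when both sides are null sets. *)
pose M := fine (lam A) + fine (lam B) + 1.
have M0 : 0 < M by rewrite ltr_wpDl// addr_ge0// fine_ge0.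
have d0 : 0 < e / M by rewrite divr_gt0.
have cA := shiftc_line mA Aoo d0; have cB := shiftc_line mB Boo d0.
have nA : \forall z \near F0, (dif lam shift1 A z.1 <= (e / M)%:E)%E.
  exact: (@cvg_fst _ _ (nbhs (0 : R)) (nbhs (0 : R)) _ _ cA).
have nB : \forall z \near F0, (dif lam shift1 B z.2 <= (e / M)%:E)%E.
  exact: (@cvg_snd _ _ (nbhs (0 : R)) (nbhs (0 : R)) _ _ cB).
apply: filterS2 nA nB => z Az Bz.
have mshift : forall y, mpres lam (shift1 y) := fun y => mpres_shift1 y.
pose ga (x : mR) := (`|\1_A (x + z.1 : mR) - \1_A x : R|)%:E.
pose gb (x : mR) := (`|\1_B (shift1 z.2 x) - \1_B x : R|)%:E.
have mga : measurable_fun setT ga by exact: (measurable_dif mshift).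
have mgb : measurable_fun setT gb by exact: (measurable_dif mshift).
have iA (C : set mR) : measurable C -> measurable_fun setT (fun x : mR => (\1_C x : R)%:E).
  by move=> mC; apply/measurable_EFinP; exact: measurable_indic.
have iB : measurable_fun setT (fun x : mR => (\1_B (shift1 z.2 x) : R)%:E).
  by apply/measurable_EFinP; exact: (measurable_indic_shift mshift).
have prod (u v : mR -> \bar R) : measurable_fun setT u -> measurable_fun setT v ->
    (forall x, 0 <= u x)%E -> (forall x, 0 <= v x)%E ->
    (\int[mu2]_x (u x.1 * v x.2) = (\int[lam]_x u x) * (\int[lam]_x v x))%E.
  move=> mu mv u0 v0.
  have muv : measurable_fun [set: R2] (fun x => (u x.1 * v x.2)%E).
    by apply: emeasurable_funM; [exact: (measurableT_comp mu measurable_fst)|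
      exact: (measurableT_comp mv measurable_snd)].
  have := @fubini_tonelli1 _ _ _ _ _ lam lam _ muv (fun x => mule_ge0 (u0 _) (v0 _)).
  rewrite /mu2 /leb2 => ->; rewrite /fubini_F /=.
  under eq_integral do rewrite ge0_integralZl//.
  by rewrite ge0_integralZr//; exact: integral_ge0.
apply: (@le_trans _ _ (\int[mu2]_x (ga x.1 * (\1_B (shift1 z.2 x.2) : R)%:E + (\1_A x.1 : R)%:E * gb x.2))%E).
  have mga1 : measurable_fun [set: R2] (fun x => ga x.1) := measurableT_comp mga measurable_fst.
  have mgb2 : measurable_fun [set: R2] (fun x => gb x.2) := measurableT_comp mgb measurable_snd.
  have mB2 : measurable_fun [set: R2] (fun x => (\1_B (shift1 z.2 x.2) : R)%:E) := measurableT_comp iB measurable_snd.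
  have mA1 : measurable_fun [set: R2] (fun x => (\1_A x.1 : R)%:E) := measurableT_comp (iA _ mA) measurable_fst.
  apply: ge0_int_le.
  - by move=> x; rewrite lee_fin.
  - by apply: (measurable_dif mpres_tshift); exact: measurableX.
  - by apply: emeasurable_funD; exact: emeasurable_funM.
  - move=> x; rewrite /ga /gb -!EFinM -EFinD lee_fin.
    have ind (y : R2) : \1_(A `*` B) y = \1_A y.1 * \1_B y.2 :> R.
      by rewrite !indicE in_setX; case: (_ \in A); case: (_ \in B); rewrite /= ?mulr1 ?mulr0 ?mul0r.
    rewrite !ind /=.
    set a := \1_A _; set b := \1_B _; set a' := \1_A _; set b' := \1_B _.
    have -> : a * b - a' * b' = (a - a') * b + a' * (b - b') by ring.
    apply: le_trans (ler_normD _ _) _; rewrite !normrM.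
    by rewrite (ger0_norm (_ : 0 <= b))// (ger0_norm (_ : 0 <= a')).
rewrite ge0_integralD; first last.
- by apply: emeasurable_funM; [exact: (measurableT_comp (iA _ mA) measurable_fst)|exact: (measurableT_comp mgb measurable_snd)].
- by move=> x _; rewrite mule_ge0// lee_fin.
- by apply: emeasurable_funM; [exact: (measurableT_comp mga measurable_fst)|exact: (measurableT_comp iB measurable_snd)].
- by move=> x _; rewrite mule_ge0// lee_fin.
- exact: measurableT.
have ga0 x : (0 <= ga x)%E by rewrite lee_fin.
have gb0 x : (0 <= gb x)%E by rewrite lee_fin.
have ind0 (C : set mR) x : (0 <= (\1_C x : R)%:E)%E by rewrite lee_fin.
rewrite (prod ga (fun y => (\1_B (shift1 z.2 y))%:E) mga iB ga0 (fun=> ind0 _ _)).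
rewrite (prod (fun x => (\1_A x)%:E) gb (iA _ mA) mgb (ind0 _) gb0).
rewrite (ge0_integral_mpres (f := fun x : mR => (\1_B x : R)%:E) (mshift z.2) (iA _ mB) (ind0 _)).
rewrite !integral_indic// !setIT.
apply: (@le_trans _ _ ((e / M)%:E * lam B + lam A * (e / M)%:E)%E).
  by apply: leeD; [rewrite lee_wpmul2r|rewrite lee_wpmul2l].
rewrite -(fineK Afin) -(fineK Bfin) -!EFinM -EFinD lee_fin.
rewrite /= (_ : e / M * fine (lam B) + fine (lam A) * (e / M) = e * ((fine (lam A) + fine (lam B)) / M)).
  by rewrite ler_piMr ?(ltW e0)// ler_pdivrMr// mul1r /M lerDl.
by ring.
Qed.

Lemma shiftc_plane (A : set R2) : measurable A -> (mu2 A < +oo)%E -> shiftc mu2 F0 tshift A.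
Proof.
move=> mA Aoo.
apply: (@shiftc_exhaust _ _ _ _ _ _ _ _ mpres_tshift square) => //.
- exact: measurable_square.
- exact: nd_square.
- exact: bigcup_square.
move=> n; pose I : set mR := `[- n%:R, n%:R]%classic.
have mI : measurable I by exact: measurable_itv.
have Ioo : (lam I < +oo)%E.
  by rewrite /I lebesgue_measure_itv; case: ifP => _; rewrite ?ltry.
have sub (B : set mR) : measurable B -> (lam (B `&` I) < +oo)%E.
  move=> mB; apply: le_lt_trans Ioo; apply: le_measure; rewrite ?inE//; exact: measurableI.
apply: (@shiftc_dynkin _ _ _ _ _ _ _ _ mpres_tshift
  [set A `*` B | A in [set B : set mR | measurable B] & B in [set B : set mR | measurable B]]) => //.
- exact: measurable_prod_measurableType.
- move=> _ _ [A1 mA1 [B1 mB1 <-]] [A2 mA2 [B2 mB2 <-]].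
  exists (A1 `&` A2); first exact: measurableI.
  by exists (B1 `&` B2); [exact: measurableI|rewrite setXI].
- exact: measurable_square.
- exact: leb2_square_lty.
- exact: shiftc_rectangle.
- move=> _ [A1 mA1 [B1 mB1 <-]]; rewrite /square -/I -setXI.
  by apply: shiftc_rectangle; [exact: measurableI|exact: measurableI|exact: sub|exact: sub].
Qed.

Theorem translation_continuous (f : R2 -> R[i]) : isL2 mu2 f -> forall e : R, 0 < e ->
  exists2 del : R, 0 < del & forall z : R2, `|z.1 : R| < del -> `|z.2 : R| < del ->
    n2 mu2 (fun x => f (tshift z x) - f x) <= e.
Proof.
move=> f2 e e0; have h : nbhs (0 : R * R) [set z | n2 mu2 (fun x => f (tshift z x) - f x) <= e].
  exact: (tc_L2 mpres_tshift shiftc_plane f2 e0).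
move/nbhs_ballP : h => [del /= d0 H]; exists del => // z z1 z2; apply: (H z).
by split; rewrite /ball/= sub0r normrN.
Qed.

End PlaneMeasure.

(** * Differentiation rules in one real variable *)

Section DeriveRules.
Context {R : realType}.
Implicit Types (f g : R -> R) (x a b : R).

Lemma is_derive_add f g x a b : is_derive x 1 f a -> is_derive x 1 g b ->
  is_derive x 1 (fun y => f y + g y) (a + b).
Proof. by move=> df dg; exact: is_deriveD. Qed.

Lemma is_derive_mul f g x a b : is_derive x 1 f a -> is_derive x 1 g b ->
  is_derive x 1 (fun y => f y * g y) (a * g x + f x * b).
Proof.
move=> df dg; apply: is_derive_eq (is_deriveM df dg) _.
by rewrite addrC; congr (_ + _); exact: mulrC.
Qed.

Lemma is_derive_scale f x a c : is_derive x 1 f a -> is_derive x 1 (fun y => c * f y) (c * a).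
Proof. by move=> df; exact: is_deriveZ. Qed.

Lemma is_derive_linear x c : is_derive x 1 (fun y => c * y) c.
Proof. by apply: is_derive_eq (is_derive_scale c (is_derive_id x 1)) _; rewrite mulr1. Qed.

Lemma is_derive_compose f g x a b : is_derive (g x) 1 f a -> is_derive x 1 g b ->
  is_derive x 1 (fun y => f (g y)) (a * b).
Proof. by move=> df dg; exact: (is_derive1_comp (f := f) (g := g)). Qed.

Lemma is_derive_derive1 f x a : is_derive x 1 f a -> derivable f x 1 /\ derive1 f x = a.
Proof. by move=> df; split; [exact: ex_derive|rewrite derive1E; exact: derive_val]. Qed.

Lemma is_derive_conv f x a b : is_derive x 1 f a -> a = b -> is_derive x 1 f b.
Proof. by move=> df <-. Qed.

End DeriveRules.

(** * Fourier transform and Plancherel theorem *)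

Section Poisson.
Context {R : realType}.
Local Notation lam := (@lebesgue_measure R).
Local Notation mR := (measurableTypeR R).

Lemma ge0_even_integral (f F : R -> R) (l : R) : (forall x, 0 <= f x) ->
  (forall x, f (- x) = f x) -> continuous f ->
  (forall x : R, 0 < x -> derivable F x 1 /\ derive1 F x = f x) -> {for 0, continuous F} ->
  F x @[x --> +oo] --> l ->
  (\int[lam]_x (f x)%:E = (2 * (l - F 0))%:E)%E.
Proof.
move=> f0 fN cf dF cF Fl.
rewrite ge0_symfun_integralT//; last by move=> x /=; rewrite fN.
rewrite -set_itvcy.
rewrite (@ge0_continuous_FTC2y _ f F 0 l)//.
- exact: continuous_subspaceT.
- by move=> x /dF [].
- exact: cvg_at_right_filter.
- by move=> x; rewrite in_itv/= andbT => /dF[].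
Qed.

(** An exponential rather than a Gaussian: its Fourier transform, and the total mass of that
    transform, come from elementary antiderivatives. *)
Definition pexp (eps xi : R) : R := expR (- (eps * `|xi|)).

Lemma continuous_pexp eps : continuous (pexp eps).
Proof.
move=> x; apply: (@continuous_comp _ _ _ (fun x => - (eps * `|x|)) expR); last exact: continuous_expR.
by apply: cvgN; apply: cvgM; [exact: cvg_cst|exact: norm_continuous].
Qed.

Lemma is_derive_expN (eps x : R) : is_derive x 1 (fun y => expR (- eps * y)) (expR (- eps * x) * - eps).
Proof. exact: (is_derive_compose (is_derive_expR _) (is_derive_linear _ _)). Qed.

Lemma cvg_expN (eps : R) : 0 < eps -> expR (- eps * x) @[x --> +oo] --> (0 : R).
Proof.
move=> e0.
have -> : (fun x => expR (- eps * x)) = (fun y => expR (- y)) \o (fun x => eps * x).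
  by apply/funext => x /=; rewrite mulNr.
apply: (cvg_comp _ _ _ (@cvgr_expR R)).
by apply: gt0_cvgMry => //; exact: cvg_id.
Qed.

Lemma integral_pexp (eps : R) : 0 < eps -> (\int[lam]_x (pexp eps x)%:E = (2 / eps)%:E)%E.
Proof.
move=> e0; have en0 : eps != 0 by rewrite gt_eqF.
rewrite (@ge0_even_integral (pexp eps) (fun x => - eps^-1 * expR (- eps * x)) 0).
- by rewrite mulr0 expR0 mulr1 sub0r opprK.
- by move=> x; exact: expR_ge0.
- by move=> x; rewrite /pexp normrN.
- exact: continuous_pexp.
- move=> x x0; apply: is_derive_derive1; rewrite /pexp gtr0_norm//.
  apply: is_derive_conv (is_derive_scale _ (is_derive_expN _ _)) _.
  by rewrite -[in RHS]mulNr; field.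
- by apply/differentiable_continuous/derivable1_diffP; case: (is_derive_scale (- eps^-1) (is_derive_expN eps 0)).
- by rewrite -[X in _ --> X](mulr0 (- eps^-1)); apply: cvgM; [exact: cvg_cst|exact: cvg_expN].
Qed.

(** Adding 1 to the cosine makes the integrand nonnegative, as [ge0_even_integral] requires; the
    extra term is the integral of [pexp] and is subtracted in [cint_pexp_cis]. *)
Lemma integral_pexp_cos (eps x : R) : 0 < eps ->
  (\int[lam]_t (pexp eps t * (1 + cos (x * t)))%:E = (2 / eps + 2 * eps / (eps ^+ 2 + x ^+ 2))%:E)%E.
Proof.
move=> e0; have en0 : eps != 0 by rewrite gt_eqF.
have d0 : eps ^+ 2 + x ^+ 2 != 0 by rewrite gt_eqF// ltr_wpDr ?sqr_ge0// exprn_gt0.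
(* Up to the factor [expR (- eps * t)], this is the antiderivative of the damped cosine found by
   integrating by parts twice. *)
pose G (t : R) : R := (eps ^+ 2 + x ^+ 2)^-1 * (x * sin (x * t) + - eps * cos (x * t)).
have dG (t : R) : is_derive t 1 G ((eps ^+ 2 + x ^+ 2)^-1 * (x * (cos (x * t) * x) + - eps * (- sin (x * t) * x))).
  exact: (is_derive_scale _ (is_derive_add
    (is_derive_scale _ (is_derive_compose (is_derive_sin _) (is_derive_linear _ _)))
    (is_derive_scale _ (is_derive_compose (is_derive_cos _) (is_derive_linear _ _))))).
pose F (t : R) : R := expR (- eps * t) * (- eps^-1 + G t).
have dF (t : R) : is_derive t 1 F (expR (- eps * t) * (1 + cos (x * t))).
  apply: is_derive_conv (is_derive_mul (is_derive_expN _ _) (is_derive_add (f := fun=> - eps^-1) (is_derive_cst _ _ _) (dG t))) _.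
  by rewrite /G; field; rewrite en0 d0.
rewrite (@ge0_even_integral _ F 0).
- congr (_%:E); rewrite /F /G !mulr0 expR0 mul1r sin0 cos0.
  by field; rewrite en0 d0.
- by move=> t; rewrite mulr_ge0 ?expR_ge0// -lerBlDl sub0r cos_geN1.
- by move=> t; rewrite /pexp normrN mulrN cosN.
- move=> t; apply: cvgM; first exact: continuous_pexp.
  apply: cvgD; first exact: cvg_cst.
  by apply: (@continuous_comp _ _ _ ( *%R x) cos); [exact: mulrl_continuous|exact: continuous_cos].
- by move=> t t0; apply: is_derive_derive1; rewrite /pexp gtr0_norm// -mulNr.
- by apply/differentiable_continuous/derivable1_diffP; case: (dF 0).
- pose K := (eps^-1 + (eps ^+ 2 + x ^+ 2)^-1 * (`|x| + eps)).
  have hK : expR (- eps * t) * K @[t --> +oo] --> (0 : R).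
    by rewrite -[X in _ --> X](mul0r K); apply: cvgM; [exact: cvg_expN|exact: cvg_cst].
  apply: (@squeeze_cvgr _ _ _ _ (fun t => - (expR (- eps * t) * K)) (fun t => expR (- eps * t) * K)) => //.
  + apply: nearW => t; rewrite -ler_norml /F normrM ger0_norm ?expR_ge0// ler_wpM2l ?expR_ge0//.
    apply: le_trans (ler_normD _ _) _; apply: lerD.
      by rewrite normrN ger0_norm// invr_ge0 ltW.
    rewrite normrM ger0_norm ?invr_ge0 ?addr_ge0 ?sqr_ge0// ler_wpM2l ?invr_ge0 ?addr_ge0 ?sqr_ge0//.
    apply: le_trans (ler_normD _ _) _; rewrite !normrM normrN (ger0_norm (ltW e0)); apply: lerD.
      by rewrite ler_piMr// ler_norml sin_geN1 sin_le1.
    by rewrite ler_piMr ?(ltW e0)// ler_norml cos_geN1 cos_le1.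
  + by rewrite -[X in _ --> X]oppr0; exact: cvgN.
Qed.

(** The Poisson kernel of the half-plane at height [eps], a probability density (the Cauchy law). *)
Definition pkernel (eps t : R) : R := eps / (pi * (eps ^+ 2 + t ^+ 2)).

Lemma pkernel_ge0 eps t : 0 < eps -> 0 <= pkernel eps t.
Proof. by move=> e0; rewrite divr_ge0 ?(ltW e0)// mulr_ge0 ?pi_ge0// addr_ge0 ?sqr_ge0. Qed.

Lemma continuous_pkernel eps : 0 < eps -> continuous (pkernel eps).
Proof.
move=> e0 t; apply: cvgM; first exact: cvg_cst.
apply: cvgV.
  by rewrite mulf_neq0 ?gt_eqF ?pi_gt0// ltr_wpDr ?sqr_ge0// exprn_gt0.
by apply: cvgM; [exact: cvg_cst|apply: cvgD; [exact: cvg_cst|apply: exprn_continuous]].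
Qed.

Lemma integral_pkernel eps : 0 < eps -> (\int[lam]_t (pkernel eps t)%:E = 1)%E.
Proof.
move=> e0; have en0 : eps != 0 by rewrite gt_eqF.
have p0 : pi != 0 :> R by rewrite gt_eqF// pi_gt0.
have dF (t : R) : is_derive t 1 (fun t => pi^-1 * atan (eps^-1 * t)) (pkernel eps t).
  apply: is_derive_conv (is_derive_scale _ (is_derive_compose (is_derive1_atan _) (is_derive_linear _ _))) _.
  have d0 : eps ^+ 2 + t ^+ 2 != 0 by rewrite gt_eqF// ltr_wpDr ?sqr_ge0// exprn_gt0.
  rewrite /pkernel (_ : 1 + (eps^-1 * t) ^+ 2 = (eps ^+ 2 + t ^+ 2) / eps ^+ 2); last by field.
  by move: (@pi R) p0 => p p0; field; rewrite p0 d0 en0.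
rewrite (@ge0_even_integral _ (fun t => pi^-1 * atan (eps^-1 * t)) (pi^-1 * (pi / 2))).
- by congr (_%:E); rewrite mulr0 atan0; move: (@pi R) p0 => p p0; field.
- by move=> t; exact: pkernel_ge0.
- by move=> t; rewrite /pkernel sqrrN.
- exact: continuous_pkernel.
- by move=> t _; exact: is_derive_derive1.
- by apply/differentiable_continuous/derivable1_diffP; case: (dF 0).
- apply: cvgM; first exact: cvg_cst.
  have h : eps^-1 * t @[t --> +oo] --> +oo by apply: gt0_cvgMry; [rewrite invr_gt0|exact: cvg_id].
  exact: (cvg_comp _ _ h (@cvgy_atan R)).
Qed.

End Poisson.

(** * Integrals of tensor products *)

Section ProductIntegral.
Context {R : realType} d1 d2 (T1 : measurableType d1) (T2 : measurableType d2).
Variables (m1 : {sigma_finite_measure set T1 -> \bar R}) (m2 : {sigma_finite_measure set T2 -> \bar R}).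
Local Notation C := R[i].

Lemma cint_iterated (f : T1 * T2 -> C) : cintable (m1 \x m2)%E f ->
  cint (m1 \x m2)%E f = cint m1 (fun x => cint m2 (fun y => f (x, y))).
Proof.
move=> If.
have H (u : T1 * T2 -> R) : (m1 \x m2)%E.-integrable setT (EFin \o u) ->
    Rintegral (m1 \x m2)%E setT u = Rintegral m1 setT (fun x => Rintegral m2 setT (fun y => u (x, y))).
  move=> iu; have mu : measurable_fun setT u by have := measurable_int _ iu => /measurable_EFinP.
  rewrite [LHS]/Rintegral -(integral12_prod_meas1 iu) [RHS]/Rintegral; congr fine.
  apply: ae_eq_integral => //.
  - exact: (measurable_fubini_F iu).
  - exact/measurable_EFinP/measurable_Rintegral_fst.
  - have := ae_integrable1 iu; apply: filterS => x h _.
    by rewrite /Rintegral fineK// integrable_fin_num.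
apply: complexP.
  exact: (H (fun z => complex.Re (f z)) (cintable_Re If)).
exact: (H (fun z => complex.Im (f z)) (cintable_Im If)).
Qed.

Lemma ge0_int_prod (u : T1 -> \bar R) (v : T2 -> \bar R) :
  measurable_fun setT u -> measurable_fun setT v ->
  (forall x, 0 <= u x)%E -> (forall x, 0 <= v x)%E ->
  (\int[m1 \x m2]_x (u x.1 * v x.2) = (\int[m1]_x u x) * (\int[m2]_x v x))%E.
Proof.
move=> mu mv u0 v0.
have muv : measurable_fun setT (fun x : T1 * T2 => (u x.1 * v x.2)%E).
  by apply: emeasurable_funM; [exact: (measurableT_comp mu measurable_fst)|
    exact: (measurableT_comp mv measurable_snd)].
have := @fubini_tonelli1 _ _ _ _ _ m1 m2 _ muv (fun x => mule_ge0 (u0 _) (v0 _)).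
move=> ->; rewrite /fubini_F /=.
under eq_integral do rewrite ge0_integralZl//.
by rewrite ge0_integralZr//; exact: integral_ge0.
Qed.

Lemma cintable_tensor (f : T1 -> C) (g : T2 -> C) : cintable m1 f -> cintable m2 g ->
  cintable (m1 \x m2)%E (fun x => f x.1 * g x.2).
Proof.
move=> [mf foo] [mg goo]; split.
  by apply: cmeasM; [exact: (cmeas_comp measurable_fst mf)|exact: (cmeas_comp measurable_snd mg)].
under eq_integral do rewrite normcM EFinM.
rewrite (ge0_int_prod (u := fun x => (normc (f x))%:E) (v := fun x => (normc (g x))%:E)).
- have n0 d (T : measurableType d) (m : {measure set T -> \bar R}) (h : T -> C) :
      (0 <= \int[m]_x (normc (h x))%:E)%E.
    by apply: integral_ge0 => x _; rewrite lee_fin normc_ge0.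
  by rewrite lte_mul_pinfty// ge0_fin_numE.
- exact/measurable_EFinP/measurable_normc.
- exact/measurable_EFinP/measurable_normc.
- by move=> x; rewrite lee_fin normc_ge0.
- by move=> x; rewrite lee_fin normc_ge0.
Qed.

Lemma cint_tensor (f : T1 -> C) (g : T2 -> C) : cintable m1 f -> cintable m2 g ->
  cint (m1 \x m2)%E (fun x => f x.1 * g x.2) = cint m1 f * cint m2 g.
Proof.
move=> If Ig; rewrite cint_iterated/=; last exact: cintable_tensor.
under cint_eq do rewrite (cintZ _ Ig) mulrC.
by rewrite cintZ// mulrC.
Qed.

End ProductIntegral.

(** * Fourier transform of integrable functions *)

Section Fourier1.
Context {R : realType}.
Local Notation lam := (@lebesgue_measure R).
Local Notation mR := (measurableTypeR R).
Local Notation R2 := (mR * mR)%type.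
Local Notation C := R[i].
Local Notation "x %:C" := (real_complex R x).
Implicit Types f g : R2 -> C.

Definition dot (x y : R * R) : R := x.1 * y.1 + x.2 * y.2.

Lemma dotC x y : dot x y = dot y x.
Proof. by rewrite /dot mulrC [X in _ + X]mulrC. Qed.

Lemma measurable_dot : measurable_fun [set: R2 * R2] (fun p => dot p.1 p.2).
Proof.
have m1 : measurable_fun [set: R2 * R2] (fun p => p.1.1 : R) := measurableT_comp measurable_fst measurable_fst.
have m2 : measurable_fun [set: R2 * R2] (fun p => p.1.2 : R) := measurableT_comp measurable_snd measurable_fst.
have m3 : measurable_fun [set: R2 * R2] (fun p => p.2.1 : R) := measurableT_comp measurable_fst measurable_snd.
have m4 : measurable_fun [set: R2 * R2] (fun p => p.2.2 : R) := measurableT_comp measurable_snd measurable_snd.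
by apply: measurable_funD; exact: measurable_funM.
Qed.

Lemma measurable_dotl (y : R * R) : measurable_fun [set: R2] (fun x => dot x y).
Proof. exact: (measurable_fun_pair1 (f := fun p : R2 * R2 => dot p.1 p.2) (y : R2) measurable_dot). Qed.

Definition ftc : R := (2 * pi)^-1.

Lemma ftcE : ftc = (2 * pi)^-1.
Proof. by []. Qed.

Lemma ftc_gt0 : 0 < ftc.
Proof. by rewrite invr_gt0 mulr_gt0// pi_gt0. Qed.

Lemma fourier1E f xi : fourier1 f xi = ftc%:C * cint mu2 (fun x => cis (- dot x xi) * f x).
Proof. by []. Qed.

Opaque ftc.

Lemma ftc_neq0 : ftc%:C != 0 :> C.
Proof. by rewrite -normc_eq0 normc_real normr_eq0 gt_eqF// ftc_gt0. Qed.

Lemma cmeas_cis_dot (xi : R * R) : cmeas (fun x : R2 => cis (- dot x xi)).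
Proof. by apply: cmeas_cis; apply: measurableT_comp => //; exact: measurable_dotl. Qed.

Lemma cintable_cis f (u : R2 -> R) : measurable_fun setT u -> cintable mu2 f ->
  cintable mu2 (fun x => cis (u x) * f x).
Proof.
move=> mu If; apply: (@cintableMr _ _ _ _ f _ 1) => //; first exact: cmeas_cis.
by move=> x; rewrite normc_cis.
Qed.

Lemma cintable_cis_dot f xi : cintable mu2 f -> cintable mu2 (fun x => cis (- dot x xi) * f x).
Proof. by apply: cintable_cis; apply: measurableT_comp => //; exact: measurable_dotl. Qed.

Lemma cmeas_kernel : cmeas (fun p : R2 * R2 => cis (- dot p.1 p.2)).
Proof. by apply: cmeas_cis; apply: measurableT_comp => //; exact: measurable_dot. Qed.

Lemma cmeas_fourier1 f : cmeas f -> cmeas (fourier1 f).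
Proof.
move=> mf; apply: cmeasM; first exact: cmeas_cst.
apply: (@cmeas_cint_snd _ _ _ _ _ mu2 (fun p : R2 * R2 => cis (- dot p.1 p.2) * f p.1)).
by apply: cmeasM; [exact: cmeas_kernel|exact: cmeas_comp measurable_fst mf].
Qed.

Lemma normc_fourier1 f xi : cintable mu2 f ->
  normc (fourier1 f xi) <= ftc * fine (\int[mu2]_x (normc (f x))%:E).
Proof.
move=> If; rewrite fourier1E normcM normc_real ger0_norm ?(ltW ftc_gt0)//.
rewrite ler_wpM2l ?(ltW ftc_gt0)// -lee_fin fineK; last first.
  by rewrite ge0_fin_numE ?If.2//; apply: integral_ge0 => x _; rewrite lee_fin normc_ge0.
apply: le_trans (normc_cint_le (cintable_cis_dot xi If)) _.
by under eq_integral do rewrite normcM normc_cis mul1r.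
Qed.

(** Fubini's theorem for the kernel [cis (- dot x y)], which is symmetric in [x] and [y]. *)
Lemma fourier1_mult f g : cintable mu2 f -> cintable mu2 g ->
  cint mu2 (fun x => fourier1 f x * g x) = cint mu2 (fun x => f x * fourier1 g x).
Proof.
move=> If Ig; pose K (p : R2 * R2) := cis (- dot p.1 p.2) * (f p.1 * g p.2).
have mK : cmeas K.
  apply: cmeasM; first exact: cmeas_kernel.
  by apply: cmeasM; [exact: cmeas_comp measurable_fst If.1|exact: cmeas_comp measurable_snd Ig.1].
have fin : (\int[mu2]_x \int[mu2]_y (normc (K (x, y)))%:E < +oo)%E.
  have E x y : normc (K (x, y)) = normc (f x) * normc (g y) by rewrite /K normcM normc_cis mul1r normcM.
  under eq_integral do under eq_integral do rewrite E.
  rewrite -(fubini_tonelli1 (fun p : R2 * R2 => (normc (f p.1) * normc (g p.2))%:E)).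
  - have := (cintable_tensor If Ig).2.
    by under eq_integral do rewrite normcM.
  - have := measurable_normc (cintable_tensor If Ig).1.
    by under eq_fun do rewrite normcM; move=> h; exact/measurable_EFinP.
  - by move=> p; rewrite lee_fin mulr_ge0 ?normc_ge0.
have := cint_fubini mK fin.
set c := ftc%:C => E.
transitivity (c * cint mu2 (fun y => cint mu2 (fun x => K (x, y)))).
  (* Up to the nonzero constant [c], the inner integral is [fourier1 f y * g y], a bounded function
     times an integrable one; its integrability is obtained by dividing that product by [c]. *)
  rewrite -cintZ; last first.
    have E1 : (fun y => cint mu2 (fun x => K (x, y))) = (fun y => cint mu2 (fun x => cis (- dot x y) * f x) * g y).
      apply/funext => y; rewrite [RHS]mulrC -cintZ; last exact: cintable_cis_dot.
      by apply: cint_eq => x; rewrite /K /=; ring.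
    rewrite E1.
    have Ic : cintable mu2 (fun y => fourier1 f y * g y).
      exact: cintableMr Ig (cmeas_fourier1 If.1) (fun xi => normc_fourier1 xi If).
    have := cintableZ c^-1 Ic; congr (cintable _ _); apply/funext => y.
    by rewrite fourier1E -/c !mulrA (mulVf ftc_neq0) mul1r.
  apply: cint_eq => y; rewrite fourier1E -/c -mulrA; congr (_ * _).
  rewrite mulrC -cintZ; last exact: cintable_cis_dot.
  by apply: cint_eq => x; rewrite /K /=; ring.
rewrite -E -cintZ; last exact: cintable_cint_fst.
apply: cint_eq => x; rewrite fourier1E -/c mulrCA; congr (_ * _).
rewrite -cintZ; last exact: cintable_cis_dot.
by apply: cint_eq => y; rewrite /K /= dotC; ring.
Qed.

End Fourier1.

Section PoissonTransform.
Context {R : realType}.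
Local Notation lam := (@lebesgue_measure R).
Local Notation mR := (measurableTypeR R).
Local Notation R2 := (mR * mR)%type.
Local Notation C := R[i].
Local Notation "x %:C" := (real_complex R x).
Implicit Types f g : R2 -> C.

Lemma cintable_real d (T : measurableType d) (mu : {measure set T -> \bar R}) (u : T -> R) :
  measurable_fun setT u -> (forall x, 0 <= u x) -> (\int[mu]_x (u x)%:E < +oo)%E ->
  cintable mu (fun x => (u x)%:C).
Proof.
move=> mu' u0 uoo; split; first exact: cmeas_real.
by under eq_integral do rewrite normc_real ger0_norm//.
Qed.

Lemma measurable_pexp (eps : R) : measurable_fun [set: mR] (pexp eps).
Proof. by apply: continuous_measurable_fun; exact: continuous_pexp. Qed.

Lemma measurable_pkernel (eps : R) : 0 < eps -> measurable_fun [set: mR] (pkernel eps).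
Proof. by move=> e0; apply: continuous_measurable_fun; exact: continuous_pkernel. Qed.

Lemma cintable_pexp eps : 0 < eps -> cintable lam (fun t : mR => (pexp eps t)%:C).
Proof.
move=> e0; apply: cintable_real; first exact: measurable_pexp.
  by move=> x; exact: expR_ge0.
by rewrite integral_pexp// ltry.
Qed.

Lemma cintable_pkernel eps : 0 < eps -> cintable lam (fun t : mR => (pkernel eps t)%:C).
Proof.
move=> e0; apply: cintable_real; first exact: measurable_pkernel.
  by move=> x; exact: pkernel_ge0.
by rewrite integral_pkernel// ltry.
Qed.

Lemma cint_pkernel eps : 0 < eps -> cint lam (fun t : mR => (pkernel eps t)%:C) = 1.
Proof. by move=> e0; rewrite cint_real /Rintegral integral_pkernel//= rmorph1. Qed.

(** The real part is a difference of two integrals of nonnegative functions; the imaginary part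
    vanishes because its integrand is odd. *)
Lemma cint_pexp_cis eps x : 0 < eps ->
  cint lam (fun t : mR => cis (- (t * x)) * (pexp eps t)%:C) = (2 * pi * pkernel eps x)%:C.
Proof.
move=> e0.
have Ip := cintable_pexp e0.
have mx : measurable_fun setT (fun t : mR => - (t * x) : R).
  by apply: measurableT_comp => //; apply: measurable_funM => //; exact: measurable_cst.
have Ic : cintable lam (fun t : mR => cis (- (t * x)) * (pexp eps t)%:C).
  apply: (@cintableMr _ _ _ _ _ _ 1) => //; first exact: cmeas_cis.
  by move=> t; rewrite normc_cis.
have pE : 2 * pi * pkernel eps x = 2 * eps / (eps ^+ 2 + x ^+ 2).
  rewrite /pkernel; have d0 : eps ^+ 2 + x ^+ 2 != 0 by rewrite gt_eqF// ltr_wpDr ?sqr_ge0// exprn_gt0.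
  have := @pi_gt0 R; move: (@pi R) => p /lt0r_neq0 p0; field.
  by rewrite p0 d0.
apply: complexP; rewrite pE {pE}.
- change (Rintegral lam setT (fun t : mR => complex.Re (cis (- (t * x)) * (pexp eps t)%:C)) = 2 * eps / (eps ^+ 2 + x ^+ 2)).
  have ReE (t : R) : complex.Re (cis (- (t * x)) * (pexp eps t)%:C) = pexp eps t * cos (x * t).
    by rewrite /cis /= mulr0 subr0 cosN mulrC [t * x]mulrC.
  have iR := cintable_Re Ic.
  have iP := cintable_Re Ip.
  under eq_Rintegral do rewrite ReE.
  have iE : (EFin \o (fun t : mR => complex.Re (cis (- (t * x)) * (pexp eps t)%:C))) =
      (EFin \o (fun t : mR => pexp eps t * cos (x * t))).
    by apply/funext => t /=; rewrite -ReE.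
  rewrite iE in iR.
  have := RintegralD (mu := lam) measurableT iP iR.
  rewrite [in X in X = _ -> _]/Rintegral.
  rewrite (_ : \int[lam]_x0 _ = (2 / eps + 2 * eps / (eps ^+ 2 + x ^+ 2))%:E)%E; last first.
    rewrite -integral_pexp_cos//; apply: eq_integral => t _ /=.
    by rewrite mulrDr mulr1.
  rewrite [X in _ = X + _ -> _]/Rintegral integral_pexp// => /= h.
  by apply: (addrI (2 / eps)); rewrite h.
- change (Rintegral lam setT (fun t : mR => complex.Im (cis (- (t * x)) * (pexp eps t)%:C)) = 0).
  set I := Rintegral _ _ _.
  suff : I = - I by move=> h; lra.
  rewrite /I -[in LHS](Rintegral_mpres (@mpres_opp1 R) (f := fun t : mR => complex.Im (cis (- (t * x)) * (pexp eps t)%:C))); last exact: Ic.1.2.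
  rewrite -[RHS]mulN1r -RintegralZl//; last exact: cintable_Im.
  apply: eq_Rintegral => t _ /=.
  rewrite /pexp normrN mulNr opprK !mulr0 !add0r sinN; ring.
Qed.

Definition pexp2 (eps : R) (x : R2) : R := pexp eps x.1 * pexp eps x.2.
Definition pkernel2 (eps : R) (x : R2) : R := pkernel eps x.1 * pkernel eps x.2.

Lemma pexp2E eps x : (pexp2 eps x)%:C = (pexp eps x.1)%:C * (pexp eps x.2)%:C.
Proof. by rewrite /pexp2 rmorphM. Qed.

Lemma pkernel2E eps x : (pkernel2 eps x)%:C = (pkernel eps x.1)%:C * (pkernel eps x.2)%:C.
Proof. by rewrite /pkernel2 rmorphM. Qed.

Lemma pexp2_ge0 eps x : 0 <= pexp2 eps x.
Proof. by rewrite mulr_ge0// expR_ge0. Qed.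

Lemma pkernel2_ge0 eps x : 0 < eps -> 0 <= pkernel2 eps x.
Proof. by move=> e0; rewrite mulr_ge0// pkernel_ge0. Qed.

Lemma cintable_pexp2 eps : 0 < eps -> cintable mu2 (fun x : R2 => (pexp2 eps x)%:C).
Proof.
move=> e0; under eq_fun do rewrite pexp2E.
exact: (cintable_tensor (cintable_pexp e0) (cintable_pexp e0)).
Qed.

Lemma cintable_pkernel2 eps : 0 < eps -> cintable mu2 (fun x : R2 => (pkernel2 eps x)%:C).
Proof.
move=> e0; under eq_fun do rewrite pkernel2E.
exact: (cintable_tensor (cintable_pkernel e0) (cintable_pkernel e0)).
Qed.

Lemma cint_pkernel2 eps : 0 < eps -> cint mu2 (fun x : R2 => (pkernel2 eps x)%:C) = 1.
Proof.
move=> e0; under cint_eq do rewrite pkernel2E.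
have := cint_tensor (cintable_pkernel e0) (cintable_pkernel e0).
by rewrite !cint_pkernel// mulr1.
Qed.

Lemma ge0_int_pkernel_prod (e1 e2 : R) : 0 < e1 -> 0 < e2 ->
  (\int[mu2]_x (pkernel e1 x.1 * pkernel e2 x.2)%:E = 1)%E.
Proof.
move=> e10 e20.
have := @ge0_int_prod _ _ _ _ _ lam lam (fun t : mR => (pkernel e1 t)%:E) (fun t : mR => (pkernel e2 t)%:E).
rewrite !integral_pkernel// mule1 => <- //.
- by apply/measurable_EFinP; exact: measurable_pkernel.
- by apply/measurable_EFinP; exact: measurable_pkernel.
- by move=> t; rewrite lee_fin pkernel_ge0.
- by move=> t; rewrite lee_fin pkernel_ge0.
Qed.

Lemma fourier1_pexp2 eps x : 0 < eps ->
  fourier1 (fun xi : R2 => (pexp2 eps xi)%:C) x = (ftc^-1 * pkernel2 eps x)%:C.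
Proof.
move=> e0; rewrite fourier1E.
have It (y : R) : cintable lam (fun t : mR => cis (- (t * y)) * (pexp eps t)%:C).
  apply: (@cintableMr _ _ _ _ _ _ 1) => //.
  - exact: cintable_pexp.
  - apply/cmeas_cis; apply: measurableT_comp => //.
    by apply: measurable_funM => //; exact: measurable_cst.
  - by move=> t; rewrite normc_cis.
have := cint_tensor (It x.1) (It x.2).
rewrite !cint_pexp_cis// => E.
rewrite (_ : cint _ _ = cint mu2 (fun t : R2 => cis (- (t.1 * x.1)) * (pexp eps t.1)%:C *
   (cis (- (t.2 * x.2)) * (pexp eps t.2)%:C))); last first.
  apply: cint_eq => t; rewrite pexp2E /dot opprD cisD; ring.
rewrite E -!rmorphM; congr (real_complex R _); rewrite ftcE /pkernel2 invrK.
have := @pi_gt0 R; move: (pkernel _ _) (pkernel _ _) (@pi R) => a b p /lt0r_neq0 p0; by field; rewrite ?p0.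
Qed.

End PoissonTransform.

Lemma conjcM {R : realType} (z w : R[i]) : conjc (z * w) = conjc z * conjc w.
Proof. by case: z w => [a b] [c e]; apply: complexP => /=; ring. Qed.

Lemma rcM {R : realType} (x y : R) :
  real_complex R (x * y) = real_complex R x * real_complex R y.
Proof. exact: rmorphM. Qed.

Lemma conjcR {R : realType} (x : R) : conjc (real_complex R x) = real_complex R x.
Proof. by apply: complexP => //=; rewrite oppr0. Qed.

(** * Plancherel identity regularised by the Poisson kernel *)

Section Plancherel.
Context {R : realType}.
Local Notation lam := (@lebesgue_measure R).
Local Notation mR := (measurableTypeR R).
Local Notation R2 := (mR * mR)%type.
Local Notation C := R[i].
Local Notation "x %:C" := (real_complex R x).
Implicit Types f g : R2 -> C.

Lemma fourier1_modulation f (x y : R2) :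
  fourier1 (fun xi => cis (dot xi x) * f xi) y = fourier1 f (y.1 - x.1, y.2 - x.2).
Proof.
rewrite !fourier1E; congr (_ * _); apply: cint_eq => xi.
by rewrite mulrA -cisD; congr (cis _ * _); rewrite /dot /=; ring.
Qed.

Lemma measurable_pkernel2 eps : 0 < eps -> measurable_fun setT (@pkernel2 R eps).
Proof. by move=> e0; exact: (cintable_pkernel2 e0).1.1. Qed.

Lemma cintable_shift_pkernel2 f eps x : 0 < eps -> cintable mu2 f ->
  cintable mu2 (fun z => (pkernel2 eps z)%:C * f (tshift x z)).
Proof.
move=> e0 If; have If' := cintable_mpres (mpres_tshift x) If.
apply: (@cintableMr _ _ _ _ _ _ ((pi * eps)^-1 * (pi * eps)^-1)) => //.
  exact: (cintable_pkernel2 e0).1.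
move=> z; rewrite normc_real ger0_norm ?pkernel2_ge0//.
have H t : pkernel eps t <= (pi * eps)^-1.
  rewrite /pkernel.
  have p0 := @pi_gt0 R.
  have d0 : 0 < eps ^+ 2 + t ^+ 2 by rewrite ltr_wpDr ?sqr_ge0// exprn_gt0.
  rewrite ler_pdivrMr ?mulr_gt0// mulrC ler_pdivlMr ?mulr_gt0//.
  by rewrite mulrCA ler_wpM2l ?(ltW p0)// -expr2 lerDl sqr_ge0.
by rewrite /pkernel2 ler_pM ?pkernel_ge0// H.
Qed.

(** The multiplication formula is used twice: to move the outer transform off [f], and, for fixed
    [x], to move the remaining transform of [f] onto a modulated [pexp2], whose transform is a
    Poisson kernel centred at [x]. The damping makes every integral absolutely convergent. *)
Lemma plancherel_mollified f eps : 0 < eps -> cintable mu2 f ->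
  cint mu2 (fun xi => fourier1 f xi * ((pexp2 eps xi)%:C * conjc (fourier1 f xi))) =
  cint mu2 (fun x => f x * conjc (cint mu2 (fun z => (pkernel2 eps z)%:C * f (tshift x z)))).
Proof.
move=> e0 If; set A := fourier1 f.
have mA : cmeas A := cmeas_fourier1 If.1.
have Ie : cintable mu2 (fun xi => (pexp2 eps xi)%:C) := cintable_pexp2 e0.
have Ig : cintable mu2 (fun xi => (pexp2 eps xi)%:C * conjc (A xi)).
  under eq_fun do rewrite mulrC.
  apply: (cintableMr Ie (cmeas_conj mA)) => xi; rewrite normc_conj.
  exact: normc_fourier1.
rewrite fourier1_mult//; apply: cint_eq => x; congr (_ * _).
pose h (xi : R2) := cis (dot xi x) * (pexp2 eps xi)%:C.
have Ih : cintable mu2 h by apply: cintable_cis => //; exact: measurable_dotl.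
have Ihc : cintable mu2 (fun xi => A xi * h xi).
  exact: (cintableMr Ih mA (fun xi => normc_fourier1 xi If)).
have -> : fourier1 (fun xi => (pexp2 eps xi)%:C * conjc (A xi)) x =
    conjc (ftc%:C * cint mu2 (fun xi => A xi * h xi)).
  rewrite fourier1E conjcM conjcR -cint_conj//; congr (_ * _).
  by apply: cint_eq => xi; rewrite /h (conjcM (A xi)) (conjcM (cis _)) conj_cis conjcR; ring.
congr (conjc _); rewrite fourier1_mult//.
have E1 y : fourier1 h y = (ftc^-1 * pkernel2 eps (y.1 - x.1, y.2 - x.2))%:C.
  by rewrite fourier1_modulation fourier1_pexp2.
under cint_eq do rewrite E1.
rewrite -cintZ; last first.
  apply: (eq_ind _ (cintable mu2) (cintable_mpres (mpres_tshift (- x.1, - x.2))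
    (cintableZ (ftc^-1)%:C (cintable_shift_pkernel2 x e0 If)))).
  apply/funext => y; rewrite [in RHS]rcM mulrA [in RHS]mulrC; congr (_ * f _).
  by case: y => a b; rewrite /tshift /= !subrK.
rewrite -(cint_mpres (mpres_tshift x)) /=; last first.
  apply: cmeasM; first exact: cmeas_cst; apply: cmeasM => //; first exact: If.1.
  apply: cmeas_real; apply: measurable_funM; first exact: measurable_cst.
  exact: (measurableT_comp (measurable_pkernel2 e0) (mpres_tshift (- x.1, - x.2)).1).
apply: cint_eq => z; rewrite /tshift /= !addrK -surjective_pairing rcM.
have -> : ftc%:C * (f (z.1 + x.1, z.2 + x.2) * ((ftc^-1)%:C * (pkernel2 eps z)%:C)) =
  (ftc%:C * (ftc^-1)%:C) * ((pkernel2 eps z)%:C * f (z.1 + x.1, z.2 + x.2)) by ring.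
by rewrite -rcM divff ?rmorph1 ?mul1r// gt_eqF// ftc_gt0.
Qed.

End Plancherel.

Section PlancherelLimit.
Context {R : realType}.
Local Notation lam := (@lebesgue_measure R).
Local Notation mR := (measurableTypeR R).
Local Notation R2 := (mR * mR)%type.
Local Notation C := R[i].
Local Notation "x %:C" := (real_complex R x).
Implicit Types f g : R2 -> C.

(** Comparison with the kernel of scale 1, of mass 1, bounds the mass away from 0 by [O(eps)] with
    no tail integral to compute. *)
Lemma pkernel_tail (eps del t : R) : 0 < eps -> 0 < del -> del <= `|t| ->
  pkernel eps t <= eps * (1 + del ^- 2) * pkernel 1 t.
Proof.
move=> e0 d0 dt; rewrite /pkernel.
have pp := @pi_gt0 R; move: (@pi R) pp => p p0.
have h1 : 0 < eps ^+ 2 + t ^+ 2 by rewrite ltr_wpDr ?sqr_ge0// exprn_gt0.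
have h2 : 0 < 1 ^+ 2 + t ^+ 2 by rewrite ltr_wpDr ?sqr_ge0// expr1n.
rewrite ler_pdivrMr ?mulr_gt0//.
rewrite [leRHS](_ : _ = eps * ((1 + del ^- 2) * (eps ^+ 2 + t ^+ 2) / (1 ^+ 2 + t ^+ 2))); last first.
  by field; rewrite expr1n in h2; rewrite !gt_eqF.
rewrite ler_peMr ?(ltW e0)// ler_pdivlMr// mul1r expr1n.
have : 1 <= del ^- 2 * t ^+ 2.
  rewrite mulrC ler_pdivlMr ?exprn_gt0// mul1r -(real_normK (num_real t)).
  by rewrite ler_sqr ?nnegrE ?normr_ge0 ?(ltW d0).
have : 0 <= del ^- 2 * eps ^+ 2 by rewrite mulr_ge0 ?invr_ge0 ?exprn_ge0// ltW.
have := sqr_ge0 eps.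
by move: (del ^- 2) => q; nra.
Qed.

Lemma measurable_tshift : measurable_fun [set: R2 * R2] (fun p => tshift p.1 p.2).
Proof.
have m1 : measurable_fun [set: R2 * R2] (fun p => p.1.1 : R) := measurableT_comp measurable_fst measurable_fst.
have m2 : measurable_fun [set: R2 * R2] (fun p => p.1.2 : R) := measurableT_comp measurable_snd measurable_fst.
have m3 : measurable_fun [set: R2 * R2] (fun p => p.2.1 : R) := measurableT_comp measurable_fst measurable_snd.
have m4 : measurable_fun [set: R2 * R2] (fun p => p.2.2 : R) := measurableT_comp measurable_snd measurable_snd.
by apply: measurable_fun_pair; exact: measurable_funD.
Qed.

Lemma tshiftC (x z : R2) : tshift x z = tshift z x.
Proof. by rewrite /tshift addrC [X in (_, X)]addrC. Qed.

(** The kernel has mass 1, so the difference is a double integral of the kernel against the pairing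
    of [f] with [f (tshift z x) - f x]. Small [z] costs [eta]; otherwise the increment has norm at
    most [2 * n2 mu2 f] and one of the two coordinates lies in the tail, whence the factor 4. *)
Lemma mollified_dist f (eps del eta : R) : 0 < eps -> 0 < del -> 0 <= eta ->
  cintable mu2 f -> isL2 mu2 f ->
  (forall z : R2, `|z.1 : R| < del -> `|z.2 : R| < del ->
     n2 mu2 (fun x => f (tshift z x) - f x) <= eta) ->
  normc (cint mu2 (fun x => f x * conjc (cint mu2 (fun z => (pkernel2 eps z)%:C * f (tshift x z))))
     - (n2 mu2 f ^+ 2)%:C) <=
  n2 mu2 f * (eta + 4 * n2 mu2 f * (eps * (1 + del ^- 2))).
Proof.
move=> e0 d0 eta0 If f2 small.
set K := eps * (1 + del ^- 2); set N := n2 mu2 f.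
have K0 : 0 <= K by rewrite mulr_ge0 ?(ltW e0)// addr_ge0// invr_ge0 exprn_ge0// ltW.
have N0 : 0 <= N := n2_ge0 _ _.
pose G (p : R2 * R2) := f p.1 * conjc ((pkernel2 eps p.2)%:C * (f (tshift p.1 p.2) - f p.1)).
have mf1 : cmeas (fun p : R2 * R2 => f p.1) := cmeas_comp measurable_fst If.1.
have mG : cmeas G.
  apply: cmeasM => //; apply: cmeas_conj; apply: cmeasM.
    exact: (cmeas_comp (f := fun z => (pkernel2 eps z)%:C) measurable_snd (cintable_pkernel2 e0).1).
  by apply: cmeasB => //; exact: (cmeas_comp measurable_tshift If.1).
have GE x z : normc (G (x, z)) = pkernel2 eps z * normc (f x * (f (tshift z x) - f x)).
  rewrite /G /= normcM normc_conj !normcM normc_real ger0_norm ?pkernel2_ge0//.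
  by rewrite tshiftC mulrCA.
have mnG : measurable_fun setT (fun p => (normc (G p))%:E).
  exact/measurable_EFinP/measurable_normc.
have bound : (\int[mu2]_x \int[mu2]_z (normc (G (x, z)))%:E <= (N * (eta + 4 * N * K))%:E)%E.
  have nG0 (p : R2 * R2) : (0 <= (normc (G p))%:E)%E by rewrite lee_fin normc_ge0.
  have -> : (\int[mu2]_x \int[mu2]_z (normc (G (x, z)))%:E = \int[mu2]_z \int[mu2]_x (normc (G (x, z)))%:E)%E.
    exact: (@fubini_tonelli _ _ _ _ _ mu2 mu2 _ mnG nG0).
  (* Majorant of the inner integral: the first term serves when both coordinates of [z] are below
     [del], the second when [z.1] is large, the third when [z.2] is large. *)
  pose H (z : R2) : R := N * eta * pkernel2 eps z + 2 * N * N * K * (pkernel 1 z.1 * pkernel eps z.2) +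
     2 * N * N * K * (pkernel eps z.1 * pkernel 1 z.2).
  have HE z : (H z)%:E = ((N * eta)%:E * (pkernel2 eps z)%:E +
      (2 * N * N * K)%:E * (pkernel 1 z.1 * pkernel eps z.2)%:E +
      (2 * N * N * K)%:E * (pkernel eps z.1 * pkernel 1 z.2)%:E)%E.
    by rewrite -!EFinM -!EFinD.
  have mp (e1 e2 : R) : 0 < e1 -> 0 < e2 ->
      measurable_fun [set: R2] (fun z => (pkernel e1 z.1 * pkernel e2 z.2)%:E).
    move=> e10 e20; apply/measurable_EFinP/measurable_funM.
      exact: (measurableT_comp (measurable_pkernel e10) measurable_fst).
    exact: (measurableT_comp (measurable_pkernel e20) measurable_snd).
  have p0 (e1 e2 : R) (z : R2) : 0 < e1 -> 0 < e2 -> 0 <= pkernel e1 z.1 * pkernel e2 z.2.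
    by move=> *; rewrite mulr_ge0// pkernel_ge0.
  have c0 : 0 <= 2 * N * N * K by do 3?[apply: mulr_ge0 => //].
  have Ne0 : 0 <= N * eta by rewrite mulr_ge0.
  have l01 : 0 < 1 :> R by [].
  apply: (@le_trans _ _ (\int[mu2]_z (H z)%:E)%E).
    apply: ge0_int_le.
    - by move=> z; apply: integral_ge0 => x _; rewrite lee_fin normc_ge0.
    - have := @measurable_fun_fubini_tonelli_G _ _ _ _ _ mu2 _ mnG; apply => p.
      by rewrite lee_fin normc_ge0.
    - under eq_fun do rewrite HE.
      by apply: emeasurable_funD; [apply: emeasurable_funD|];
        apply: measurable_funeM; apply: mp.
    - move=> z; under eq_integral do rewrite GE EFinM.
      have fz2 : isL2 mu2 (fun x => f (tshift z x) - f x).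
        exact: isL2B (isL2_mpres (mpres_tshift z) f2) f2.
      rewrite ge0_integralZl//; last 3 first.
      + exact/measurable_EFinP/measurable_normc/cmeasM/fz2.1/If.1.
      + by move=> x _; rewrite lee_fin normc_ge0.
      + by rewrite lee_fin pkernel2_ge0.
      apply: le_trans (lee_wpmul2l _ (hoelder2_n2 f2 fz2)) _.
        by rewrite lee_fin pkernel2_ge0.
      rewrite -EFinM lee_fin -/N /H.
      have A := p0 _ _ z l01 e0; have B := p0 _ _ z e0 l01; have D := pkernel2_ge0 z e0.
      have w2 : n2 mu2 (fun x => f (tshift z x) - f x) <= 2 * N.
        apply: le_trans (n2B (isL2_mpres (mpres_tshift z) f2) f2) _.
        by rewrite (n2_mpres (mpres_tshift z) If.1) mulr_natl mulr2n.
      have tail : pkernel2 eps z <= K * (pkernel 1 z.1 * pkernel eps z.2) + K * (pkernel eps z.1 * pkernel 1 z.2) ->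
          pkernel2 eps z * (N * n2 mu2 (fun x => f (tshift z x) - f x)) <=
          N * eta * pkernel2 eps z + 2 * N * N * K * (pkernel 1 z.1 * pkernel eps z.2) + 2 * N * N * K * (pkernel eps z.1 * pkernel 1 z.2).
        move=> T; apply: (@le_trans _ _ ((K * (pkernel 1 z.1 * pkernel eps z.2) + K * (pkernel eps z.1 * pkernel 1 z.2)) * (N * (2 * N)))).
          by apply: ler_pM => //; rewrite ?mulr_ge0 ?n2_ge0// ler_wpM2l.
        rewrite -subr_ge0.
        have -> : N * eta * pkernel2 eps z + 2 * N * N * K * (pkernel 1 z.1 * pkernel eps z.2) +
             2 * N * N * K * (pkernel eps z.1 * pkernel 1 z.2) -
             (K * (pkernel 1 z.1 * pkernel eps z.2) + K * (pkernel eps z.1 * pkernel 1 z.2)) * (N * (2 * N))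
             = N * eta * pkernel2 eps z by ring.
        by rewrite mulr_ge0.
      have [z1|z1] := ltP `|z.1 : R| del; last first.
        apply: tail; apply: (@le_trans _ _ (K * (pkernel 1 z.1 * pkernel eps z.2))).
          by rewrite mulrA ler_wpM2r ?pkernel_ge0// pkernel_tail.
        by rewrite lerDl mulr_ge0.
      have [z2|z2] := ltP `|z.2 : R| del; last first.
        apply: tail; apply: (@le_trans _ _ (K * (pkernel eps z.1 * pkernel 1 z.2))).
          by rewrite mulrCA ler_wpM2l ?pkernel_ge0// pkernel_tail.
        by rewrite lerDr mulr_ge0.
      rewrite -addrA; apply: (@le_trans _ _ (N * eta * pkernel2 eps z)).
        by rewrite mulrC ler_wpM2r// ler_wpM2l// small.
      by rewrite lerDl addr_ge0// mulr_ge0.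
  under eq_integral do rewrite HE.
  have e3 : (forall z : R2, 0 <= (2 * N * N * K)%:E * (pkernel eps z.1 * pkernel 1 z.2)%:E)%E.
    by move=> z; rewrite -EFinM lee_fin mulr_ge0// p0.
  have e2 : (forall z : R2, 0 <= (2 * N * N * K)%:E * (pkernel 1 z.1 * pkernel eps z.2)%:E)%E.
    by move=> z; rewrite -EFinM lee_fin mulr_ge0// p0.
  have e1 : (forall z : R2, 0 <= (N * eta)%:E * (pkernel2 eps z)%:E)%E.
    by move=> z; rewrite -EFinM lee_fin mulr_ge0// p0.
  have m3 : measurable_fun [set: R2] (fun z => (2 * N * N * K)%:E * (pkernel eps z.1 * pkernel 1 z.2)%:E)%E.
    by apply: measurable_funeM; exact: mp.
  have m2 : measurable_fun [set: R2] (fun z => (2 * N * N * K)%:E * (pkernel 1 z.1 * pkernel eps z.2)%:E)%E.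
    by apply: measurable_funeM; exact: mp.
  have m1 : measurable_fun [set: R2] (fun z => (N * eta)%:E * (pkernel2 eps z)%:E)%E.
    by apply: measurable_funeM; exact: mp.
  rewrite ge0_integralD//; last 2 first.
  - by move=> z _; rewrite adde_ge0.
  - exact: emeasurable_funD.
  rewrite ge0_integralD//.
  rewrite !ge0_integralZl//; try by [exact: mp|move=> z _; rewrite lee_fin p0].
  rewrite /pkernel2 !ge0_int_pkernel_prod// !mule1 -!EFinD lee_fin.
  by rewrite le_eqVlt; apply/orP; left; apply/eqP; ring.
have fin : (\int[mu2]_x \int[mu2]_z (normc (G (x, z)))%:E < +oo)%E.
  by apply: le_lt_trans bound _; rewrite ltry.
have E : cint mu2 (fun x => f x * conjc (cint mu2 (fun z => (pkernel2 eps z)%:C * f (tshift x z))))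
     - (N ^+ 2)%:C = cint mu2 (fun x => cint mu2 (fun z => G (x, z))).
  have Ip x := cintable_shift_pkernel2 x e0 If.
  have Iq c : cintable mu2 (fun z => (pkernel2 eps z)%:C * c).
    by under eq_fun do rewrite mulrC; exact: cintableZ (cintable_pkernel2 e0).
  have inner x : cint mu2 (fun z => G (x, z)) = f x * conjc (cint mu2 (fun z => (pkernel2 eps z)%:C * f (tshift x z))) - f x * conjc (f x).
    have Id : cintable mu2 (fun z => (pkernel2 eps z)%:C * f (tshift x z) - (pkernel2 eps z)%:C * f x).
      exact: cintableB.
    transitivity (f x * conjc (cint mu2 (fun z => (pkernel2 eps z)%:C * f (tshift x z) - (pkernel2 eps z)%:C * f x))).
      rewrite -cint_conj// -cintZ; last exact: cintable_conj.
      by apply: cint_eq => z; rewrite /G /= mulrBr.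
    rewrite cintB// -mulrBr; congr (_ * _).
    have -> : cint mu2 (fun z => (pkernel2 eps z)%:C * f x) = f x.
      transitivity (f x * cint mu2 (fun z : R2 => (pkernel2 eps z)%:C)).
        by rewrite -cintZ; [apply: cint_eq => z; rewrite mulrC|exact: cintable_pkernel2].
      by rewrite cint_pkernel2// mulr1.
    by case: (cint _ _) (f x) => [a b] [c d]; apply: complexP => /=; ring.
  rewrite -(cint_sqr f2).
  have I0 : cintable mu2 (fun x => cint mu2 (fun z => G (x, z))) by exact: cintable_cint_fst.
  have I1 : cintable mu2 (fun x => f x * conjc (f x)) by apply: cintable_mul => //; exact: isL2_conj.
  rewrite -cintB//.
    by apply: cint_eq => x; rewrite inner.
  have := cintableD I0 I1; congr (cintable _ _); apply/funext => x.
  by rewrite inner subrK.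
rewrite E -lee_fin; apply: le_trans bound.
apply: le_trans (normc_cint_le (cintable_cint_fst mG fin)) _.
have mnF : measurable_fun [set: R2] (fun x => \int[mu2]_z (normc (G (x, z)))%:E)%E.
  have := @measurable_fun_fubini_tonelli_F _ _ _ _ _ mu2 _ mnG; apply => p.
  by rewrite lee_fin normc_ge0.
have I0 := cintable_cint_fst mG fin.
have iN := cintable_integrable (cintable_prod mG fin).
apply: ae_ge0_le_integral => //.
- by move=> x _; rewrite lee_fin normc_ge0.
- exact/measurable_EFinP/measurable_normc/I0.1.
- by move=> x _; apply: integral_ge0 => z _; rewrite lee_fin normc_ge0.
- have := ae_integrable1 iN; apply: filterS => x h _.
  apply: normc_cint_le; apply: cintableP => //.
  by case: mG => g1 g2; split; [exact: (measurable_fun_pair2 x g1)|exact: (measurable_fun_pair2 x g2)].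
Qed.

End PlancherelLimit.

Section PlancherelL1L2.
Context {R : realType}.
Local Notation mR := (measurableTypeR R).
Local Notation R2 := (mR * mR)%type.
Local Notation C := R[i].
Local Notation "x %:C" := (real_complex R x).
Implicit Types f g : R2 -> C.

Lemma archimedean_inv (K e : R) : 0 <= K -> 0 < e -> exists N, forall n, (N <= n)%N -> K / n.+1%:R <= e.
Proof.
move=> K0 e0; exists (Num.truncn (K / e)) => n Nn.
have Ke : 0 <= K / e by rewrite divr_ge0// ltW.
have /andP[_ /ltW h] := truncn_itv Ke.
rewrite ler_pdivrMr ?ltr0n// mulrC -ler_pdivrMr//; apply: le_trans h _.
by rewrite ler_nat.
Qed.

(** Energies damped with [eps = 1/(n+1)]. They increase with [n], so monotone convergence identifies
    their limit with [sq mu2 (fourier1 f)] before that quantity is known to be finite. *)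
Let energy f (n : nat) : \bar R := (\int[mu2]_xi (pexp2 n.+1%:R^-1 xi * normc (fourier1 f xi) ^+ 2)%:E)%E.

Let en_gt0 (n : nat) : 0 < n.+1%:R^-1 :> R. Proof. by rewrite invr_gt0 ltr0n. Qed.

Lemma energy_cvg f : cintable mu2 f -> isL2 mu2 f ->
  energy f n @[n --> \oo] --> (n2 mu2 f ^+ 2)%:E.
Proof.
move=> If f2; set N := n2 mu2 f; have N0 : 0 <= N := n2_ge0 _ _.
pose b := ftc * fine (\int[mu2]_x (normc (f x))%:E).
have Ab xi : normc (fourier1 f xi) <= b := normc_fourier1 xi If.
have mA := cmeas_fourier1 If.1.
have term xi n : fourier1 f xi * ((pexp2 n.+1%:R^-1 xi)%:C * conjc (fourier1 f xi)) =
    (pexp2 n.+1%:R^-1 xi * normc (fourier1 f xi) ^+ 2)%:C.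
  by rewrite rcM -mul_conjc; ring.
have fin n : (energy f n < +oo)%E.
  have I1 : cintable mu2 (fun xi => fourier1 f xi * (pexp2 n.+1%:R^-1 xi)%:C).
    exact: (cintableMr (cintable_pexp2 (en_gt0 n)) mA Ab).
  have I2 : cintable mu2 (fun xi => conjc (fourier1 f xi) * (fourier1 f xi * (pexp2 n.+1%:R^-1 xi)%:C)).
    by apply: (cintableMr I1 (cmeas_conj mA)) => xi; rewrite normc_conj; exact: Ab.
  rewrite (_ : energy f n = \int[mu2]_xi (normc (conjc (fourier1 f xi) * (fourier1 f xi * (pexp2 n.+1%:R^-1 xi)%:C)))%:E)%E.
    exact: I2.2.
  apply: eq_integral => xi _.
  rewrite (_ : conjc _ * _ = (pexp2 n.+1%:R^-1 xi * normc (fourier1 f xi) ^+ 2)%:C).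
    by rewrite normc_real ger0_norm// mulr_ge0 ?pexp2_ge0 ?sqr_ge0.
  by rewrite -term; ring.
have E0 n : (0 <= energy f n)%E.
  by apply: integral_ge0 => xi _; rewrite lee_fin mulr_ge0 ?pexp2_ge0 ?sqr_ge0.
have En n : energy f n = (fine (energy f n))%:E by rewrite fineK// ge0_fin_numE.
rewrite (funext En); apply: cvg_EFin; first exact: nearW.
apply/cvgrPdist_le => e e0.
(* Dividing by [N + 1] rather than [N] also covers a null function. *)
have [eta eta0 Neta] : exists2 eta : R, 0 < eta & N * eta <= e / 2.
  exists (e / 2 / (N + 1)); first by rewrite !divr_gt0// ltr_wpDl.
  by rewrite mulrCA ler_piMr ?divr_ge0 ?(ltW e0)// ler_pdivrMr ?ltr_wpDl// mul1r lerDl.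
have [del d0 small] := translation_continuous f2 eta0.
have K0 : 0 <= 4 * N * N * (1 + del ^- 2).
  by do 3?[apply: mulr_ge0 => //]; rewrite addr_ge0// invr_ge0 exprn_ge0// ltW.
have e20 : 0 < e / 2 by rewrite divr_gt0.
have [n0 n0P] := archimedean_inv K0 e20.
exists n0 => // n /= nn.
have := mollified_dist (en_gt0 n) d0 (ltW eta0) If f2 small.
rewrite -plancherel_mollified//.
under cint_eq do rewrite term.
rewrite cint_real -rmorphB normc_real -/N distrC => h; apply: le_trans h _.
rewrite mulrDr (splitr e); apply: lerD => //.
apply: le_trans (n0P n nn); rewrite le_eqVlt; apply/orP; left; apply/eqP.
by move: (del ^- 2) (n.+1%:R^-1) => a c; ring.
Qed.

Lemma energy_monotone f : cintable mu2 f -> energy f n @[n --> \oo] --> sq mu2 (fourier1 f).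
Proof.
move=> If; have mA := cmeas_fourier1 If.1.
pose g n (xi : R2) := (pexp2 n.+1%:R^-1 xi * normc (fourier1 f xi) ^+ 2)%:E.
have mg n : measurable_fun setT (g n).
  apply/measurable_EFinP/measurable_funM; first exact: (cintable_pexp2 (en_gt0 n)).1.1.
  exact: measurable_normc2.
have g0 n xi : setT xi -> (0 <= g n xi)%E.
  by move=> _; rewrite lee_fin mulr_ge0 ?pexp2_ge0 ?sqr_ge0.
have eN (n m : nat) : (n <= m)%N -> m.+1%:R^-1 <= n.+1%:R^-1 :> R.
  by move=> nm; rewrite lef_pV2 ?posrE ?ltr0n// ler_nat.
have ndg xi : setT xi -> {homo g^~ xi : n m / (n <= m)%N >-> (n <= m)%E}.
  move=> _ n m nm; rewrite lee_fin ler_wpM2r ?sqr_ge0//.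
  by apply: ler_pM; rewrite ?expR_ge0// ler_expR lerN2 ler_wpM2r ?normr_ge0// eN.
have := @cvg_monotone_convergence _ _ _ mu2 setT measurableT g mg g0 ndg.
rewrite (_ : (\int[mu2]_(x in setT) _)%E = sq mu2 (fourier1 f))//.
apply: eq_integral => xi _; apply/cvg_lim => //; apply: cvg_EFin; first exact: nearW.
rewrite -[X in _ --> X]mul1r; apply: cvgM; last exact: cvg_cst.
have e1 (t : R) : pexp n.+1%:R^-1 t @[n --> \oo] --> (1 : R).
  have h : - (n.+1%:R^-1 * `|t|) @[n --> \oo] --> (0 : R).
    rewrite -[X in _ --> X]oppr0 -[X in _ --> - X](mul0r `|t|); apply: cvgN.
    by apply: cvgM; [exact: cvg_harmonic|exact: cvg_cst].
  rewrite -[X in _ --> X](@expR0 R).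
  by apply: (continuous_cvg _ _ h); exact: continuous_expR.
by rewrite -[X in _ --> X](mulr1 (1 : R)); apply: cvgM; exact: e1.
Qed.

(** The two limits found for the damped energies must agree; this gives finiteness and the norm
    identity together. *)
Theorem plancherel_L1L2 f : cintable mu2 f -> isL2 mu2 f ->
  isL2 mu2 (fourier1 f) /\ n2 mu2 (fourier1 f) = n2 mu2 f.
Proof.
move=> If f2.
have E : sq mu2 (fourier1 f) = (n2 mu2 f ^+ 2)%:E.
  exact: (cvg_unique _ (energy_monotone If) (energy_cvg If f2)).
split; first by split; [exact: cmeas_fourier1 If.1|rewrite E ltry].
by rewrite /n2 E /= sqrtr_sqr ger0_norm// n2_ge0.
Qed.

End PlancherelL1L2.

Section AlmostEverywhere.
Context d (T : measurableType d) (R : realType) (mu : {measure set T -> \bar R}).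

Lemma ae_imp (P Q : T -> Prop) : (forall x, P x -> Q x) ->
  (\forall x \ae mu, P x) -> \forall x \ae mu, Q x.
Proof. by move=> PQ; apply: filterS => x /PQ. Qed.

Lemma ae_all (P : T -> Prop) : (forall x, P x) -> \forall x \ae mu, P x.
Proof. by move=> h; apply: filterE. Qed.

Lemma ae_imp2 (P P' Q : T -> Prop) : (forall x, P x -> P' x -> Q x) ->
  (\forall x \ae mu, P x) -> (\forall x \ae mu, P' x) -> \forall x \ae mu, Q x.
Proof. by move=> PQ; apply: filterS2 => x /PQ. Qed.

End AlmostEverywhere.

(** * Fourier transform on L2 *)

Section FourierL2.
Context {R : realType}.
Local Notation mR := (measurableTypeR R).
Local Notation R2 := (mR * mR)%type.
Local Notation C := R[i].
Local Notation "x %:C" := (real_complex R x).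
Implicit Types (f g h k : R * R -> C).

Lemma Lp2P f : Lp 2 f <-> isL2 mu2 f.
Proof.
split=> -[mf h]; split => //; first by have := (Lnorm2_lty mu2 f).1 h.
by have := (Lnorm2_lty mu2 f).2 h.
Qed.

Lemma Lp1P f : Lp 1 f <-> cintable mu2 f.
Proof.
have E : Lpnorm 1 f = (\int[mu2]_x (normc (f x))%:E)%E.
  rewrite /Lpnorm Lnorm1; apply: eq_integral => x _.
  by rewrite abse_EFin ger0_norm ?normc_ge0.
by split=> -[mf h]; split => //; rewrite ?E// -E.
Qed.

Lemma Lpnorm2E f : isL2 mu2 f -> Lpnorm 2 f = (n2 mu2 f)%:E.
Proof. by move=> f2; have := Lnorm2_n2 f2. Qed.

Lemma cvg_EFin0 (a : nat -> R) : (a n)%:E @[n --> \oo] --> 0%E <-> a n @[n --> \oo] --> (0 : R).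
Proof.
split=> [h|h]; last by apply: cvg_EFin => //; exact: nearW.
by have /fine_cvg := h.
Qed.

Lemma cvgn_eq (T : topologicalType) (a b : nat -> T) (l : T) :
  a =1 b -> a @ \oo --> l -> b @ \oo --> l.
Proof. by move=> /funext ->. Qed.

Definition n2cvg (u : nat -> R * R -> C) f := n2 mu2 (fun x => u n x - f x) @[n --> \oo] --> (0 : R).

(** The calculus below is carried by the relation rather than by [fourier2]: a transform is
    determined only almost everywhere, and the relation accepts every measurable representative. *)
Lemma is_fourier2P f g : is_fourier2 f g <-> [/\ isL2 mu2 f, isL2 mu2 g &
  exists u, [/\ forall n, cintable mu2 (u n) /\ isL2 mu2 (u n), n2cvg u f &
     n2cvg (fun n => fourier1 (u n)) g]].
Proof.
split=> -[f2 g2 [u [u12 uf ug]]].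
  have {}f2 := (Lp2P f).1 f2; have {}g2 := (Lp2P g).1 g2.
  have {}u12 n : cintable mu2 (u n) /\ isL2 mu2 (u n).
    by have [a b] := u12 n; split; [exact/Lp1P|exact/Lp2P].
  split => //; exists u; split => //; apply/cvg_EFin0.
    apply: cvgn_eq uf => n.
    by rewrite (Lpnorm2E (isL2B (u12 n).2 f2 : isL2 mu2 (u n - f))).
  apply: cvgn_eq ug => n.
  by rewrite (Lpnorm2E (isL2B (plancherel_L1L2 (u12 n).1 (u12 n).2).1 g2 : isL2 mu2 (fourier1 (u n) - g))).
split; [exact/Lp2P|exact/Lp2P|exists u; split].
- by move=> n; have [a b] := u12 n; split; [exact/Lp1P|exact/Lp2P].
- apply: cvgn_eq ((cvg_EFin0 _).2 uf) => n.
  by rewrite (Lpnorm2E (isL2B (u12 n).2 f2 : isL2 mu2 (u n - f))).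
- apply: cvgn_eq ((cvg_EFin0 _).2 ug) => n.
  by rewrite (Lpnorm2E (isL2B (plancherel_L1L2 (u12 n).1 (u12 n).2).1 g2 : isL2 mu2 (fourier1 (u n) - g))).
Qed.

Lemma n2cvg_eq (u v : nat -> R * R -> C) f : (forall n x, u n x = v n x) -> n2cvg u f -> n2cvg v f.
Proof. by move=> uv; have -> : u = v by apply/funext => n; apply/funext. Qed.

Lemma n2cvg_squeeze (u : nat -> R * R -> C) f (b : nat -> R) :
  (forall n, n2 mu2 (fun x => u n x - f x) <= b n) -> b n @[n --> \oo] --> (0 : R) -> n2cvg u f.
Proof.
move=> ub b0; apply: (@squeeze_cvgr _ _ _ _ (fun=> 0) b) => //; last exact: cvg_cst.
by apply: nearW => n; rewrite n2_ge0 ub.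
Qed.

Lemma n2cvg_n2 (u : nat -> R * R -> C) f : (forall n, isL2 mu2 (u n)) -> isL2 mu2 f ->
  n2cvg u f -> n2 mu2 (u n) @[n --> \oo] --> n2 mu2 f.
Proof.
move=> u2 f2 uf; apply/cvgrPdist_le => e e0.
move/cvgrPdist_le : uf => /(_ e e0); apply: filterS => n; rewrite sub0r normrN ger0_norm ?n2_ge0//.
by rewrite distrC; apply: le_trans; exact: n2_dist.
Qed.

Lemma n2cvgD (u v : nat -> R * R -> C) f g c : (forall n, isL2 mu2 (u n)) -> (forall n, isL2 mu2 (v n)) ->
  isL2 mu2 f -> isL2 mu2 g -> n2cvg u f -> n2cvg v g ->
  n2cvg (fun n x => c * u n x + v n x) (fun x => c * f x + g x).
Proof.
move=> u2 v2 f2 g2 uf vg.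
apply: (@n2cvg_squeeze _ _ (fun n => normc c * n2 mu2 (fun x => u n x - f x) + n2 mu2 (fun x => v n x - g x))).
  move=> n; have a2 := isL2B (u2 n) f2; have b2 := isL2B (v2 n) g2.
  rewrite -n2Z//; have := n2D (isL2Z c a2) b2; congr (_ <= _); congr n2; apply/funext => x; ring.
by rewrite -[X in _ --> X](addr0 (0 : R)) -{1}(mulr0 (normc c)); apply: cvgD => //; apply: cvgM => //; exact: cvg_cst.
Qed.

Lemma fourier1_lin c f g xi : cintable mu2 f -> cintable mu2 g ->
  fourier1 (fun x => c * f x + g x) xi = c * fourier1 f xi + fourier1 g xi.
Proof.
move=> If Ig; rewrite !fourier1E.
have If' := cintable_cis_dot xi If; have Ig' := cintable_cis_dot xi Ig.
rewrite (_ : cint mu2 (fun x => _ * (c * f x + g x)) =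
  c * cint mu2 (fun x => cis (- dot x xi) * f x) + cint mu2 (fun x => cis (- dot x xi) * g x)).
  by ring.
rewrite -cintZ// -cintD//; last exact: cintableZ.
by apply: cint_eq => x; ring.
Qed.

Lemma fourier1B f g xi : cintable mu2 f -> cintable mu2 g ->
  fourier1 (fun x => f x - g x) xi = fourier1 f xi - fourier1 g xi.
Proof.
move=> If Ig; have := fourier1_lin (-1) xi Ig If; rewrite mulN1r [RHS]addrC => <-.
by congr (fourier1 _ xi); apply/funext => x; ring.
Qed.

Lemma fourier2_L1 f : cintable mu2 f -> isL2 mu2 f -> is_fourier2 f (fourier1 f).
Proof.
move=> If f2; have [F2 _] := plancherel_L1L2 If f2.
apply/is_fourier2P; split => //; exists (fun=> f); split => //.
  by rewrite /n2cvg; under eq_fun do under [X in n2 _ X]eq_fun do rewrite subrr; rewrite n2_0; exact: cvg_cst.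
by rewrite /n2cvg; under eq_fun do under [X in n2 _ X]eq_fun do rewrite subrr; rewrite n2_0; exact: cvg_cst.
Qed.

Definition trunc f (n : nat) (x : R * R) : C := (\1_(square n : set R2) x)%:C * f x.

Lemma isL2_trunc f n : isL2 mu2 f -> cintable mu2 (trunc f n) /\ isL2 mu2 (trunc f n).
Proof.
move=> f2; have s2 := isL2_indic (measurable_square n) (leb2_square_lty n : (mu2 (square n) < +oo)%E).
split; first exact: cintable_mul.
apply: (isL2M (M := 1) (s2 R).1 _ f2) => x.
by rewrite normc_real indicE; case: (_ \in _); rewrite ?normr1 ?normr0.
Qed.

Lemma trunc_cvg f : isL2 mu2 f -> n2cvg (trunc f) f.
Proof.
move=> f2; apply: (n2_dct f2).
- by move=> n; exact: cmeasB (isL2_trunc n f2).2.1 f2.1.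
- apply: nearW => x; have : [set: R2] x by []; rewrite -bigcup_square => -[N _ xN].
  apply: cvg_near_cst; exists N => // n /= Nn.
  have xn : square n x by have /subsetPset := @nd_square R _ _ Nn; apply.
  by rewrite /trunc indicE mem_set// rmorph1 mul1r subrr normc0.
- move=> n x; rewrite /trunc indicE; case: (_ \in _); rewrite ?rmorph1 ?mul1r ?subrr ?normc0 ?normc_ge0//.
  by rewrite rmorph0 mul0r sub0r normcN.
Qed.

(** Restricting [f] to growing squares gives functions in both [L1] and [L2]; by the Plancherel
    identity their transforms form a Cauchy sequence. *)
Lemma fourier2_exists f : isL2 mu2 f -> exists g, is_fourier2 f g.
Proof.
move=> f2; have T n := isL2_trunc n f2; have tc := trunc_cvg f2.
have F2 n := plancherel_L1L2 (T n).1 (T n).2.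
have [eps e0|g g2 gc] := L2_complete (fun n => (F2 n).1).
  have e2 : 0 < eps / 2 by rewrite divr_gt0.
  move/cvgrPdist_le : tc => /(_ _ e2)[N _ NP]; exists N => m n Nm Nn.
  have := NP m Nm; have := NP n Nn; rewrite !sub0r !normrN !ger0_norm; [|exact: n2_ge0|exact: n2_ge0] => hn hm.
  have I := cintableB (T m).1 (T n).1; have J := isL2B (T m).2 (T n).2.
  have -> : (fun x => fourier1 (trunc f m) x - fourier1 (trunc f n) x) = fourier1 (fun x => trunc f m x - trunc f n x).
    by apply/funext => xi; rewrite fourier1B//; case: (T m); case: (T n).
  rewrite (plancherel_L1L2 I J).2.
  apply: le_trans (n2_tri (T m).2 f2 (T n).2) _.
  by rewrite (splitr eps); apply: lerD; [exact: hm|rewrite n2C; exact: hn].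
by exists g; apply/is_fourier2P; split => //; exists (trunc f).
Qed.

Lemma fourier2_isL2 f g : is_fourier2 f g -> isL2 mu2 f /\ isL2 mu2 g.
Proof. by move=> /is_fourier2P[]. Qed.

Lemma fourier2_n2 f g : is_fourier2 f g -> n2 mu2 g = n2 mu2 f.
Proof.
move=> /is_fourier2P[f2 g2 [u [u12 uf ug]]].
have F2 n := plancherel_L1L2 (u12 n).1 (u12 n).2.
have h1 := n2cvg_n2 (fun n => (F2 n).1) g2 ug.
have h2 := n2cvg_n2 (fun n => (u12 n).2) f2 uf.
exact: (cvg_unique _ h1 (cvgn_eq (fun n => esym (F2 n).2) h2)).
Qed.

Lemma fourier2_lin c f g f' g' : is_fourier2 f g -> is_fourier2 f' g' ->
  is_fourier2 (fun x => c * f x + f' x) (fun x => c * g x + g' x).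
Proof.
move=> /is_fourier2P[f2 g2 [u [u12 uf ug]]] /is_fourier2P[f2' g2' [u' [u12' uf' ug']]].
apply/is_fourier2P; split; [exact: isL2D (isL2Z _ f2) f2'|exact: isL2D (isL2Z _ g2) g2'|].
exists (fun n x => c * u n x + u' n x); split.
- move=> n; have [a b] := u12 n; have [a' b'] := u12' n.
  by split; [apply: cintableD => //; exact: cintableZ|apply: isL2D => //; exact: isL2Z].
- by apply: n2cvgD => // n; case: (u12 n); case: (u12' n).
have F2 n := (plancherel_L1L2 (u12 n).1 (u12 n).2).1.
have F2' n := (plancherel_L1L2 (u12' n).1 (u12' n).2).1.
apply: n2cvg_eq (n2cvgD c F2 F2' g2 g2' ug ug') => n xi.
by rewrite fourier1_lin//; [case: (u12 n)|case: (u12' n)].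
Qed.

(** By linearity the difference of two transforms of [f] is a transform of 0, and the isometry makes
    it null. *)
Lemma fourier2_uniq f g g' : is_fourier2 f g -> is_fourier2 f g' -> g = g' %[ae mu2].
Proof.
move=> h h'; have [f2 g2] := fourier2_isL2 h; have [_ g2'] := fourier2_isL2 h'.
have := fourier2_n2 (fourier2_lin (-1) h' h).
have -> : (fun x => -1 * f x + f x) = (fun=> 0) by apply/funext => x; ring.
rewrite n2_0 (_ : (fun x => -1 * g' x + g x) = (fun x => g x - g' x)); last first.
  by apply/funext => x; ring.
exact: n2B_eq0.
Qed.

Lemma n2cvg_ae (u : nat -> R * R -> C) f f' : (forall n, cmeas (u n : R2 -> C)) -> cmeas (f : R2 -> C) ->
  cmeas (f' : R2 -> C) -> f = f' %[ae mu2] -> n2cvg u f -> n2cvg u f'.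
Proof.
move=> mu mf mf' ff' uf; apply: cvgn_eq uf => n.
apply: n2_ae; [exact: cmeasB|exact: cmeasB|].
by apply: ae_imp ff' => x h /h ->.
Qed.

Lemma fourier2_ae f g f' g' : is_fourier2 f g -> cmeas (f' : R2 -> C) -> cmeas (g' : R2 -> C) ->
  f = f' %[ae mu2] -> g = g' %[ae mu2] -> is_fourier2 f' g'.
Proof.
move=> /is_fourier2P[f2 g2 [u [u12 uf ug]]] mf' mg' ff' gg'.
apply/is_fourier2P; split; [exact: isL2_ae ff' f2|exact: isL2_ae gg' g2|].
exists u; split => //.
  by apply: n2cvg_ae ff' uf => // [n|]; [exact: (u12 n).2.1|exact: f2.1].
apply: n2cvg_ae gg' ug => // [n|]; last exact: g2.1.
exact: (plancherel_L1L2 (u12 n).1 (u12 n).2).1.1.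
Qed.

Lemma fourier2_spec f : isL2 mu2 f -> is_fourier2 f (fourier2 f).
Proof. by move=> f2; apply: xgetPex; exact: fourier2_exists. Qed.

Lemma fourier2_adjoint f g h k : is_fourier2 f g -> is_fourier2 h k ->
  cint mu2 (fun x => g x * h x) = cint mu2 (fun x => f x * k x).
Proof.
move=> /is_fourier2P[f2 g2 [u [u12 uf ug]]] /is_fourier2P[h2 k2 [v [v12 vh vk]]].
have F2 n := (plancherel_L1L2 (u12 n).1 (u12 n).2).1.
have G2 n := (plancherel_L1L2 (v12 n).1 (v12 n).2).1.
apply: (eq_cint_mul_lim F2 (fun n => (v12 n).2) g2 h2 (fun n => (u12 n).2) G2 f2 k2 ug vh uf vk).
by move=> n; apply: fourier1_mult; [case: (u12 n)|case: (v12 n)].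
Qed.

(** Conjugation turns the inverse transform into the direct one. If [k] is the transform of
    [conjc g], the adjoint formula gives the pairing of [k] with [f] the value [n2 g ^+ 2]; all
    norms being equal, [k] and [conjc f] are at distance 0 by polarisation. Surjectivity follows. *)
Lemma fourier2_inv f g : is_fourier2 f g -> is_fourier2 (fun x => conjc (g x)) (fun x => conjc (f x)).
Proof.
move=> h; have [f2 g2] := fourier2_isL2 h.
have cg2 := isL2_conj g2; have cf2 := isL2_conj f2.
have [k hk] := fourier2_exists cg2; have [_ k2] := fourier2_isL2 hk.
apply: (fourier2_ae hk) => //; [exact: cg2.1|exact: cf2.1|exact: ae_all|].
apply: n2B_eq0 => //; apply/eqP; rewrite -sqrf_eq0 n2_sub_sqr//.
rewrite (fourier2_n2 hk) !n2_conj (fourier2_n2 h).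
have -> : cint mu2 (fun x => k x * conjc (conjc (f x))) = (n2 mu2 f ^+ 2)%:C.
  rewrite -(fourier2_n2 h) -cint_sqr// (fourier2_adjoint h hk).
  by apply: cint_eq => x; rewrite conjcK mulrC.
by rewrite /=; apply/eqP; ring.
Qed.

Lemma fourier2_surj g : isL2 mu2 g -> exists f, is_fourier2 f g.
Proof.
move=> g2; have [k hk] := fourier2_exists (isL2_conj g2).
exists (fun x => conjc (k x)); have := fourier2_inv hk.
by congr is_fourier2; apply/funext => x; rewrite conjcK.
Qed.

Lemma fourier2_modulation f g (z : R * R) : is_fourier2 f g ->
  is_fourier2 (fun x => cis (- dot x z) * f x) (fun xi => g (tshift z xi)).
Proof.
move=> /is_fourier2P[f2 g2 [u [u12 uf ug]]].
have mc := cmeas_cis_dot z; have cis1 x : normc (cis (- dot x z)) <= 1 by rewrite normc_cis.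
apply/is_fourier2P; split; [exact: isL2M f2|exact: isL2_mpres (mpres_tshift z) g2|].
exists (fun n x => cis (- dot x z) * u n x); split.
- by move=> n; have [a b] := u12 n; split; [exact: cintable_cis_dot|exact: isL2M b].
- apply: cvgn_eq uf => n.
  by apply: n2_norm_eq => x; rewrite -mulrBr normcM normc_cis mul1r.
apply: cvgn_eq ug => n.
rewrite -(n2_mpres (mpres_tshift z)); last first.
  by apply: cmeasB; [exact: cmeas_fourier1 (u12 n).1.1|exact: g2.1].
congr n2; apply/funext => xi; congr (_ - _).
have := fourier1_modulation (u n) (- z.1, - z.2) xi; rewrite /= !opprK => <-.
congr (fourier1 _ xi); apply/funext => x; congr (cis _ * _).
by rewrite /dot /=; ring.
Qed.

Lemma fourier2_translation f g (z : R * R) : is_fourier2 f g ->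
  is_fourier2 (fun x => f (tshift z x)) (fun xi => cis (dot xi z) * g xi).
Proof.
move=> /fourier2_inv/(fourier2_modulation z)/fourier2_inv.
congr is_fourier2; apply/funext => x; first by rewrite conjcK.
by rewrite conjcM conjcK conj_cis opprK.
Qed.

Lemma fourier2_conj f g : is_fourier2 f g ->
  is_fourier2 (fun x => conjc (f x)) (fun xi => conjc (g (- xi.1, - xi.2))).
Proof.
move=> /is_fourier2P[f2 g2 [u [u12 uf ug]]].
apply/is_fourier2P; split; [exact: isL2_conj|exact: isL2_conj (isL2_mpres (@mpres_opp R) g2)|].
exists (fun n x => conjc (u n x)); split.
- by move=> n; have [a b] := u12 n; split; [exact: cintable_conj|exact: isL2_conj].
- apply: cvgn_eq uf => n.
  by apply: n2_norm_eq => x; rewrite -[in RHS]normc_conj; congr normc; case: (u n x) (f x) => [a b] [c d]; apply: complexP => /=; ring.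
apply: cvgn_eq ug => n.
rewrite -(n2_mpres (@mpres_opp R)); last first.
  by apply: cmeasB; [exact: cmeas_fourier1 (u12 n).1.1|exact: g2.1].
apply: n2_norm_eq => xi.
have -> : fourier1 (fun x => conjc (u n x)) xi = conjc (fourier1 (u n) (- xi.1, - xi.2)).
  rewrite !fourier1E conjcM conjcR -cint_conj; last exact: cintable_cis_dot (u12 n).1.
  congr (_ * _); apply: cint_eq => x; rewrite conjcM conj_cis; congr (cis _ * _).
  by rewrite /dot /=; ring.
by rewrite -[in RHS]normc_conj; congr normc; case: (fourier1 _ _) (g _) => [a b] [c d]; apply: complexP => /=; ring.
Qed.

(** The character is absorbed into [f], where it translates [fh], and inversion takes care of
    [conjc g]. The product being integrable, this correlation formula holds at every [xi], which
    pointwise decay estimates require. *)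
Lemma fourier1_product f g fh gh xi : is_fourier2 f fh -> is_fourier2 g gh ->
  fourier1 (fun x => f x * conjc (g x)) xi =
  ftc%:C * cint mu2 (fun eta => fh (tshift xi eta) * conjc (gh eta)).
Proof.
move=> hf hg; rewrite fourier1E; congr (_ * _).
rewrite (fourier2_adjoint (fourier2_modulation xi hf) (fourier2_inv hg)).
by apply: cint_eq => x; rewrite mulrA.
Qed.

End FourierL2.

(** * Products in Sobolev spaces *)

Section Bracket.
Context {R : realType}.
Local Notation lam := (@lebesgue_measure R).
Local Notation mR := (measurableTypeR R).
Local Notation R2 := (mR * mR)%type.
Implicit Types (x y : R * R) (p q s : R).

Definition jw (s : R) (x : R * R) : R := jbracket x `^ s.

Lemma powR_add (a p q : R) : 0 < a -> a `^ (p + q) = a `^ p * a `^ q.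
Proof. by move=> a0; apply: powRD; rewrite (gt_eqF a0) implybT. Qed.

Lemma jbracket_sqr x : jbracket x ^+ 2 = 1 + x.1 ^+ 2 + x.2 ^+ 2.
Proof. by rewrite /jbracket sqr_sqrtr// !addr_ge0 ?sqr_ge0. Qed.

Lemma jbracket_ge1 x : 1 <= jbracket x.
Proof.
rewrite -sqrtr1 /jbracket ler_sqrt; first by rewrite -addrA lerDl addr_ge0 ?sqr_ge0.
by rewrite !addr_ge0 ?sqr_ge0.
Qed.

Lemma jbracket_gt0 x : 0 < jbracket x.
Proof. exact: lt_le_trans ltr01 (jbracket_ge1 x). Qed.

Lemma jw_gt0 s x : 0 < jw s x.
Proof. exact: powR_gt0 (jbracket_gt0 x). Qed.

Lemma jw_ge0 s x : 0 <= jw s x.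
Proof. exact: powR_ge0. Qed.

Lemma jwD s p x : jw (s + p) x = jw s x * jw p x.
Proof. exact: powR_add (jbracket_gt0 x). Qed.

Lemma jw0 x : jw 0 x = 1.
Proof. by rewrite /jw powRr0. Qed.

Lemma jwNl s x : jw (- s) x * jw s x = 1.
Proof. by rewrite -jwD addNr jw0. Qed.

Lemma jw_le s p x : s <= p -> jw s x <= jw p x.
Proof. by move=> sp; apply: ler_powR => //; exact: jbracket_ge1. Qed.

Lemma jw_ge1 s x : 0 <= s -> 1 <= jw s x.
Proof. by move=> s0; rewrite -(jw0 x) jw_le. Qed.

Lemma jw_le1 s x : s <= 0 -> jw s x <= 1.
Proof. by move=> s0; rewrite -(jw0 x) jw_le. Qed.

Lemma jw_sqr s x : jw s x ^+ 2 = jw (s * 2) x.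
Proof. by rewrite mulr_natr jwD expr2. Qed.

Lemma jbracket_opp x : jbracket (- x.1, - x.2) = jbracket x.
Proof. by rewrite /jbracket /= !sqrrN. Qed.

Lemma jw_opp s x : jw s (- x.1, - x.2) = jw s x.
Proof. by rewrite /jw jbracket_opp. Qed.

(** Triangle inequality for [y] and [tshift x y], whose difference is [x]; [key] is a consequence of
    Cauchy-Schwarz in the plane. *)
Lemma peetre x y : jbracket x <= jbracket (tshift x y) + jbracket y.
Proof.
have g1 := jbracket_gt0 (tshift x y); have g2 := jbracket_gt0 y.
rewrite -(@ler_sqr _ (jbracket x)) ?nnegrE; [|exact: ltW (jbracket_gt0 x)|by rewrite addr_ge0 ?ltW].
have key : - ((y.1 + x.1) * y.1 + (y.2 + x.2) * y.2) <= jbracket (tshift x y) * jbracket y.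
  apply: le_trans (ler_norm _) _; rewrite normrN.
  rewrite -(@ler_sqr _ `|_|) ?nnegrE ?mulr_ge0 ?(ltW g1) ?(ltW g2)//.
  rewrite real_normK ?num_real// exprMn !jbracket_sqr /=.
  have := sqr_ge0 ((y.1 + x.1) * y.2 - (y.2 + x.2) * y.1).
  have := sqr_ge0 (y.1 + x.1); have := sqr_ge0 (y.2 + x.2); have := sqr_ge0 y.1; have := sqr_ge0 y.2.
  move: (y.1 + x.1) (y.2 + x.2) => a b; nra.
rewrite sqrrD !jbracket_sqr /=.
move: (jbracket _ * jbracket _) key => k key; nra.
Qed.

(** A sum of weights rather than the usual product: each summand later cancels a negative weight
    exactly. *)
Lemma jw_peetre s x y : 0 <= s -> jw s x <= 2 `^ s * (jw s (tshift x y) + jw s y).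
Proof.
move=> s0; have g1 := jbracket_gt0 (tshift x y); have g2 := jbracket_gt0 y.
have h := peetre x y; rewrite /jw.
have main (a b : R) : 0 < a -> 0 < b -> a <= b -> (a + b) `^ s <= 2 `^ s * (a `^ s + b `^ s).
  move=> a0 b0 ab; apply: (@le_trans _ _ ((2 * b) `^ s)).
    by apply: ge0_ler_powR => //; rewrite ?nnegrE; lra.
  by rewrite powRM ?(ltW b0)// ler_wpM2l ?powR_ge0// lerDr powR_ge0.
have step : jbracket x `^ s <= (jbracket (tshift x y) + jbracket y) `^ s.
  apply: ge0_ler_powR => //; rewrite nnegrE; [exact: ltW (jbracket_gt0 x)|exact: ltW (addr_gt0 g1 g2)].
apply: le_trans step _; case/orP : (le_total (jbracket (tshift x y)) (jbracket y)) => le.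
  exact: main.
by rewrite addrC [X in _ <= _ * X]addrC; exact: main.
Qed.

(* Young's inequality without constants, by comparing both bases with the smaller one. *)
Lemma jw_mul_le p q x y : p <= 0 -> q <= 0 -> jw p x * jw q y <= jw (p + q) x + jw (p + q) y.
Proof.
move=> p0 q0; rewrite /jw.
have main (a b r t : R) : 0 < a -> a <= b -> t <= 0 -> a `^ r * b `^ t <= a `^ (r + t).
  move=> a0 ab t0; rewrite powR_add//; apply: ler_wpM2l; first exact: powR_ge0.
  have b0 : 0 < b := lt_le_trans a0 ab.
  have [u u0 ->] : exists2 u, 0 <= u & t = - u by exists (- t); rewrite ?oppr_ge0// opprK.
  rewrite !powRN lef_pV2 ?posrE ?powR_gt0//.
  apply: ge0_ler_powR => //; rewrite nnegrE; exact: ltW.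
case/orP : (le_total (jbracket x) (jbracket y)) => le.
  apply: le_trans (main _ _ _ _ (jbracket_gt0 x) le q0) _.
  by rewrite lerDl powR_ge0.
rewrite mulrC addrC [p + q]addrC; apply: le_trans (main _ _ _ _ (jbracket_gt0 y) le p0) _.
by rewrite lerDl powR_ge0.
Qed.

Lemma measurable_jbracket : measurable_fun [set: R2] (@jbracket R).
Proof.
apply: (@measurableT_comp _ _ _ R2 mR mR (@Num.sqrt R)).
  exact: continuous_measurable_fun (@sqrt_continuous R).
apply: measurable_funD; [apply: measurable_funD => //|]; apply: measurable_funX; [exact: measurable_fst|exact: measurable_snd].
Qed.

Lemma measurable_jw s : measurable_fun [set: R2] (jw s).
Proof. exact: measurableT_comp (measurable_powR s) measurable_jbracket. Qed.

Lemma continuous_one_norm (p : R) : continuous (fun t : R => (1 + `|t|) `^ p).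
Proof.
move=> t; have h : 0 < 1 + `|t| by rewrite ltr_wpDr.
have c : {for 1 + `|t|, continuous (@powR R ^~ p)}.
  by apply/differentiable_continuous/derivable1_diffP; apply: derivable_powR; rewrite in_itv/= h.
apply: (@continuous_comp _ _ _ (fun t : R => 1 + `|t|) (@powR R ^~ p)) => //.
by apply: cvgD; [exact: cvg_cst|exact: norm_continuous].
Qed.

Lemma cvg_powR_neg (p : R) : 0 < p -> (1 + t) `^ (- p) @[t --> +oo] --> (0 : R).
Proof.
move=> p0; apply/cvgrPdist_le => e e0.
near=> t; rewrite sub0r normrN ger0_norm ?powR_ge0// powRN.
have h : e^-1 `^ p^-1 <= t by near: t; exact: nbhs_pinfty_ge.
have ep : 0 < e^-1 by rewrite invr_gt0.
have hp : 0 < e^-1 `^ p^-1 by exact: powR_gt0.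
rewrite -[e]invrK lef_pV2 ?posrE ?powR_gt0//; last by lra.
have -> : e^-1 = (e^-1 `^ p^-1) `^ p by rewrite -powRrM mulVf ?gt_eqF// powRr1// (ltW ep).
by apply: ge0_ler_powR; [exact: ltW|rewrite nnegrE; lra|rewrite nnegrE; lra|lra].
Unshelve. all: by end_near.
Qed.

Lemma integral_one_norm (q : R) : 1 < q -> (\int[lam]_t ((1 + `|t|) `^ (- q))%:E < +oo)%E.
Proof.
move=> q1; have q0 : 0 < q - 1 by lra.
have qn : q - 1 != 0 by rewrite gt_eqF.
have dF (t : R) : 0 <= t -> is_derive t 1 (fun t => - (q - 1)^-1 * (1 + t) `^ (- (q - 1))) ((1 + t) `^ (- q)).
  move=> t0; have h : 0 < 1 + t by lra.
  apply: is_derive_conv (is_derive_scale _ (is_derive_compose (is_derive1_powR _ h) (is_derive_add (is_derive_cst _ _ _) (is_derive_id _ _)))) _.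
  by rewrite (_ : - (q - 1) - 1 = - q); [field|ring].
rewrite (@ge0_even_integral _ (fun t => (1 + `|t|) `^ (- q)) (fun t => - (q - 1)^-1 * (1 + t) `^ (- (q - 1))) 0).
- exact: ltry.
- by move=> t; exact: powR_ge0.
- by move=> t; rewrite normrN.
- exact: continuous_one_norm.
- by move=> t t0; rewrite (ger0_norm (ltW t0)); exact: is_derive_derive1 (dF t (ltW t0)).
- by apply/differentiable_continuous/derivable1_diffP; case: (dF 0 (lexx 0)).
- rewrite -[X in _ --> X](mulr0 (- (q - 1)^-1)); apply: cvgM; first exact: cvg_cst.
  exact: cvg_powR_neg.
Qed.

(** From [(1 + |a|) (1 + |b|) <= 2 (1 + a^2 + b^2)]: a product of one-variable functions dominates
    the weight, so integrability over the plane reduces to the line. *)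
Lemma jw_tensor_bound q x : 0 <= q ->
  jw (- (2 * q)) x <= 2 `^ q * ((1 + `|x.1|) `^ (- q) * (1 + `|x.2|) `^ (- q)).
Proof.
move=> q0; rewrite /jw powRN powRrM powR_mulrn ?(ltW (jbracket_gt0 x))// jbracket_sqr.
have a1 : 0 < 1 + `|x.1| by rewrite ltr_wpDr.
have a2 : 0 < 1 + `|x.2| by rewrite ltr_wpDr.
have a3 : 0 < 1 + x.1 ^+ 2 + x.2 ^+ 2 by rewrite ltr_wpDr ?sqr_ge0// ltr_wpDr ?sqr_ge0.
rewrite -powRM ?(ltW a1) ?(ltW a2)// powRN -ler_pdivrMr ?invr_gt0 ?powR_gt0 ?mulr_gt0// invrK.
rewrite mulrC ler_pdivrMr ?powR_gt0// -powRM ?(ltW a3)//.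
apply: ge0_ler_powR => //; rewrite ?nnegrE; [by rewrite mulr_ge0 ?(ltW a1) ?(ltW a2)|by rewrite mulr_ge0 ?(ltW a3)|].
rewrite -(real_normK (num_real x.1)) -(real_normK (num_real x.2)).
have := sqr_ge0 (1 - `|x.1|); have := sqr_ge0 (1 - `|x.2|); have := sqr_ge0 (`|x.1| - `|x.2|).
by move: `|x.1| `|x.2| => a b; nra.
Qed.

Lemma jw_integrable (s : R) : 0 < s -> (\int[mu2]_x (jw (- (2 + s)) x)%:E < +oo)%E.
Proof.
move=> s0; pose q := 1 + s / 2; have q1 : 1 < q by rewrite /q; lra.
have m1 : measurable_fun [set: mR] (fun t : mR => (1 + `|t|) `^ (- q) : R).
  exact: continuous_measurable_fun (@continuous_one_norm _).
have m1e : measurable_fun [set: mR] (fun t : mR => ((1 + `|t|) `^ (- q))%:E) by exact/measurable_EFinP.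
have mt : measurable_fun [set: R2] (fun x : R2 => (1 + `|x.1|) `^ (- q) * (1 + `|x.2|) `^ (- q)).
  by apply: measurable_funM; [exact: measurableT_comp m1 measurable_fst|exact: measurableT_comp m1 measurable_snd].
apply: (@le_lt_trans _ _ (\int[mu2]_x ((2 `^ q)%:E * ((1 + `|x.1|) `^ (- q) * (1 + `|x.2|) `^ (- q))%:E))%E).
  apply: ge0_int_le.
  - by move=> x; rewrite lee_fin jw_ge0.
  - by apply/measurable_EFinP; exact: measurable_jw.
  - by apply: measurable_funeM; exact/measurable_EFinP.
  - move=> x; rewrite -EFinM lee_fin; have := @jw_tensor_bound q x (ltW (lt_trans ltr01 q1)).
    by rewrite (_ : 2 * q = 2 + s) // /q; field.
rewrite ge0_integralZl//; first last.
- exact/measurable_EFinP.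
under eq_integral do rewrite EFinM.
rewrite (@ge0_int_prod _ _ _ _ _ lam lam (fun t => ((1 + `|t|) `^ (- q))%:E) (fun t => ((1 + `|t|) `^ (- q))%:E))//.
have I0 : (0 <= \int[lam]_t ((1 + `|t|) `^ (- q))%:E)%E by apply: integral_ge0 => t _; rewrite lee_fin powR_ge0.
have := integral_one_norm q1; move: I0; case: (\int[lam]_t _)%E => // r _ _.
by rewrite -!EFinM ltry.
Qed.

End Bracket.

Section RingIdentities.
Variable K : comPzRingType.

Lemma cross_distr (a b c d : K) : (a + b) * (c * d) = c * a * d + d * b * c.
Proof. ring. Qed.

Lemma cancel_weights (a b c d e y z : K) : c * b = 1 -> e * d = 1 ->
  b * y * (a * c * e * (d * z)) = a * (y * z).
Proof. by move=> cb ed; transitivity ((c * b) * (e * d) * (a * (y * z))); [ring|rewrite cb ed !mul1r]. Qed.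

Lemma cancel_weights' (a b c d e y z : K) : c * b = 1 -> d * e = 1 ->
  b * y * d * (a * c * e * z) = a * (y * z).
Proof. by move=> cb ed; transitivity ((c * b) * (d * e) * (a * (y * z))); [ring|rewrite cb ed !mul1r]. Qed.

Lemma distr_weights (p a b c d A j : K) :
  p * (a + b) * (c * d * (A * j)) = A * p * (c * a * (d * j) + c * (b * d * j)).
Proof. ring. Qed.

End RingIdentities.

Lemma sqrD_le {R : realDomainType} (a b : R) : (a + b) ^+ 2 <= 2 * a ^+ 2 + 2 * b ^+ 2.
Proof. by have := sqr_ge0 (a - b); nra. Qed.

(** * Multiplication by a function with decaying transform *)

Section Products.
Context {R : realType}.
Local Notation mR := (measurableTypeR R).
Local Notation R2 := (mR * mR)%type.
Local Notation C := R[i].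
Local Notation "x %:C" := (real_complex R x).
Implicit Types (f g h v fh gh hh vh : R * R -> C) (s A : R).

Definition wt (s : R) (g : R * R -> C) (x : R * R) : C := (jw s x)%:C * g x.

Lemma normc_wt s g x : normc (wt s g x) = jw s x * normc (g x).
Proof. by rewrite /wt normcM normc_real ger0_norm ?jw_ge0. Qed.

Lemma cmeas_jw s : cmeas (fun x : R2 => (jw s x)%:C).
Proof. by apply: cmeas_real; exact: measurable_jw. Qed.

Lemma cmeas_wt s g : cmeas (g : R2 -> C) -> cmeas (wt s g : R2 -> C).
Proof. by move=> mg; apply: cmeasM => //; exact: cmeas_jw. Qed.

Lemma measurable_tshift1 (z : R2) : measurable_fun [set: R2] (tshift z).
Proof. by case: (mpres_tshift z). Qed.

Lemma cmeas_unwt s g : cmeas (wt s g : R2 -> C) -> cmeas (g : R2 -> C).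
Proof.
move=> mg; rewrite (_ : g = wt (- s) (wt s g)); first exact: cmeas_wt.
by apply/funext => x; rewrite /wt mulrA -rcM jwNl rmorph1 mul1r.
Qed.

Lemma fourier1_product_decay s f g fh gh xi : 0 <= s ->
  is_fourier2 f fh -> is_fourier2 g gh -> isL2 mu2 (wt s fh) -> isL2 mu2 (wt s gh) ->
  normc (fourier1 (fun x => f x * conjc (g x)) xi) <=
  ftc * (2 `^ s * 2) * (n2 mu2 (wt s fh) * n2 mu2 (wt s gh)) * jw (- s) xi.
Proof.
move=> s0 hf hg f2 g2; rewrite (fourier1_product xi hf hg) normcM normc_real gtr0_norm ?ftc_gt0//.
rewrite -!mulrA ler_pM2l ?ftc_gt0// !mulrA.
set X := cint _ _; have -> : normc X = jw s xi * normc X * jw (- s) xi.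
  by rewrite mulrAC [jw s xi * _]mulrC jwNl mul1r.
apply: ler_wpM2r; first exact: jw_ge0.
(* The weight left over once [wt s] is put on both transforms. By Peetre's inequality it is at most
   [2^s] times [jw (- s) eta + jw (- s) (tshift xi eta)], hence at most [2^s * 2]. *)
pose m (eta : R * R) := jw s xi * jw (- s) (tshift xi eta) * jw (- s) eta.
have m0 eta : 0 <= m eta by rewrite !mulr_ge0 ?jw_ge0.
have mle eta : m eta <= 2 `^ s * 2.
  have h := jw_peetre xi eta s0; rewrite /m.
  have a1 := jw_le1 (tshift xi eta) (_ : - s <= 0); have a2 := jw_le1 eta (_ : - s <= 0).
  apply: (@le_trans _ _ (2 `^ s * (jw s (tshift xi eta) + jw s eta) * jw (- s) (tshift xi eta) * jw (- s) eta)).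
    by rewrite -!mulrA [leRHS]mulrA; apply: ler_wpM2r => //; rewrite mulr_ge0 ?jw_ge0.
  rewrite -!mulrA; apply: ler_wpM2l; first exact: powR_ge0.
  have e1 := jwNl s (tshift xi eta); have e2 := jwNl s eta.
  rewrite cross_distr.
  rewrite e1 e2 !mul1r (_ : 2 = 1 + 1)//; apply: lerD; [apply: a2|apply: a1]; by rewrite oppr_le0.
have mm : cmeas (fun eta : R2 => (m eta)%:C).
  apply: cmeas_real; apply: measurable_funM; last exact: measurable_jw.
  apply: measurable_funM => //; exact: measurableT_comp (@measurable_jw _ _) (measurable_tshift1 xi).
have mle' eta : normc (m eta)%:C <= 2 `^ s * 2 by rewrite normc_real ger0_norm.
have C2 : 0 <= 2 `^ s * 2 :> R by rewrite mulr_ge0 ?powR_ge0.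
have g2' : isL2 mu2 (fun eta => conjc (wt s gh eta)) := isL2_conj g2.
have f2' : isL2 mu2 (fun eta => wt s fh (tshift xi eta)) := isL2_mpres (mpres_tshift xi) f2.
have := cauchy_schwarz f2' (isL2M mm mle' g2').
have -> : cint mu2 (fun eta => wt s fh (tshift xi eta) * ((m eta)%:C * conjc (wt s gh eta))) =
    (jw s xi)%:C * cint mu2 (fun eta => fh (tshift xi eta) * conjc (gh eta)).
  rewrite -cintZ; last first.
    apply: cintable_mul; [exact: isL2_mpres (mpres_tshift xi) (fourier2_isL2 hf).2|].
    exact: isL2_conj (fourier2_isL2 hg).2.
  apply: cint_eq => eta; rewrite /wt conjcM conjcR /m !rcM.
  have e1 := congr1 (real_complex R) (jwNl s (tshift xi eta)); have e2 := congr1 (real_complex R) (jwNl s eta).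
  rewrite !rcM rmorph1 in e1 e2.
  exact: cancel_weights.
rewrite normcM normc_real ger0_norm ?jw_ge0// => h; apply: le_trans h _.
rewrite (n2_mpres (mpres_tshift xi) f2.1) [leRHS]mulrAC [leRHS]mulrC; apply: ler_wpM2l; first exact: n2_ge0.
by apply: le_trans (n2M_le mm mle' C2 g2') _; rewrite n2_conj.
Qed.

(** By inversion an integrable transform gives a representative of [v] that is bounded everywhere;
    it makes products of [v] with [L2] functions square integrable. *)
Lemma fourier2_bounded v vh : is_fourier2 v vh -> cintable mu2 vh ->
  exists2 w, v = w %[ae mu2] & cmeas (w : R2 -> C) /\ exists M, forall x, normc (w x) <= M.
Proof.
move=> hv Iv; have [v2 vh2] := fourier2_isL2 hv.
have Ic := cintable_conj Iv.
have h1 := fourier2_L1 Ic (isL2_conj vh2).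
exists (fun x => conjc (fourier1 (fun y => conjc (vh y)) x)).
  by apply: ae_imp (fourier2_uniq (fourier2_inv hv) h1) => x h /h <-; rewrite conjcK.
split; first by apply: cmeas_conj; exact: cmeas_fourier1 Ic.1.
by eexists => x; rewrite normc_conj; apply: normc_fourier1.
Qed.

Lemma jw_decay_integrable s A vh : 0 < s -> cmeas (vh : R2 -> C) ->
  (forall eta, normc (vh eta) <= A * jw (- (2 + s)) eta) -> cintable mu2 vh.
Proof.
move=> s0 mv vA; split => //.
have A0 : 0 <= A by have := le_trans (normc_ge0 _) (vA 0); rewrite pmulr_lge0 ?jw_gt0.
apply: (@le_lt_trans _ _ (\int[mu2]_x (A%:E * (jw (- (2 + s)) x)%:E))%E).
  apply: ge0_int_le.
  - by move=> x; rewrite lee_fin normc_ge0.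
  - by apply/measurable_EFinP; exact: measurable_normc.
  - by apply: measurable_funeM; apply/measurable_EFinP; exact: measurable_jw.
  - by move=> x; rewrite -EFinM lee_fin.
rewrite ge0_integralZl//; first last.
- by move=> x _; rewrite lee_fin jw_ge0.
- by apply/measurable_EFinP; exact: measurable_jw.
have I0 : (0 <= \int[mu2]_t (jw (- (2 + s)) t)%:E)%E by apply: integral_ge0 => t _; rewrite lee_fin jw_ge0.
have := jw_integrable s0; move: I0; case: (\int[mu2]_t _)%E => // r _ _.
by rewrite -EFinM ltry.
Qed.

Definition jwint (s : R) : R := fine (\int[mu2]_x (jw (- (2 + s)) x)%:E)%E.

Lemma jwintE s : 0 < s -> (\int[mu2]_x (jw (- (2 + s)) x)%:E = (jwint s)%:E)%E.
Proof.
move=> s0; rewrite /jwint fineK// ge0_fin_numE ?jw_integrable//.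
by apply: integral_ge0 => t _; rewrite lee_fin jw_ge0.
Qed.

Lemma jwint_ge0 s : 0 <= jwint s.
Proof. by apply: fine_ge0; apply: integral_ge0 => t _; rewrite lee_fin jw_ge0. Qed.

(* The weight [<eta>^(-(2 + t) / 2)] is moved into the first factor of Cauchy-Schwarz so that its
   square becomes an integrable convolution kernel; [t = min s 1] keeps both exponents negative. *)
Lemma sq_convolution_weight s t A vh xi : 0 <= s -> 0 < t -> t <= s -> t <= 1 ->
  cmeas (vh : R2 -> C) -> (forall eta, normc (vh eta) <= A * jw (- (2 + s)) eta) ->
  (sq mu2 (fun eta => (jw s xi * jw (- s) (tshift xi eta) * jw ((2 + t) / 2) eta)%:C * vh (- eta.1, - eta.2))%R
    <= ((A * 2 `^ s) ^+ 2 * (6 * jwint t))%:E)%E.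
Proof.
move=> s0 t0 ts t1 mv vA.
have A0 : 0 <= A by have := le_trans (normc_ge0 _) (vA 0); rewrite pmulr_lge0 ?jw_gt0.
have As : 0 <= A * 2 `^ s by rewrite mulr_ge0 ?powR_ge0.
have pt eta : normc ((jw s xi * jw (- s) (tshift xi eta) * jw ((2 + t) / 2) eta)%:C * vh (- eta.1, - eta.2)) ^+ 2 <=
    (A * 2 `^ s) ^+ 2 * (4 * jw (- (2 + t)) eta + 2 * jw (- (2 + t)) (tshift xi eta)).
  set x := tshift xi eta.
  apply: (@le_trans _ _ ((A * 2 `^ s * (jw (- ((2 + t) / 2)) eta + jw (- t) x * jw ((2 + t) / 2 - 2) eta)) ^+ 2)).
    rewrite ler_sqr ?nnegrE ?normc_ge0//; last by rewrite mulr_ge0// addr_ge0 ?mulr_ge0 ?jw_ge0.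
    rewrite normcM normc_real ger0_norm ?mulr_ge0 ?jw_ge0//.
    have h1 := vA (- eta.1, - eta.2); rewrite jw_opp in h1.
    apply: le_trans (ler_wpM2l _ h1) _; first by rewrite !mulr_ge0 ?jw_ge0.
    have h2 := jw_peetre xi eta s0; rewrite -/x in h2.
    apply: (@le_trans _ _ (2 `^ s * (jw s x + jw s eta) * (jw (- s) x * jw ((2 + t) / 2) eta * (A * jw (- (2 + s)) eta)))).
      by rewrite -!mulrA [leRHS]mulrA; apply: ler_wpM2r => //; rewrite !mulr_ge0 ?jw_ge0.
    rewrite distr_weights.
    apply: ler_wpM2l => //; rewrite jwNl mul1r -!jwD; apply: lerD; first by apply: jw_le; clear -ts; lra.
    rewrite (_ : s + (2 + t) / 2 + - (2 + s) = (2 + t) / 2 - 2); last by ring.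
    by apply: ler_wpM2r; [exact: jw_ge0|apply: jw_le; clear -ts; lra].
  rewrite exprMn; apply: ler_wpM2l; first exact: sqr_ge0.
  (* The exponents [- (2 * t)] and [t - 2] are negative and add up to [- (2 + t)], so the mixed term
     splits into two integrable weights. *)
  have h3 : jw (- (2 * t)) x * jw (t - 2) eta <= jw (- (2 + t)) x + jw (- (2 + t)) eta.
    have := @jw_mul_le _ (- (2 * t)) (t - 2) x eta; rewrite (_ : - (2 * t) + (t - 2) = - (2 + t)); last by ring.
    by apply; lra.
  have e1 : jw (- ((2 + t) / 2)) eta ^+ 2 = jw (- (2 + t)) eta by rewrite jw_sqr; congr jw; field.
  have e2 : (jw (- t) x * jw ((2 + t) / 2 - 2) eta) ^+ 2 = jw (- (2 * t)) x * jw (t - 2) eta.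
    by rewrite exprMn !jw_sqr; congr (jw _ _ * jw _ _); field.
  apply: le_trans (sqrD_le _ _) _; rewrite e1 e2.
  have -> : 4 * jw (- (2 + t)) eta = 2 * jw (- (2 + t)) eta + 2 * jw (- (2 + t)) eta.
    by rewrite -mulrDl -natrD.
  have := ler_wpM2l (ler0n R 2) h3; rewrite mulrDr [leRHS]addrC => h4.
  by rewrite -[leRHS]addrA; exact: lerD (lexx _) h4.
have mj : measurable_fun [set: R2] (fun eta => (jw (- (2 + t)) eta)%:E) by apply/measurable_EFinP; exact: measurable_jw.
have mjx : measurable_fun [set: R2] (fun eta => (jw (- (2 + t)) (tshift xi eta))%:E).
  exact: measurableT_comp mj (measurable_tshift1 xi).
have j0 (x : R * R) : (0 <= (jw (- (2 + t)) x)%:E)%E by rewrite lee_fin jw_ge0.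
apply: (@le_trans _ _ (\int[mu2]_eta (((A * 2 `^ s) ^+ 2)%:E * (4%:E * (jw (- (2 + t)) eta)%:E + 2%:E * (jw (- (2 + t)) (tshift xi eta))%:E)))%E).
  apply: ge0_int_le.
  - by move=> x; rewrite lee_fin sqr_ge0.
  - apply: measurable_sq; apply: cmeasM; last first.
      by apply: (cmeas_comp (h := fun x : R2 => (- x.1, - x.2) : R2)) => //; case: (@mpres_opp R).
    apply: cmeas_real; apply: measurable_funM; last exact: measurable_jw.
    by apply: measurable_funM => //; exact: measurableT_comp (@measurable_jw _ _) (measurable_tshift1 xi).
  - by apply: measurable_funeM; apply: emeasurable_funD; apply: measurable_funeM.
  - by move=> x; rewrite -(EFinM 4) -(EFinM 2) -EFinD -EFinM lee_fin.
rewrite ge0_integralZl//; first last.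
- by rewrite lee_fin sqr_ge0.
- by move=> x _; rewrite adde_ge0// mule_ge0.
- by apply: emeasurable_funD; apply: measurable_funeM.
rewrite ge0_integralD//; first last.
- exact: measurable_funeM.
- by move=> x _; rewrite mule_ge0.
- exact: measurable_funeM.
- by move=> x _; rewrite mule_ge0.
rewrite !ge0_integralZl//.
rewrite (ge0_integral_mpres (f := fun x : R2 => (jw (- (2 + t)) x)%:E) (mpres_tshift xi) mj j0) jwintE//.
rewrite -(EFinM 4) -(EFinM 2) -EFinD -EFinM lee_fin; apply: ler_wpM2l; first exact: sqr_ge0.
by rewrite -mulrDl -natrD.
Qed.

(** Tonelli's theorem and translation invariance factor the double integral: Young's inequality for
    two nonnegative [L1] functions, with equality. *)
Lemma sq_convolution t g : 0 < t -> isL2 mu2 g ->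
  (\int[mu2]_xi sq mu2 (fun eta => g (tshift xi eta) * (jw (- ((2 + t) / 2)) eta)%:C)%R = (jwint t * n2 mu2 g ^+ 2)%:E)%E.
Proof.
move=> t0 g2.
have E xi : sq mu2 (fun eta => g (tshift xi eta) * (jw (- ((2 + t) / 2)) eta)%:C) =
    (\int[mu2]_eta ((jw (- (2 + t)) eta)%:E * (normc (g (tshift xi eta)) ^+ 2)%:E))%E.
  apply: eq_integral => eta _; rewrite -EFinM normcM exprMn normc_real ger0_norm ?jw_ge0// jw_sqr mulrC.
  by congr (jw _ _ * _)%:E; field.
under eq_integral do rewrite E.
have mj : measurable_fun [set: R2] (fun eta => (jw (- (2 + t)) eta)%:E) by apply/measurable_EFinP; exact: measurable_jw.
have j0 (x : R * R) : (0 <= (jw (- (2 + t)) x)%:E)%E by rewrite lee_fin jw_ge0.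
have q0 (x : R * R) : (0 <= (normc (g x) ^+ 2)%:E)%E by rewrite lee_fin sqr_ge0.
have mF : measurable_fun [set: R2 * R2] (fun p : R2 * R2 => ((jw (- (2 + t)) p.2)%:E * (normc (g (tshift p.1 p.2)) ^+ 2)%:E)%E).
  apply: emeasurable_funM; first exact: measurableT_comp mj measurable_snd.
  exact: measurableT_comp (measurable_sq g2.1) measurable_tshift.
rewrite (@fubini_tonelli _ _ _ _ _ mu2 mu2 _ mF) /=; last by move=> p; rewrite mule_ge0.
have E2 eta : (\int[mu2]_xi ((jw (- (2 + t)) eta)%:E * (normc (g (tshift xi eta)) ^+ 2)%:E) = (n2 mu2 g ^+ 2)%:E * (jw (- (2 + t)) eta)%:E)%E.
  rewrite ge0_integralZl//; last first.
    apply: (measurableT_comp (measurable_sq g2.1)).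
    by have := measurable_tshift1 eta; congr measurable_fun; apply/funext => x; rewrite tshiftC.
  rewrite muleC -(sqE g2) -(sq_mpres (mpres_tshift eta) g2.1); congr (_ * _)%E.
  by apply: eq_integral => x _; rewrite tshiftC.
under eq_integral do rewrite E2.
by rewrite ge0_integralZl// ?lee_fin ?sqr_ge0// jwintE// -EFinM mulrC.
Qed.

(** The 3 dominates the square root of the 6 in [sq_convolution_weight], and [Num.min s 1] is the
    exponent [t] of that lemma. *)
Definition prodC (s : R) : R := ftc * (3 * 2 `^ s * jwint (Num.min s 1)).

Lemma prodC_ge0 s : 0 <= prodC s.
Proof. by rewrite /prodC !mulr_ge0 ?jwint_ge0 ?powR_ge0 ?(ltW ftc_gt0). Qed.

(** Cauchy-Schwarz is applied at each [xi] separately: the factor containing [vh] is bounded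
    uniformly in [xi], and the factor containing [hh] integrates in [xi] to a convolution. *)
Theorem product_bound s A v vh h hh : 0 < s -> is_fourier2 v vh ->
  (forall eta, normc (vh eta) <= A * jw (- (2 + s)) eta) ->
  is_fourier2 h hh -> isL2 mu2 (wt s hh) ->
  [/\ is_fourier2 (fun x => v x * h x) (fourier1 (fun x => v x * h x)),
      isL2 mu2 (wt s (fourier1 (fun x => v x * h x))) &
      n2 mu2 (wt s (fourier1 (fun x => v x * h x))) <= prodC s * A * n2 mu2 (wt s hh)].
Proof.
move=> s0 hv vA hh' w2; have [v2 vh2] := fourier2_isL2 hv; have [h2 hh2] := fourier2_isL2 hh'.
have A0 : 0 <= A by have := le_trans (normc_ge0 _) (vA 0); rewrite pmulr_lge0 ?jw_gt0.
have Iv := jw_decay_integrable s0 vh2.1 vA.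
have Ivh : cintable mu2 (fun x => v x * h x) := cintable_mul v2 h2.
have [w vw [mw [M wM]]] := fourier2_bounded hv Iv.
have vh2' : isL2 mu2 (fun x => v x * h x).
  apply: (isL2_ae _ _ (isL2M mw wM h2)); first exact: cmeasM v2.1 h2.1.
  by apply: ae_imp vw => x e _; rewrite (e I).
have IF := fourier2_L1 Ivh vh2'.
set t := Num.min s 1.
have t0 : 0 < t by rewrite lt_min s0 ltr01.
have ts : t <= s by rewrite ge_min lexx.
have t1 : t <= 1 by rewrite ge_min lexx orbT.
set K := (A * 2 `^ s) ^+ 2 * (6 * jwint t).
have K0 : 0 <= K by rewrite mulr_ge0 ?sqr_ge0// mulr_ge0 ?jwint_ge0.
pose u xi eta := wt s hh (tshift xi eta) * (jw (- ((2 + t) / 2)) eta)%:C.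
pose w' xi (eta : R * R) := (jw s xi * jw (- s) (tshift xi eta) * jw ((2 + t) / 2) eta)%:C * vh (- eta.1, - eta.2).
have u2 xi : isL2 mu2 (u xi).
  rewrite /u (_ : (fun eta => _) = fun eta => (jw (- ((2 + t) / 2)) eta)%:C * wt s hh (tshift xi eta)); last first.
    by apply/funext => eta; rewrite mulrC.
  apply: (isL2M (M := 1) (cmeas_jw _)); last exact: isL2_mpres (mpres_tshift xi) w2.
  by move=> x; rewrite normc_real ger0_norm ?jw_ge0// jw_le1// oppr_le0 divr_ge0// addr_ge0// ltW.
have w'2 xi : isL2 mu2 (w' xi).
  split; last by apply: le_lt_trans (sq_convolution_weight xi (ltW s0) t0 ts t1 vh2.1 vA) (ltry _).
  apply: cmeasM; last first.
    by apply: (cmeas_comp (h := fun x : R2 => (- x.1, - x.2) : R2)) vh2.1; case: (@mpres_opp R).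
  apply: cmeas_real; apply: measurable_funM; last exact: measurable_jw.
  by apply: measurable_funM => //; exact: measurableT_comp (@measurable_jw _ _) (measurable_tshift1 xi).
(* [v] is written as the conjugate of its conjugate to fit [fourier1_product]; the transform of
   [conjc v] accounts for the reflected argument of [vh]. *)
have FE xi : wt s (fourier1 (fun x => v x * h x)) xi = ftc%:C * cint mu2 (fun eta => u xi eta * w' xi eta).
  have -> : fourier1 (fun x => v x * h x) = fourier1 (fun x => h x * conjc (conjc (v x))).
    by congr fourier1; apply/funext => x; rewrite conjcK mulrC.
  rewrite /wt (fourier1_product xi hh' (fourier2_conj hv)) mulrCA; congr (_ * _).
  rewrite -cintZ; last first.
    apply: cintable_mul; first exact: isL2_mpres (mpres_tshift xi) hh2.
    exact: isL2_conj (isL2_conj (isL2_mpres (@mpres_opp R) vh2)).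
  apply: cint_eq => eta; rewrite conjcK /u /w' /wt !rcM.
  have e1 := congr1 (real_complex R) (jwNl s (tshift xi eta)); have e2 := congr1 (real_complex R) (jwNl ((2 + t) / 2) eta).
  rewrite !rcM rmorph1 in e1 e2.
  by symmetry; exact: cancel_weights'.
have mW : cmeas (wt s (fourier1 (fun x => v x * h x)) : R2 -> C) by apply: cmeas_wt; exact: cmeas_fourier1 Ivh.1.
set F := wt s _ in mW *; have sqle : (sq mu2 F <= ((prodC s * A * n2 mu2 (wt s hh)) ^+ 2)%:E)%E.
  apply: (@le_trans _ _ (\int[mu2]_xi ((ftc ^+ 2 * K)%:E * sq mu2 (u xi)))%E).
    apply: ge0_int_le.
    - by move=> xi; rewrite lee_fin sqr_ge0.
    - exact: measurable_sq.
    - apply: measurable_funeM.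
      have mF : measurable_fun [set: R2 * R2] (fun p : R2 * R2 => (normc (u p.1 p.2) ^+ 2)%:E).
        apply: (@measurable_sq _ _ _ (fun p : R2 * R2 => u p.1 p.2)); apply: cmeasM.
          exact: (cmeas_comp measurable_tshift w2.1).
        exact: (cmeas_comp measurable_snd (cmeas_jw _)).
      by have := @measurable_fun_fubini_tonelli_F _ _ _ _ _ mu2 _ mF; apply => p; rewrite lee_fin sqr_ge0.
    - move=> xi; rewrite /F FE normcM normc_real gtr0_norm ?ftc_gt0// (sqE (u2 xi)) -EFinM lee_fin exprMn -[leRHS]mulrA.
      apply: ler_wpM2l; first exact: sqr_ge0.
      apply: (@le_trans _ _ ((n2 mu2 (u xi) * n2 mu2 (w' xi)) ^+ 2)).
        by rewrite ler_sqr ?nnegrE ?normc_ge0 ?mulr_ge0 ?n2_ge0//; exact: cauchy_schwarz.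
      rewrite exprMn mulrC; apply: ler_wpM2r; first exact: sqr_ge0.
      have := sq_convolution_weight xi (ltW s0) t0 ts t1 vh2.1 vA.
      by rewrite (sqE (w'2 xi)) lee_fin.
  rewrite ge0_integralZl//; first last.
  - by rewrite lee_fin mulr_ge0// sqr_ge0.
  - by move=> xi _; exact: sq_ge0.
  - have mF : measurable_fun [set: R2 * R2] (fun p : R2 * R2 => (normc (u p.1 p.2) ^+ 2)%:E).
      apply: (@measurable_sq _ _ _ (fun p : R2 * R2 => u p.1 p.2)); apply: cmeasM.
        exact: (cmeas_comp measurable_tshift w2.1).
      exact: (cmeas_comp measurable_snd (cmeas_jw _)).
    by have := @measurable_fun_fubini_tonelli_F _ _ _ _ _ mu2 _ mF; apply => p; rewrite lee_fin sqr_ge0.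
  rewrite sq_convolution// -EFinM lee_fin /prodC -/t /K.
  rewrite [leLHS](_ : _ = 6 * (ftc * A * 2 `^ s * jwint t * n2 mu2 (wt s hh)) ^+ 2); last by ring.
  rewrite [leRHS](_ : _ = 9 * (ftc * A * 2 `^ s * jwint t * n2 mu2 (wt s hh)) ^+ 2); last by ring.
  by apply: ler_wpM2r; [exact: sqr_ge0|lra].
split => //; first by split => //; apply: le_lt_trans sqle (ltry _).
by apply: n2_le sqle; apply: mulr_ge0; [apply: mulr_ge0 => //; exact: prodC_ge0|exact: n2_ge0].
Qed.

End Products.

(** * Scalar Sobolev spaces and the resolvent *)

Section ScalarSobolev.
Context {R : realType}.
Local Notation mR := (measurableTypeR R).
Local Notation R2 := (mR * mR)%type.
Local Notation C := R[i].
Local Notation "x %:C" := (real_complex R x).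
Implicit Types (f g h v fh gh hh vh q : R * R -> C) (s A b : R).

Definition hs s f := isL2 mu2 f /\ isL2 mu2 (wt s (fourier2 f)).
Definition hn s f : R := n2 mu2 (wt s (fourier2 f)).

Lemma hn_ge0 s f : 0 <= hn s f.
Proof. exact: n2_ge0. Qed.

Lemma wt_ae s f g : f = g %[ae mu2] -> wt s f = wt s g %[ae mu2].
Proof. by apply: ae_imp => x h /h e; rewrite /wt e. Qed.

(** Frees the Sobolev norm from the representative chosen by [fourier2]. *)
Lemma fourier2_wt s f fh : is_fourier2 f fh -> (hs s f <-> isL2 mu2 (wt s fh)) /\ hn s f = n2 mu2 (wt s fh).
Proof.
move=> hf; have [f2 fh2] := fourier2_isL2 hf.
have hf' := fourier2_spec f2; have [_ fh2'] := fourier2_isL2 hf'.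
have e := wt_ae s (fourier2_uniq hf hf').
have m1 := cmeas_wt s fh2.1; have m2 := cmeas_wt s fh2'.1.
split; last by symmetry; exact: n2_ae.
split=> [[_ w2]|w2]; last by split => //; exact: isL2_ae w2.
by apply: isL2_ae w2 => //; apply: ae_imp e => x h /h ->.
Qed.

Lemma hsP s f fh : is_fourier2 f fh -> isL2 mu2 (wt s fh) -> hs s f.
Proof. by move=> hf; case: (fourier2_wt s hf) => -[]. Qed.

Lemma hnE s f fh : is_fourier2 f fh -> hn s f = n2 mu2 (wt s fh).
Proof. by move=> hf; case: (fourier2_wt s hf). Qed.

Lemma hs_fourier s f : hs s f -> is_fourier2 f (fourier2 f).
Proof. by move=> [f2 _]; exact: fourier2_spec. Qed.

Lemma wt_lin s c f g x : wt s (fun x => c * f x + g x) x = c * wt s f x + wt s g x.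
Proof. by rewrite /wt mulrDr mulrCA. Qed.

Lemma hs_lin s c f g : hs s f -> hs s g -> hs s (fun x => c * f x + g x).
Proof.
move=> hf hg; apply: (hsP (fourier2_lin c (hs_fourier hf) (hs_fourier hg))).
rewrite (_ : wt s _ = fun x => c * wt s (fourier2 f) x + wt s (fourier2 g) x); last by apply/funext => x; exact: wt_lin.
by apply: isL2D; [exact: isL2Z hf.2|exact: hg.2].
Qed.

Lemma hn_lin s c f g : hs s f -> hs s g -> hn s (fun x => c * f x + g x) =
  n2 mu2 (fun x => c * wt s (fourier2 f) x + wt s (fourier2 g) x).
Proof.
move=> hf hg; rewrite (hnE s (fourier2_lin c (hs_fourier hf) (hs_fourier hg))).
by congr n2; apply/funext => x; exact: wt_lin.
Qed.

Lemma hnD s f g : hs s f -> hs s g -> hn s (fun x => f x + g x) <= hn s f + hn s g.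
Proof.
move=> hf hg; rewrite (_ : (fun x => f x + g x) = (fun x => 1 * f x + g x)); last by apply/funext => x; rewrite mul1r.
rewrite hn_lin//; apply: le_trans (n2D (isL2Z _ hf.2) hg.2) _.
by rewrite n2Z ?normc1 ?mul1r//; exact: hf.2.
Qed.

Lemma hs0 s : hs s (fun=> 0).
Proof.
have h : @is_fourier2 R (fun=> 0) (fun=> 0).
  have [k hk] := @fourier2_exists R _ (@isL20 _ _ _ mu2).
  have := fourier2_lin (-1) hk hk.
  by congr is_fourier2; apply/funext => x; ring.
by apply: (hsP h); rewrite (_ : wt s _ = fun=> 0); [exact: isL20|apply/funext => x; rewrite /wt mulr0].
Qed.

Lemma hsZ s c f : hs s f -> hs s (fun x => c * f x).
Proof.
move=> hf; rewrite (_ : (fun x => _) = fun x => c * f x + 0); last by apply/funext => x; rewrite addr0.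
exact: hs_lin (hs0 s).
Qed.

Lemma hsB s f g : hs s f -> hs s g -> hs s (fun x => f x - g x).
Proof.
move=> hf hg; rewrite (_ : (fun x => _) = fun x => -1 * g x + f x); last by apply/funext => x; rewrite mulN1r addrC.
exact: hs_lin.
Qed.

Lemma hsD s f g : hs s f -> hs s g -> hs s (fun x => f x + g x).
Proof.
move=> hf hg; rewrite (_ : (fun x => _) = fun x => 1 * f x + g x); last by apply/funext => x; rewrite mul1r.
exact: hs_lin.
Qed.

Lemma hnB s f g : hs s f -> hs s g -> hn s (fun x => f x - g x) =
  n2 mu2 (fun x => wt s (fourier2 f) x - wt s (fourier2 g) x).
Proof.
move=> hf hg; rewrite (_ : (fun x => f x - g x) = fun x => -1 * g x + f x); last by apply/funext => x; rewrite mulN1r addrC.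
by rewrite hn_lin//; congr n2; apply/funext => x; rewrite mulN1r addrC.
Qed.

Lemma hnZ s c f : hs s f -> hn s (fun x => c * f x) = normc c * hn s f.
Proof.
move=> hf; rewrite (hnE s (_ : is_fourier2 _ (fun x => c * fourier2 f x))); last first.
  have h0 := hs_fourier (hs0 s).
  have := fourier2_lin c (hs_fourier hf) (fourier2_lin (-1) h0 h0).
  by congr is_fourier2; apply/funext => x; ring.
rewrite -(n2Z c hf.2); congr n2; apply/funext => x; by rewrite /wt mulrCA.
Qed.

Lemma hs_ae s f g : cmeas (g : R2 -> C) -> f = g %[ae mu2] -> hs s f -> hs s g /\ hn s g = hn s f.
Proof.
move=> mg fg hf; have hf' := hs_fourier hf; have [_ fh2] := fourier2_isL2 hf'.
have h : is_fourier2 g (fourier2 f) by apply: (fourier2_ae hf') => //; [exact: fh2.1|exact: ae_all].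
by split; [exact: (hsP h hf.2)|rewrite (hnE s h)].
Qed.

Lemma n2_le_hn s f : 0 <= s -> hs s f -> n2 mu2 f <= hn s f.
Proof.
move=> s0 hf; rewrite -(fourier2_n2 (hs_fourier hf)); apply: n2_le_norm; [|exact: hf.2|].
  exact: (fourier2_isL2 (hs_fourier hf)).2.1.
by move=> x; rewrite normc_wt ler_peMl ?normc_ge0// jw_ge1.
Qed.

(** The weighted transforms converge in [L2]. Dividing their limit by the weight keeps it in [L2]
    because [s] is nonnegative, and surjectivity of the transform brings it back. *)
Lemma hs_complete s (f : nat -> R * R -> C) : 0 <= s -> (forall n, hs s (f n)) ->
  (forall eps : R, 0 < eps -> exists N, forall m n, (N <= m)%N -> (N <= n)%N ->
     hn s (fun x => f m x - f n x) <= eps) ->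
  exists2 l, hs s l & hn s (fun x => f n x - l x) @[n --> \oo] --> (0 : R).
Proof.
move=> s0 hf cf.
have [|g g2 gc] := L2_complete (fun n => (hf n).2).
  move=> e e0; have [N NP] := cf e e0; exists N => m n Nm Nn.
  by rewrite -hnB//; exact: NP.
have g2' : isL2 mu2 (wt (- s) g).
  apply: (isL2M (M := 1) (cmeas_jw _)) g2 => x.
  by rewrite normc_real ger0_norm ?jw_ge0// jw_le1// oppr_le0.
have [l hl] := fourier2_surj g2'.
have wg : wt s (wt (- s) g) = g.
  by apply/funext => x; rewrite /wt mulrA -rcM mulrC -mulrC [jw s x * _]mulrC jwNl rmorph1 mul1r.
have Hl : hs s l by apply: (hsP hl); rewrite wg.
exists l => //; apply: cvgn_eq gc => n.
rewrite (hnB (hf n) Hl); apply: n2_ae.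
- exact: cmeasB (hf n).2.1 g2.1.
- exact: cmeasB (hf n).2.1 Hl.2.1.
- have := wt_ae s (fourier2_uniq hl (hs_fourier Hl)); rewrite wg.
  by apply: ae_imp => x h /h ->.
Qed.

Definition rsym (b : R) (xi : R * R) : R := (b + (xi.1 ^+ 2 + xi.2 ^+ 2))^-1.

Lemma rsym_bound b xi : 0 < b -> 0 <= rsym b xi <= (1 + b^-1) * jw (- 2) xi.
Proof.
move=> b0; have q0 : 0 <= xi.1 ^+ 2 + xi.2 ^+ 2 by rewrite addr_ge0 ?sqr_ge0.
have B0 : 0 < b + (xi.1 ^+ 2 + xi.2 ^+ 2) by rewrite ltr_wpDr.
rewrite /rsym invr_ge0 (ltW B0) /= /jw powRN powR_mulrn ?(ltW (jbracket_gt0 xi))// jbracket_sqr -addrA.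
rewrite ler_pdivlMr ?ltr_wpDr// mulrC ler_pdivrMr//.
have : 0 < b^-1 by rewrite invr_gt0.
have : b^-1 * b = 1 by rewrite mulVf ?gt_eqF.
move: (b^-1) (_ + _) q0 => c q q0 cb c0; nra.
Qed.

Lemma measurable_rsym b : 0 < b -> measurable_fun [set: R2] (rsym b : R2 -> R).
Proof.
move=> b0; rewrite (_ : rsym b = fun x => (b + (x.1 ^+ 2 + x.2 ^+ 2)) `^ (- 1)); last first.
  by apply/funext => x; rewrite powR_inv1// addr_ge0 ?addr_ge0 ?sqr_ge0// ltW.
apply: (@measurableT_comp _ _ _ R2 mR mR (@powR R ^~ (- 1))); first exact: measurable_powR.
apply: measurable_funD => //; apply: measurable_funD; apply: measurable_funX; [exact: measurable_fst|exact: measurable_snd].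
Qed.

Lemma isL2_bounded_integrable (M : R) f : cintable mu2 f -> (forall x, normc (f x) <= M) -> isL2 mu2 f.
Proof.
move=> If fM; split; first exact: If.1.
have M0 : 0 <= M := le_trans (normc_ge0 _) (fM 0).
apply: (@le_lt_trans _ _ (\int[mu2]_x (M%:E * (normc (f x))%:E))%E).
  apply: ge0_int_le.
  - by move=> x; rewrite lee_fin sqr_ge0.
  - exact: measurable_sq If.1.
  - by apply: measurable_funeM; apply/measurable_EFinP; exact: measurable_normc If.1.
  - by move=> x; rewrite -EFinM lee_fin expr2 ler_wpM2r ?normc_ge0.
rewrite ge0_integralZl//; first last.
- by move=> x _; rewrite lee_fin normc_ge0.
- by apply/measurable_EFinP; exact: measurable_normc If.1.
have I0 : (0 <= \int[mu2]_t (normc (f t))%:E)%E by apply: integral_ge0 => t _; rewrite lee_fin normc_ge0.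
have := If.2; move: I0; case: (\int[mu2]_t _)%E => // r _ _.
by rewrite -EFinM ltry.
Qed.

(** [resolvent] is picked by [xget], so an admissible function has to be exhibited: the damped
    transform is bounded and integrable, hence in [L2], hence the transform of some function. *)
Lemma resolvent_spec b s A q : 0 < b -> 0 < s -> cintable mu2 q ->
  (forall xi, normc (fourier1 q xi) <= A * jw (- s) xi) ->
  is_fourier2 (resolvent b q) (fun xi => (rsym b xi)%:C * fourier1 q xi) /\
  forall xi, normc ((rsym b xi)%:C * fourier1 q xi) <= (1 + b^-1) * A * jw (- (2 + s)) xi.
Proof.
move=> b0 s0 Iq qA.
have bnd xi : normc ((rsym b xi)%:C * fourier1 q xi) <= (1 + b^-1) * A * jw (- (2 + s)) xi.
  have /andP[r0 rb] := rsym_bound xi b0.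
  rewrite normcM normc_real ger0_norm// opprD jwD mulrACA.
  by apply: ler_pM => //; exact: normc_ge0.
split => //.
have mF : cmeas (fun xi : R2 => (rsym b xi)%:C * fourier1 q xi).
  by apply: cmeasM; [apply: cmeas_real; exact: measurable_rsym b0|exact: cmeas_fourier1 Iq.1].
have IF := jw_decay_integrable s0 mF bnd.
have F2 : isL2 mu2 (fun xi => (rsym b xi)%:C * fourier1 q xi).
  apply: (isL2_bounded_integrable (M := (1 + b^-1) * A) IF) => xi; apply: le_trans (bnd xi) _.
  have A0 : 0 <= (1 + b^-1) * A by have := le_trans (normc_ge0 _) (bnd 0); rewrite pmulr_lge0 ?jw_gt0.
  by rewrite ler_piMr// jw_le1// oppr_le0 addr_ge0// ltW.
have [v hv] := fourier2_surj F2.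
have : Lp 2 (resolvent b q) /\ fourier2 (resolvent b q) = (fun xi => (rsym b xi)%:C * fourier1 q xi) %[ae leb2].
  apply: (@xgetPex _ (fun=> 0) [set g | Lp 2 g /\ fourier2 g = (fun xi => (rsym b xi)%:C * fourier1 q xi) %[ae leb2]]).
  exists v; have [v2 _] := fourier2_isL2 hv; split; first exact/Lp2P.
  exact: (fourier2_uniq (fourier2_spec v2) hv).
move=> [/Lp2P v2 e]; apply: (fourier2_ae (fourier2_spec v2)) => //; [exact: v2.1|exact: ae_all].
Qed.

Definition decayC (s : R) : R := ftc * (2 `^ s * 2).

Lemma decayC_ge0 s : 0 <= decayC s.
Proof. by rewrite /decayC !mulr_ge0 ?powR_ge0// ltW// ftc_gt0. Qed.

Lemma hs_product_decay s f g xi : 0 <= s -> hs s f -> hs s g ->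
  cintable mu2 (fun x => f x * conjc (g x)) /\
  normc (fourier1 (fun x => f x * conjc (g x)) xi) <= decayC s * (hn s f * hn s g) * jw (- s) xi.
Proof.
move=> s0 hf hg; split; first exact: cintable_mul hf.1 (isL2_conj hg.1).
exact: fourier1_product_decay s0 (hs_fourier hf) (hs_fourier hg) hf.2 hg.2.
Qed.

Lemma hs_product s A v vh h : 0 < s -> is_fourier2 v vh ->
  (forall eta, normc (vh eta) <= A * jw (- (2 + s)) eta) -> hs s h ->
  hs s (fun x => v x * h x) /\ hn s (fun x => v x * h x) <= prodC s * A * hn s h.
Proof.
move=> s0 hv vA hh; have [h1 h2 h3] := product_bound s0 hv vA (hs_fourier hh) hh.2.
by split; [exact: hsP h1 h2|rewrite (hnE s h1)].
Qed.

End ScalarSobolev.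

(** * Spinors *)

Section PairNorm.
Context {R : realType}.
Implicit Types a b : 'I_2 -> R.

Definition vnorm a : R := Num.sqrt (\sum_(k < 2) a k ^+ 2).

Lemma sum2E (V : nmodType) (F : 'I_2 -> V) : \sum_(k < 2) F k = F ord0 + F (lift ord0 ord0).
Proof. by rewrite !big_ord_recl big_ord0 addr0. Qed.

Lemma I2P (i : 'I_2) : i = ord0 \/ i = lift ord0 ord0.
Proof. by case: i => [[|[|m]] im] //; [left|right]; exact/val_inj. Qed.

Lemma vnorm_ge0 a : 0 <= vnorm a.
Proof. exact: sqrtr_ge0. Qed.

Lemma vnorm_sqr a : vnorm a ^+ 2 = \sum_(k < 2) a k ^+ 2.
Proof. by rewrite sqr_sqrtr// sumr_ge0// => k _; exact: sqr_ge0. Qed.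

Lemma vnorm_ext a b : a =1 b -> vnorm a = vnorm b.
Proof. by move=> /funext ->. Qed.

Lemma vnorm_mono a b : (forall k, 0 <= a k <= b k) -> vnorm a <= vnorm b.
Proof.
move=> ab; rewrite ler_wsqrtr// ler_sum// => k _; have /andP[a0 h] := ab k.
by rewrite ler_sqr// nnegrE// (le_trans a0).
Qed.

Lemma le_vnorm a k : a k <= vnorm a.
Proof.
apply: le_trans (ler_norm _) _; rewrite -sqrtr_sqr ler_wsqrtr// (bigD1 k)//= lerDl.
by rewrite sumr_ge0// => i _; exact: sqr_ge0.
Qed.

Lemma vnorm_le_sum a : (forall k, 0 <= a k) -> vnorm a <= \sum_(k < 2) a k.
Proof.
move=> a0; rewrite -(@ler_sqr _ (vnorm a)) ?nnegrE ?vnorm_ge0 ?sumr_ge0//.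
rewrite vnorm_sqr !sum2E; have := a0 ord0; have := a0 (lift ord0 ord0); nra.
Qed.

Lemma vnormD a b : vnorm (fun k => a k + b k) <= vnorm a + vnorm b.
Proof.
have A0 := vnorm_ge0 a; have B0 := vnorm_ge0 b.
rewrite -(@ler_sqr _ (vnorm (fun k => a k + b k))) ?nnegrE ?vnorm_ge0 ?addr_ge0//.
have A := vnorm_sqr a; have B := vnorm_sqr b; have D := vnorm_sqr (fun k => a k + b k).
rewrite !sum2E in A B D; rewrite D.
have key : a ord0 * b ord0 + a (lift ord0 ord0) * b (lift ord0 ord0) <= vnorm a * vnorm b.
  apply: le_trans (ler_norm _) _; rewrite -(@ler_sqr _ `|_|) ?nnegrE ?mulr_ge0//.
  rewrite real_normK ?num_real// exprMn A B.
  have := sqr_ge0 (a ord0 * b (lift ord0 ord0) - a (lift ord0 ord0) * b ord0).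
  by move: (a _) (a _) (b _) (b _) => x y z t; nra.
rewrite [leRHS]sqrrD A B; move: key.
by move: (a _) (a _) (b _) (b _) (vnorm a * _) => x y z t p; nra.
Qed.

Lemma vnormZ c a : 0 <= c -> vnorm (fun k => c * a k) = c * vnorm a.
Proof.
move=> c0; apply/eqP; rewrite -(@eqrXn2 _ 2) ?mulr_ge0 ?vnorm_ge0//.
by rewrite exprMn !vnorm_sqr mulr_sumr; apply/eqP/eq_bigr => k _; rewrite exprMn.
Qed.

Lemma vnorm_eq0 a : vnorm a = 0 -> forall k, a k = 0.
Proof.
move=> h k; apply/eqP; rewrite -sqrf_eq0.
have := vnorm_sqr a; rewrite h expr0n /= => /esym/eqP.
by rewrite psumr_eq0 => [/allP/(_ k)/=|i _]; [rewrite mem_index_enum => /(_ isT)|exact: sqr_ge0].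
Qed.

Lemma cvg_vnorm (T : Type) (F : set_system T) (FF : Filter F) (a : T -> 'I_2 -> R) :
  (forall k, a x k @[x --> F] --> (0 : R)) -> (forall x k, 0 <= a x k) -> vnorm (a x) @[x --> F] --> (0 : R).
Proof.
move=> h a0; apply: (@squeeze_cvgr _ _ _ _ (fun=> 0) (fun x => \sum_(k < 2) a x k)).
- by apply: nearW => x; rewrite vnorm_ge0 vnorm_le_sum.
- exact: cvg_cst.
- under eq_fun do rewrite sum2E.
  by have := @cvgD _ _ _ _ FF _ _ _ _ (h ord0) (h (lift ord0 ord0)); rewrite addr0.
Qed.

End PairNorm.

Lemma cross_terms_factor (K : comPzRingType) (d x y z j : K) :
  d * (2 * (x * z)) * j + d * (2 * (z * y)) * j = d * (2 * ((x + y) * z)) * j.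
Proof. ring. Qed.

(** The arithmetic of the Lipschitz estimate, with [x], [y], [z] the norms of two spinors and of
    their difference. It rests on [2 (x + y) x + 2 y^2 <= 4 (x + y)^2]. *)
Lemma cubic_bound (K : realDomainType) (P B D x y z u v : K) :
  0 <= P -> 0 <= B -> 0 <= D -> 0 <= x -> 0 <= y -> 0 <= z -> u <= x -> v <= z ->
  P * (B * (D * (2 * ((x + y) * z)))) * u + P * (B * (D * (2 * (y * y)))) * v <=
  P * (B * (D * 4)) * (x + y) ^+ 2 * z.
Proof.
move=> P0 B0 D0 x0 y0 z0 ux vz; have K0 : 0 <= P * (B * D) by rewrite !mulr_ge0.
have le1 : P * (B * (D * (2 * ((x + y) * z)))) * u <= P * (B * D) * (2 * (x + y) * x * z).
  rewrite [leLHS](_ : _ = P * (B * D) * (2 * (x + y) * z * u)); last by ring.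
  apply: ler_wpM2l => //; rewrite -[leRHS]mulrA [x * z]mulrC [leRHS]mulrA.
  by apply: ler_wpM2l => //; rewrite !mulr_ge0 ?addr_ge0.
have le2 : P * (B * (D * (2 * (y * y)))) * v <= P * (B * D) * (2 * (y * y) * z).
  rewrite [leLHS](_ : _ = P * (B * D) * (2 * (y * y) * v)); last by ring.
  by apply: ler_wpM2l => //; apply: ler_wpM2l => //; rewrite !mulr_ge0.
apply: le_trans (lerD le1 le2) _; rewrite -mulrDr.
rewrite [leRHS](_ : _ = P * (B * D) * (4 * (x + y) ^+ 2 * z)); last by ring.
apply: ler_wpM2l => //; rewrite -mulrDl; apply: ler_wpM2r => //.
by have := mulr_ge0 x0 y0; have := sqr_ge0 x; have := sqr_ge0 y; nra.
Qed.

Section Spinors.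
Context {R : realType}.
Local Notation mR := (measurableTypeR R).
Local Notation R2 := (mR * mR)%type.
Local Notation C := R[i].
Local Notation "x %:C" := (real_complex R x).
Local Notation spinor := (@spinor R).
Implicit Types (psi phi chi : spinor) (s b : R) (k : 'I_2).

Lemma componentP a psi phi k :
  component (a *: psi + phi) k = fun x => a * component psi k x + component phi k x.
Proof. by apply/funext => x; rewrite /component /= !mxE. Qed.

Lemma componentD psi phi k : component (psi + phi) k = fun x => component psi k x + component phi k x.
Proof. by apply/funext => x; rewrite /component /= !mxE. Qed.

Lemma componentB psi phi k : component (psi - phi) k = fun x => component psi k x - component phi k x.
Proof. by apply/funext => x; rewrite /component /= !mxE. Qed.

Lemma componentZ a psi k : component (a *: psi) k = fun x => a * component psi k x.
Proof. by apply/funext => x; rewrite /component /= !mxE. Qed.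

Lemma component0 k : component (0 : spinor) k = fun=> 0.
Proof. by apply/funext => x; rewrite /component /= !mxE. Qed.

Lemma spinor_ae psi phi : (forall k, component psi k = component phi k %[ae mu2]) -> psi = phi %[ae mu2].
Proof.
move=> h; apply: (ae_imp2 _ (h ord0) (h (lift ord0 ord0))) => x h0 h1 _.
apply/matrixP => i j; rewrite !ord1.
by have [->|->] := I2P i; [exact: h0|exact: h1].
Qed.

Lemma component_ae psi phi k : psi = phi %[ae mu2] -> component psi k = component phi k %[ae mu2].
Proof. by apply: ae_imp => x h /h e; rewrite /component e. Qed.

Definition sL2 psi := forall k, isL2 mu2 (component psi k).
Definition sn psi : R := vnorm (fun k => n2 mu2 (component psi k)).

Lemma L2P psi : L2 psi <-> sL2 psi.
Proof. by split=> h k; have := h k => /Lp2P. Qed.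

Lemma L2norm_sn psi : sL2 psi -> L2norm psi = (sn psi)%:E.
Proof.
move=> h; have d0 x : 0 <= density psi x by apply: sumr_ge0 => k _; exact: sqr_ge0.
have E x : normc (Num.sqrt (density psi x))%:C = Num.sqrt (density psi x).
  by rewrite normc_real ger0_norm// sqrtr_ge0.
have md : measurable_fun [set: R2] (density psi : R2 -> R).
  by apply: measurable_sum => k; apply: measurable_normc2; exact: (h k).1.
have sqd : sq mu2 (fun x => (Num.sqrt (density psi x))%:C) = (sn psi ^+ 2)%:E.
  rewrite /sn vnorm_sqr /sq.
  under eq_integral do rewrite E sqr_sqrtr// /density -sumEFin.
  rewrite (ge0_integral_sum mu2)//; first last.
  - by move=> k x _; rewrite lee_fin sqr_ge0.
  - by move=> k; apply: measurable_sq; exact: (h k).1.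
  by rewrite -sumEFin; apply: eq_bigr => k _; rewrite -(sqE (h k)).
have f2 : isL2 mu2 (fun x => (Num.sqrt (density psi x))%:C).
  split; last by rewrite sqd ltry.
  apply: cmeas_real; apply: (@measurableT_comp _ _ _ R2 mR mR (@Num.sqrt R)) => //.
  exact: continuous_measurable_fun (@sqrt_continuous R).
have := Lnorm2_n2 f2; rewrite /L2norm; under [in X in X -> _]eq_fun do rewrite E.
move=> ->; congr (_%:E); apply/eqP; rewrite -(@eqrXn2 _ 2) ?n2_ge0 ?vnorm_ge0//.
by rewrite -eqe -sqd (sqE f2).
Qed.

Lemma component_Hweight s psi k : component (Hweight s psi) k = wt s (fourier2 (component psi k)).
Proof. by apply/funext => x; rewrite /component /Hweight /fourier /wt /= !mxE. Qed.

Definition shn s psi : R := vnorm (fun k => hn s (component psi k)).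

Lemma HsP s psi : Hs s psi <-> forall k, hs s (component psi k).
Proof.
split=> [[/L2P h1 /L2P h2] k|h]; first by split; [exact: h1|rewrite -component_Hweight; exact: h2].
split; apply/L2P => k; first by case: (h k).
by rewrite component_Hweight; case: (h k).
Qed.

Lemma Hnorm_shn s psi : Hs s psi -> Hnorm s psi = (shn s psi)%:E.
Proof.
move=> [_ /L2P h]; rewrite /Hnorm (L2norm_sn h); congr (vnorm _)%:E.
by apply/funext => k; rewrite component_Hweight.
Qed.

Lemma shn_ge0 s psi : 0 <= shn s psi.
Proof. exact: vnorm_ge0. Qed.

Lemma hn_le_shn s psi k : hn s (component psi k) <= shn s psi.
Proof. exact: (le_vnorm (fun k => hn s (component psi k))). Qed.

Lemma shn_le_sum s psi : shn s psi <= \sum_(k < 2) hn s (component psi k).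
Proof. by apply: vnorm_le_sum => k; exact: hn_ge0. Qed.

Lemma Hs0 s : Hs s (0 : spinor).
Proof. by apply/HsP => k; rewrite component0; exact: hs0. Qed.

Lemma Hs_lin s a psi phi : Hs s psi -> Hs s phi -> Hs s (a *: psi + phi).
Proof. by move=> /HsP h /HsP h'; apply/HsP => k; rewrite componentP; exact: hs_lin. Qed.

Lemma HsB s psi phi : Hs s psi -> Hs s phi -> Hs s (psi - phi).
Proof. by move=> /HsP h /HsP h'; apply/HsP => k; rewrite componentB; exact: hsB. Qed.

Lemma shnD s psi phi : Hs s psi -> Hs s phi -> shn s (psi + phi) <= shn s psi + shn s phi.
Proof.
move=> /HsP h /HsP h'; apply: le_trans (vnormD _ _); apply: vnorm_mono => k.
by rewrite hn_ge0 componentD; exact: hnD.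
Qed.

Lemma shnZ s a psi : Hs s psi -> shn s (a *: psi) = normc a * shn s psi.
Proof.
move=> /HsP h; rewrite /shn -vnormZ ?normc_ge0//; congr vnorm; apply/funext => k.
by rewrite componentZ; exact: hnZ.
Qed.

Lemma Hs_ae s psi phi : L2 phi -> psi = phi %[ae mu2] -> Hs s psi -> Hs s phi /\ shn s phi = shn s psi.
Proof.
move=> /L2P l e /HsP h.
have H k := hs_ae (l k).1 (component_ae k e) (h k).
split; first by apply/HsP => k; case: (H k).
by apply: vnorm_ext => k; case: (H k).
Qed.

Lemma sn_le_shn s psi : 0 <= s -> Hs s psi -> sn psi <= shn s psi.
Proof. by move=> s0 /HsP h; apply: vnorm_mono => k; rewrite n2_ge0; exact: n2_le_hn. Qed.

Lemma sn_eq0 psi : sL2 psi -> sn psi = 0 -> psi = 0 %[ae mu2].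
Proof.
move=> h /vnorm_eq0 e; apply: spinor_ae => k; rewrite component0.
exact: n2_eq0 (h k) (e k).
Qed.

Lemma Hs_sL2 s psi : Hs s psi -> sL2 psi.
Proof. by case=> /L2P. Qed.

Lemma shn_eq0 s psi : 0 <= s -> Hs s psi -> shn s psi = 0 -> psi = 0 %[ae mu2].
Proof.
move=> s0 h e; apply: sn_eq0 (Hs_sL2 h) _; apply/eqP; rewrite eq_le vnorm_ge0 andbT.
by rewrite -e; exact: sn_le_shn.
Qed.

Lemma Hs_complete s (u : nat -> spinor) : 0 <= s -> (forall n, Hs s (u n)) ->
  (forall eps : R, 0 < eps -> exists N, forall m n, (N <= m)%N -> (N <= n)%N -> shn s (u m - u n) <= eps) ->
  exists2 l, Hs s l & shn s (u n - l) @[n --> \oo] --> (0 : R).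
Proof.
move=> s0 hu cu; have hu' n := (HsP s (u n)).1 (hu n).
have H k : exists l, hs s l /\ hn s (fun x => component (u n) k x - l x) @[n --> \oo] --> (0 : R).
  have [||l l1 l2] := @hs_complete _ s (fun n => component (u n) k) s0; [by move=> n; exact: hu'| |by exists l].
  move=> e e0; have [N NP] := cu e e0; exists N => m n Nm Nn.
  apply: le_trans (NP m n Nm Nn); rewrite -componentB; exact: (le_vnorm (fun k => hn s (component (u m - u n) k))).
have [l lP] := choice H.
pose L : spinor := fun x => \col_k l k x.
have EL k : component L k = l k by apply/funext => x; rewrite /component /L mxE.
exists L; first by apply/HsP => k; rewrite EL; case: (lP k).
apply: (@cvg_vnorm _ _ _ eventually_filter (fun n k => hn s (component (u n - L) k))); last by move=> *; exact: hn_ge0.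
by move=> k; have [_] := lP k; apply: cvgn_eq => n; rewrite componentB EL.
Qed.

Opaque hn shn prodC decayC.

Lemma density_sum psi x : (density psi x)%:C = \sum_(k < 2) component psi k x * conjc (component psi k x).
Proof. by rewrite /density sum2E rmorphD sum2E !mul_conjc. Qed.

Lemma cintable_density s psi : Hs s psi -> cintable mu2 (fun x => (density psi x)%:C).
Proof.
move=> /HsP h; under eq_fun do rewrite density_sum sum2E.
by apply: cintableD; apply: cintable_mul; [exact: (h _).1|exact: isL2_conj (h _).1|exact: (h _).1|exact: isL2_conj (h _).1].
Qed.

(** The sesquilinear form with the density on its diagonal, through which differences of densities
    are expressed. *)
Definition cross psi phi (x : R * R) : C := \sum_(k < 2) component psi k x * conjc (component phi k x).

Lemma cross_decay s psi phi xi : 0 <= s -> Hs s psi -> Hs s phi ->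
  cintable mu2 (cross psi phi) /\
  normc (fourier1 (cross psi phi) xi) <= decayC s * (2 * (shn s psi * shn s phi)) * jw (- s) xi.
Proof.
move=> s0 /HsP h /HsP h'.
have [I0 b0] := hs_product_decay xi s0 (h ord0) (h' ord0).
have [I1 b1] := hs_product_decay xi s0 (h (lift ord0 ord0)) (h' (lift ord0 ord0)).
have E : cross psi phi = fun x => 1 * (component psi ord0 x * conjc (component phi ord0 x)) +
   component psi (lift ord0 ord0) x * conjc (component phi (lift ord0 ord0) x).
  by apply/funext => x; rewrite /cross sum2E mul1r.
have le k : hn s (component psi k) * hn s (component phi k) <= shn s psi * shn s phi.
  by apply: ler_pM; [exact: hn_ge0|exact: hn_ge0|exact: hn_le_shn|exact: hn_le_shn].
rewrite E; split; first by apply: cintableD => //; exact: cintableZ.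
rewrite fourier1_lin// mul1r; apply: le_trans (normcD _ _) _.
rewrite mulr_natl mulrnAr mulr2n mulrDl.
apply: lerD; [apply: le_trans b0 _|apply: le_trans b1 _]; apply: ler_wpM2r; rewrite ?jw_ge0//;
  by apply: ler_wpM2l; rewrite ?decayC_ge0.
Qed.

Lemma density_sub psi phi x : (density psi x)%:C - (density phi x)%:C = cross psi (psi - phi) x + cross (psi - phi) phi x.
Proof.
rewrite !density_sum /cross !sum2E !componentB.
have conjB (z w : C) : conjc (z - w) = conjc z - conjc w.
  by case: z w => [a b] [c d]; apply: complexP => /=; ring.
rewrite !conjB; move: (component psi _ x) (conjc (component psi _ x)) (component phi _ x) (conjc (component phi _ x)).
move: (component psi _ x) (conjc (component psi _ x)) (component phi _ x) (conjc (component phi _ x)).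
by move=> a1 a2 a3 a4 b1 b2 b3 b4; ring.
Qed.

Lemma component_gamma0 psi (v : R * R -> C) k :
  component (fun x => v x *: (gamma0 *m psi x)) k = fun x => (-1) ^+ k * (v x * component psi k x).
Proof.
apply/funext => x; rewrite /component mxE [(gamma0 *m psi x) k 0]mxE big_ord_recl big_ord_recl big_ord0 addr0 !mxE.
by have [->|->] := I2P k; rewrite /= ?mul1r ?mul0r ?add0r ?addr0 ?expr0 ?expr1 ?mul1r ?mulN1r ?mulrN.
Qed.

(** [prodC] comes from the product, [1 + b^-1] from the resolvent symbol and [decayC] from the
    density; the 4 is that of [cubic_bound], the 2 counts components. *)
Definition nonlinC b s : R := 2 * (prodC s * ((1 + b^-1) * (decayC s * 4))).

Lemma nonlinC_ge0 b s : 0 < b -> 0 <= nonlinC b s.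
Proof.
move=> b0; apply: mulr_ge0 => //; apply: mulr_ge0; first exact: prodC_ge0.
apply: mulr_ge0; first by rewrite addr_ge0// invr_ge0 ltW.
by apply: mulr_ge0 => //; exact: decayC_ge0.
Qed.

Definition potential b psi := resolvent b (fun y => (density psi y)%:C).

Lemma density_decay s psi xi : 0 <= s -> Hs s psi ->
  normc (fourier1 (fun y => (density psi y)%:C) xi) <= decayC s * (2 * (shn s psi * shn s psi)) * jw (- s) xi.
Proof.
move=> s0 h; have [_] := cross_decay xi s0 h h.
by rewrite (_ : cross psi psi = fun y => (density psi y)%:C)//; apply/funext => y; rewrite density_sum.
Qed.

Lemma potential_spec b s psi : 0 < b -> 0 < s -> Hs s psi ->
  is_fourier2 (potential b psi) (fun xi => (rsym b xi)%:C * fourier1 (fun y => (density psi y)%:C) xi) /\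
  forall xi, normc ((rsym b xi)%:C * fourier1 (fun y => (density psi y)%:C) xi) <=
    (1 + b^-1) * (decayC s * (2 * (shn s psi * shn s psi))) * jw (- (2 + s)) xi.
Proof.
move=> b0 s0 h; apply: resolvent_spec => //; first exact: cintable_density h.
by move=> xi; apply: density_decay => //; exact: ltW.
Qed.

(** Each potential is a representative picked by choice, so the difference is treated on the Fourier
    side, where linearity turns it into the damped transform of two cross terms. *)
Lemma potential_sub b s psi phi : 0 < b -> 0 < s -> Hs s psi -> Hs s phi ->
  exists2 vh, is_fourier2 (fun x => potential b psi x - potential b phi x) vh &
  forall xi, normc (vh xi) <= (1 + b^-1) * (decayC s * (2 * ((shn s psi + shn s phi) * shn s (psi - phi)))) * jw (- (2 + s)) xi.
Proof.
move=> b0 s0 h h'; have [p1 _] := potential_spec b0 s0 h; have [p2 _] := potential_spec b0 s0 h'.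
have hB := HsB h h'.
have I1 := cintable_density h; have I2 := cintable_density h'.
eexists.
  have := fourier2_lin (-1) p2 p1.
  rewrite (_ : (fun x => -1 * potential b phi x + potential b psi x) = fun x => potential b psi x - potential b phi x); first by apply.
  by apply/funext => x; rewrite mulN1r addrC.
move=> xi; have /andP[r0 rb] := rsym_bound xi b0.
rewrite (_ : _ + _ = (rsym b xi)%:C * fourier1 (fun y => (density psi y)%:C - (density phi y)%:C) xi); last first.
  by rewrite fourier1B// mulN1r mulrBr addrC.
rewrite normcM normc_real ger0_norm// opprD jwD mulrACA.
apply: ler_pM => //; first exact: normc_ge0.
have [J1 d1] := cross_decay xi (ltW s0) h hB; have [J2 d2] := cross_decay xi (ltW s0) hB h'.
rewrite (_ : (fun y => _) = fun y => 1 * cross psi (psi - phi) y + cross (psi - phi) phi y); last first.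
  by apply/funext => y; rewrite mul1r density_sub.
rewrite (fourier1_lin 1 xi J1 J2) mul1r; apply: le_trans (normcD _ _) _; apply: le_trans (lerD d1 d2) _.
generalize (shn s (psi - phi)) (shn s psi) (shn s phi) (decayC s) => z x y d.
by have := cross_terms_factor d x y z (jw (- s) xi) => ->.
Qed.

(** With [V] the potential, the difference splits as [(V psi - V phi) psi + V phi (psi - phi)];
    [gamma0] acts on each component by a sign and preserves norms. *)
Theorem nonlinearity_lipschitz b s psi phi : 0 < b -> 0 < s -> Hs s psi -> Hs s phi ->
  Hs s (nonlinearity b psi) /\
  shn s (nonlinearity b psi - nonlinearity b phi) <=
    nonlinC b s * (shn s psi + shn s phi) ^+ 2 * shn s (psi - phi).
Proof.
move=> b0 s0 h h'.
have hB := HsB h h'.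
have [p1 d1] := potential_spec b0 s0 h; have [p2 d2] := potential_spec b0 s0 h'.
have [vh p3 d3] := potential_sub b0 s0 h h'.
have c k := (HsP s psi).1 h k; have c' k := (HsP s phi).1 h' k; have cB k := (HsP s (psi - phi)).1 hB k.
split.
  apply/HsP => k; rewrite /nonlinearity component_gamma0.
  exact: hsZ (hs_product s0 p1 d1 (c k)).1.
have n1 := shn_ge0 s psi; have n2 := shn_ge0 s phi; have n3 := shn_ge0 s (psi - phi).
have bound k : hn s (component (nonlinearity b psi - nonlinearity b phi) k) <=
    prodC s * ((1 + b^-1) * (decayC s * 4)) * (shn s psi + shn s phi) ^+ 2 * shn s (psi - phi).
  have [a1 e1] := hs_product s0 p3 d3 (c k); have [a2 e2] := hs_product s0 p2 d2 (cB k).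
  rewrite componentB !component_gamma0.
  rewrite (_ : (fun x => _) = fun x => (-1) ^+ k * ((potential b psi x - potential b phi x) * component psi k x +
     potential b phi x * component (psi - phi) k x)); last first.
    apply/funext => x; rewrite componentB -mulrBr; congr (_ * _).
    rewrite -/(potential b psi) -/(potential b phi).
    move: (potential b psi x) (potential b phi x) (component psi k x) (component phi k x) => p q r t; by rewrite mulrBr mulrBl addrA addrNK.
  rewrite hnZ; last exact: hsD.
  have -> : normc ((-1) ^+ k : C) = 1 by have [->|->] := I2P k; rewrite ?expr0 ?expr1 ?normcN normc1.
  rewrite mul1r; apply: le_trans (hnD a1 a2) _; apply: le_trans (lerD e1 e2) _.
  have l1 := hn_le_shn s psi k.
  have l2 := hn_le_shn s (psi - phi) k.
  have P0 := prodC_ge0 s; have D0 := decayC_ge0 s.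
  have B0 : 0 <= 1 + b^-1 by rewrite addr_ge0// invr_ge0 ltW.
  revert l1 l2 n1 n2 n3 P0 D0 B0; clear.
  generalize (hn s (component (psi - phi) k)) (hn s (component psi k)) (shn s (psi - phi)) (shn s psi) (shn s phi).
  generalize (decayC s) (prodC s) (1 + b^-1) => D P B v u z x y ux vz x0 y0 z0 P0 D0 B0.
  exact: (cubic_bound P0 B0 D0 x0 y0 z0 ux vz).
apply: le_trans (shn_le_sum _ _) _.
rewrite sum2E; apply: le_trans (lerD (bound _) (bound _)) _.
rewrite /nonlinC; clear.
generalize (shn s (psi - phi)) (shn s psi) (shn s phi) (decayC s) (prodC s) (1 + b^-1) => z x y D P B.
by rewrite -mulr2n -!(mulrA 2) mulr_natl.
Qed.

End Spinors.

(** * Semilinear evolution in a seminormed space *)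

Section Partitions.
Context {R : realType}.

Lemma fine_partition (a b del : R) : a < b -> 0 < del ->
  exists p : seq R, itv_partition a b p /\
    forall i, (i < size p)%N -> nth b (a :: p) i.+1 - nth b (a :: p) i < del.
Proof.
move=> ab d0; have ba : 0 < b - a by rewrite subr_gt0.
pose n := (Num.Def.truncn ((b - a) / del)).+1.
have n0 : 0 < n%:R :> R by rewrite ltr0n.
pose h := (b - a) / n%:R.
have h0 : 0 < h by rewrite divr_gt0.
have hd : h < del.
  rewrite /h ltr_pdivrMr// mulrC -ltr_pdivrMr//; exact: truncnS_gt.
pose p := mkseq (fun k => a + k.+1%:R * h) n.
have nthE i : (i <= n)%N -> nth b (a :: p) i = a + i%:R * h.
  by case: i => [|i] ni; [rewrite /= mul0r addr0|rewrite /= nth_mkseq].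
exists p; split; last first.
  move=> i; rewrite size_mkseq => ni; rewrite !nthE ?(ltnW ni)// -natr1.
  by rewrite (_ : a + (i%:R + 1) * h - (a + i%:R * h) = h)//; ring.
split.
  apply/(pathP b) => i; rewrite size_mkseq => ni.
  rewrite -[nth b p i]/(nth b (a :: p) i.+1) !nthE ?(ltnW ni)// ltrD2l ltr_pM2r// ltr_nat.
  exact: ltnSn.
by rewrite (last_nth b) size_mkseq nthE// /h mulrC divfK ?(lt0r_neq0 n0)// addrC subrK.
Qed.

Lemma partition_step (a b : R) p i : itv_partition a b p -> (i < size p)%N ->
  [/\ a <= nth b (a :: p) i, nth b (a :: p) i <= nth b (a :: p) i.+1 & nth b (a :: p) i.+1 <= b].
Proof.
move=> ip si; split.
- by apply: itv_partition_nth_ge ip; exact: ltnW.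
- by case: ip => /(pathP b)/(_ i si)/ltW.
- by apply: itv_partition_nth_le ip.
Qed.

End Partitions.

Section AbelianIdentities.
Variable V : zmodType.

Lemma subBACA (a b c d : V) : a - b - (c - d) = a - c - (b - d).
Proof. by rewrite !opprD !opprK addrACA. Qed.

Lemma addBCA (a x b y z : V) : a + x - b - (y + z) = a - b - z + (x - y).
Proof. by rewrite [a + x - b]addrAC [y + z]addrC opprD addrACA. Qed.

End AbelianIdentities.

Section SeminormedODE.
Context {R : realType} (V : lmodType R[i]).
Local Notation C := R[i].
Local Notation "x %:C" := (real_complex R x).
Variables (P : V -> Prop) (N : V -> R).
Hypothesis P0 : P 0.
Hypothesis Plin : forall a x y, P x -> P y -> P (a *: x + y).
Hypothesis N_ge0 : forall x, 0 <= N x.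
Hypothesis N_tri : forall x y, P x -> P y -> N (x + y) <= N x + N y.
Hypothesis N_hom : forall a x, P x -> N (a *: x) = normc a * N x.

Lemma PZ a x : P x -> P (a *: x).
Proof. by move=> Px; rewrite -[_ *: _]addr0; exact: Plin. Qed.

Lemma PD x y : P x -> P y -> P (x + y).
Proof. by move=> Px Py; rewrite -[x]scale1r; exact: Plin. Qed.

Lemma PB x y : P x -> P y -> P (x - y).
Proof. by move=> Px Py; rewrite -scaleN1r addrC; exact: Plin. Qed.

Lemma Psum n (F : 'I_n -> V) : (forall i, P (F i)) -> P (\sum_(i < n) F i).
Proof. by move=> h; elim/big_ind: _ => //; exact: PD. Qed.

Lemma N0 : N 0 = 0.
Proof. by rewrite -(scale0r 0) N_hom// normc0 mul0r. Qed.

Lemma N_opp x y : P x -> P y -> N (x - y) = N (y - x).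
Proof.
move=> Px Py; have -> : x - y = -1 *: (y - x) by rewrite scaleN1r opprB.
rewrite N_hom; last exact: PB.
by rewrite normcN normc1 mul1r.
Qed.

Lemma N_dist x y z : P x -> P y -> P z -> N (x - z) <= N (x - y) + N (y - z).
Proof. by move=> Px Py Pz; rewrite -(subrKA y) N_tri//; exact: PB. Qed.

Lemma N_sub_le x y : P x -> P y -> N (x - y) <= N x + N y.
Proof.
move=> Px Py; rewrite -scaleN1r; apply: le_trans (N_tri Px (PZ _ Py)) _.
by rewrite N_hom// normcN normc1 mul1r.
Qed.

Lemma N_le x y : P x -> P y -> N x <= N y + N (x - y).
Proof. by move=> Px Py; rewrite -{1}(subrK y x) addrC N_tri//; exact: PB. Qed.

Lemma N_real (a : R) x : 0 <= a -> P x -> N (a%:C *: x) = a * N x.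
Proof. by move=> a0 Px; rewrite N_hom// normc_real ger0_norm. Qed.

Lemma N_dist0 x y : P x -> P y -> N (x - y) = 0 -> N x = N y.
Proof.
move=> Px Py e; apply/eqP; rewrite eq_le; apply/andP; split.
  by have := N_le Px Py; rewrite e addr0.
by have := N_le Py Px; rewrite -N_opp// e addr0.
Qed.

Lemma N_sum n (F : 'I_n -> V) : (forall i, P (F i)) -> N (\sum_(i < n) F i) <= \sum_(i < n) N (F i).
Proof.
move=> h; elim: n F h => [|n IH] F h; first by rewrite !big_ord0 N0.
rewrite !big_ord_recr /=; apply: le_trans (N_tri (Psum (fun i => h _)) (h _)) _.
by rewrite lerD2r IH.
Qed.

(** Continuity on a closed interval measured by [N], since [V] carries no topology. *)
Definition contT (T : R) (F : R -> V) := forall t, 0 <= t <= T -> P (F t) /\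
  forall e : R, 0 < e -> exists2 d : R, 0 < d &
    forall t', 0 <= t' <= T -> `|t' - t| < d -> N (F t' - F t) <= e.

(** Heine's theorem, from the compactness of the segment in its near-covering form. *)
Lemma contT_unif T F : contT T F -> forall e : R, 0 < e -> exists2 d : R, 0 < d &
  forall t t', 0 <= t <= T -> 0 <= t' <= T -> `|t' - t| < d -> N (F t' - F t) <= e.
Proof.
move=> cF e e0.
pose Q (i x : R) := forall t', 0 <= t' <= T -> `|t' - x| < i -> N (F t' - F x) <= e.
have /compact_near_coveringP/near_covering_withinP := @segment_compact R 0 T.
move=> /(_ R (nbhs (0 : R)) Q _)[].
  move=> x; rewrite /= in_itv /= => xT; have [Px /(_ (e / 2))[|d d0 dP]] := cF x xT.
    by rewrite divr_gt0.
  exists ([set x' | `|x' - x| < d / 2], [set i | i < d / 2]).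
    split; first by exists (d / 2) => /=; rewrite ?divr_gt0// => y /=; rewrite distrC.
    exists (d / 2) => /=; rewrite ?divr_gt0// => y /=; rewrite sub0r normrN => h.
    exact: le_lt_trans (ler_norm _) h.
  move=> [x' i] /= [hx' hi]; rewrite in_itv /= => x'T t' t'T ht'.
  have [Px' _] := cF x' x'T; have [Pt' _] := cF t' t'T.
  apply: le_trans (N_dist Pt' Px Px') _; rewrite (splitr e); apply: lerD.
    apply: dP => //; rewrite -(subrKA x'); apply: le_lt_trans (ler_normD _ _) _.
    by rewrite (splitr d) ltrD// (lt_trans ht').
  rewrite N_opp//; apply: dP => //; apply: lt_le_trans hx' _.
  by rewrite ler_pdivrMr// ler_peMr ?(ltW d0)// ler1n.
move=> d /= d0 dP; exists (d / 2); first by rewrite divr_gt0.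
move=> t t' tT t'T; apply: (dP (d / 2) _ t _ t' t'T); last by rewrite /= in_itv.
by rewrite /= sub0r normrN gtr0_norm ?divr_gt0// ltr_pdivrMr// ltr_pMr// ltr1n.
Qed.

(** Uniform continuity with tolerance 1: each of [n] short steps raises the norm by at most 1. *)
Lemma contT_bounded T F : 0 <= T -> contT T F -> exists2 M : R, 0 <= M & forall t, 0 <= t <= T -> N (F t) <= M.
Proof.
move=> T0 cF; have [d d0 dP] := contT_unif cF ltr01.
pose n := (Num.Def.truncn (T / d)).+1.
have n0 : 0 < n%:R :> R by rewrite ltr0n.
have hd : T / n%:R < d.
  by rewrite ltr_pdivrMr// mulrC -ltr_pdivrMr//; exact: truncnS_gt.
have z0 : 0 <= (0 : R) <= T by rewrite lexx.
have key k t : (k <= n)%N -> 0 <= t <= k%:R * (T / n%:R) -> N (F t) <= N (F 0) + k%:R.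
  elim: k t => [|k IH] t kn /andP[t0 tk].
    have -> : t = 0 by apply/eqP; rewrite eq_le t0 andbT; rewrite mul0r in tk.
    by rewrite addr0.
  have h0 : 0 <= T / n%:R by rewrite divr_ge0// ltW.
  have tT : 0 <= t <= T.
    rewrite t0 /=; apply: le_trans tk _; apply: (@le_trans _ _ (n%:R * (T / n%:R))).
      by apply: ler_wpM2r => //; rewrite ler_nat.
    by rewrite mulrC divfK// gt_eqF.
  have [le|lt] := leP t (k%:R * (T / n%:R)).
    apply: le_trans (IH t (ltnW kn) _) _; first by rewrite t0.
    by rewrite lerD2l ler_nat.
  have kk : 0 <= k%:R * (T / n%:R) <= T.
    by rewrite mulr_ge0//=; apply: le_trans (ltW lt) _; case/andP: tT.
  have kP : 0 <= k%:R * (T / n%:R) <= k%:R * (T / n%:R) by rewrite lexx andbT; case/andP: kk.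
  apply: le_trans (N_le (cF t tT).1 (cF _ kk).1) _.
  rewrite -natr1 addrA; apply: lerD; first exact: IH (ltnW kn) kP.
  apply: dP => //; rewrite gtr0_norm ?subr_gt0//; apply: le_lt_trans hd.
  by rewrite lerBlDl -[X in _ + X]mul1r -mulrDl natr1.
exists (N (F 0) + n%:R); first by rewrite addr_ge0.
by move=> t tT; apply: key => //; rewrite mulrC divfK// gt_eqF.
Qed.

(* A continuous antiderivative, with the derivative replaced by a uniform increment estimate. *)
Definition antider T (F J : R -> V) := (forall t, 0 <= t <= T -> P (J t)) /\
  forall e : R, 0 < e -> exists2 d : R, 0 < d &
    forall u v, 0 <= u -> u <= v -> v <= T -> v - u < d ->
      N (J v - J u - (v - u)%:C *: F u) <= e * (v - u).

(** Subdivision into steps shorter than [d], then telescoping; this takes the place of the mean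
    value inequality. *)
Lemma increments_le (T : R) (D : R -> V) (phi : R -> R) d : 0 < d ->
  (forall t, 0 <= t <= T -> P (D t)) ->
  (forall u v, 0 <= u -> u <= v -> v <= T -> v - u < d -> N (D v - D u) <= phi v - phi u) ->
  forall u v, 0 <= u -> u <= v -> v <= T -> N (D v - D u) <= phi v - phi u.
Proof.
move=> d0 PD' h u v u0 uv vT.
pose n := (Num.Def.truncn ((v - u) / d)).+1.
have n0 : 0 < n%:R :> R by rewrite ltr0n.
pose s := (v - u) / n%:R.
have s0 : 0 <= s by rewrite divr_ge0 ?subr_ge0// ltW.
have sd : s < d.
  by rewrite /s ltr_pdivrMr// mulrC -ltr_pdivrMr//; exact: truncnS_gt.
have inT k : (k <= n)%N -> 0 <= u + k%:R * s <= T.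
  move=> kn; apply/andP; split; first by apply: addr_ge0 => //; exact: mulr_ge0.
  apply: le_trans vT.
  rewrite -lerBrDl; apply: (@le_trans _ _ (n%:R * s)); first by apply: ler_wpM2r => //; rewrite ler_nat.
  by rewrite /s mulrC divfK// gt_eqF.
have key k : (k <= n)%N -> N (D (u + k%:R * s) - D u) <= phi (u + k%:R * s) - phi u.
  elim: k => [|k IH] kn; first by rewrite mul0r addr0 !subrr N0.
  have uT := inT 0%N isT; rewrite mul0r addr0 in uT.
  apply: le_trans (N_dist (PD' _ (inT _ kn)) (PD' _ (inT _ (ltnW kn))) (PD' _ uT)) _.
  rewrite -[leRHS](subrKA (phi (u + k%:R * s))); apply: lerD; last exact: IH (ltnW kn).
  have e : u + k.+1%:R * s - (u + k%:R * s) = s by rewrite -natr1; ring.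
  apply: h; first by case/andP: (inT _ (ltnW kn)).
  - by rewrite -subr_ge0 e.
  - by case/andP: (inT _ kn).
  - by rewrite e.
have e : u + n%:R * s = v by rewrite /s mulrC divfK ?(lt0r_neq0 n0)// addrC subrK.
by have := key n (leqnn _); rewrite e.
Qed.

(** [phi] plays the role of a primitive of the majorant [m]. Letting [m] vary is what permits
    exponential weights in the uniqueness proof. *)
Lemma antider_le (T : R) F J (m phi : R -> R) : antider T F J -> (forall t, 0 <= t <= T -> P (F t)) ->
  (forall t, 0 <= t <= T -> N (F t) <= m t) ->
  (forall u v, 0 <= u -> u <= v -> v <= T -> (v - u) * m u <= phi v - phi u) ->
  forall u v, 0 <= u -> u <= v -> v <= T -> N (J v - J u) <= phi v - phi u.
Proof.
move=> [PJ aJ] PF Fm mphi u v u0 uv vT; apply/ler_addgt0Pr => e e0.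
have e1 : 0 < e / (v - u + 1) by rewrite divr_gt0// ltr_wpDl// subr_ge0.
have [d d0 dP] := aJ _ e1.
have T0 : 0 <= T by rewrite (le_trans u0)// (le_trans uv).
have H := @increments_le T J (fun t => phi t + e / (v - u + 1) * t) d d0 PJ.
apply: le_trans (H _ u v u0 uv vT) _; last first.
  rewrite opprD addrACA lerD2l -mulrBr mulrAC ler_pdivrMr ?ltr_wpDl ?subr_ge0//.
  by apply: ler_wpM2l; rewrite ?ltW// ltrDl.
move=> a b a0 ab bT bad; have := dP a b a0 ab bT bad.
have aT : 0 <= a <= T by rewrite a0 (le_trans ab).
have bT' : 0 <= b <= T by rewrite bT (le_trans a0).
have Pa := PJ a aT; have Pb := PJ b bT'; have PFa := PF a aT.
have ba0 : 0 <= b - a by rewrite subr_ge0.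
move=> h; apply: le_trans (N_le (PB Pb Pa) (PZ (b - a)%:C PFa)) _.
rewrite opprD addrACA -mulrBr; apply: lerD => //.
by rewrite N_real//; apply: le_trans (mphi a b a0 ab bT); apply: ler_wpM2l => //; exact: Fm.
Qed.

Lemma antider_bound T F J M : antider T F J -> (forall t, 0 <= t <= T -> P (F t)) ->
  (forall t, 0 <= t <= T -> N (F t) <= M) ->
  forall u v, 0 <= u -> u <= v -> v <= T -> N (J v - J u) <= M * (v - u).
Proof.
move=> aJ PF FM u v u0 uv vT; rewrite mulrBr.
apply: (@antider_le T F J (fun=> M) (fun t => M * t)) => // a b a0 ab bT.
by rewrite -mulrBr mulrC.
Qed.

Lemma antider_sub T F F' J J' : antider T F J -> antider T F' J' ->
  (forall t, 0 <= t <= T -> P (F t)) -> (forall t, 0 <= t <= T -> P (F' t)) ->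
  antider T (fun t => F t - F' t) (fun t => J t - J' t).
Proof.
move=> [PJ aJ] [PJ' aJ'] PF PF'; split; first by move=> t tT; apply: PB; [exact: PJ|exact: PJ'].
move=> e e0; have e2 : 0 < e / 2 by rewrite divr_gt0.
have [d d0 dP] := aJ _ e2; have [d' d0' dP'] := aJ' _ e2.
exists (Num.min d d'); first by rewrite lt_min d0.
move=> u v u0 uv vT; rewrite lt_min => /andP[vd vd'].
have uT : 0 <= u <= T by rewrite u0 (le_trans uv).
have vT' : 0 <= v <= T by rewrite vT (le_trans u0).
have -> : J v - J' v - (J u - J' u) - (v - u)%:C *: (F u - F' u) =
    (J v - J u - (v - u)%:C *: F u) - (J' v - J' u - (v - u)%:C *: F' u).
  by rewrite scalerBr (subBACA (J v)) (subBACA (J v - J u)).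
rewrite (splitr e) mulrDl.
have Q1 : P (J v - J u - (v - u)%:C *: F u) by apply: PB; [apply: PB; exact: PJ|apply: PZ; exact: PF].
have Q2 : P (J' v - J' u - (v - u)%:C *: F' u) by apply: PB; [apply: PB; exact: PJ'|apply: PZ; exact: PF'].
apply: le_trans (N_sub_le Q1 Q2) _.
by apply: lerD; [exact: dP|exact: dP'].
Qed.

(** For fields known only up to null vectors, as at the fixed point of the Picard map. *)
Lemma antider_ext T F F' J : antider T F J -> (forall t, 0 <= t <= T -> P (F t)) ->
  (forall t, 0 <= t <= T -> P (F' t)) -> (forall t, 0 <= t <= T -> N (F t - F' t) = 0) -> antider T F' J.
Proof.
move=> [PJ aJ] PF PF' FF'; split => // e e0; have [d d0 dP] := aJ e e0; exists d => // u v u0 uv vT vd.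
have uT : 0 <= u <= T by rewrite u0 (le_trans uv).
have vT' : 0 <= v <= T by rewrite vT (le_trans u0).
have vu0 : 0 <= v - u by rewrite subr_ge0.
have PJJ : P (J v - J u) by apply: PB; exact: PJ.
apply: le_trans (dP u v u0 uv vT vd).
have Z1 := PZ (v - u)%:C (PF u uT); have Z2 := PZ (v - u)%:C (PF' u uT).
apply: le_trans (N_dist PJJ Z1 Z2) _.
by rewrite -scalerBr N_real ?FF' ?mulr0 ?addr0//; apply: PB; [exact: PF|exact: PF'].
Qed.

(** Euler polygons: over each step, shorter than [d], the primitive is continued linearly with the
    slope at the left node [a]. An increment ends before [a], straddles [a], or lies within the new
    step. *)
Lemma approx_antider T F d e : 0 <= T -> 0 < d -> 0 <= e -> (forall t, 0 <= t <= T -> P (F t)) ->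
  (forall t t', 0 <= t <= T -> 0 <= t' <= T -> `|t' - t| < d -> N (F t' - F t) <= e) ->
  exists J, (forall t, P (J t)) /\ forall u v, 0 <= u -> u <= v -> v <= T -> v - u < d ->
    N (J v - J u - (v - u)%:C *: F u) <= e * (v - u).
Proof.
move=> T0 d0 e0 PF Fd.
pose n := (Num.Def.truncn (T / d)).+1.
have n0 : 0 < n%:R :> R by rewrite ltr0n.
pose h := T / n%:R.
have h0 : 0 <= h by rewrite divr_ge0// ltW.
have hd : h < d.
  by rewrite /h ltr_pdivrMr// mulrC -ltr_pdivrMr//; exact: truncnS_gt.
have nh : n%:R * h = T by rewrite /h mulrC divfK// gt_eqF.
suff key k : (k <= n)%N -> exists J, (forall t, P (J t)) /\ forall u v, 0 <= u -> u <= v -> v <= k%:R * h -> v - u < d ->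
    N (J v - J u - (v - u)%:C *: F u) <= e * (v - u).
  by have [J [PJ JP]] := key n (leqnn _); exists J; split => // u v u0 uv vT; apply: JP; rewrite ?nh.
elim: k => [|k IH] kn.
  exists (fun=> 0); split => // u v u0 uv; rewrite mul0r => v0 _.
  have -> : v = u by apply/eqP; rewrite eq_le uv (le_trans v0).
  by rewrite !subrr scale0r subrr N0 mulr0.
have [J [PJ JP]] := IH (ltnW kn); pose a := k%:R * h.
have aT : 0 <= a <= T.
  by rewrite mulr_ge0//= -nh; apply: ler_wpM2r => //; rewrite ler_nat ltnW.
exists (fun t => if t <= a then J t else J a + (t - a)%:C *: F a); split.
  by move=> t; case: ifP => // _; apply: PD => //; apply: PZ; exact: PF.
move=> u v u0 uv vk vud.
have vT : v <= T by apply: le_trans vk _; rewrite -nh; apply: ler_wpM2r => //; rewrite ler_nat.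
have uT : 0 <= u <= T by rewrite u0 (le_trans uv).
have vu0 : 0 <= v - u by rewrite subr_ge0.
have Pu := PF u uT; have Pa := PF a aT.
have [va|av] := leP v a; first by rewrite (le_trans uv va); exact: JP.
have [ua|au] := leP u a.
  have va0 : 0 <= v - a by rewrite subr_ge0 ltW.
  have av0 : 0 <= a - u by rewrite subr_ge0.
  have -> : J a + (v - a)%:C *: F a - J u - (v - u)%:C *: F u =
     (J a - J u - (a - u)%:C *: F u) + (v - a)%:C *: (F a - F u).
    have -> : (v - u)%:C = (v - a)%:C + (a - u)%:C :> C by rewrite -rmorphD /= subrKA.
    by rewrite scalerDl scalerBr addBCA.
  have Q1 : P (J a - J u - (a - u)%:C *: F u) by apply: PB; [exact: PB|exact: PZ].
  have Q2 : P ((v - a)%:C *: (F a - F u)) by apply: PZ; exact: PB.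
  apply: le_trans (N_tri Q1 Q2) _.
  rewrite (_ : e * (v - u) = e * (a - u) + (v - a) * e); last by ring.
  apply: lerD.
    apply: JP => //; apply: le_lt_trans vud; by rewrite lerD2r ltW.
  rewrite N_real//; last exact: PB.
  apply: ler_wpM2l => //; apply: Fd => //.
  by rewrite ger0_norm//; apply: le_lt_trans vud; rewrite lerD2r ltW.
have -> : J a + (v - a)%:C *: F a - (J a + (u - a)%:C *: F a) - (v - u)%:C *: F u = (v - u)%:C *: (F a - F u).
  rewrite opprD addrACA subrr add0r -scalerBl -rmorphB /=.
  by rewrite opprB addrA subrK -scalerBr.
rewrite N_real//; last exact: PB.
rewrite mulrC; apply: ler_wpM2r => //; apply: Fd => //.
rewrite distrC gtr0_norm ?subr_gt0//; apply: le_lt_trans hd.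
rewrite lerBlDl; apply: le_trans uv _; apply: le_trans vk _.
by rewrite -natr1 mulrDl mul1r.
Qed.

Hypothesis N_complete : forall u : nat -> V, (forall n, P (u n)) ->
  (forall e : R, 0 < e -> exists n0, forall m n, (n0 <= m)%N -> (n0 <= n)%N -> N (u m - u n) <= e) ->
  exists2 l, P l & N (u n - l) @[n --> \oo] --> (0 : R).

Lemma N_lim_le (u : nat -> V) l y (c : R) n0 : (forall n, P (u n)) -> P l -> P y ->
  N (u n - l) @[n --> \oo] --> (0 : R) -> (forall n, (n0 <= n)%N -> N (u n - y) <= c) -> N (l - y) <= c.
Proof.
move=> Pu Pl Py ul uy; apply/ler_addgt0Pl => e e0.
move/cvgrPdist_le : ul => /(_ e e0)[n1 _ n1P].
have := n1P (maxn n0 n1) (leq_maxr _ _); rewrite /= sub0r normrN ger0_norm// => h.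
apply: le_trans (N_dist Pl (Pu (maxn n0 n1)) Py) _.
by rewrite N_opp//; apply: lerD => //; apply: uy; exact: leq_maxl.
Qed.

(** Polygons with errors [1/(n+1)] differ by functions with uniformly small increments, so they
    converge at each time. Since increments are compared, the error stays proportional to [v - u] in
    the limit. *)
Lemma antider_exists (T : R) F : 0 <= T -> contT T F -> exists J, [/\ antider T F J, J 0 = 0 & forall t, P (J t)].
Proof.
move=> T0 cF; have PF t : 0 <= t <= T -> P (F t) by move=> /cF[].
have H n : exists G, exists2 d : R, 0 < d & (forall t, P (G t)) /\ G 0 = 0 /\ forall u v, 0 <= u -> u <= v -> v <= T -> v - u < d ->
    N (G v - G u - (v - u)%:C *: F u) <= n.+1%:R^-1 * (v - u).
  have e0 : 0 < n.+1%:R^-1 :> R by rewrite invr_gt0.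
  have [d d0 dP] := contT_unif cF e0.
  have [G [PG GP]] := approx_antider T0 d0 (ltW e0) PF dP.
  exists (fun t => G t - G 0), d => //; split; first by move=> t; exact: PB.
  split; first by rewrite subrr.
  by move=> u v u0 uv vT vd; rewrite opprB addrA subrK; exact: GP.
have [G GP] := choice H.
have cmp n m : forall u v, 0 <= u -> u <= v -> v <= T ->
    N (G n v - G m v - (G n u - G m u)) <= (n.+1%:R^-1 + m.+1%:R^-1) * (v - u).
  move=> u v u0 uv vT; have [d d0 [PG [_ dP]]] := GP n; have [d' d0' [PG' [_ dP']]] := GP m.
  rewrite mulrBr.
  apply: (@increments_le T (fun t => G n t - G m t) (fun t => (n.+1%:R^-1 + m.+1%:R^-1) * t) (Num.min d d')) => //.
  - by rewrite lt_min d0.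
  - by move=> t _; exact: PB.
  move=> a b a0 ab bT; rewrite lt_min => /andP[bd bd'].
  have aT : 0 <= a <= T by rewrite a0 (le_trans ab).
  have -> : G n b - G m b - (G n a - G m a) = (G n b - G n a) - (G m b - G m a).
    by rewrite subBACA.
  rewrite -mulrBr mulrDl.
  apply: le_trans (N_dist (PB (PG _) (PG _)) (PZ (b - a)%:C (PF a aT)) (PB (PG' _) (PG' _))) _.
  apply: lerD; first exact: dP.
  rewrite N_opp; [exact: dP'| exact: PZ (PF a aT)|exact: PB].
have PG n t : P (G n t) by have [d _ []] := GP n.
have G0 n : G n 0 = 0 by have [d _ [_ []]] := GP n.
have inv_small (e : R) : 0 < e -> exists n0, forall n, (n0 <= n)%N -> n.+1%:R^-1 <= e.
  move=> e0; exists (Num.Def.truncn e^-1) => n hn.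
  rewrite -[e]invrK lef_pV2 ?posrE ?invr_gt0//; apply: le_trans (ltW (truncnS_gt _)) _.
  by rewrite ler_nat ltnS.
have L t : exists l, P l /\ (0 <= t <= T -> N (G n t - l) @[n --> \oo] --> (0 : R)).
  have [tT|] := boolP (0 <= t <= T); last by exists 0.
  have [|l Pl lP] := @N_complete (fun n => G n t) (fun n => PG n t); last by exists l.
  move=> e e0; have [n0 n0P] := inv_small (e / (2 * (T + 1))) (divr_gt0 e0 (mulr_gt0 (ltr0Sn _ _) (ltr_wpDl T0 ltr01))).
  exists n0 => m n n0m n0n; case/andP: (tT) => t0 tT'.
  have := cmp m n 0 t (lexx _) t0 tT'; rewrite !G0 subrr !subr0 => h; apply: le_trans h _.
  apply: (@le_trans _ _ ((e / (2 * (T + 1)) + e / (2 * (T + 1))) * (T + 1))).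
    apply: ler_pM => //; [by apply: lerD; exact: n0P|by rewrite (le_trans tT')// lerDl].
  by rewrite le_eqVlt; apply/orP; left; apply/eqP; field; rewrite gt_eqF// ltr_wpDl.
have [J JP] := choice L.
have PJ t : P (J t) by case: (JP t).
have lim n u v : 0 <= u -> u <= v -> v <= T -> N (J v - J u - (G n v - G n u)) <= 2 * n.+1%:R^-1 * (v - u).
  move=> u0 uv vT.
  have uT : 0 <= u <= T by rewrite u0 (le_trans uv).
  have vT' : 0 <= v <= T by rewrite vT (le_trans u0).
  have c : N ((G k v - G k u) - (J v - J u)) @[k --> \oo] --> (0 : R).
    apply: (@squeeze_cvgr _ _ _ _ (fun=> 0) (fun k => N (G k v - J v) + N (G k u - J u))).
    - apply: nearW => k; rewrite N_ge0 /=.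
      rewrite (_ : _ - _ - _ = (G k v - J v) - (G k u - J u)); last first.
        by rewrite subBACA.
      by apply: N_sub_le; exact: PB.
    - exact: cvg_cst.
    - have := @cvgD _ _ _ _ eventually_filter _ _ _ _ ((JP v).2 vT') ((JP u).2 uT).
      by rewrite addr0.
  apply: (N_lim_le (u := fun k => G k v - G k u) (n0 := n) _ _ _ c).
  - by move=> k; exact: PB.
  - exact: PB.
  - exact: PB.
  move=> k nk; rewrite (_ : _ - _ - _ = G k v - G n v - (G k u - G n u)); last first.
    by rewrite subBACA.
  apply: le_trans (cmp k n u v u0 uv vT) _; apply: ler_wpM2r; first by rewrite subr_ge0.
  by rewrite mulr_natl mulr2n lerD2r lef_pV2 ?posrE// ler_nat.
exists (fun t => J t - J 0); split; [split|by rewrite subrr|by move=> t; exact: PB].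
  by move=> t _; exact: PB.
move=> e e0; have [n0 n0P] := inv_small (e / 3) (divr_gt0 e0 (ltr0Sn _ _)).
have [d d0 [_ [_ dP]]] := GP n0; exists d => // u v u0 uv vT vd.
have uT : 0 <= u <= T by rewrite u0 (le_trans uv).
rewrite (_ : J v - J 0 - (J u - J 0) = J v - J u); last by rewrite opprB addrA subrK.
apply: le_trans (N_dist (PB (PJ v) (PJ u)) (PB (PG n0 v) (PG n0 u)) (PZ (v - u)%:C (PF u uT))) _.
apply: le_trans (lerD (lim n0 u v u0 uv vT) (dP u v u0 uv vT vd)) _.
rewrite -mulrDl; apply: ler_wpM2r; first by rewrite subr_ge0.
have := n0P n0 (leqnn _); move: (n0.+1%:R^-1) => x; lra.
Qed.

Definition is_int (a b : R) (F : R -> V) I := [/\ forall tau, a <= tau <= b -> P (F tau), P I &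
  forall eps : R, 0 < eps -> exists2 delta : R, 0 < delta & forall (p : seq R) (tag : nat -> R),
    itv_partition a b p ->
    (forall i, (i < size p)%N -> nth b (a :: p) i <= tag i <= nth b (a :: p) i.+1 /\
       nth b (a :: p) i.+1 - nth b (a :: p) i < delta) ->
    N (\sum_(i < size p) (nth b (a :: p) i.+1 - nth b (a :: p) i)%:C *: F (tag i) - I) < eps].

(** Each cell carries two errors proportional to its length, the displacement of the tag and the
    defect of the antiderivative; the lengths telescope to [t]. *)
Lemma riemann_antider T F J t (eps : R) : antider T F J -> contT T F -> 0 <= t <= T -> 0 < eps ->
  exists2 delta : R, 0 < delta & forall (p : seq R) (tag : nat -> R), itv_partition 0 t p ->
    (forall i, (i < size p)%N -> nth t (0 :: p) i <= tag i <= nth t (0 :: p) i.+1 /\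
       nth t (0 :: p) i.+1 - nth t (0 :: p) i < delta) ->
    N (\sum_(i < size p) (nth t (0 :: p) i.+1 - nth t (0 :: p) i)%:C *: F (tag i) - (J t - J 0)) <= eps.
Proof.
move=> [PJ aJ] cF /andP[t0 tT] e0.
(* [t + 1] instead of [t] keeps the tolerance meaningful at [t = 0]. *)
have e1 : 0 < eps / (2 * (t + 1)) by rewrite divr_gt0// mulr_gt0// ltr_wpDl.
have [d d0 dP] := aJ _ e1; have [d' d0' dP'] := contT_unif cF e1.
exists (Num.min d d'); first by rewrite lt_min d0.
move=> p tag ip tagP; pose x i := nth t (0 :: p) i.
have xP i : (i < size p)%N -> [/\ 0 <= x i <= T, 0 <= x i.+1 <= T, x i <= x i.+1 & 0 <= tag i <= T].
  move=> ip'; have [h1 h2 h3] := partition_step ip ip'; have [/andP[h4 h5] _] := tagP i ip'.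
  rewrite /x; split => //.
  - by rewrite h1 (le_trans h2)// (le_trans h3).
  - by rewrite (le_trans h1 h2) (le_trans h3).
  - by rewrite (le_trans h1 h4) (le_trans h5)// (le_trans h3).
have PF s : 0 <= s <= T -> P (F s) by move=> /cF[].
have -> : J t - J 0 = \sum_(i < size p) (J (x i.+1) - J (x i)).
  by rewrite -(big_mkord xpredT (fun i => J (x i.+1) - J (x i))) telescope_sumr// /x (itv_partition_nth_size _ ip).
rewrite -sumrB.
apply: le_trans (N_sum _) _.
  move=> i; have [a1 a2 _ a3] := xP i (ltn_ord i).
  by apply: PB; [apply: PZ; exact: PF|apply: PB; exact: PJ].
apply: (@le_trans _ _ (\sum_(i < size p) (eps / (t + 1)) * (x i.+1 - x i))).
  apply: ler_sum => i _; have [a1 a2 a3 a4] := xP i (ltn_ord i).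
  have [tg] := tagP i (ltn_ord i); rewrite lt_min => /andP[l1 l2].
  have len0 : 0 <= x i.+1 - x i by rewrite subr_ge0.
  have Q1 := PZ (x i.+1 - x i)%:C (PF _ a4); have Q2 := PZ (x i.+1 - x i)%:C (PF _ a1).
  have Q3 := PB (PJ _ a2) (PJ _ a1).
  apply: le_trans (N_dist Q1 Q2 Q3) _.
  rewrite (_ : eps / (t + 1) * (x i.+1 - x i) = (x i.+1 - x i) * (eps / (2 * (t + 1))) + eps / (2 * (t + 1)) * (x i.+1 - x i)); last first.
    by field; rewrite gt_eqF// ltr_wpDl.
  apply: lerD.
    rewrite -scalerBr N_real//; last by apply: PB; exact: PF.
    apply: ler_wpM2l => //; apply: dP' => //.
    case/andP: tg => g1 g2; rewrite ger0_norm ?subr_ge0//; apply: le_lt_trans l2.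
    by rewrite lerD2r.
  rewrite N_opp//; apply: dP => //; [by case/andP: a1|by case/andP: a2].
rewrite -mulr_sumr -(big_mkord xpredT (fun i => x i.+1 - x i)) telescope_sumr// /x (itv_partition_nth_size _ ip) /= subr0.
by rewrite mulrAC ler_pdivrMr ?ltr_wpDl// ler_wpM2l ?(ltW e0)// lerDl.
Qed.

Lemma eqN_trans x y z : P x -> P y -> P z -> N (x - y) = 0 -> N (y - z) = 0 -> N (x - z) = 0.
Proof.
move=> Px Py Pz h1 h2; apply/eqP; rewrite eq_le N_ge0 andbT.
by apply: le_trans (N_dist Px Py Pz) _; rewrite h1 h2 addr0.
Qed.

Lemma eqN_D x y x' y' : P x -> P y -> P x' -> P y' -> N (x - x') = 0 -> N (y - y') = 0 ->
  N (x + y - (x' + y')) = 0.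
Proof.
move=> Px Py Px' Py' h1 h2; apply/eqP; rewrite eq_le N_ge0 andbT opprD addrACA.
by apply: le_trans (N_tri (PB Px Px') (PB Py Py')) _; rewrite h1 h2 addr0.
Qed.

Lemma eqN_Z a x y : P x -> P y -> N (x - y) = 0 -> N (a *: x - a *: y) = 0.
Proof. by move=> Px Py h; rewrite -scalerBr N_hom ?h ?mulr0//; exact: PB. Qed.

Lemma eqN_sym x y : P x -> P y -> N (x - y) = 0 -> N (y - x) = 0.
Proof. by move=> Px Py; rewrite N_opp. Qed.

Variable U : R -> V -> V.
Hypothesis UP : forall t x, P x -> P (U t x).
Hypothesis UN : forall t x, P x -> N (U t x) = N x.
Hypothesis Ulin : forall t a x y, P x -> P y -> N (U t (a *: x + y) - (a *: U t x + U t y)) = 0.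
Hypothesis U0 : forall x, P x -> N (U 0 x - x) = 0.
Hypothesis UD : forall t t' x, P x -> N (U (t + t') x - U t (U t' x)) = 0.
Hypothesis U_cont0 : forall x, P x -> forall e : R, 0 < e -> exists2 d : R, 0 < d &
  forall t, `|t| < d -> N (U t x - x) <= e.

(** Linearity holds only up to null vectors, so preservation of [N] has to be carried over to
    differences. *)
Lemma U_isom t x y : P x -> P y -> N (U t x - U t y) = N (x - y).
Proof.
move=> Px Py; have h := Ulin t (-1) Py Px; have Pc := Plin (-1) Py Px.
have := N_dist0 (UP t Pc) (Plin (-1) (UP t Py) (UP t Px)) h.
by rewrite UN// !scaleN1r ![- _ + _]addrC => <-.
Qed.

Lemma U_ae t x y : P x -> P y -> N (x - y) = 0 -> N (U t x - U t y) = 0.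
Proof. by move=> Px Py; rewrite U_isom. Qed.

Lemma U_sum t n (a : 'I_n -> C) (F : 'I_n -> V) : (forall i, P (F i)) ->
  N (U t (\sum_(i < n) a i *: F i) - \sum_(i < n) a i *: U t (F i)) = 0.
Proof.
elim: n a F => [|n IH] a F PF; first by rewrite !big_ord0 subr0 UN// N0.
rewrite !big_ord_recl.
have PF' i : P (F (lift ord0 i)) by [].
have PS : P (\sum_(i < n) a (lift ord0 i) *: F (lift ord0 i)) by apply: Psum => i; exact: PZ.
have PS' : P (\sum_(i < n) a (lift ord0 i) *: U t (F (lift ord0 i))) by apply: Psum => i; apply: PZ; exact: UP.
have PU := UP t (PF ord0).
apply: (eqN_trans (UP t (Plin _ (PF ord0) PS)) (Plin _ PU (UP t PS)) (Plin _ PU PS') (Ulin t _ (PF ord0) PS)).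
apply: eqN_D; [exact: PZ|exact: UP|exact: PZ|exact: PS'| |exact: IH].
by rewrite subrr N0.
Qed.

Lemma U_add t t' x : P x -> N (U t (U t' x) - U (t + t') x) = 0.
Proof. by move=> Px; apply: eqN_sym; [exact: UP|apply: UP; exact: UP|exact: UD]. Qed.

Lemma U_inv t x : P x -> N (U t (U (- t) x) - x) = 0.
Proof.
move=> Px; have h := U_add t (- t) Px; rewrite subrr in h.
by apply: (eqN_trans _ _ _ h (U0 Px)) => //; do ?[exact: UP]; apply: UP; exact: UP.
Qed.

Lemma U_invN t x : P x -> N (U (- t) (U t x) - x) = 0.
Proof. by move=> Px; have := U_inv (- t) Px; rewrite opprK. Qed.

Lemma U_cont t x : P x -> forall e : R, 0 < e -> exists2 d : R, 0 < d &
  forall t', `|t' - t| < d -> N (U t' x - U t x) <= e.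
Proof.
move=> Px e e0; have [d d0 dP] := U_cont0 Px e0; exists d => // t' tt'.
have et : t + (t' - t) = t' by rewrite addrC subrK.
have h := U_add t (t' - t) Px; rewrite et in h.
have P1 := UP (t' - t) Px.
have h' := eqN_sym (UP t P1) (UP t' Px) h.
apply: le_trans (N_dist (UP t' Px) (UP t P1) (UP t Px)) _.
by rewrite h' add0r U_isom//; exact: dP.
Qed.

(** The reparametrisation [s] is the identity or the opposite, for leaving or entering the
    interaction picture. Joint continuity comes from strong continuity and isometry. *)
Lemma U_contT T (s : R -> R) v : (forall t t', `|s t' - s t| = `|t' - t|) -> contT T v -> contT T (fun t => U (s t) (v t)).
Proof.
move=> sP cv t tT; have [Pv vP] := cv t tT; split; first exact: UP.
move=> e e0; have e2 : 0 < e / 2 by rewrite divr_gt0.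
have [d d0 dP] := vP _ e2; have [d' d0' dP'] := U_cont (s t) Pv e2.
exists (Num.min d d'); first by rewrite lt_min d0.
move=> t' t'T; rewrite lt_min => /andP[l1 l2]; have [Pv' _] := cv t' t'T.
apply: le_trans (N_dist (UP (s t') Pv') (UP (s t') Pv) (UP (s t) Pv)) _.
rewrite (splitr e); apply: lerD; first by rewrite U_isom//; exact: dP.
by apply: dP'; rewrite sP.
Qed.

Variables (G : V -> V) (K : R) (c : C).
Hypothesis PG : forall x, P x -> P (G x).
Hypothesis K0 : 0 <= K.
Hypothesis G_lip : forall x y, P x -> P y -> N (G x - G y) <= K * (N x + N y) ^+ 2 * N (x - y).
Hypothesis G0 : N (G 0) = 0.
Hypothesis c1 : normc c = 1.

Lemma G_ae x y : P x -> P y -> N (x - y) = 0 -> N (G x - G y) = 0.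
Proof.
move=> Px Py h; apply/eqP; rewrite eq_le N_ge0 andbT.
by apply: le_trans (G_lip Px Py) _; rewrite h mulr0.
Qed.

Lemma G_bound x : P x -> N (G x) <= K * N x ^+ 3.
Proof.
move=> Px; have := N_le (PG Px) (PG P0); rewrite G0 add0r => h; apply: le_trans h _.
by apply: le_trans (G_lip Px P0) _; rewrite N0 addr0 subr0 -mulrA -exprSr.
Qed.

Lemma G_contT T v : contT T v -> contT T (fun t => G (v t)).
Proof.
move=> cv t tT; have [Pv vP] := cv t tT; split; first exact: PG.
move=> e e0; pose L := K * (2 * N (v t) + 1) ^+ 2 + 1.
have L0 : 0 < L by rewrite ltr_wpDl// mulr_ge0// sqr_ge0.
have [d d0 dP] := vP _ (divr_gt0 e0 L0); have [d' d0' dP'] := vP _ ltr01.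
exists (Num.min d d'); first by rewrite lt_min d0.
move=> t' t'T; rewrite lt_min => /andP[l1 l2]; have [Pv' _] := cv t' t'T.
have h1 := dP t' t'T l1; have h2 := dP' t' t'T l2.
apply: le_trans (G_lip Pv' Pv) _.
rewrite -[e](divfK (lt0r_neq0 L0)) mulrC; apply: ler_pM => //.
  by rewrite mulr_ge0// sqr_ge0.
apply: (@le_trans _ _ (K * (2 * N (v t) + 1) ^+ 2)); last by rewrite lerDl.
apply: ler_wpM2l => //; rewrite ler_sqr ?nnegrE ?addr_ge0//; last by rewrite mulr_ge0.
have := N_le Pv' Pv; have := N_ge0 (v t); move: h2; move: (N (v t)) (N (v t')) (N (_ - _)) => a b q; lra.
Qed.

(* The vector field of the interaction picture [w t = U (- t) (psi t)]. *)
Definition vfield (w : R -> V) t := U (- t) (G (U t (w t))).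

Lemma vfield_contT T w : contT T w -> contT T (vfield w).
Proof.
move=> cw; apply: (@U_contT T (fun t => - t)); first by move=> t t'; rewrite -opprD normrN.
by apply: G_contT; exact: (@U_contT T (fun t => t)).
Qed.

Lemma vfield_P w t : P (w t) -> P (vfield w t).
Proof. by move=> Pw; apply: UP; apply: PG; exact: UP. Qed.

Lemma vfield_lip w w' t : P (w t) -> P (w' t) ->
  N (vfield w t - vfield w' t) <= K * (N (w t) + N (w' t)) ^+ 2 * N (w t - w' t).
Proof.
move=> Pw Pw'; have P1 := UP t Pw; have P2 := UP t Pw'.
rewrite /vfield U_isom; [|exact: PG|exact: PG].
by apply: le_trans (G_lip P1 P2) _; rewrite !UN// U_isom.
Qed.

Lemma vfield_bound w t : P (w t) -> N (vfield w t) <= K * N (w t) ^+ 3.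
Proof.
move=> Pw; have P1 := UP t Pw; rewrite UN; last exact: PG.
by rewrite -(UN t Pw); exact: G_bound.
Qed.

Definition mild T x0 (w : R -> V) := contT T w /\ exists J, [/\ antider T (vfield w) J, J 0 = 0,
  forall t, P (J t) & forall t, 0 <= t <= T -> N (w t - (x0 + c *: J t)) = 0].

(** Short enough that the cubic bound keeps the ball of radius [r + 1] invariant and that the Picard
    map contracts by 1/2 there, since [(2 (r + 1))^2 <= 4 (r + 1)^3]. The last 1 covers [K = 0]. *)
Definition lifespan (r : R) : R := (8 * K * (r + 1) ^+ 3 + 1)^-1.

Lemma lifespan_gt0 r : 0 <= r -> 0 < lifespan r.
Proof. move=> r0; rewrite invr_gt0 ltr_wpDl//; apply: mulr_ge0; first exact: mulr_ge0.
by rewrite exprn_ge0// addr_ge0. Qed.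

Lemma lifespan_bound r : 0 <= r -> K * (r + 1) ^+ 3 * lifespan r <= 1 /\ K * (2 * (r + 1)) ^+ 2 * lifespan r <= 2^-1.
Proof.
move=> r0; have T0 := lifespan_gt0 r0.
have h : (8 * K * (r + 1) ^+ 3 + 1) * lifespan r = 1.
  by rewrite /lifespan mulfV// gt_eqF// -invr_gt0.
have k3 : 0 <= K * (r + 1) ^+ 3 by rewrite mulr_ge0// exprn_ge0// addr_ge0.
have k23 : K * (r + 1) ^+ 2 <= K * (r + 1) ^+ 3.
  by apply: ler_wpM2l => //; rewrite [leRHS]exprS ler_peMl ?exprn_ge0 ?addr_ge0// lerDr.
have h2 : (8 * (K * (r + 1) ^+ 3) + 1) * lifespan r = 1 by rewrite [8 * _]mulrA.
have kT : K * (r + 1) ^+ 2 * lifespan r <= K * (r + 1) ^+ 3 * lifespan r by rewrite ler_wpM2r ?(ltW T0).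
have kT0 : 0 <= K * (r + 1) ^+ 3 * lifespan r by rewrite mulr_ge0 ?(ltW T0).
rewrite (_ : K * (2 * (r + 1)) ^+ 2 * lifespan r = 4 * (K * (r + 1) ^+ 2 * lifespan r)); last by ring.
rewrite mulrDl mul1r -mulrA in h2.
by split; lra.
Qed.

Section Picard.
Variable x0 : V.
Hypothesis Px0 : P x0.
Local Notation T := (lifespan (N x0)).
Local Notation rho := (N x0 + 1).

Let T0 : 0 <= T. Proof. exact/ltW/lifespan_gt0. Qed.
Let rho0 : 0 <= rho. Proof. exact: addr_ge0. Qed.

Let inball w := contT T w /\ forall t, 0 <= t <= T -> N (w t) <= rho.
(** A relation, since the antiderivative is only known to exist; choice makes it a function in
    [mild_exists]. *)
Let rel w w' := exists J, [/\ antider T (vfield w) J, J 0 = 0, forall t, P (J t) & w' = fun t => x0 + c *: J t].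

Let vfield_inball w t : inball w -> 0 <= t <= T -> P (vfield w t) /\ N (vfield w t) <= K * rho ^+ 3.
Proof.
move=> [cw bw] tT; have [Pw _] := cw t tT; split; first exact: vfield_P.
apply: le_trans (vfield_bound Pw) _; apply: ler_wpM2l => //.
by apply: lerXn2r; rewrite ?nnegrE//; exact: bw.
Qed.

Let J_lip w J : inball w -> antider T (vfield w) J ->
  forall u v, 0 <= u -> u <= v -> v <= T -> N (J v - J u) <= K * rho ^+ 3 * (v - u).
Proof.
move=> bw aJ; apply: (antider_bound aJ); first by move=> t tT; case: (vfield_inball bw tT).
by move=> t tT; case: (vfield_inball bw tT).
Qed.

Lemma picard_step w : inball w -> exists w', rel w w' /\ inball w'.
Proof.
move=> bw; have [J [aJ J0 PJ]] := antider_exists T0 (vfield_contT bw.1).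
have Lip := J_lip bw aJ; have M0 : 0 <= K * rho ^+ 3 by rewrite mulr_ge0// exprn_ge0.
have Pcx t : P (x0 + c *: J t) by apply: PD => //; exact: PZ.
exists (fun t => x0 + c *: J t); split; first by exists J.
have E u v : N (x0 + c *: J v - (x0 + c *: J u)) = N (J v - J u).
  by rewrite opprD addrACA subrr add0r -scalerBr N_hom ?c1 ?mul1r//; exact: PB.
split.
  move=> t tT; split => // e e0; exists (e / (K * rho ^+ 3 + 1)); first by rewrite divr_gt0// ltr_wpDl.
  move=> t' t'T; rewrite ltr_pdivlMr ?ltr_wpDl// => h.
  have {}h : K * rho ^+ 3 * `|t' - t| <= e.
    by apply: le_trans (ltW h); rewrite mulrC ler_wpM2l// lerDl.
  rewrite E; case/andP: tT => t0 tT; case/andP: t'T => t0' tT'.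
  case/orP : (le_total t t') => tt'.
    by apply: le_trans h; rewrite ger0_norm ?subr_ge0//; exact: Lip.
  by apply: le_trans h; rewrite distrC ger0_norm ?subr_ge0// N_opp//; exact: Lip.
move=> t /andP[t0 tT]; apply: le_trans (N_tri Px0 (PZ c (PJ t))) _.
rewrite N_hom// c1 mul1r lerD2l; have := Lip 0 t (lexx _) t0 tT; rewrite J0 !subr0 => h; apply: le_trans h _.
by apply: le_trans (lifespan_bound (N_ge0 x0)).1; apply: ler_wpM2l.
Qed.

Lemma picard_contract w1 w2 w1' w2' (D : R) : inball w1 -> inball w2 -> rel w1 w1' -> rel w2 w2' -> 0 <= D ->
  (forall t, 0 <= t <= T -> N (w1 t - w2 t) <= D) -> forall t, 0 <= t <= T -> N (w1' t - w2' t) <= D / 2.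
Proof.
move=> b1 b2 [J1 [a1 z1 P1 ->]] [J2 [a2 z2 P2 ->]] D0 h t /andP[t0 tT].
have F1 s : 0 <= s <= T -> P (vfield w1 s) by move=> sT; case: (vfield_inball b1 sT).
have F2 s : 0 <= s <= T -> P (vfield w2 s) by move=> sT; case: (vfield_inball b2 sT).
have a12 := antider_sub a1 a2 F1 F2.
have PF s : 0 <= s <= T -> P (vfield w1 s - vfield w2 s) by move=> sT; apply: PB; [exact: F1|exact: F2].
have FM s : 0 <= s <= T -> N (vfield w1 s - vfield w2 s) <= K * (2 * rho) ^+ 2 * D.
  move=> sT; have [Q1 _] := b1.1 s sT; have [Q2 _] := b2.1 s sT.
  apply: le_trans (vfield_lip Q1 Q2) _; apply: ler_pM => //; last exact: h.
    by rewrite mulr_ge0// sqr_ge0.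
  apply: ler_wpM2l => //; rewrite ler_sqr ?nnegrE ?addr_ge0 ?mulr_ge0//.
  by rewrite mulr_natl mulr2n lerD//; [exact: b1.2|exact: b2.2].
have := antider_bound a12 PF FM (lexx 0) t0 tT.
rewrite z1 z2 !subr0 => hJ.
rewrite opprD addrACA subrr add0r -scalerBr N_hom ?c1 ?mul1r; last exact: PB.
apply: le_trans hJ _; rewrite mulrAC mulrC; apply: ler_wpM2l => //.
apply: le_trans (lifespan_bound (N_ge0 x0)).2; apply: ler_wpM2l => //.
by rewrite mulr_ge0// sqr_ge0.
Qed.

(** The limit of the iteration agrees with its Picard image only up to null vectors. The image
    satisfies the integral equation literally, with a field that may be replaced by its own. *)
Lemma rel_mild w w' : inball w -> inball w' -> rel w w' ->
  (forall t, 0 <= t <= T -> N (w t - w' t) = 0) -> mild T x0 w'.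
Proof.
move=> bw bw' [J [aJ J0 PJ Ew']] ww'; split; first exact: bw'.1.
exists J; split => //; last by move=> t _; rewrite Ew' subrr N0.
apply: (antider_ext aJ); [by move=> t tT; case: (vfield_inball bw tT)|by move=> t tT; case: (vfield_inball bw' tT)|].
move=> t tT; have [Q1 _] := bw.1 t tT; have [Q2 _] := bw'.1 t tT.
apply/eqP; rewrite eq_le N_ge0 andbT; apply: le_trans (vfield_lip Q1 Q2) _.
by rewrite ww'// mulr0.
Qed.

Theorem mild_exists : exists w, mild T x0 w.
Proof.
have H w : exists w', inball w -> rel w w' /\ inball w'.
  have [bw|nb] := pselect (inball w); last by exists w.
  by have [w' h] := picard_step bw; exists w'.
have [step stepP] := choice H.
pose w n := iter n step (fun=> x0).
have bw n : inball (w n).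
  elim: n => [|n IH]; last by case: (stepP _ IH).
  split; last by move=> t _; rewrite /w /= lerDl.
  by move=> t _; split => // e e0; exists 1 => // t' _ _; rewrite /w /= subrr N0 ltW.
have rw n : rel (w n) (w n.+1) by case: (stepP _ (bw n)).
have Pw n t : 0 <= t <= T -> P (w n t) by move=> tT; case: ((bw n).1 t tT).
(* The first two iterates lie in the ball and are at most [2 * rho] apart; summing the geometric
   series doubles this to the [4 * rho] below. *)
have d1 n t : 0 <= t <= T -> N (w n.+1 t - w n t) <= (2 * rho) / 2 ^+ n.
  elim: n t => [|n IH] t tT.
    rewrite expr0 divr1; apply: le_trans (N_sub_le (Pw _ _ tT) (Pw _ _ tT)) _.
    by rewrite mulr_natl mulr2n lerD//; [exact: (bw 1%N).2|exact: (bw 0%N).2].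
  rewrite exprSr invfM mulrA; apply: (picard_contract (bw n.+1) (bw n) (rw n.+1) (rw n)) => //.
  by rewrite divr_ge0 ?mulr_ge0 ?exprn_ge0.
have dk n k t : 0 <= t <= T -> N (w (n + k)%N t - w n t) <= (2 * rho) / 2 ^+ n * (2 - 2 / 2 ^+ k).
  move=> tT; elim: k => [|k IH]; first by rewrite addn0 subrr N0 expr0 divr1 subrr mulr0.
  apply: le_trans (N_dist (Pw _ _ tT) (Pw (n + k)%N _ tT) (Pw n _ tT)) _; rewrite addnS.
  apply: le_trans (lerD (d1 _ _ tT) IH) _.
  rewrite exprD exprS le_eqVlt; apply/orP; left; apply/eqP; field.
  by rewrite !expf_neq0.
have dn n k t : 0 <= t <= T -> N (w (n + k)%N t - w n t) <= (4 * rho) / 2 ^+ n.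
  move=> tT; apply: le_trans (dk n k t tT) _.
  rewrite (_ : 4 * rho / 2 ^+ n = 2 * rho / 2 ^+ n * 2); last by ring.
  apply: ler_wpM2l; first by rewrite divr_ge0 ?mulr_ge0 ?exprn_ge0.
  by rewrite gerBl divr_ge0// exprn_ge0.
have small (e : R) : 0 < e -> exists n0, forall n, (n0 <= n)%N -> (4 * rho) / 2 ^+ n <= e.
  move=> e0; exists (Num.Def.truncn (e^-1 * (4 * rho))) => n hn.
  rewrite ler_pdivrMr ?exprn_gt0// -ler_pdivrMl//.
  apply: le_trans (ltW (truncnS_gt _)) _; apply: (@le_trans _ _ n.+1%:R); first by rewrite ler_nat ltnS.
  by rewrite -natrX ler_nat ltn_expl.
have L t : exists l, P l /\ (0 <= t <= T -> N (w n t - l) @[n --> \oo] --> (0 : R)).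
  have [tT|] := boolP (0 <= t <= T); last by exists 0.
  have [|l Pl lP] := @N_complete (fun n => w n t) (fun n => Pw n t tT); last by exists l.
  move=> e e0; have [n0 n0P] := small e e0; exists n0 => m n n0m n0n.
  case/orP: (leq_total n m) => nm.
    by apply: le_trans (n0P n n0n); rewrite -(subnKC nm); exact: dn.
  rewrite N_opp; [|exact: Pw|exact: Pw].
  by apply: le_trans (n0P m n0m); rewrite -(subnKC nm); exact: dn.
have [v vP] := choice L.
have Pv t : P (v t) by case: (vP t).
have vw n t : 0 <= t <= T -> N (w n t - v t) <= (4 * rho) / 2 ^+ n.
  move=> tT; rewrite N_opp//; last exact: Pw.
  apply: (N_lim_le (u := fun k => if (n <= k)%N then w k t else w n t) (n0 := n)) => //.
  - by move=> k; case: ifP => _; exact: Pw.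
  - exact: Pw.
  - have := (vP t).2 tT; apply: cvg_trans; apply: near_eq_cvg; exists n => // k /= nk.
    by rewrite nk.
  - by move=> k nk; rewrite nk -(subnKC nk); exact: dn.
have bv : inball v.
  split; last first.
    move=> t tT; apply/ler_addgt0Pr => e e0; have [n0 n0P] := small e e0.
    apply: le_trans (N_le (Pv t) (Pw n0 t tT)) _; apply: lerD; first exact: (bw n0).2.
    by rewrite N_opp//; [apply: le_trans (vw n0 t tT) _; exact: n0P|exact: Pw].
  move=> t tT; split => // e e0; have e3 : 0 < e / 3 by rewrite divr_gt0.
  have [n0 n0P] := small _ e3; have [_ /(_ _ e3)[d d0 dP]] := (bw n0).1 t tT.
  exists d => // t' t'T h.
  apply: le_trans (N_dist (Pv t') (Pw n0 t' t'T) (Pv t)) _.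
  apply: le_trans (lerD (lexx _) (N_dist (Pw n0 t' t'T) (Pw n0 t tT) (Pv t))) _.
  have := dP t' t'T h; have := le_trans (vw n0 t tT) (n0P n0 (leqnn _)).
  have := le_trans (vw n0 t' t'T) (n0P n0 (leqnn _)); rewrite N_opp//; last exact: Pw.
  move: (N _) (N (w n0 t' - _)) (N (w n0 t - _)) => a b q; lra.
have [rv bsv] := stepP _ bv.
(* The contraction sends [w n] and [v] to [w n.+1] and [step v], so the iterates converge to both
   [v] and [step v]. *)
exists (step v); apply: (rel_mild bv bsv rv) => t tT.
have Psv : P (step v t) by case: (bsv.1 t tT).
apply/eqP; rewrite eq_le N_ge0 andbT; apply/ler_addgt0Pr => e e0; rewrite add0r.
have e2 : 0 < e / 2 by rewrite divr_gt0.
have [n0 n0P] := small _ e2.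
have q0 : 0 <= (4 * rho) / 2 ^+ n0 by rewrite divr_ge0 ?mulr_ge0 ?exprn_ge0.
have h := picard_contract (bw n0) bv (rw n0) rv q0 (vw n0) tT.
apply: le_trans (N_dist (Pv t) (Pw n0.+1 t tT) Psv) _.
rewrite (splitr e); apply: lerD.
  rewrite N_opp//; last exact: Pw.
  by apply: le_trans (vw n0.+1 t tT) _; exact: n0P.
apply: le_trans h _; apply: le_trans (n0P n0 (leqnn _)).
by rewrite ler_pdivrMr// ler_peMr// ler1n.
Qed.

End Picard.

(** The abstract counterpart of [duhamel_solution], with equality up to null vectors. *)
Definition sol T x0 (psi : R -> V) := (forall t, 0 <= t < T -> P (psi t) /\
    forall e : R, 0 < e -> exists2 d : R, 0 < d & forall t', 0 <= t' < T -> `|t' - t| < d -> N (psi t' - psi t) <= e) /\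
  forall t, 0 <= t < T -> exists2 I, is_int 0 t (fun tau => U (t - tau) (G (psi tau))) I &
    N (psi t - (U t x0 + c *: I)) = 0.

(** The group law and linearity move [U t] out of the sum. This is how the Duhamel integral becomes
    [U t] applied to an antiderivative in the interaction picture. *)
Lemma U_riemann_sum t n (a : 'I_n -> C) (tau : 'I_n -> R) (g : R -> V) : (forall i, P (g (tau i))) ->
  N (\sum_(i < n) a i *: U (t - tau i) (g (tau i)) - U t (\sum_(i < n) a i *: U (- tau i) (g (tau i)))) = 0.
Proof.
move=> Pg; have Pg' i : P (U (- tau i) (g (tau i))) by exact: UP.
have PS : P (\sum_(i < n) a i *: U (t - tau i) (g (tau i))) by apply: Psum => i; apply: PZ; exact: UP.
have PS' : P (\sum_(i < n) a i *: U t (U (- tau i) (g (tau i)))) by apply: Psum => i; apply: PZ; exact: UP.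
have PS'' : P (U t (\sum_(i < n) a i *: U (- tau i) (g (tau i)))) by apply: UP; apply: Psum => i; exact: PZ.
apply: (eqN_trans PS PS' PS''); last by apply: eqN_sym => //; exact: U_sum.
rewrite -sumrB; apply/eqP; rewrite eq_le N_ge0 andbT; apply: le_trans (N_sum _) _.
  by move=> i; apply: PB; apply: PZ; exact: UP.
rewrite big1// => i _; apply: eqN_Z; [exact: UP|exact: UP|exact: UD].
Qed.

Lemma mild_sol T x0 w : P x0 -> mild T x0 w -> sol T x0 (fun t => U t (w t)).
Proof.
move=> Px0 [cw [J [aJ J0 PJ wJ]]].
have sub t : 0 <= t < T -> 0 <= t <= T by move=> /andP[-> /ltW].
have cU := @U_contT T (fun t => t) w (fun _ _ => erefl) cw.
split.
  move=> t /sub tT; have [Pt h] := cU t tT; split => // e e0; have [d d0 dP] := h e e0.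
  by exists d => // t' /sub t'T; exact: dP.
move=> t /sub tT; exists (U t (J t)); last first.
  have Pw := (cw t tT).1; have PcJ := PZ c (PJ t); have Px := PD Px0 PcJ.
  have h := U_ae t Pw Px (wJ t tT).
  have h' := Ulin t c (PJ t) Px0; rewrite [_ + x0]addrC [_ + U t x0]addrC in h'.
  by apply: (eqN_trans _ _ _ h h'); [exact: UP|exact: UP|apply: PD; [exact: UP|apply: PZ; exact: UP]].
have inT tau : 0 <= tau <= t -> 0 <= tau <= T.
  by case/andP: tT => t0 tT /andP[-> /le_trans]; apply.
have PGw tau : 0 <= tau <= t -> P (G (U tau (w tau))).
  by move=> /inT h; apply: PG; apply: UP; case: (cw tau h).
split; [by move=> tau h; apply: UP; exact: PGw|exact: UP|].
move=> eps e0; have e2 : 0 < eps / 2 by rewrite divr_gt0.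
have [d d0 dP] := riemann_antider aJ (vfield_contT cw) tT e2.
exists d => // p tag ip tagP; have := dP p tag ip tagP; rewrite J0 subr0.
have tg i : (i < size p)%N -> 0 <= tag i <= t.
  move=> si; have [h1 h2 h3] := partition_step ip si; have [/andP[h4 h5] _] := tagP i si.
  by rewrite (le_trans h1 h4) (le_trans h5).
have Pgi (i : 'I_(size p)) : P (G (U (tag i) (w (tag i)))) by apply: PGw; exact: tg.
have := U_riemann_sum t (fun i : 'I_(size p) => (nth t (0 :: p) i.+1 - nth t (0 :: p) i)%:C)
  (tau := fun i => tag i) (g := fun tau => G (U tau (w tau))) Pgi.
set S := \sum_(i < size p) _ *: U (t - tag i) _; set S' := \sum_(i < size p) _ *: U (- tag i) _ => SS'.
change (N (S' - J t) <= eps / 2 -> N (S - U t (J t)) < eps) => h.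
have PS : P S by apply: Psum => i; apply: PZ; exact: UP.
have PS' : P S' by apply: Psum => i; apply: PZ; exact: UP.
apply: le_lt_trans (N_dist PS (UP t PS') (UP t (PJ t))) _.
rewrite SS' add0r U_isom//; apply: le_lt_trans h _.
by rewrite ltr_pdivrMr// ltr_pMr// ltr1n.
Qed.

(** A solution lives on a half-open interval, so uniform continuity is available on [[0, T']] with
    [T' < T]. Integral and antiderivative are compared through a single partition, tagged at left
    endpoints and fine enough for both. *)
Lemma sol_mild T x0 psi T' : P x0 -> sol T x0 psi -> 0 <= T' -> T' < T ->
  contT T' (fun t => U (- t) (psi t)) /\ exists J, [/\ antider T' (vfield (fun t => U (- t) (psi t))) J, J 0 = 0,
    forall t, P (J t) & forall t, 0 <= t <= T' -> N (U (- t) (psi t) - (x0 + c *: J t)) = 0].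
Proof.
move=> Px0 [cpsi ipsi] T'0 T'T.
have sub t : 0 <= t <= T' -> 0 <= t < T by move=> /andP[-> /le_lt_trans]; apply.
have cp : contT T' psi.
  move=> t /sub tT; have [Pt h] := cpsi t tT; split => // e e0; have [d d0 dP] := h e e0.
  by exists d => // t' /sub t'T; exact: dP.
have cw : contT T' (fun t => U (- t) (psi t)).
  by apply: (@U_contT T' (fun t => - t)) => // t t'; rewrite -opprD normrN.
split => //; have cv := vfield_contT cw.
have [J [aJ J0 PJ]] := antider_exists T'0 cv; exists J; split => // t tT'.
have [I [PI0 PI IP] psiI] := ipsi t (sub t tT').
have Ppsi s : 0 <= s <= T' -> P (psi s) by move=> /cp[].
have JI : N (I - U t (J t)) = 0.
  apply/eqP; rewrite eq_le N_ge0 andbT; apply/ler_addgt0Pr => e e0; rewrite add0r.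
  have e2 : 0 < e / 2 by rewrite divr_gt0.
  have [d d0 dP] := IP _ e2; have [d' d0' dP'] := riemann_antider aJ cv tT' e2.
  have m0 : 0 < Num.min d d' by rewrite lt_min d0.
  have [p [ip pd]] : exists p : seq R, itv_partition 0 t p /\
      forall i, (i < size p)%N -> nth t (0 :: p) i.+1 - nth t (0 :: p) i < Num.min d d'.
    (* At [t = 0] the partition is empty. *)
    case/andP: tT'; rewrite le_eqVlt => /orP[/eqP <- _|t0 _]; last exact: fine_partition.
    by exists [::].
  pose tag i := nth t (0 :: p) i.
  have tagP i : (i < size p)%N -> [/\ tag i <= tag i <= nth t (0 :: p) i.+1, nth t (0 :: p) i.+1 - tag i < d,
      nth t (0 :: p) i.+1 - tag i < d' & 0 <= tag i <= T'].
    move=> si; have [h1 h2 h3] := partition_step ip si; have := pd i si; rewrite lt_min => /andP[l1 l2].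
    split => //; first by rewrite lexx.
    by rewrite /tag h1 (le_trans h2)// (le_trans h3)//; case/andP: tT'.
  have h1 := dP p tag ip (fun i si => let: And4 a b _ _ := tagP i si in conj a b).
  have h2 := dP' p tag ip (fun i si => let: And4 a _ b _ := tagP i si in conj a b).
  rewrite J0 subr0 in h2.
  have Pps (i : 'I_(size p)) : P (psi (tag i)) by have [_ _ _ /Ppsi] := tagP i (ltn_ord i).
  have Pgi (i : 'I_(size p)) : P (G (psi (tag i))) by exact: PG.
  have := U_riemann_sum t (fun i : 'I_(size p) => (nth t (0 :: p) i.+1 - nth t (0 :: p) i)%:C)
    (tau := fun i => tag i) (g := fun tau => G (psi tau)) Pgi.
  move: h1 h2.
  set S := \sum_(i < size p) _ *: U (t - tag i) _; set S'' := \sum_(i < size p) _ *: vfield _ (tag i).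
  set S' := \sum_(i < size p) _ *: U (- tag i) _ => h1 h2 SS'.
  have PS : P S by apply: Psum => i; apply: PZ; exact: UP.
  have PS' : P S' by apply: Psum => i; apply: PZ; exact: UP.
  have Pvi (i : 'I_(size p)) : P (vfield (fun t => U (- t) (psi t)) (tag i)) by apply: vfield_P; exact: UP.
  have PS'' : P S'' by apply: Psum => i; exact: PZ.
  (* The field evaluates the nonlinearity at [U (tag i) (U (- tag i) (psi (tag i)))], which agrees
     with [psi (tag i)] only up to a null vector. *)
  have SS'' : N (S' - S'') = 0.
    rewrite -sumrB; apply/eqP; rewrite eq_le N_ge0 andbT; apply: le_trans (N_sum _) _.
      by move=> i; apply: PB; apply: PZ => //; exact: UP.
    rewrite big1// => i _; apply: eqN_Z; [exact: UP|exact: Pvi|].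
    rewrite /vfield; apply: U_ae; [exact: PG|by apply: PG; apply: UP; exact: UP|].
    apply: eqN_sym; [by apply: PG; apply: UP; exact: UP|exact: PG|].
    by apply: G_ae; [apply: UP; exact: UP|exact: Pps|exact: U_inv].
  rewrite N_opp//; last exact: UP.
  apply: le_trans (N_dist (UP t (PJ t)) (UP t PS') PI) _.
  rewrite (splitr e) addrC; apply: lerD.
    rewrite N_opp//; last exact: UP.
    apply: le_trans (N_dist PI PS (UP t PS')) _.
    by rewrite SS' addr0 N_opp//; exact: ltW.
  rewrite U_isom// N_opp//.
  by apply: le_trans (N_dist PS' PS'' (PJ t)) _; rewrite SS'' add0r.
have Pt := Ppsi t tT'; have PU := UP t Px0; have PcI := PZ c PI; have PUJ := UP t (PJ t).
have Pa : P (U t x0 + c *: I) by exact: PD.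
have Pb : P (U t x0 + c *: U t (J t)) by apply: PD => //; exact: PZ.
have Pc : P (x0 + c *: J t) by apply: PD => //; exact: PZ.
have e1 : N (U t x0 + c *: I - (U t x0 + c *: U t (J t))) = 0.
  by apply: eqN_D => //; [exact: PZ|by rewrite subrr N0|exact: eqN_Z].
have e2 : N (U t x0 + c *: U t (J t) - U t (x0 + c *: J t)) = 0.
  have h := Ulin t c (PJ t) Px0; rewrite [_ + x0]addrC [_ + U t x0]addrC in h.
  by apply: eqN_sym => //; exact: UP.
have e3 := eqN_trans Pt Pa Pb psiI e1.
have e4 := eqN_trans Pt Pb (UP t Pc) e3 e2.
have e5 := U_ae (- t) Pt (UP t Pc) e4.
by apply: (eqN_trans _ _ _ e5 (U_invN t Pc)) => //; apply: UP => //; exact: UP.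
Qed.

Lemma exp_increment (lam u v : R) : lam * (v - u) * expR (lam * u) <= expR (lam * v) - expR (lam * u).
Proof.
have -> : expR (lam * v) = expR (lam * (v - u)) * expR (lam * u) by rewrite -expRD -mulrDr subrK.
by rewrite -[X in _ <= _ - X]mul1r -mulrBl; apply: ler_wpM2r; [exact: expR_ge0|rewrite lerBrDl expR_ge1Dx].
Qed.

(** Gronwall's lemma as an iteration: on [[0, t0]] both solutions are bounded, and under the weight
    [expR (lam * t)] each use of the integral equation halves the bound on their difference. *)
Theorem sol_unique T x0 psi phi : P x0 -> sol T x0 psi -> sol T x0 phi ->
  forall t, 0 <= t < T -> N (phi t - psi t) = 0.
Proof.
move=> Px0 spsi sphi t0 /andP[t00 t0T].
have [c2 [J2 [a2 z2 PJ2 e2]]] := sol_mild Px0 spsi t00 t0T.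
have [c1' [J1 [a1 z1 PJ1 e1]]] := sol_mild Px0 sphi t00 t0T.
have [B1 B10 B1P] := contT_bounded t00 c1'; have [B2 B20 B2P] := contT_bounded t00 c2.
set w1 := fun t => U (- t) (phi t) in c1' a1 e1 B1P *; set w2 := fun t => U (- t) (psi t) in c2 a2 e2 B2P *.
pose L := K * (B1 + B2) ^+ 2; have L0 : 0 <= L by rewrite mulr_ge0// sqr_ge0.
(* [lam >= 2 * L] yields the factor 1/2, and the summand 1 allows division by [lam]. *)
pose lam := 2 * L + 1; have lam0 : 0 < lam by rewrite ltr_wpDl// mulr_ge0.
have P1 t : 0 <= t <= t0 -> P (w1 t) by move=> /c1'[].
have P2 t : 0 <= t <= t0 -> P (w2 t) by move=> /c2[].
have F1 s : 0 <= s <= t0 -> P (vfield w1 s) by move=> h; apply: vfield_P; exact: P1.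
have F2 s : 0 <= s <= t0 -> P (vfield w2 s) by move=> h; apply: vfield_P; exact: P2.
have PF s : 0 <= s <= t0 -> P (vfield w1 s - vfield w2 s) by move=> h; apply: PB; [exact: F1|exact: F2].
have key n t : 0 <= t <= t0 -> N (w1 t - w2 t) <= (B1 + B2) / 2 ^+ n * expR (lam * t).
  elim: n t => [|n IH] t tT.
    rewrite expr0 divr1; apply: le_trans (N_sub_le (P1 t tT) (P2 t tT)) _.
    apply: (@le_trans _ _ (B1 + B2)); first by apply: lerD; [exact: B1P|exact: B2P].
    rewrite ler_peMr ?addr_ge0// -expR0 ler_expR mulr_ge0// ?(ltW lam0)//; by case/andP: tT.
  set D := (B1 + B2) / 2 ^+ n; have D0 : 0 <= D by rewrite divr_ge0 ?addr_ge0// exprn_ge0.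
  have LD0 : 0 <= lam^-1 * (L * D) by apply: mulr_ge0; [rewrite invr_ge0 ltW|exact: mulr_ge0].
  pose m s := L * D * expR (lam * s); pose ph s := lam^-1 * (L * D) * expR (lam * s).
  have Fm s : 0 <= s <= t0 -> N (vfield w1 s - vfield w2 s) <= m s.
    move=> sT; apply: le_trans (vfield_lip (P1 s sT) (P2 s sT)) _.
    rewrite /m -[leRHS]mulrA; apply: ler_pM => //; [by rewrite mulr_ge0// sqr_ge0| |exact: IH].
    apply: ler_wpM2l => //; rewrite ler_sqr ?nnegrE ?addr_ge0//.
    by apply: lerD; [exact: B1P|exact: B2P].
  have mph u v : 0 <= u -> u <= v -> v <= t0 -> (v - u) * m u <= ph v - ph u.
    move=> _ uv _; rewrite /ph /m -mulrBr.
    rewrite (_ : (v - u) * (L * D * expR (lam * u)) = lam^-1 * (L * D) * (lam * (v - u) * expR (lam * u))); last first.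
      by field; rewrite gt_eqF.
    by apply: ler_wpM2l; [exact: LD0|exact: exp_increment].
  case/andP: (tT) => t0' tT'.
  have := antider_le (antider_sub a1 a2 F1 F2) PF Fm mph (lexx 0) t0' tT'.
  rewrite z1 z2 !subr0 => hJ.
  have Q1 : P (x0 + c *: J1 t) by apply: PD => //; exact: PZ.
  have Q2 : P (x0 + c *: J2 t) by apply: PD => //; exact: PZ.
  apply: le_trans (N_dist (P1 t tT) Q1 (P2 t tT)) _; rewrite e1// add0r.
  apply: le_trans (N_dist Q1 Q2 (P2 t tT)) _; rewrite [N (_ - w2 t)]N_opp//; last exact: P2.
  rewrite e2// addr0 opprD addrACA subrr add0r -scalerBr N_hom ?c1 ?mul1r; last exact: PB.
  apply: le_trans hJ _; apply: (@le_trans _ _ (ph t)).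
    by rewrite gerBl; apply: mulr_ge0; [exact: LD0|exact: expR_ge0].
  have -> : (B1 + B2) / 2 ^+ n.+1 = 2^-1 * D by rewrite /D exprSr invfM mulrA mulrC.
  apply: ler_wpM2r; first exact: expR_ge0.
  rewrite mulrA; apply: ler_wpM2r => //.
  by rewrite mulrC ler_pdivrMr// mulrC ler_pdivlMr// /lam; lra.
have t00T : 0 <= t0 <= t0 by rewrite t00 lexx.
have wz : N (w1 t0 - w2 t0) = 0.
  apply/eqP; rewrite eq_le N_ge0 andbT; apply/ler_addgt0Pr => e e0; rewrite add0r.
  pose M := (B1 + B2) * expR (lam * t0).
  apply: le_trans (key (Num.Def.truncn (e^-1 * M)) t0 t00T) _.
  rewrite mulrAC -/M ler_pdivrMr ?exprn_gt0// -ler_pdivrMl//.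
  apply: le_trans (ltW (truncnS_gt _)) _.
  by rewrite -natrX ler_nat ltn_expl.
have Pphi : P (phi t0) by case: (sphi.1 t0 _); rewrite ?t00.
have Ppsi : P (psi t0) by case: (spsi.1 t0 _); rewrite ?t00.
by rewrite -(U_isom (- t0) Pphi Ppsi).
Qed.

Theorem local_wellposedness : exists T : R -> R, (forall r, 0 <= r -> 0 < T r) /\
  forall x0, P x0 -> exists2 psi, sol (T (N x0)) x0 psi &
    forall phi, sol (T (N x0)) x0 phi -> forall t, 0 <= t < T (N x0) -> N (phi t - psi t) = 0.
Proof.
exists lifespan; split; first exact: lifespan_gt0.
move=> x0 Px0; have [w mw] := mild_exists Px0; have s := mild_sol Px0 mw.
by exists (fun t => U t (w t)) => // phi sphi; exact: sol_unique Px0 s sphi.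
Qed.

End SeminormedODE.

(** * Weak derivatives and Fourier multipliers *)

Section PlaneFunctions.
Context {R : realType}.
Local Notation mR := (measurableTypeR R).
Local Notation R2 := (mR * mR)%type.
Local Notation C := R[i].
Local Notation "x %:C" := (real_complex R x).

Lemma near_common_point (x y a q d : R) : 2 * q <= d -> x - q < a -> a < x + q -> a - q < y -> y < a + q ->
  `|x - y| < d.
Proof. by move=> *; rewrite ltr_norml; apply/andP; split; lra. Qed.

(** The plane carries the product sigma-algebra, so an open set is written as a countable union of
    squares with rational centres and half-widths [1/(n+1)]. This makes continuous test functions
    measurable. *)
Lemma open_measurable_plane (A : set (R * R)) : open A -> measurable (A : set R2).
Proof.
move=> oA.
pose B (i : rat * rat * nat) : set R2 :=
  [set` `](ratr i.1.1 - i.2.+1%:R^-1), (ratr i.1.1 + i.2.+1%:R^-1)[ : interval R] `*`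
  [set` `](ratr i.1.2 - i.2.+1%:R^-1), (ratr i.1.2 + i.2.+1%:R^-1)[ : interval R].
have mB i : measurable (B i) by apply: measurableX; exact: measurable_itv.
rewrite (_ : A = \bigcup_i (if pselect (B i `<=` A) then B i else set0)); last first.
  apply/seteqP; split => x; last first.
    by move=> [i _]; case: pselect => // h /h.
  move=> Ax; have : nbhs x A by exact: open_nbhs_nbhs.
  move=> /nbhs_ballP[d /= d0 dA].
  have [n nd] : exists n : nat, 2 * n.+1%:R^-1 <= d :> R.
    exists (Num.Def.truncn (2 / d)); rewrite ler_pdivrMr// mulrC -ler_pdivrMr//.
    exact: ltW (truncnS_gt _).
  have e0 : 0 < n.+1%:R^-1 :> R by rewrite invr_gt0.
  have lt (y : R) : y - n.+1%:R^-1 < y + n.+1%:R^-1 by rewrite ltrBlDr -addrA ltrDl addr_gt0.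
  have [a /itvP a1] := rat_in_itvoo (lt x.1).
  have [b /itvP b1] := rat_in_itvoo (lt x.2).
  have ha : x.1 - n.+1%:R^-1 < ratr a /\ ratr a < x.1 + n.+1%:R^-1 by rewrite !a1.
  have hb : x.2 - n.+1%:R^-1 < ratr b /\ ratr b < x.2 + n.+1%:R^-1 by rewrite !b1.
  have BA : B (a, b, n) `<=` A.
    move=> y [/=]; rewrite !in_itv /= => /andP[y1 y2] /andP[y3 y4]; apply: dA.
    by split; [exact: near_common_point nd ha.1 ha.2 y1 y2|exact: near_common_point nd hb.1 hb.2 y3 y4].
  exists (a, b, n) => //; case: pselect => // h.
  by case: ha hb => a2 a3 [b2 b3]; split; rewrite /= in_itv /=; apply/andP; split; [rewrite ltrBlDr|rewrite -ltrBlDr|rewrite ltrBlDr|rewrite -ltrBlDr].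
apply: countable_bigcupT_measurable => [|i]; first exact: countableP.
case: pselect => h; [exact: mB|exact: measurable0].
Qed.

Lemma continuous_measurable_plane (f : R * R -> R) : continuous f -> measurable_fun [set: R2] (f : R2 -> R).
Proof.
move=> /continuousP cf; apply: (measurability _ (RGenOpens.measurableE R)).
move=> _ [_ [a [b ->] <-]]; rewrite setTI; apply: open_measurable_plane.
exact/cf/interval_open.
Qed.

Lemma compact_bounded_fun (T : topologicalType) (K : set T) (f : T -> R) : compact K -> continuous f ->
  exists M, forall x, K x -> `|f x| <= M.
Proof.
move=> cK cf; have : compact (f @` K).
  by apply: continuous_compact => //; exact: continuous_subspaceT.
move=> /compact_bounded[M [_ /(_ (M + 1))]]; rewrite ltrDl ltr01 => /(_ isT) h.
by exists (M + 1) => x Kx; apply: h; exists x.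
Qed.

Lemma compact_sub_square (K : set (R * R)) : compact K -> exists N, K `<=` square N.
Proof.
move=> cK.
have [M1 h1] := compact_bounded_fun cK (fun x => @cvg_fst _ _ (nbhs x.1) (nbhs x.2) _ : {for x, continuous fst}).
have [M2 h2] := compact_bounded_fun cK (fun x => @cvg_snd _ _ (nbhs x.1) (nbhs x.2) _ : {for x, continuous snd}).
exists (Num.Def.truncn (Num.max M1 M2)).+1 => x Kx.
have le : Num.max M1 M2 <= (Num.Def.truncn (Num.max M1 M2)).+1%:R by exact: ltW (truncnS_gt _).
by apply: mem_square; apply: le_trans le; rewrite le_max ?h1 ?h2 ?orbT.
Qed.

Lemma compact_square N : compact (square N : set (R * R)).
Proof. by apply: compact_setX; exact: segment_compact. Qed.

Lemma is_derive_line (f : R * R -> R) (e x : R * R) (r : R) : (forall y, derivable f y e) ->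
  is_derive r 1 (fun r => f (r *: e + x)) ('D_e f (r *: e + x)).
Proof.
move=> df; have E : (fun h : R => h^-1 *: (((fun r => f (r *: e + x)) \o shift r) (h *: 1) - f (r *: e + x))) =
    (fun h => h^-1 *: ((f \o shift (r *: e + x)) (h *: e) - f (r *: e + x))).
  apply/funext => h /=; congr (_ *: (f _ - _)).
  by rewrite /shift /= [h *: 1]mulr1 scalerDl addrA.
split; first by rewrite /derivable E; exact: df.
by rewrite /derive E.
Qed.

Definition dquot (e : R * R) (f : R * R -> R) (n : nat) (x : R * R) : R :=
  n.+1%:R * (f (n.+1%:R^-1 *: e + x) - f x).

Lemma cvg_dquot e f x : derivable f x e -> dquot e f n x @[n --> \oo] --> 'D_e f x.
Proof.
move=> df.
have c : (n.+1%:R^-1 : R) @[n --> \oo] --> (0 : R)^'.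
  move=> A A0.
  have : \forall n \near \oo, (n.+1%:R^-1 : R) != 0 -> A n.+1%:R^-1 := @cvg_harmonic R _ A0.
  by apply: filterS => n; apply; rewrite gt_eqF// invr_gt0.
have := cvg_comp _ _ c df.
by apply: cvg_trans; apply: near_eq_cvg; apply: nearW => n; rewrite /dquot /= invrK.
Qed.

(** Steps have length at most 1 in each coordinate, so the supports of all quotients stay in one
    larger square. *)
Lemma dquot_square e f N : `|e.1| <= 1 -> `|e.2| <= 1 -> (forall x, ~ square N x -> f x = 0) ->
  forall n x, ~ square N.+1 x -> dquot e f n x = 0.
Proof.
move=> e1 e2 f0 n x nx; have h0 : 0 <= n.+1%:R^-1 :> R by [].
have h1 : n.+1%:R^-1 <= 1 :> R by rewrite invf_le1// ler1n.
have split_norm y1 y2 (s : R) : `|s| <= 1 -> `|n.+1%:R^-1 * s + y1| <= y2 -> `|y1| <= y2 + 1.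
  move=> s1 h; rewrite -[y1](addKr (n.+1%:R^-1 * s)) addrC; apply: le_trans (ler_normD _ _) _; apply: lerD => //.
  by rewrite normrN normrM ger0_norm//; exact: mulr_ile1.
rewrite /dquot !f0 ?subrr ?mulr0//.
- by move=> h; apply: nx; have /subsetPset := @nd_square R _ _ (leqnSn N); apply.
- move=> [/=]; rewrite !in_itv /= -!ler_norml => a b; apply: nx; apply: mem_square.
    by rewrite -natr1; exact: split_norm e1 a.
  by rewrite -natr1; exact: split_norm e2 b.
Qed.

(** Mean value theorem along a segment that may leave [square N.+1] by at most one unit, hence
    [N.+2]. *)
Lemma dquot_bound e f N M : `|e.1| <= 1 -> `|e.2| <= 1 -> (forall y, derivable f y e) ->
  (forall y, square N.+2 y -> `|'D_e f y| <= M) ->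
  forall n x, square N.+1 x -> `|dquot e f n x| <= M.
Proof.
move=> e1 e2 df dM n x nx; have h0 : 0 <= n.+1%:R^-1 :> R by [].
have h1 : n.+1%:R^-1 <= 1 :> R by rewrite invf_le1// ler1n.
have [] := @MVT_segment R (fun r => f (r *: e + x)) (fun r => 'D_e f (r *: e + x)) 0 n.+1%:R^-1 h0.
- by move=> r _; exact: is_derive_line.
- apply: continuous_subspaceT => r; apply/differentiable_continuous/derivable1_diffP.
  by case: (is_derive_line x r df).
move=> r; rewrite in_itv /= => /andP[r0 r1]; rewrite scale0r add0r subr0 => E.
rewrite /dquot E mulrC mulrAC -mulrA mulfV ?mulr1//; apply: dM.
have rr s : `|s| <= 1 -> `|r * s| <= 1.
  by move=> s1; rewrite normrM mulr_ile1//; rewrite ger0_norm// (le_trans r1).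
case: nx => /=; rewrite !in_itv /= -!ler_norml => a b; apply: mem_square.
  by rewrite /= -[N.+2%:R]natr1 addrC; apply: le_trans (ler_normD _ _) _; apply: lerD => //; exact: rr.
by rewrite /= -[N.+2%:R]natr1 addrC; apply: le_trans (ler_normD _ _) _; apply: lerD => //; exact: rr.
Qed.

Lemma isL2_bounded_square (f : R * R -> R) N (M : R) : measurable_fun [set: R2] (f : R2 -> R) ->
  (forall x, ~ square N x -> f x = 0) -> (forall x, square N x -> `|f x| <= M) ->
  isL2 mu2 (fun x => (f x)%:C).
Proof.
move=> mf f0 fM.
have s2 := isL2_indic (measurable_square N) (leb2_square_lty N : (mu2 (square N) < +oo)%E).
apply: (isL2_le (cmeas_real mf) (isL2Z M%:C (s2 R))) => x.
rewrite normcM !normc_real indicE; case: (boolP (x \in square N)) => [/set_mem|/negP] h.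
  by rewrite normr1 mulr1; apply: le_trans (fM x h) _; exact: ler_norm.
by rewrite f0 ?normr0 ?mulr0// => hx; apply: h; exact: mem_set.
Qed.

Lemma dquot_L2 e f N : `|e.1| <= 1 -> `|e.2| <= 1 -> continuous f -> (forall y, derivable f y e) ->
  continuous ('D_e f) -> (forall x, ~ square N x -> f x = 0) ->
  [/\ isL2 mu2 (fun x => (f x)%:C), isL2 mu2 (fun x => ('D_e f x)%:C),
   (forall n, isL2 mu2 (fun x => (dquot e f n x)%:C)) &
   n2cvg (fun n x => (dquot e f n x)%:C) (fun x => ('D_e f x)%:C)].
Proof.
move=> e1 e2 cf df cD f0.
have [M0 M0P] := compact_bounded_fun (@compact_square N) cf.
have [M MP] := compact_bounded_fun (@compact_square N.+2) cD.
have q0 := dquot_square e1 e2 f0.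
have qM := dquot_bound e1 e2 df MP.
have D0 x : ~ square N.+1 x -> 'D_e f x = 0.
  move=> nx; have := cvg_dquot (df x); rewrite (_ : (fun n => dquot e f n x) = fun=> 0); last first.
    by apply/funext => n; exact: q0.
  by move=> h; apply/esym; exact: (cvg_unique _ (cvg_cst (0 : R)) h).
have sub : square N.+1 `<=` @square R N.+2 by have /subsetPset := @nd_square R _ _ (leqnSn N.+1).
have mf := continuous_measurable_plane cf.
have mz n : measurable_fun [set: R2] (fun x : R2 => (n.+1%:R^-1 *: e + x : R * R) : R2).
  rewrite (_ : (fun x => _) = tshift (n.+1%:R^-1 *: e)); last by apply/funext => x; rewrite /tshift addrC.
  by case: (mpres_tshift (n.+1%:R^-1 *: e)).
have mq n : measurable_fun [set: R2] (dquot e f n : R2 -> R).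
  apply: measurable_funM => //; apply: measurable_funB => //.
  exact: measurableT_comp mf (mz n).
have mD := continuous_measurable_plane cD.
split.
- exact: isL2_bounded_square mf f0 M0P.
- by apply: isL2_bounded_square mD D0 _ => x /sub; exact: MP.
- by move=> n; apply: isL2_bounded_square (mq n) (q0 n) (qM n).
have s2 := isL2_indic (measurable_square N.+1) (leb2_square_lty N.+1 : (mu2 (square N.+1) < +oo)%E).
apply: (n2_dct (isL2Z (2 * M)%:C (s2 R))).
- by move=> n; apply: cmeasB; apply: cmeas_real.
- apply: ae_all => x; rewrite (_ : (fun n => _) = fun n => `|dquot e f n x - 'D_e f x|); last first.
    by apply/funext => n; rewrite -rmorphB normc_real.
  by apply/norm_cvg0P; apply/subr_cvg0; exact: cvg_dquot.
move=> n x; rewrite -rmorphB normcM !normc_real indicE; case: (boolP (x \in square N.+1)) => [/set_mem|/negP] h.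
  rewrite normr1 mulr1; apply: le_trans (ler_norm _); apply: le_trans (ler_normB _ _) _.
  by rewrite mulr_natl mulr2n lerD//; [exact: qM|apply: MP; exact: sub].
have nh : ~ square N.+1 x by move=> hx; apply: h; exact: mem_set.
by rewrite D0// q0// subrr normr0 mulr_ge0.
Qed.

Lemma normr_sin_le (t : R) : `|sin t| <= `|t|.
Proof.
wlog t0 : t / 0 <= t.
  move=> H; case/orP : (le_total 0 t) => h; first exact: H.
  by have := H (- t); rewrite sinN !normrN; apply; rewrite oppr_ge0.
have [|c _] := @MVT_segment R sin cos 0 t t0 (fun x _ => is_derive_sin x).
  by apply: continuous_subspaceT; exact: continuous_sin.
rewrite sin0 !subr0 => ->; rewrite normrM ler_piMl// ler_norml cos_geN1 cos_le1//.
Qed.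

Lemma cos_ge_quadratic (t : R) : 1 - cos t <= t ^+ 2 / 2.
Proof.
have -> : 1 - cos t = 2 * sin (t / 2) ^+ 2.
  have := cos2Dsin2 (t / 2); have -> : cos t = cos (t / 2) ^+ 2 - sin (t / 2) ^+ 2.
    by rewrite {1}(splitr t) cosD -!expr2.
  by move=> h; rewrite -{1}h; ring.
have : sin (t / 2) ^+ 2 <= (t / 2) ^+ 2.
  by rewrite -(real_normK (num_real (sin _))) -[leRHS](real_normK (num_real _)) ler_sqr ?nnegrE// normr_sin_le.
by move: (sin _ ^+ 2) => s; lra.
Qed.

Lemma normc_cis_sub1 (t : R) : normc (cis t - 1) <= `|t|.
Proof.
rewrite -(@ler_sqr _ (normc _)) ?nnegrE ?normc_ge0// sqr_normcE real_normK ?num_real// /= oppr0 addr0.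
have := cos2Dsin2 t; have := cos_ge_quadratic t; move: (cos t) (sin t) => c s; nra.
Qed.

(** The remainder only has to be [o(t)]; the cubic term is a crude bound for the sine. *)
Lemma normc_cis_taylor (t : R) : normc (cis t - 1 - imunit * t%:C) <= t ^+ 2 / 2 + `|t| ^+ 3 / 2.
Proof.
apply: le_trans (normc_ReIm _) _.
have -> : complex.Re (cis t - 1 - imunit * t%:C) = cos t - 1.
  by rewrite /=; ring.
have -> : complex.Im (cis t - 1 - imunit * t%:C) = sin t - t.
  by rewrite /=; ring.
apply: lerD.
  by rewrite distrC ger0_norm ?subr_ge0 ?cos_le1// cos_ge_quadratic.
wlog t0 : t / 0 <= t.
  move=> H; case/orP : (le_total 0 t) => h; first exact: H.
  by have := H (- t); rewrite sinN -opprD !normrN; apply; rewrite oppr_ge0.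
have dsin (x : R) : is_derive x 1 (fun x => sin x - x) (cos x - 1) by exact: is_deriveB.
have [|c] := @MVT_segment R (fun x => sin x - x) (fun x => cos x - 1) 0 t t0 (fun x _ => dsin x).
  apply: continuous_subspaceT => x; apply/differentiable_continuous/derivable1_diffP; by case: (dsin x).
rewrite in_itv /= sin0 !subr0 => /andP[c0 ct] ->.
rewrite normrM (ger0_norm t0) exprSr mulrAC; apply: ler_wpM2r => //.
rewrite distrC ger0_norm ?subr_ge0 ?cos_le1//; apply: le_trans (cos_ge_quadratic c) _.
by apply: ler_wpM2r => //; rewrite ler_sqr ?nnegrE.
Qed.

Lemma scaled_cancel (K : comPzRingType) (p q j A t : K) : p * q = 1 -> p * A + j * t = p * (A - j * - (q * t)).
Proof. by move=> pq; transitivity (p * A + (p * q) * (j * t)); [rewrite pq mul1r|ring]. Qed.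

(** A change of variables moves the difference quotient from [theta] to [f]. There its Fourier
    multiplier tends to [- imunit * dot xi e] and is dominated by [|dot xi e|], so the quotients of
    [f] converge to [- d] in [L2]. *)
Lemma weak_derivative_fourier (e : R * R) (f fh d : R * R -> C) : `|e.1| <= 1 -> `|e.2| <= 1 ->
  is_fourier2 f fh -> is_fourier2 d (fun xi => imunit * (dot xi e)%:C * fh xi) ->
  forall theta : R * R -> R, continuous theta -> (forall y, derivable theta y e) -> continuous ('D_e theta) ->
  (exists K, compact K /\ forall x, ~ K x -> theta x = 0) ->
  cintegral (fun x => f x * ('D_e theta x)%:C) = - cintegral (fun x => d x * (theta x)%:C).
Proof.
move=> e1 e2 hf hd theta ct dt cD [K [cK K0]].
have [N KN] := compact_sub_square cK.
have t0 x : ~ square N x -> theta x = 0 by move=> h; apply: K0 => /KN.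
have [th2 D2 q2 qc] := dquot_L2 e1 e2 ct dt cD t0.
have [f2 fh2] := fourier2_isL2 hf; have [d2 dh2] := fourier2_isL2 hd.
pose z n : R2 := (- (n.+1%:R^-1 * e.1), - (n.+1%:R^-1 * e.2)).
pose F n x := n.+1%:R%:C * (f (tshift (z n) x) - f x).
pose Fh n xi := n.+1%:R%:C * ((cis (dot xi (z n)) - 1) * fh xi).
have hF n : is_fourier2 (F n) (Fh n).
  have h := fourier2_lin (-1) hf (fourier2_translation (z n) hf).
  (* [fourier2_lin] adds its second function unscaled, so the factor [n.+1] is obtained as
     [(n.+1 - 1) + 1]. *)
  have := fourier2_lin (n.+1%:R%:C - 1) h h.
  rewrite (_ : (fun x => _ * (-1 * f x + _) + _) = F n); last by apply/funext => x; rewrite /F; ring.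
  by rewrite (_ : (fun x => _ * (-1 * fh x + _) + _) = Fh n)//; apply/funext => x; rewrite /Fh; ring.
have F2 n : isL2 mu2 (F n) by case: (fourier2_isL2 (hF n)).
have Fc : n2cvg F (fun x => - d x).
  have hs n : n2 mu2 (fun x => F n x - - d x) = n2 mu2 (fun xi => Fh n xi + imunit * (dot xi e)%:C * fh xi).
    have := fourier2_n2 (fourier2_lin 1 (hF n) hd).
    rewrite (_ : (fun x => 1 * F n x + d x) = fun x => F n x - - d x); last by apply/funext => x; rewrite opprK mul1r.
    by move=> <-; congr n2; apply/funext => x; rewrite mul1r.
  rewrite /n2cvg; under eq_fun do rewrite hs.
  have zdot n xi : dot xi (z n) = - (n.+1%:R^-1 * dot xi e) by rewrite /dot /z /=; move: (n.+1%:R^-1) => q; ring.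
  have hn n : n.+1%:R != 0 :> R by [].
  apply: (n2_dct (isL2Z 2%:C dh2)).
  - by move=> n; apply: cmeasD; [exact: (fourier2_isL2 (hF n)).2.1|exact: dh2.1].
  - apply: ae_all => xi; set s := dot xi e.
    apply: (@squeeze_cvgr _ _ _ _ (fun=> 0) (fun n => n.+1%:R^-1 * ((s ^+ 2 / 2 + `|s| ^+ 3 / 2) * normc (fh xi)))).
    + apply: nearW => n; rewrite normc_ge0 /= /Fh mulrA -mulrDl normcM mulrA; apply: ler_wpM2r; first exact: normc_ge0.
      have -> : n.+1%:R%:C * (cis (dot xi (z n)) - 1) + imunit * s%:C =
          n.+1%:R%:C * (cis (dot xi (z n)) - 1 - imunit * (dot xi (z n))%:C).
        have -> : (dot xi (z n))%:C = - ((n.+1%:R^-1)%:C * s%:C) :> C by rewrite zdot -rcM -rmorphN.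
        by apply: scaled_cancel; rewrite -rcM mulfV// rmorph1.
      rewrite normcM normc_real ger0_norm// zdot -/s.
      apply: le_trans (ler_wpM2l (ler0n _ _) (normc_cis_taylor _)) _.
      rewrite normrN normrM sqrrN !exprMn (@ger0_norm _ n.+1%:R^-1)//.
      have h1 : n.+1%:R^-1 <= 1 :> R by rewrite invf_le1// ler1n.
      have h0 : 0 <= n.+1%:R^-1 :> R by [].
      have hE : n.+1%:R * n.+1%:R^-1 = 1 :> R by rewrite mulfV.
      have s3 : 0 <= `|s| ^+ 3 by rewrite exprn_ge0.
      move: hE h1 h0; move: (n.+1%:R) (n.+1%:R^-1) => p q pq q1 q0.
      rewrite (_ : p * _ = (p * q) * (q * (s ^+ 2 / 2) + q * q * (`|s| ^+ 3 / 2))); last by ring.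
      rewrite pq mul1r mulrDr; apply: lerD => //; apply: ler_wpM2r; first by rewrite divr_ge0.
      by rewrite ler_piMr.
    + exact: cvg_cst.
    + rewrite -[X in _ --> X](mul0r ((s ^+ 2 / 2 + `|s| ^+ 3 / 2) * normc (fh xi))).
      by apply: cvgM; [exact: cvg_harmonic|exact: cvg_cst].
  - move=> n xi; rewrite normcM normc_real ger0_norm// mulr_natl mulr2n.
    apply: le_trans (normcD _ _) _; apply: lerD => //.
    rewrite /Fh !normcM normc_real ger0_norm// normc_imunit mul1r normc_real mulrA; apply: ler_wpM2r; first exact: normc_ge0.
    apply: le_trans (ler_wpM2l (ler0n _ _) (normc_cis_sub1 _)) _.
    by rewrite zdot normrN normrM (@ger0_norm _ n.+1%:R^-1)// mulrA mulfV// mul1r.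
have nd2 : isL2 mu2 (fun x => - d x) by exact: isL2N.
rewrite !cintegral_cint -cintN; last exact: cintable_mul d2 th2.
rewrite (_ : cint mu2 (fun x => - (d x * (theta x)%:C)) = cint mu2 (fun x => - d x * (theta x)%:C)); last first.
  by apply: cint_eq => x; rewrite mulNr.
have cst0 (g : R * R -> C) : n2cvg (fun=> g) g.
  by rewrite /n2cvg; under eq_fun do under [X in n2 _ X]eq_fun do rewrite subrr; rewrite n2_0; exact: cvg_cst.
apply: (eq_cint_mul_lim (fun=> f2) q2 f2 D2 F2 (fun=> th2) nd2 th2 (cst0 f) qc Fc (cst0 (fun x => (theta x)%:C))).
move=> n; have tz2 : isL2 mu2 (fun x => (theta (tshift (n.+1%:R^-1 *: e) x))%:C) := isL2_mpres (mpres_tshift (n.+1%:R^-1 *: e)) th2.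
have fz2 : isL2 mu2 (fun x => f (tshift (z n) x)) := isL2_mpres (mpres_tshift (z n)) f2.
transitivity (n.+1%:R%:C * (cint mu2 (fun x => f x * (theta (tshift (n.+1%:R^-1 *: e) x))%:C) - cint mu2 (fun x => f x * (theta x)%:C))).
  rewrite -cintB; [|exact: cintable_mul|exact: cintable_mul].
  rewrite -cintZ; last by apply: cintableB; exact: cintable_mul.
  apply: cint_eq => x; rewrite /dquot rcM rmorphB -mulrBr mulrCA.
  by rewrite /tshift [n.+1%:R^-1 *: e + x]addrC.
have -> : cint mu2 (fun x => f x * (theta (tshift (n.+1%:R^-1 *: e) x))%:C) = cint mu2 (fun x => f (tshift (z n) x) * (theta x)%:C).
  rewrite -(cint_mpres (mpres_tshift (n.+1%:R^-1 *: e)) (cintable_mul fz2 th2).1); apply: cint_eq => x.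
  congr (f _ * _); case: x => a b; rewrite /tshift /z /=; congr pair; exact: esym (addrK _ _).
rewrite -cintB; [|exact: cintable_mul|exact: cintable_mul].
rewrite -cintZ; last by apply: cintableB; exact: cintable_mul.
by apply: cint_eq => x; rewrite /F -mulrA mulrBl.
Qed.

End PlaneFunctions.

(** * Bounded Fourier multipliers and the Dirac operator *)

Section Multipliers.
Context {R : realType}.
Local Notation mR := (measurableTypeR R).
Local Notation R2 := (mR * mR)%type.
Local Notation C := R[i].
Local Notation "x %:C" := (real_complex R x).
Local Notation spinor := (@spinor R).
Implicit Types (f g h : R * R -> C) (psi phi chi : spinor) (p : R * R -> R) (s m : R).

Lemma sL2_lin a psi phi : sL2 psi -> sL2 phi -> sL2 (a *: psi + phi).
Proof. by move=> h h' k; rewrite componentP; apply: isL2D => //; exact: isL2Z. Qed.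

Lemma sL20 : sL2 (0 : spinor).
Proof. by move=> k; rewrite component0; exact: isL20. Qed.

Lemma sn_ge0 psi : 0 <= sn psi.
Proof. exact: vnorm_ge0. Qed.

Lemma snD psi phi : sL2 psi -> sL2 phi -> sn (psi + phi) <= sn psi + sn phi.
Proof.
move=> h h'; apply: le_trans (vnormD _ _); apply: vnorm_mono => k.
by rewrite n2_ge0 componentD; exact: n2D.
Qed.

Lemma snZ a psi : sL2 psi -> sn (a *: psi) = normc a * sn psi.
Proof.
move=> h; rewrite /sn -vnormZ ?normc_ge0//; apply: vnorm_ext => k.
by rewrite componentZ; exact: n2Z.
Qed.

Lemma sn_ae0 psi phi : sL2 psi -> sL2 phi -> psi = phi %[ae mu2] -> sn (psi - phi) = 0.
Proof.
move=> h h' e; rewrite /sn (@vnorm_ext _ _ (fun=> 0)); last first.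
  move=> k; rewrite componentB -(@n2_0 _ _ _ mu2); apply: n2_ae.
  - exact: cmeasB (h k).1 (h' k).1.
  - exact: cmeas_cst.
  - by apply: ae_imp (component_ae k e) => x hx /hx ->; rewrite subrr.
by rewrite /vnorm sum2E expr0n /= addr0 sqrtr0.
Qed.

(** A relation, like [is_fourier2], so that any representatives may be used. *)
Definition smult p f f' := exists fh, is_fourier2 f fh /\ is_fourier2 f' (fun xi => (p xi)%:C * fh xi).

Lemma smult_fh p f f' fh : smult p f f' -> is_fourier2 f fh -> cmeas (fun xi => (p xi)%:C : C) ->
  is_fourier2 f' (fun xi => (p xi)%:C * fh xi).
Proof.
move=> [gh [hg hf']] hf mp; have [f2 _] := fourier2_isL2 hf'.
apply: (fourier2_ae hf') => //; first exact: f2.1.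
- by apply: cmeasM => //; exact: (fourier2_isL2 hf).2.1.
- exact: ae_all.
- by apply: ae_imp (fourier2_uniq hg hf) => x h /h ->.
Qed.

Section Bounded.
Variables (p : R * R -> R) (M : R).
Hypotheses (mp : measurable_fun [set: R2] (p : R2 -> R)) (pM : forall xi, `|p xi| <= M).

Lemma cmeas_symbol : cmeas (fun xi : R2 => (p xi)%:C).
Proof. exact: cmeas_real. Qed.

Let pM' xi : normc (p xi)%:C <= M. Proof. by rewrite normc_real. Qed.

Lemma bound_ge0 : 0 <= M.
Proof. exact: le_trans (normr_ge0 _) (pM 0). Qed.

Lemma smult_exists f : isL2 mu2 f -> exists f', smult p f f'.
Proof.
move=> f2; have [fh hf] := fourier2_exists f2; have [_ fh2] := fourier2_isL2 hf.
have [f' hf'] := fourier2_surj (isL2M cmeas_symbol pM' fh2).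
by exists f'; exists fh.
Qed.

Lemma smult_lin c f g f' g' : smult p f f' -> smult p g g' ->
  smult p (fun x => c * f x + g x) (fun x => c * f' x + g' x).
Proof.
move=> [fh [hf hf']] [gh [hg hg']]; exists (fun xi => c * fh xi + gh xi); split; first exact: fourier2_lin.
by have := fourier2_lin c hf' hg'; congr is_fourier2; apply/funext => xi; rewrite mulrDr mulrCA.
Qed.

Lemma smult_n2 f f' : smult p f f' -> n2 mu2 f' <= M * n2 mu2 f.
Proof.
move=> [fh [hf hf']]; rewrite -(fourier2_n2 hf) -(fourier2_n2 hf').
exact: n2M_le cmeas_symbol pM' bound_ge0 (fourier2_isL2 hf).2.
Qed.

Definition is_mult psi phi := forall k, smult p (component psi k) (component phi k).

Lemma is_mult_exists psi : sL2 psi -> exists phi, is_mult psi phi.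
Proof.
move=> h; have [f fP] := choice (fun k => smult_exists (h k)).
exists (fun x => \col_k f k x) => k.
by rewrite (_ : component (fun x => \col_k f k x) k = f k)//; apply/funext => x; rewrite /component mxE.
Qed.

Lemma is_mult_sL2 psi phi : is_mult psi phi -> sL2 psi /\ sL2 phi.
Proof. by move=> h; split => k; have [fh [/fourier2_isL2[? _] /fourier2_isL2[? _]]] := h k. Qed.

Lemma is_mult_lin c psi phi psi' phi' : is_mult psi psi' -> is_mult phi phi' ->
  is_mult (c *: psi + phi) (c *: psi' + phi').
Proof. by move=> h h' k; rewrite !componentP; exact: smult_lin. Qed.

Lemma is_mult_sn psi phi : is_mult psi phi -> sn phi <= M * sn psi.
Proof.
move=> h; rewrite /sn -vnormZ ?bound_ge0//; apply: vnorm_mono => k.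
by rewrite n2_ge0; exact: smult_n2.
Qed.

Lemma is_mult_sub psi phi psi' phi' : is_mult psi psi' -> is_mult phi phi' ->
  sn (psi' - phi') <= M * sn (psi - phi).
Proof.
move=> h h'; have := is_mult_sn (is_mult_lin (-1) h' h).
by rewrite !scaleN1r ![- _ + _]addrC.
Qed.

End Bounded.

(** The operator described by Fourier symbols. The commutation argument asks for one image of each
    element of [H^1]; such a pair supplies it and is visibly compatible with multipliers. *)
Definition dirac_pair m psi chi := exists d1 d2 : spinor,
  (forall k, exists fh, [/\ is_fourier2 (component psi k) fh,
     is_fourier2 (component d1 k) (fun xi => imunit * (dot xi (1, 0))%:C * fh xi) &
     is_fourier2 (component d2 k) (fun xi => imunit * (dot xi (0, 1))%:C * fh xi)]) /\
  chi = fun x => - imunit *: (alpha1 *m d1 x + alpha2 *m d2 x) + m%:C *: (gamma0 *m psi x).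

(** Both components are arranged as nested combinations [c * f + g], the shape of the linearity
    lemmas; [imunit * imunit = -1] makes the coefficients of [d1] real. *)
Lemma component_dirac m (d1 d2 psi : spinor) k :
  component (fun x => - imunit *: (alpha1 *m d1 x + alpha2 *m d2 x) + m%:C *: (gamma0 *m psi x)) k =
  if k == ord0 then fun x => m%:C * component psi ord0 x + (- imunit * component d2 (lift ord0 ord0) x + component d1 (lift ord0 ord0) x)
  else fun x => - m%:C * component psi (lift ord0 ord0) x + (- imunit * component d2 ord0 x + -1 * component d1 ord0 x).
Proof.
have ii : imunit * imunit = -1 :> C by apply: complexP => /=; ring.
have [->|->] := I2P k; apply/funext => x /=; rewrite /component !mxE !sum2E !mxE /=.
  move: (d1 x _ _) (d1 x _ _) (d2 x _ _) (d2 x _ _) (psi x _ _) (psi x _ _) => a b c d e f.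
  move: ii; move: imunit (m%:C) => i M ii.
  transitivity (- (i * i) * a - i * c + M * f); first by ring.
  by rewrite ii; ring.
move: (d1 x _ _) (d1 x _ _) (d2 x _ _) (d2 x _ _) (psi x _ _) (psi x _ _) => a b c d e f.
move: ii; move: imunit (m%:C) => i M ii.
transitivity ((i * i) * b - i * d - M * e); first by ring.
by rewrite ii; ring.
Qed.

Lemma dot_le_jbracket xi (e : R * R) : e = (1, 0) \/ e = (0, 1) -> `|dot xi e| <= jw 1 xi.
Proof.
move=> he; have j1 := jw_ge0 1 xi.
rewrite -(@ler_sqr _ `|_|) ?nnegrE// real_normK ?num_real// /jw powRr1 ?(ltW (jbracket_gt0 xi))// jbracket_sqr.
have := sqr_ge0 xi.1; have := sqr_ge0 xi.2.
by case: he => ->; rewrite /dot /= ?mulr1 ?mulr0 ?addr0 ?add0r; lra.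
Qed.

Lemma measurable_dot_fixed (e : R * R) : cmeas (fun xi : R2 => imunit * (dot xi e)%:C : C).
Proof. by apply: cmeasM; [exact: cmeas_cst|apply: cmeas_real; exact: measurable_dotl]. Qed.

Lemma derivative_exists f fh (e : R * R) : e = (1, 0) \/ e = (0, 1) -> is_fourier2 f fh -> isL2 mu2 (wt 1 fh) ->
  exists d, is_fourier2 d (fun xi => imunit * (dot xi e)%:C * fh xi).
Proof.
move=> he hf w2; apply: fourier2_surj; apply: (isL2_le _ w2).
  exact: cmeasM (measurable_dot_fixed e) (fourier2_isL2 hf).2.1.
move=> xi; rewrite normc_wt !normcM normc_imunit mul1r normc_real ler_wpM2r ?normc_ge0//.
exact: dot_le_jbracket.
Qed.

Lemma dirac_pair_exists m psi : Hs 1 psi -> exists chi, dirac_pair m psi chi.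
Proof.
move=> /HsP h.
have H k : exists fd : (R * R -> C) * (R * R -> C) * (R * R -> C), [/\ is_fourier2 (component psi k) fd.1.1,
    is_fourier2 fd.1.2 (fun xi => imunit * (dot xi (1, 0))%:C * fd.1.1 xi) &
    is_fourier2 fd.2 (fun xi => imunit * (dot xi (0, 1))%:C * fd.1.1 xi)].
  have hf := hs_fourier (h k).
  have [d1 h1] := derivative_exists (or_introl erefl) hf (h k).2.
  have [d2 h2] := derivative_exists (or_intror erefl) hf (h k).2.
  by exists (fourier2 (component psi k), d1, d2).
have [F FP] := choice H.
pose d1 : spinor := fun x => \col_k (F k).1.2 x; pose d2 : spinor := fun x => \col_k (F k).2 x.
eexists; exists d1, d2; split; last by [].
move=> k; exists (F k).1.1; have [h1 h2 h3] := FP k.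
rewrite (_ : component d1 k = (F k).1.2); last by apply/funext => x; rewrite /component mxE.
by rewrite (_ : component d2 k = (F k).2)//; apply/funext => x; rewrite /component mxE.
Qed.

Lemma dirac_pair_sL2 m psi chi : dirac_pair m psi chi -> sL2 chi.
Proof.
move=> [d1 [d2 [h ->]]] k.
have p2 k' : isL2 mu2 (component psi k') by have [fh [/fourier2_isL2[]]] := h k'.
have d12 k' : isL2 mu2 (component d1 k') by have [fh [_ /fourier2_isL2[]]] := h k'.
have d22 k' : isL2 mu2 (component d2 k') by have [fh [_ _ /fourier2_isL2[]]] := h k'.
rewrite component_dirac; case: ifP => _.
  by apply: isL2D; [exact: isL2Z|apply: isL2D => //; exact: isL2Z].
by apply: isL2D; [exact: isL2Z|apply: isL2D; exact: isL2Z].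
Qed.

Lemma test_function_C1 (theta : R * R -> R) : test_function theta ->
  [/\ continuous theta, forall y, derivable theta y (1, 0), continuous ('D_(1, 0) theta),
     forall y, derivable theta y (0, 1) & continuous ('D_(0, 1) theta)].
Proof.
move=> [h _]; have [c [d1 [c1 [d2 c2]]]] := h 1%N.
by split; [exact: c|exact: d1|exact: c1.1|exact: d2|exact: c2.1].
Qed.

Lemma dirac_pair_op m psi chi : Hs 1 psi -> dirac_pair m psi chi -> dirac_op m psi chi.
Proof.
move=> H1 dp; have chi2 := dirac_pair_sL2 dp; case: dp => d1 [d2 [h E]].
split => //; split; first exact/L2P.
have one0 : `|(1 : R)| <= 1 /\ `|(0 : R)| <= 1 by rewrite normr1 normr0.
exists d1, d2; split; last by rewrite E; exact: ae_all.
- split; first by apply/L2P => k; have [fh [_ /fourier2_isL2[]]] := h k.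
  move=> k theta tt; have [fh [hf hd _]] := h k; have [ct dt cD _ _] := test_function_C1 tt.
  exact: (@weak_derivative_fourier R (1, 0) _ _ _ one0.1 one0.2 hf hd theta ct dt cD tt.2).
- split; first by apply/L2P => k; have [fh [_ _ /fourier2_isL2[]]] := h k.
  move=> k theta tt; have [fh [hf _ hd]] := h k; have [ct _ _ dt cD] := test_function_C1 tt.
  exact: (@weak_derivative_fourier R (0, 1) _ _ _ one0.2 one0.1 hf hd theta ct dt cD tt.2).
Qed.

(** The symbol commutes with those of the derivatives and acts alike on both components, so it
    passes through the matrices. *)
Lemma dirac_pair_mult m p M psi psi' chi : measurable_fun [set: R2] (p : R2 -> R) -> (forall xi, `|p xi| <= M) ->
  Hs 1 psi -> is_mult p psi psi' -> dirac_pair m psi chi ->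
  Hs 1 psi' /\ exists chi', dirac_pair m psi' chi' /\ is_mult p chi chi'.
Proof.
move=> mp pM /HsP H1 pp' [d1 [d2 [h E]]].
have cp := cmeas_symbol mp.
have pM' xi : normc (p xi)%:C <= M by rewrite normc_real.
split.
  apply/HsP => k; have hf := hs_fourier (H1 k); apply: (hsP (smult_fh (pp' k) hf cp)).
  rewrite (_ : wt 1 _ = fun xi => (p xi)%:C * wt 1 (fourier2 (component psi k)) xi); last first.
    by apply/funext => xi; rewrite /wt mulrCA.
  exact: isL2M cp pM' (H1 k).2.
have p1 : is_mult p d1 d1 \/ True by right.
have [d1' h1] : exists d1', is_mult p d1 d1'.
  by apply: (is_mult_exists mp pM) => k; have [fh [_ /fourier2_isL2[]]] := h k.
have [d2' h2] : exists d2', is_mult p d2 d2'.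
  by apply: (is_mult_exists mp pM) => k; have [fh [_ _ /fourier2_isL2[]]] := h k.
eexists; split.
  exists d1', d2'; split; last by [].
  move=> k; have [fh [hf hd1 hd2]] := h k; exists (fun xi => (p xi)%:C * fh xi); split.
  - exact: smult_fh (pp' k) hf cp.
  - by have := smult_fh (h1 k) hd1 cp; congr is_fourier2; apply/funext => xi; rewrite mulrCA.
  - by have := smult_fh (h2 k) hd2 cp; congr is_fourier2; apply/funext => xi; rewrite mulrCA.
rewrite E => k; rewrite !component_dirac; case: ifP => _.
  by apply: smult_lin; [exact: pp'|apply: smult_lin; [exact: h2|exact: h1]].
have z0 : smult p (fun=> 0) (fun=> 0).
  exists (fun=> 0); have hz : @is_fourier2 R (fun=> 0) (fun=> 0).
    have [kk hk] := @fourier2_exists R _ (@isL20 _ _ _ mu2).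
    by have := fourier2_lin (-1) hk hk; congr is_fourier2; apply/funext => x; ring.
  by split => //; move: hz; congr is_fourier2; apply/funext => x; rewrite mulr0.
apply: smult_lin; first exact: pp'.
apply: smult_lin; first exact: h2.
have := smult_lin (-1) (h1 ord0) z0.
by congr smult; apply/funext => x; rewrite addr0.
Qed.

(** Sharp frequency cut-off of the weight, bounded for each [n] and increasing to [jw s]; [pw 0 n]
    is the plain projection on low frequencies. *)
Definition pw (s : R) (n : nat) (xi : R * R) : R := if jbracket xi <= n%:R then jw s xi else 0.

Lemma pw_ge0 s n xi : 0 <= pw s n xi.
Proof. by rewrite /pw; case: ifP => // _; exact: jw_ge0. Qed.

Lemma pw_le s n xi : pw s n xi <= jw s xi.
Proof. by rewrite /pw; case: ifP => // _; exact: jw_ge0. Qed.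

Lemma pw_bound s n xi : 0 <= s -> `|pw s n xi| <= n%:R `^ s.
Proof.
move=> s0; rewrite ger0_norm ?pw_ge0// /pw; case: ifP => h; last exact: powR_ge0.
by apply: ge0_ler_powR; rewrite ?nnegrE// (ltW (jbracket_gt0 xi)).
Qed.

Lemma pw_eventually s xi : exists N, forall n, (N <= n)%N -> pw s n xi = jw s xi.
Proof.
exists (Num.Def.truncn (jbracket xi)).+1 => n hn; rewrite /pw ifT//.
by apply: le_trans (ltW (truncnS_gt _)) _; rewrite ler_nat.
Qed.

Lemma pw_nd s xi : {homo (pw s)^~ xi : n m / (n <= m)%N >-> n <= m}.
Proof.
move=> n m nm; rewrite /pw; case: ifP => h; last by case: ifP => // _; exact: jw_ge0.
by rewrite ifT// (le_trans h)// ler_nat.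
Qed.

Lemma measurable_pw s n : measurable_fun [set: R2] (pw s n : R2 -> R).
Proof.
apply: measurable_fun_ifT; last exact: measurable_cst; last exact: measurable_jw.
by apply: measurable_fun_ler => //; exact: measurable_jbracket.
Qed.

Lemma pw_L2_cvg s g : isL2 mu2 (wt s g) -> n2cvg (fun n xi => (pw s n xi)%:C * g xi) (wt s g).
Proof.
move=> w2; have mg := cmeas_unwt w2.1.
apply: (n2_dct w2).
- by move=> n; apply: cmeasB w2.1; apply: cmeasM mg; apply: cmeas_real; exact: measurable_pw.
- apply: ae_all => xi; have [N NP] := pw_eventually s xi.
  by apply: cvg_near_cst; exists N => // n /= hn; rewrite NP// subrr normc0.
- move=> n xi; rewrite /wt -mulrBl !normcM; apply: ler_wpM2r; first exact: normc_ge0.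
  rewrite -rmorphB !normc_real (ger0_norm (jw_ge0 _ _)) distrC ger0_norm ?subr_ge0 ?pw_le//.
  by rewrite gerBl pw_ge0.
Qed.

Lemma sq_pw_bound s g (c : R) : cmeas (g : R2 -> C) ->
  (forall n, (sq mu2 (fun xi => (pw s n xi)%:C * g xi)%R <= c%:E)%E) -> (sq mu2 (wt s g) <= c%:E)%E.
Proof.
move=> mg h; pose G n (xi : R2) := (normc ((pw s n xi)%:C * g xi) ^+ 2)%:E.
have GE n xi : normc ((pw s n xi)%:C * g xi) ^+ 2 = (pw s n xi * normc (g xi)) ^+ 2.
  by rewrite normcM normc_real ger0_norm ?pw_ge0.
have mG n : measurable_fun setT (G n).
  by apply: measurable_sq; apply: cmeasM mg; apply: cmeas_real; exact: measurable_pw.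
have G0 n xi : setT xi -> (0 <= G n xi)%E by move=> _; rewrite lee_fin sqr_ge0.
have ndG xi : setT xi -> {homo G^~ xi : n m / (n <= m)%N >-> (n <= m)%E}.
  move=> _ n m nm; rewrite lee_fin !GE ler_sqr ?nnegrE ?mulr_ge0 ?pw_ge0 ?normc_ge0//.
  by apply: ler_wpM2r; [exact: normc_ge0|exact: pw_nd].
have := @cvg_monotone_convergence _ _ _ mu2 setT measurableT G mG G0 ndG.
rewrite (_ : (\int[mu2]_(x in setT) _)%E = sq mu2 (wt s g)); last first.
  apply: eq_integral => xi _; apply/cvg_lim => //; have [N NP] := pw_eventually s xi.
  by apply: cvg_near_cst; exists N => // n /= hn; rewrite /G NP.
by move=> c'; apply: (cvge_to_le c'); apply: nearW.
Qed.

(** Monotone convergence turns [L2] bounds uniform in [n] into membership in [H^s]; the truncated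
    norms then converge to the full norm, which inherits the bound. *)
Lemma Hs_pw s psi (c : R) : 0 <= c -> sL2 psi ->
  (forall n phi, is_mult (pw s n) psi phi -> sn phi <= c) -> 0 <= s -> Hs s psi /\ shn s psi <= c.
Proof.
move=> c0 h hc s0.
have hf k := fourier2_spec (h k).
have F2 k := (fourier2_isL2 (hf k)).2.
have bound n : vnorm (fun k => n2 mu2 (fun xi => (pw s n xi)%:C * fourier2 (component psi k) xi)) <= c.
  have [phi pphi] := is_mult_exists (measurable_pw s n) (fun xi => pw_bound n xi s0) h.
  apply: le_trans (hc n phi pphi); rewrite le_eqVlt; apply/orP; left; apply/eqP/vnorm_ext => k.
  by rewrite (fourier2_n2 (smult_fh (pphi k) (hf k) (cmeas_symbol (measurable_pw s n)))).
have pw2 n k : isL2 mu2 (fun xi => (pw s n xi)%:C * fourier2 (component psi k) xi).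
  by apply: isL2M (cmeas_symbol (measurable_pw s n)) _ (F2 k) => xi; rewrite normc_real; exact: pw_bound.
have W k : isL2 mu2 (wt s (fourier2 (component psi k))).
  split; first exact: cmeas_wt (F2 k).1.
  apply: (@le_lt_trans _ _ (c ^+ 2)%:E); last exact: ltry.
  apply: sq_pw_bound (F2 k).1 _ => n; rewrite (sqE (pw2 n k)) lee_fin.
  rewrite ler_sqr ?nnegrE ?n2_ge0//; apply: le_trans (bound n).
  exact: (le_vnorm (fun k => n2 mu2 (fun xi => (pw s n xi)%:C * fourier2 (component psi k) xi))).
have HH : Hs s psi by apply/HsP => k; split; [exact: h|exact: W].
split => //; rewrite -(@ler_sqr _ (shn s psi)) ?nnegrE ?shn_ge0//.
have cv k : n2 mu2 (fun xi => (pw s n xi)%:C * fourier2 (component psi k) xi) ^+ 2 @[n --> \oo] --> hn s (component psi k) ^+ 2.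
  have h1 := n2cvg_n2 (fun n => pw2 n k) (W k) (pw_L2_cvg (W k)).
  by rewrite !expr2; exact: (@cvgM _ _ _ eventually_filter _ _ _ _ h1 h1).
have cs := @cvgD _ _ _ _ eventually_filter _ _ _ _ (cv ord0) (cv (lift ord0 ord0)).
rewrite /shn vnorm_sqr sum2E; apply: (cvgr_to_le cs); apply: nearW => n.
have := bound n; rewrite -(@ler_sqr _ (vnorm _)) ?nnegrE ?vnorm_ge0// vnorm_sqr sum2E; exact.
Qed.

Lemma is_mult_pw_le s n psi phi : Hs s psi -> is_mult (pw s n) psi phi -> sn phi <= shn s psi.
Proof.
move=> /HsP h pphi; apply: vnorm_mono => k; rewrite n2_ge0 /=.
have hf := hs_fourier (h k); have cp := cmeas_symbol (measurable_pw s n).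
rewrite -(fourier2_n2 (smult_fh (pphi k) hf cp)); apply: (n2_le_norm _ (h k).2).
  exact: cmeasM cp (fourier2_isL2 hf).2.1.
move=> xi; rewrite normc_wt normcM normc_real ger0_norm ?pw_ge0//.
by apply: ler_wpM2r; [exact: normc_ge0|exact: pw_le].
Qed.

Lemma pw0_Hs s n psi phi : 0 <= s -> sL2 psi -> is_mult (pw 0 n) psi phi -> Hs s phi.
Proof.
move=> s0 h pphi; apply/HsP => k.
have hf := fourier2_spec (h k); have F2 := (fourier2_isL2 hf).2.
apply: (hsP (smult_fh (pphi k) hf (cmeas_symbol (measurable_pw 0 n)))).
rewrite (_ : wt s _ = fun xi => (pw s n xi)%:C * fourier2 (component psi k) xi); last first.
  apply/funext => xi; rewrite /wt /pw; case: ifP => _; first by rewrite jw0 rmorph1 mul1r.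
  by rewrite rmorph0 !mul0r mulr0.
by apply: isL2M (cmeas_symbol (measurable_pw s n)) _ F2 => xi; rewrite normc_real; exact: pw_bound.
Qed.

Lemma pw0_cvg psi (u : nat -> spinor) : sL2 psi -> (forall n, is_mult (pw 0 n) psi (u n)) ->
  sn (psi - u n) @[n --> \oo] --> (0 : R).
Proof.
move=> h hu; have hf k := fourier2_spec (h k).
have w0 k : wt 0 (fourier2 (component psi k)) = fourier2 (component psi k).
  by apply/funext => xi; rewrite /wt jw0 rmorph1 mul1r.
apply: (@cvg_vnorm _ _ _ eventually_filter (fun n k => n2 mu2 (component (psi - u n) k))); last by move=> *; exact: n2_ge0.
move=> k; have F2 := (fourier2_isL2 (hf k)).2.
have := @pw_L2_cvg 0 (fourier2 (component psi k)); rewrite w0 => /(_ F2); apply: cvgn_eq => n.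
have h1 := smult_fh (hu n k) (hf k) (cmeas_symbol (measurable_pw 0 n)).
rewrite n2C componentB.
have := fourier2_n2 (fourier2_lin (-1) h1 (hf k)).
rewrite (_ : (fun x => -1 * component (u n) k x + component psi k x) = fun x => component psi k x - component (u n) k x); last first.
  by apply/funext => x; rewrite mulN1r addrC.
by move=> <-; congr n2; apply/funext => x; rewrite mulN1r addrC.
Qed.

Lemma Hs_weight_preimage s psi : Hs s psi -> exists W, sL2 W /\
  forall n phi, is_mult (pw s n) psi phi -> is_mult (pw 0 n) W phi.
Proof.
move=> /HsP h; have [W WP] := choice (fun k => fourier2_surj (h k).2).
exists (fun x => \col_k W k x).
have E k : component (fun x => \col_k W k x) k = W k by apply/funext => x; rewrite /component mxE.
split; first by move=> k; rewrite E; case: (fourier2_isL2 (WP k)).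
move=> n phi pphi k; rewrite E; exists (wt s (fourier2 (component psi k))); split => //.
have := smult_fh (pphi k) (hs_fourier (h k)) (cmeas_symbol (measurable_pw s n)).
congr is_fourier2; apply/funext => xi; rewrite /wt /pw; case: ifP => _; last by rewrite rmorph0 !mul0r.
by rewrite jw0 rmorph1 mul1r.
Qed.

End Multipliers.

(** * The Dirac group on Sobolev spaces *)

Section GeneratorCommutation.
Context {R : realType} (V : lmodType R[i]).
Local Notation C := R[i].
Local Notation "x %:C" := (real_complex R x).
Variables (P : V -> Prop) (N : V -> R).
Hypothesis P0 : P 0.
Hypothesis Plin : forall a x y, P x -> P y -> P (a *: x + y).
Hypothesis N_ge0 : forall x, 0 <= N x.
Hypothesis N_tri : forall x y, P x -> P y -> N (x + y) <= N x + N y.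
Hypothesis N_hom : forall a x, P x -> N (a *: x) = normc a * N x.

(** Equality up to null vectors with membership built in, which makes it a congruence that can be
    chained. *)
Definition eqv x y := [/\ P x, P y & N (x - y) = 0].

Lemma eqv_refl x : P x -> eqv x x.
Proof. by move=> Px; split => //; rewrite subrr (N0 P0 N_hom). Qed.

Lemma eqv_sym x y : eqv x y -> eqv y x.
Proof. by move=> [Px Py e]; split => //; rewrite (N_opp Plin N_hom). Qed.

Lemma eqv_trans y x z : eqv x y -> eqv y z -> eqv x z.
Proof. by move=> [Px Py e] [_ Pz e']; split => //; exact: (eqN_trans Plin N_ge0 N_tri Px Py Pz). Qed.

Lemma eqv_lin a x y x' y' : eqv x x' -> eqv y y' -> eqv (a *: x + y) (a *: x' + y').
Proof.
move=> [Px Px' e] [Py Py' e']; split; [exact: Plin|exact: Plin|].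
have -> : a *: x + y - (a *: x' + y') = a *: (x - x') + (y - y').
  by rewrite scalerBr opprD addrACA.
apply/eqP; rewrite eq_le N_ge0 andbT.
apply: le_trans (N_tri (PZ P0 Plin _ (PB Plin Px Px')) (PB Plin Py Py')) _.
by rewrite e' addr0 N_hom ?e ?mulr0//; exact: PB.
Qed.

Lemma eqvB x y x' y' : eqv x x' -> eqv y y' -> eqv (x - y) (x' - y').
Proof. by move=> h h'; have := eqv_lin (-1) h' h; rewrite !scaleN1r ![- _ + _]addrC. Qed.

Lemma eqvZ a x x' : eqv x x' -> eqv (a *: x) (a *: x').
Proof. by move=> h; have := eqv_lin a h (eqv_refl P0); rewrite !addr0. Qed.

Lemma eqv_N x y : eqv x y -> N x = N y.
Proof. by move=> [Px Py e]; exact: (N_dist0 Plin N_tri N_hom). Qed.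

Variable U : R -> V -> V.
Hypothesis UP : forall t x, P x -> P (U t x).
Hypothesis UN : forall t x, P x -> N (U t x) = N x.
Hypothesis Ulin : forall t a x y, P x -> P y -> N (U t (a *: x + y) - (a *: U t x + U t y)) = 0.
Hypothesis U0 : forall x, P x -> N (U 0 x - x) = 0.
Hypothesis UD : forall t t' x, P x -> N (U (t + t') x - U t (U t' x)) = 0.

Lemma eqv_Ulin t a x y : P x -> P y -> eqv (U t (a *: x + y)) (a *: U t x + U t y).
Proof. by move=> Px Py; split; [exact/UP/Plin|apply: Plin; exact: UP|exact: Ulin]. Qed.

Lemma eqv_UB t x y : P x -> P y -> eqv (U t (x - y)) (U t x - U t y).
Proof. by move=> Px Py; have := eqv_Ulin t (-1) Py Px; rewrite !scaleN1r ![- _ + _]addrC. Qed.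

Lemma eqv_UC t t' x : P x -> eqv (U t (U t' x)) (U t' (U t x)).
Proof.
move=> Px; apply: (@eqv_trans (U (t + t') x)).
  by apply: eqv_sym; split; [exact: UP|exact/UP/UP|exact: UD].
by rewrite addrC; split; [exact: UP|exact/UP/UP|exact: UD].
Qed.

Variables (c : C) (A : V -> V -> Prop) (D : V -> Prop).
Hypothesis AP : forall x y, P x -> P y -> A x y <-> forall e : R, 0 < e -> exists2 d : R, 0 < d &
  forall h, h != 0 -> `|h| < d -> N ((h^-1)%:C *: (U h x - x) + c *: y) <= e.
Hypothesis AD : forall x y, A x y -> D x.
Hypothesis DP : forall x, D x -> P x.

Lemma generator_U t x y : P x -> P y -> A x y -> A (U t x) (U t y).
Proof.
move=> Px Py /(AP Px Py) Axy; apply/(AP (UP t Px) (UP t Py)) => e /Axy[d d0 dP].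
exists d => // h h0 hd; apply: le_trans (dP h h0 hd).
have Pz : P (U h x - x) by apply: PB => //; exact: UP.
rewrite -(UN t (Plin _ Pz (PZ P0 Plin c Py))) le_eqVlt; apply/orP; left; apply/eqP.
apply: eqv_N; apply: eqv_sym; apply: eqv_trans (eqv_Ulin _ _ Pz (PZ P0 Plin c Py)) _.
apply: eqv_lin.
  apply: eqv_trans (eqv_UB t (UP h Px) Px) _.
  by apply: eqvB; [exact: eqv_UC|exact/eqv_refl/UP].
have := eqv_Ulin t c Py P0; rewrite addr0 => /eqv_trans; apply.
have U00 : eqv (U t 0) 0.
  by split => //; [exact: UP|rewrite subr0 UN// (N0 P0 N_hom)].
by have := eqv_lin c (eqv_refl (UP t Py)) U00; rewrite addr0.
Qed.

Variables (B : V -> V) (M : R).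
Hypothesis BP : forall x, P x -> P (B x).
Hypothesis Blin : forall a x y, P x -> P y -> N (B (a *: x + y) - (a *: B x + B y)) = 0.
Hypothesis B_lip : forall x y, P x -> P y -> N (B x - B y) <= M * N (x - y).
Hypothesis B_generator : forall x, D x -> exists y, [/\ P y, A x y & A (B x) (B y)].

Lemma eqv_B x y : eqv x y -> eqv (B x) (B y).
Proof.
move=> [Px Py e]; split; [exact: BP|exact: BP|apply/eqP; rewrite eq_le N_ge0 andbT].
by apply: le_trans (B_lip Px Py) _; rewrite e mulr0.
Qed.

Lemma eqv_Blin a x y : P x -> P y -> eqv (B (a *: x + y)) (a *: B x + B y).
Proof. by move=> Px Py; split; [exact/BP/Plin|apply: Plin; exact: BP|exact: Blin]. Qed.

Lemma eqv_BB x y : P x -> P y -> eqv (B (x - y)) (B x - B y).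
Proof. by move=> Px Py; have := eqv_Blin (-1) Py Px; rewrite !scaleN1r ![- _ + _]addrC. Qed.

Lemma eqv_BZ a x : P x -> eqv (B (a *: x)) (a *: B x).
Proof.
move=> Px; have := eqv_Blin a Px P0; rewrite addr0 => /eqv_trans; apply.
have B0 : eqv (B 0) 0.
  have := eqv_BB P0 P0; rewrite !subrr => h; exact: h.
by have := eqv_lin a (eqv_refl (BP Px)) B0; rewrite addr0.
Qed.

(** Divided by [h], the commutator is the defect of the generator at [B x] minus [B] applied to its
    defect at [x], the terms [c *: B y] cancelling; both defects tend to 0. *)
Lemma commutator_increment x (e : R) : 0 <= M -> D x -> 0 < e -> exists2 d : R, 0 < d &
  forall h, `|h| < d -> N (U h (B x) - B (U h x)) <= e * `|h|.
Proof.
move=> M0 Dx e0; have [y [Py /(AP (DP Dx) Py) a1 a2]] := B_generator Dx.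
have Px := DP Dx; move/(AP (BP Px) (BP Py)) : a2 => a2.
have e1 : 0 < e / (M + 1) by rewrite divr_gt0// ltr_wpDl.
have [d1 d10 d1P] := a1 _ e1; have [d2 d20 d2P] := a2 _ e1.
exists (Num.min d1 d2); first by rewrite lt_min d10.
move=> h; rewrite lt_min => /andP[hd1 hd2]; have [->|h0] := eqVneq h 0.
  rewrite normr0 mulr0 le_eqVlt; apply/orP; left; apply/eqP.
  have U0' z : P z -> eqv (U 0 z) z by move=> Pz; split => //; [exact: UP|exact: U0].
  have [_ _ -> //] : eqv (U 0 (B x)) (B (U 0 x)).
  by apply: eqv_trans (U0' _ (BP Px)) _; apply/eqv_B/eqv_sym/U0'.
have {}d1P := d1P h h0 hd1; have {}d2P := d2P h h0 hd2.
set b := _ + _ in d1P; set a := _ + _ in d2P.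
have PUx := PB Plin (UP h Px) Px; have Pcy := PZ P0 Plin c Py.
have Pb : P b by exact: Plin.
have PUB := PB Plin (UP h (BP Px)) (BP Px).
have Pa : P a by apply: Plin => //; apply: (PZ P0 Plin); exact: BP.
have Bb : eqv (B b) ((h^-1)%:C *: (B (U h x) - B x) + c *: B y).
  apply: eqv_trans (eqv_Blin _ PUx Pcy) _; apply: eqv_lin; last exact: eqv_BZ.
  exact: eqv_BB (UP h Px) Px.
have E : eqv (h%:C *: (a - B b)) (U h (B x) - B (U h x)).
  apply: eqv_trans (eqvZ _ (eqvB (eqv_refl Pa) Bb)) _.
  rewrite (_ : _ *: _ = U h (B x) - B (U h x)); last first.
    rewrite opprD addrACA subrr addr0 -scalerBr opprB addrA subrK scalerA -rmorphM /=.
    by rewrite divff// rmorph1 scale1r.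
  by apply/eqv_refl/(PB Plin); [exact/UP/BP|exact/BP/UP].
rewrite -(eqv_N E) N_hom; last by apply: PB => //; exact: BP.
rewrite normc_real mulrC; apply: ler_wpM2r => //.
apply: le_trans (N_sub_le P0 Plin N_tri N_hom Pa (BP Pb)) _.
have B0 : N (B 0) = 0.
  have := eqv_BB P0 P0; rewrite !subrr => -[_ _]; rewrite subr0 => h'; exact: h'.
have Bb' : N (B b) <= M * N b.
  have := B_lip Pb P0; rewrite subr0; apply: le_trans.
  apply: le_trans (N_le Plin N_tri (BP Pb) (BP P0)) _.
  by rewrite B0 add0r.
apply: le_trans (lerD d2P (le_trans Bb' (ler_wpM2l M0 d1P))) _.
rewrite -{1}[e / (M + 1)]mul1r -mulrDl addrC mulrCA divff ?mulr1//.
by rewrite lt0r_neq0// ltr_wpDl.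
Qed.

(* The commutator norm [N (U t (B x) - B (U t x))] has zero derivative in [t]. *)
Lemma commute_on_domain t x : 0 <= M -> D x -> N (U t (B x) - B (U t x)) = 0.
Proof.
move=> M0 Dx; have Px := DP Dx; pose n t := N (U t (B x) - B (U t x)).
have Dt r : D (U r x).
  by have [y [Py a _]] := B_generator Dx; exact: AD (generator_U r Px Py a).
have eUD r r' z : P z -> eqv (U (r + r') z) (U r (U r' z)).
  by move=> Pz; split; [exact: UP|exact/UP/UP|exact: UD].
(* The group law and the isometry bound an increment at time [r] by the commutator at [U r x], which
   is again in the domain. *)
have step r h : `|n (h + r) - n r| <= N (U h (B (U r x)) - B (U h (U r x))).
  have PX := DP (Dt r); have PB1 := UP h (BP PX); have PB2 := BP (UP h PX).
  have PB3 := UP h (UP r (BP Px)).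
  have -> : n (h + r) = N (U h (U r (B x)) - B (U h (U r x))).
    by apply/eqv_N/eqvB; [exact/eUD/BP|exact/eqv_B/eUD].
  have -> : n r = N (U h (U r (B x)) - U h (B (U r x))).
    by rewrite (U_isom Plin N_tri N_hom UP UN Ulin)//; [exact/UP/BP|exact: BP].
  rewrite ler_norml; apply/andP; split.
    rewrite lerBrDl addrC -lerBrDl opprK addrC (N_opp Plin N_hom PB1 PB2) addrC.
    exact: (N_dist Plin N_tri).
  by rewrite lerBlDl; exact: (N_dist Plin N_tri).
have small r (e : R) : 0 < e -> exists2 d : R, 0 < d & forall h, `|h| < d -> `|n (h + r) - n r| <= e * `|h|.
  move=> e0; have [d d0 dP] := commutator_increment M0 (Dt r) e0; exists d => // h hd.
  exact: le_trans (step r h) (dP h hd).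
have dn r : (fun h => h^-1 *: ((n \o shift r) (h *: 1) - n r)) @ (0 : R)^' --> (0 : R).
  apply/cvgrPdist_le => e e0; have [d d0 dP] := small r e e0.
  exists d => //= h /=; rewrite sub0r normrN => hd h0; rewrite sub0r normrN normrZ normfV.
  by rewrite ler_pdivrMl ?normr_gt0// mulrC [h *: 1]mulr1; exact: dP.
have der r : @is_derive R R R r 1 n 0.
  by apply: DeriveDef; [exact: cvgP (dn r)|exact/cvg_lim/dn].
rewrite -/(n t) (@is_derive_0_is_cst R n t 0 der) /n.
have U0' z : P z -> eqv (U 0 z) z by move=> Pz; split => //; [exact: UP|exact: U0].
have [//] : eqv (U 0 (B x)) (B (U 0 x)).
by apply: eqv_trans (U0' _ (BP Px)) _; apply/eqv_B/eqv_sym/U0'.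
Qed.

Hypothesis D_dense : forall x, P x -> forall e : R, 0 < e -> exists2 y, D y & N (x - y) <= e.

(** Density of the domain and boundedness of [U t] and [B] extend the commutation from [D] to the
    whole space. *)
Lemma generator_commute t x : 0 <= M -> P x -> eqv (U t (B x)) (B (U t x)).
Proof.
move=> M0 Px; have P1 := UP t (BP Px); have P2 := BP (UP t Px); split => //.
apply/eqP; rewrite eq_le N_ge0 andbT; apply/ler_addgt0Pl => e e0; rewrite addr0.
have e1 : 0 < e / (2 * (M + 1)) by rewrite divr_gt0// mulr_gt0// ltr_wpDl.
have [y Dy xy] := D_dense Px e1; have Py := DP Dy.
have P3 := UP t (BP Py); have P4 := BP (UP t Py).
apply: le_trans (N_dist Plin N_tri P1 P3 P2) _.
apply: le_trans (lerD (lexx _) (N_dist Plin N_tri P3 P4 P2)) _.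
rewrite (commute_on_domain t M0 Dy) add0r (U_isom Plin N_tri N_hom UP UN Ulin); [|exact: BP|exact: BP].
apply: le_trans (lerD (B_lip Px Py) (B_lip (UP t Py) (UP t Px))) _.
rewrite (U_isom Plin N_tri N_hom UP UN Ulin)// (N_opp Plin N_hom Py Px) -mulr2n -mulr_natl mulrA.
apply: le_trans (ler_wpM2l _ xy) _; first exact: mulr_ge0.
rewrite mulrA ler_pdivrMr; last by rewrite mulr_gt0// ltr_wpDl.
by rewrite mulrC; apply: ler_wpM2l; [exact: ltW|apply: ler_wpM2l => //; rewrite lerDl].
Qed.

End GeneratorCommutation.

Lemma fin_cvg0P (R : realType) (T : Type) (F : set_system T) (FF : Filter F) (f : T -> \bar R) (a : T -> R) :
  (forall x, 0 <= a x) -> (\forall x \near F, f x = (a x)%:E) ->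
  (f @ F --> 0%E) <-> (forall e : R, 0 < e -> \forall x \near F, a x <= e).
Proof.
move=> a0 fa; split.
  move/fine_cvgP => [_ /cvgrPdist_le h] e /h {}h; move: fa; apply: filterS2 h => x h fx.
  by move: h; rewrite /= fx /= sub0r normrN ger0_norm.
move=> h; apply/fine_cvgP; split; first by move: fa; apply: filterS => x ->.
apply/cvgrPdist_le => e /h {}h; move: fa; apply: filterS2 h => x h fx.
by rewrite /= fx /= sub0r normrN ger0_norm.
Qed.

Lemma squeeze_eq (R : realType) (a b c : R) : a <= b -> c <= a -> c = b -> a = b.
Proof. by move=> ab ca e; apply/eqP; rewrite eq_le ab -e. Qed.

(** * Unitary group generated by the Dirac operator *)

Section DiracGroup.
Context {R : realType}.
Local Notation mR := (measurableTypeR R).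
Local Notation R2 := (mR * mR)%type.
Local Notation C := R[i].
Local Notation "x %:C" := (real_complex R x).
Local Notation spinor := (@spinor R).
Implicit Types (psi phi chi : spinor) (s m t : R).

Lemma sL2B psi phi : sL2 psi -> sL2 phi -> sL2 (psi - phi).
Proof. exact: (PB (@sL2_lin R)). Qed.

Opaque sn shn.

Section Generated.
Variables (m : R) (U : R -> spinor -> spinor).
Hypothesis gen : generated_by (dirac_op m) U.

Lemma group_sL2 t psi : sL2 psi -> sL2 (U t psi).
Proof. by case: gen => h _ _ _ _ /L2P h'; apply/L2P; case: (h t psi h'). Qed.

Lemma group_sn t psi : sL2 psi -> sn (U t psi) = sn psi.
Proof.
case: (gen) => h _ _ _ _ p2; have [_] := h t psi ((L2P psi).2 p2).
by rewrite (L2norm_sn p2) (L2norm_sn (group_sL2 t p2)) => -[].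
Qed.

Lemma group_lin t a psi phi : sL2 psi -> sL2 phi ->
  sn (U t (a *: psi + phi) - (a *: U t psi + U t phi)) = 0.
Proof.
move=> h h'; apply: sn_ae0; [exact/group_sL2/sL2_lin|by apply: sL2_lin; exact: group_sL2|].
by case: gen => _ H _ _ _; apply: H; exact/L2P.
Qed.

Lemma group_0 psi : sL2 psi -> sn (U 0 psi - psi) = 0.
Proof.
move=> h; apply: sn_ae0 => //; first exact: group_sL2.
by case: gen => _ _ [H _] _ _; apply: H; exact/L2P.
Qed.

Lemma group_add t t' psi : sL2 psi -> sn (U (t + t') psi - U t (U t' psi)) = 0.
Proof.
move=> h; apply: sn_ae0; [exact: group_sL2|exact/group_sL2/group_sL2|].
by case: gen => _ _ [_ H] _ _; apply: H; exact/L2P.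
Qed.

Lemma group_cont psi : sL2 psi -> forall e : R, 0 < e -> exists2 d : R, 0 < d &
  forall t, `|t| < d -> sn (U t psi - psi) <= e.
Proof.
move=> h; case: gen => _ _ _ H _; have {H} := H psi ((L2P psi).2 h).
rewrite (@fin_cvg0P R R (nbhs (0 : R)) _ _ (fun t => sn (U t psi - psi))); last first.
- by apply: nearW => t; rewrite L2norm_sn//; apply: sL2B => //; exact: group_sL2.
- by move=> t; exact: sn_ge0.
by move=> H e /H[d /= d0 dP]; exists d => // t td; apply: dP; rewrite /= sub0r normrN.
Qed.

Lemma group_generator psi phi : sL2 psi -> sL2 phi ->
  dirac_op m psi phi <-> forall e : R, 0 < e -> exists2 d : R, 0 < d &
  forall h, h != 0 -> `|h| < d -> sn ((h^-1)%:C *: (U h psi - psi) + imunit *: phi) <= e.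
Proof.
move=> h h'; case: gen => _ _ _ _ H; rewrite (H psi phi ((L2P psi).2 h) ((L2P phi).2 h')).
rewrite (@fin_cvg0P R R (0 : R)^' _ _ (fun t => sn ((t^-1)%:C *: (U t psi - psi) + imunit *: phi))).
- split=> {}H e /H[d /= d0 dP]; exists d => //.
    by move=> t t0 td; apply: dP => //=; rewrite sub0r normrN.
  by move=> t /=; rewrite sub0r normrN => td t0; exact: dP.
- by move=> t; exact: sn_ge0.
apply: nearW => t; rewrite L2norm_sn//; apply: sL2_lin.
  by apply: sL2B => //; exact: group_sL2.
by rewrite -[_ *: _]addr0; apply: sL2_lin => //; exact: sL20.
Qed.

Let eqvL := eqv (@sL2 R) (@sn R).

Lemma is_mult_eqv p M psi psi' phi phi' : measurable_fun [set: R2] (p : R2 -> R) -> (forall xi, `|p xi| <= M) ->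
  is_mult p psi psi' -> is_mult p phi phi' -> sn (psi - phi) = 0 -> sn (psi' - phi') = 0.
Proof.
move=> mp pM h h' e; apply/eqP; rewrite eq_le sn_ge0 andbT.
by apply: le_trans (is_mult_sub mp pM h h') _; rewrite e mulr0.
Qed.

(** Cutting off high frequencies gives approximants in [H^s]; for [s = 1] this is the density of the
    generator's domain. *)
Lemma Hs_dense s psi : 0 <= s -> sL2 psi -> forall e : R, 0 < e -> exists2 phi, Hs s phi & sn (psi - phi) <= e.
Proof.
move=> s0 h e e0.
have [u uP] := choice (fun n => is_mult_exists (measurable_pw 0 n) (fun xi => pw_bound n xi (lexx 0)) h).
have /cvgrPdist_le/(_ e e0)[n _ nP] := pw0_cvg h uP.
exists (u n); first exact: pw0_Hs s0 h (uP n).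
by have := nP n (leqnn n); rewrite /= sub0r normrN ger0_norm// sn_ge0.
Qed.

(* Fourier multipliers preserve the domain [H^1] and commute with [dirac_op]. *)
Lemma group_mult p M t psi psi' phi : measurable_fun [set: R2] (p : R2 -> R) -> (forall xi, `|p xi| <= M) ->
  is_mult p psi psi' -> is_mult p (U t psi) phi -> sn (U t psi' - phi) = 0.
Proof.
move=> mp pM pp pU; have [h2 h2'] := is_mult_sL2 pp.
have M0 := bound_ge0 pM.
have Bex chi : exists chi', sL2 chi -> is_mult p chi chi'.
  have [h|h] := pselect (sL2 chi); last by exists 0.
  by have [chi' hc] := is_mult_exists mp pM h; exists chi'.
have [B BP] := choice Bex.
have BL chi : sL2 chi -> sL2 (B chi) by move=> /BP/is_mult_sL2[].
have [_ PB2 E] : eqvL (U t (B psi)) (B (U t psi)).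
  apply: (@generator_commute R spinor (@sL2 R) (@sn R) sL20 (@sL2_lin R) sn_ge0 (@snD R) (@snZ R)
    U group_sL2 group_sn group_lin group_0 group_add imunit (dirac_op m) (Hs 1) group_generator
    _ _ B M BL _ _ _ _ t psi M0 h2).
  - by move=> chi chi' [].
  - exact: Hs_sL2.
  - move=> a chi chi' hc hc'.
    have := is_mult_eqv mp pM (BP _ (sL2_lin a hc hc')) (is_mult_lin a (BP _ hc) (BP _ hc')).
    by apply; rewrite subrr (N0 sL20 (@snZ R)).
  - by move=> chi chi' hc hc'; apply: (is_mult_sub mp pM); exact: BP.
  - move=> chi Hc; have hc := Hs_sL2 Hc; have [eta he] := dirac_pair_exists m Hc.
    have e2 := dirac_pair_sL2 he; exists eta; split; [exact: e2|exact: dirac_pair_op Hc he|].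
    have [H1 [eta' [he' pe]]] := dirac_pair_mult mp pM Hc (BP _ hc) he.
    have [_ [_ [d1 [d2 [D1 D2 ae]]]]] := dirac_pair_op H1 he'.
    split => //; split; first exact/L2P/BL.
    (* The chosen [B eta] agrees with [eta'] only almost everywhere, which the graph of [dirac_op]
       tolerates. *)
    exists d1, d2; split => //; have e2' := dirac_pair_sL2 he'.
    have := is_mult_eqv mp pM (BP _ e2) pe; rewrite subrr (N0 sL20 (@snZ R)) => /(_ erefl).
    move/(sn_eq0 (sL2B (BL _ e2) e2')) => ae'.
    apply: (ae_imp2 _ ae ae') => x hx hx' _; rewrite -hx//; apply/eqP; rewrite -subr_eq0; apply/eqP.
    exact: hx'.
  - by move=> chi hc e e0; exact: Hs_dense.
have z : sn (psi - psi) = 0 by rewrite subrr (N0 sL20 (@snZ R)).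
have z' : sn (U t psi - U t psi) = 0 by rewrite subrr (N0 sL20 (@snZ R)).
have e1 : sn (U t psi' - U t (B psi)) = 0.
  rewrite (U_isom (@sL2_lin R) (@snD R) (@snZ R) group_sL2 group_sn group_lin) ?(is_mult_eqv mp pM pp (BP _ h2) z)//.
  exact: BL.
have e2 := is_mult_eqv mp pM (BP _ (group_sL2 t h2)) pU z'.
have L := eqN_trans (@sL2_lin R) sn_ge0 (@snD R).
have [_ p2] := is_mult_sL2 pU; have U' := group_sL2 t h2'; have UB := group_sL2 t (BL _ h2).
exact: (L _ _ _ U' PB2 p2 (L _ _ _ U' UB PB2 e1 E) e2).
Qed.

(** A truncated weight commutes with the [L2] isometry [U t], so every truncated norm of [U t psi]
    equals that of [psi]. *)
Lemma group_Hs_le s t psi : 0 <= s -> Hs s psi -> Hs s (U t psi) /\ shn s (U t psi) <= shn s psi.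
Proof.
move=> s0 H; have h := Hs_sL2 H.
apply: Hs_pw => //; [exact: shn_ge0|exact: group_sL2|move=> n phi pU].
have mp := measurable_pw s n; have pM xi := pw_bound n xi s0.
have [psi' pp] := is_mult_exists mp pM h.
have [_ h'] := is_mult_sL2 pp; have [_ hU] := is_mult_sL2 pU.
have e := group_mult mp pM pp pU.
rewrite -(N_dist0 (@sL2_lin R) (@snD R) (@snZ R) (group_sL2 t h') hU e) group_sn//.
exact: is_mult_pw_le H pp.
Qed.

Lemma shn_ae0 s psi phi : 0 <= s -> Hs s psi -> Hs s phi -> sn (psi - phi) = 0 -> shn s (psi - phi) = 0.
Proof.
move=> s0 H H' e; have HB := HsB H H'.
have ae : (0 : spinor) = psi - phi %[ae mu2].
  by apply: ae_imp (sn_eq0 (Hs_sL2 HB) e) => x hx /hx ->.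
have [_ ->] := Hs_ae HB.1 ae (Hs0 s).
exact: (N0 (Hs0 s) (@shnZ R s)).
Qed.

Lemma shn_dist0 s psi phi : Hs s psi -> Hs s phi -> shn s (psi - phi) = 0 -> shn s psi = shn s phi.
Proof. exact: (N_dist0 (@Hs_lin R s) (@shnD R s) (@shnZ R s)). Qed.

(** The bounds for [U t] and for its inverse [U (- t)] squeeze the norm. *)
Lemma group_shn s t psi : 0 <= s -> Hs s psi -> shn s (U t psi) = shn s psi.
Proof.
move=> s0 H; have [H1 le1] := group_Hs_le t s0 H; have [H2 le2] := group_Hs_le (- t) s0 H1.
have E0 : sn (U (- t) (U t psi) - psi) = 0.
  exact: (U_invN (@sL2_lin R) sn_ge0 (@snD R) (@snZ R) group_sL2 group_0 group_add _ (Hs_sL2 H)).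
exact: (squeeze_eq le1 le2 (shn_dist0 H2 H (shn_ae0 s0 H2 H E0))).
Qed.

(** With [W] from [Hs_weight_preimage], the truncated weight of [U t psi - psi] is the frequency
    cut-off of [U t W - W], whose [L2] norm is small uniformly in [n]. *)
Lemma group_shn_cont s psi : 0 <= s -> Hs s psi -> forall e : R, 0 < e -> exists2 d : R, 0 < d &
  forall t, `|t| < d -> shn s (U t psi - psi) <= e.
Proof.
move=> s0 H e e0; have h := Hs_sL2 H; have [W [W2 WP]] := Hs_weight_preimage H.
have [d d0 dP] := group_cont W2 e0; exists d => // t td.
have U2 := group_sL2 t h; have UW2 := group_sL2 t W2.
suff [] : Hs s (U t psi - psi) /\ shn s (U t psi - psi) <= e by [].
apply: Hs_pw => //; [exact: ltW|exact: sL2B|move=> n phi pU].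
have mp := measurable_pw s n; have pM xi := pw_bound n xi s0.
have mq := measurable_pw (0 : R) n; have qM xi := pw_bound n xi (lexx (0 : R)).
have [psi' pp] := is_mult_exists mp pM h; have pW := WP n _ pp.
have [u pu] := is_mult_exists mp pM U2.
have [w qw] := is_mult_exists mq qM UW2.
have [_ h'] := is_mult_sL2 pp; have [_ u2] := is_mult_sL2 pu; have [_ w2] := is_mult_sL2 qw; have [_ p2] := is_mult_sL2 pU.
have e1 := group_mult mp pM pp pu.
have e2 := group_mult mq qM pW qw.
have L := is_mult_lin (-1) pp pu; rewrite !scaleN1r ![- _ + _]addrC in L.
have e3 := is_mult_eqv mp pM pU L; rewrite subrr (N0 sL20 (@snZ R)) in e3.
have D := N_dist0 (@sL2_lin R) (@snD R) (@snZ R).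
rewrite (D _ _ p2 (sL2B u2 h') (e3 erefl)).
have Q := eqvB sL20 (@sL2_lin R) sn_ge0 (@snD R) (@snZ R).
have S := eqv_sym (@sL2_lin R) (@snZ R).
have U' := group_sL2 t h'.
have uw : eqvL u w.
  exact: (eqv_trans (@sL2_lin R) sn_ge0 (@snD R) (S _ _ (And3 U' u2 e1)) (And3 U' w2 e2)).
rewrite (eqv_N (@sL2_lin R) (@snD R) (@snZ R) (Q _ _ _ _ uw (eqv_refl sL20 (@snZ R) h'))).
apply: le_trans (dP t td); rewrite -[leRHS]mul1r.
apply: (is_mult_sub mq _ qw pW) => xi; have := qM xi; by rewrite powRr0.
Qed.

End Generated.

End DiracGroup.

(** * Reduction of the Duhamel equation to the abstract evolution *)

Section DiracGroupSobolev.
Context {R : realType}.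
Local Notation C := R[i].
Local Notation "x %:C" := (real_complex R x).
Local Notation spinor := (@spinor R).
Implicit Types (psi phi chi : spinor) (s m t : R).
Opaque sn shn.

(** What the abstract evolution assumes of the group, gathered because it is established separately
    for the two kinds of value that [dirac_group] may take. *)
Definition isometric_group_on s (U : R -> spinor -> spinor) :=
  [/\ (forall t psi, Hs s psi -> Hs s (U t psi) /\ shn s (U t psi) = shn s psi),
      (forall t a psi phi, Hs s psi -> Hs s phi -> shn s (U t (a *: psi + phi) - (a *: U t psi + U t phi)) = 0),
      (forall psi, Hs s psi -> shn s (U 0 psi - psi) = 0),
      (forall t t' psi, Hs s psi -> shn s (U (t + t') psi - U t (U t' psi)) = 0) &
      (forall psi, Hs s psi -> forall e : R, 0 < e -> exists2 d : R, 0 < d &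
         forall t, `|t| < d -> shn s (U t psi - psi) <= e)].

Lemma generated_isometric m s U : 0 <= s -> generated_by (dirac_op m) U -> isometric_group_on s U.
Proof.
move=> s0 gen; have UP t psi : Hs s psi -> Hs s (U t psi) by move=> h; case: (group_Hs_le gen t s0 h).
split.
- by move=> t psi h; split; [exact: UP|exact: (group_shn gen t s0 h)].
- move=> t a psi phi h h'.
  have P1 := UP t _ (Hs_lin a h h'); have P2 := Hs_lin a (UP t _ h) (UP t _ h').
  exact: (shn_ae0 s0 P1 P2 (group_lin gen t a (Hs_sL2 h) (Hs_sL2 h'))).
- by move=> psi h; exact: (shn_ae0 s0 (UP 0 _ h) h (group_0 gen (Hs_sL2 h))).
- move=> t t' psi h.
  exact: (shn_ae0 s0 (UP (t + t') _ h) (UP t _ (UP t' _ h)) (group_add gen t t' (Hs_sL2 h))).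
- by move=> psi h e e0; exact: (group_shn_cont gen s0 h e0).
Qed.

Lemma trivial_isometric s : isometric_group_on s (fun _ psi => psi).
Proof.
have z : shn s (0 : spinor) = 0 := N0 (Hs0 s) (@shnZ R s).
have zz psi : shn s (psi - psi) = 0 by rewrite subrr; exact: z.
split.
- by move=> t psi h; split; [exact: h|reflexivity].
- by move=> t a psi phi _ _; exact: zz.
- by move=> psi _; exact: zz.
- by move=> t t' psi _; exact: zz.
- by move=> psi _ e e0; exists 1; [exact: ltr01|move=> t _; rewrite zz; exact: ltW].
Qed.

(* [dirac_group m] is the constant identity should no generated group exist; both cases act isometrically. *)
Lemma dirac_group_isometric m s : 0 <= s -> isometric_group_on s (dirac_group m).
Proof.
move=> s0; rewrite /dirac_group; case: xgetP => [U -> gen|_]; last exact: trivial_isometric.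
exact: generated_isometric s0 gen.
Qed.

Lemma is_Hs_integralP s a b F (I : spinor) : is_Hs_integral s a b F I <-> is_int (Hs s) (shn s) a b F I.
Proof.
have sumE : (forall tau, a <= tau <= b -> Hs s (F tau)) -> Hs s I -> forall (p : seq R) (tag : nat -> R),
    itv_partition a b p -> (forall i, (i < size p)%N -> nth b (a :: p) i <= tag i <= nth b (a :: p) i.+1) ->
    Hnorm s (\sum_(i < size p) (nth b (a :: p) i.+1 - nth b (a :: p) i)%:C *: F (tag i) - I)%R =
    (shn s (\sum_(i < size p) (nth b (a :: p) i.+1 - nth b (a :: p) i)%:C *: F (tag i) - I)%R)%:E.
  move=> PF PI p tag ip ht; apply: Hnorm_shn; apply: HsB PI.
  apply: (Psum (Hs0 s) (@Hs_lin R s)) => i; apply: (PZ (Hs0 s) (@Hs_lin R s)); apply: PF.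
  have [h1 _ h2] := partition_step ip (ltn_ord i); have /andP[h3 h4] := ht i (ltn_ord i).
  by rewrite (le_trans h1 h3) (le_trans h4 h2).
split=> -[PF PI h]; split => // eps /h[d d0 dP]; exists d => // p tag ip ht.
  have := dP p tag ip ht; rewrite (sumE PF PI p tag ip (fun i hi => (ht i hi).1)).
  by rewrite lte_fin.
by rewrite (sumE PF PI p tag ip (fun i hi => (ht i hi).1)) lte_fin; exact: dP.
Qed.

(** [Hnorm] is identified with the real number [shn] on [Hs s], so membership at all times is
    secured before the limit is rewritten. *)
Lemma continuous_HsP s T (psi : R -> spinor) : continuous_Hs s T psi <->
  forall t, 0 <= t < T -> Hs s (psi t) /\
    forall e : R, 0 < e -> exists2 d : R, 0 < d &
      forall t', 0 <= t' < T -> `|t' - t| < d -> shn s (psi t' - psi t) <= e.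
Proof.
have key : (forall t, 0 <= t < T -> Hs s (psi t)) -> forall t, 0 <= t < T ->
    (Hnorm s (psi t' - psi t) @[t' --> within `[0, T[ (nbhs t)] --> 0%E) <->
    forall e : R, 0 < e -> exists2 d : R, 0 < d &
      forall t', 0 <= t' < T -> `|t' - t| < d -> shn s (psi t' - psi t) <= e.
  move=> HP t tT.
  rewrite (@fin_cvg0P R R (within `[0, T[ (nbhs t)) _ _ (fun t' => shn s (psi t' - psi t))).
  - split=> H e /H[d /= d0 dP]; exists d => //.
      move=> t' t'T td; apply: dP => /=; first by rewrite distrC.
      by rewrite in_itv.
    by move=> t' /=; rewrite distrC in_itv /= => td t'T; exact: dP.
  - by move=> t'; exact: shn_ge0.
  apply: filterS (withinT _ _) => t' /=; rewrite in_itv /= => t'T.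
  by apply: Hnorm_shn; apply: HsB; exact: HP.
split=> H t tT; have HP t' : 0 <= t' < T -> Hs s (psi t') by move=> /H[].
  by split; [exact: HP|apply/(key HP) => //; case: (H t tT)].
by split; [exact: HP|apply/(key HP) => //; case: (H t tT)].
Qed.

(** Dictionary between abstract equality and that of the statement; the [H^s] norm dominates the
    [L2] norm because [s] is nonnegative. *)
Lemma eq_ae_shn s psi phi : 0 <= s -> Hs s psi -> Hs s phi ->
  shn s (psi - phi) = 0 <-> psi = phi %[ae leb2].
Proof.
move=> s0 h h'; split => e.
  apply: ae_imp (shn_eq0 s0 (HsB h h') e) => x hx _; apply/eqP; rewrite -subr_eq0; apply/eqP.
  exact: hx.
exact: (shn_ae0 s0 h h' (sn_ae0 (Hs_sL2 h) (Hs_sL2 h') e)).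
Qed.

Lemma duhamel_solutionP m b s psi0 T (psi : R -> spinor) : 0 <= s -> Hs s psi0 ->
  duhamel_solution m b s psi0 T psi <->
  sol (Hs s) (shn s) (dirac_group m) (nonlinearity b) imunit T psi0 psi.
Proof.
move=> s0 h0; have [UP _ _ _ _] := dirac_group_isometric m s0.
split=> -[c H]; have HP t : 0 <= t < T -> Hs s (psi t) by move/continuous_HsP : (c) => c' /c'[].
  split; first exact/continuous_HsP.
  move=> t tT; have [I /is_Hs_integralP iI e] := H t tT; exists I => //.
  have [_ PI _] := iI.
  have PW := PD (@Hs_lin R s) (UP t psi0 h0).1 (PZ (Hs0 s) (@Hs_lin R s) imunit PI).
  exact: (eq_ae_shn s0 (HP t tT) PW).2 e.
have {}HP t : 0 <= t < T -> Hs s (psi t) by move=> /c[].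
split; first exact/continuous_HsP.
move=> t tT; have [I iI e] := H t tT; exists I; first exact/is_Hs_integralP.
have [_ PI _] := iI.
have PW := PD (@Hs_lin R s) (UP t psi0 h0).1 (PZ (Hs0 s) (@Hs_lin R s) imunit PI).
exact: (eq_ae_shn s0 (HP t tT) PW).1 e.
Qed.

End DiracGroupSobolev.

Theorem theorem2p1 (R : realType) (m b s : R) (hm : 0 < m) (hb : 0 < b)
    (hs : 0 < s) :
  exists T : R -> R, (forall r : R, 0 <= r -> 0 < T r) /\
    forall psi0 : @spinor R, Hs s psi0 ->
      exists2 psi : R -> @spinor R,
        duhamel_solution m b s psi0 (T (fine (Hnorm s psi0))) psi &
        forall phi : R -> @spinor R,
          duhamel_solution m b s psi0 (T (fine (Hnorm s psi0))) phi ->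
          forall t : R, 0 <= t < T (fine (Hnorm s psi0)) ->
            phi t = psi t %[ae leb2].
Proof.
have s0 := ltW hs; have [U1 U2 U3 U4 U5] := dirac_group_isometric m s0.
have z := Hs0 s; have L := @Hs_lin R s.
have NP psi : Hs s psi -> Hs s (nonlinearity b psi).
  by move=> h; case: (nonlinearity_lipschitz hb hs h h).
(* Whatever function the resolvent returns at 0, it multiplies [gamma0 *m 0]. *)
have Nz : shn s (nonlinearity b (0 : @spinor R)) = 0.
  have -> : nonlinearity b (0 : @spinor R) = 0.
    by apply/funext => x; rewrite /nonlinearity /= mulmx0 scaler0.
  exact: (N0 z (@shnZ R s)).
have [T [T0 TP]] := @local_wellposedness R (@spinor R) (Hs s) (shn s) z L (shn_ge0 s) (@shnD R s) (@shnZ R s)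
  (fun u => Hs_complete s0) (dirac_group m) (fun t x h => (U1 t x h).1) (fun t x h => (U1 t x h).2) U2 U3 U4 U5
  (nonlinearity b) (nonlinC b s) imunit NP (nonlinC_ge0 s hb)
  (fun x y h h' => (nonlinearity_lipschitz hb hs h h').2) Nz (@normc_imunit R).
exists T; split => // psi0 h0; have [psi sp su] := TP psi0 h0.
(* On [Hs s] the argument of [T], the [fine] of an extended norm, is the real norm [shn s psi0] of
   the abstract theorem. *)
rewrite (Hnorm_shn h0) /=; exists psi; first exact/duhamel_solutionP.
move=> phi /(duhamel_solutionP _ _ _ _ s0 h0) sphi t tT.
apply/(eq_ae_shn s0 (sphi.1 t tT).1 (sp.1 t tT).1); exact: su sphi t tT.
Qed.
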